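(* Let $p,n$ be positive integers. Let $f\colon\mathbb{C}^p\to\mathbb{P}^n(\mathbb{C})$ be a linearly nondegenerate holomorphic mapping of maximal rank, and let $\{H_i\}_{1\le i\le q}$ be a family of $q\ge n+2$ hyperplanes in general position in $\mathbb{P}^n(\mathbb{C})$. If $f$ is completely $\mu_i$-ramified over $H_i$ for each $i=1,\dots,q$, then $$\sum_{i=1}^q\left(1-\frac{\kappa(p,n)}{\mu_i}\right)\le n+1.$$
   Context: Put $\kappa(p,n)=n+1-p$ if $1\le p<n$ and $\kappa(p,n)=1$ if $p\ge n$. A holomorphic mapping $f\colon\mathbb{C}^p\to\mathbb{P}^n(\mathbb{C})$ is of maximal rank if at some point $z\in\mathbb{C}^p$ one has $\operatorname{rank}(df_z)=\min\{p,n\}$. It is linearly nondegenerate if its image is not contained in any hyperplane. Hyperplanes $H_1,\dots,H_q$ in $\mathbb{P}^n(\mathbb{C})$ ($q\ge n+1$) are in general position if any $n+1$ of them have empty intersection. For a hyperplane $H$ with $f(\mathbb{C}^p)\not\subset H$, write the pull-back divisor as $f^*H=\sum_j m_jE_j$ with $E_j$ irreducible components and $m_j>0$. Then $f$ is completely $\mu$-ramified over $H$, where $\mu=\min_j m_j$, with the convention $\mu=\infty$ if $f(\mathbb{C}^p)\cap H=\varnothing$. When $\mu=\infty$, $\kappa(p,n)/\mu$ is understood as $0$. *)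

(* Defs.v *)
From HB Require Import structures.
From mathcomp Require Import all_boot all_order all_algebra.
From mathcomp Require Import complex.
From mathcomp Require Import all_classical all_reals all_analysis.
Set Implicit Arguments.
Unset Strict Implicit.
Unset Printing Implicit Defensive.
Import Order.TTheory GRing.Theory Num.Theory.
Import numFieldNormedType.Exports.
Local Open Scope classical_set_scope.
Local Open Scope ring_scope.

(* Typing the complex numbers as a numClosedFieldType gives them, and the row
   vectors over them, the normed-module structure induced by the modulus, so
   that [differentiable] below is complex (Frechet) differentiability. *)
Definition Cplx (R : realType) : numClosedFieldType := R[i].

Definition holomorphic_near (R : realType) (V W : normedModType (Cplx R))
    (g : V -> W) (z : V) : Prop :=
  \forall w \near z, differentiable g w.

(* Points of P^n are the lines, and hyperplanes of P^n the n-dimensional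
   linear subspaces, of C^(n+1). *)
Definition proj_space (R : realType) (n : nat) :=
  {L : {vspace 'rV[Cplx R]_n.+1} | \dim L == 1%N}.

Definition hyperplane (R : realType) (n : nat) :=
  {H : {vspace 'rV[Cplx R]_n.+1} | \dim H == n}.

Definition points_of (R : realType) (n : nat) (H : hyperplane R n) :
    set (proj_space R n) :=
  [set x | (val x <= val H)%VS].

(* A nonzero vector on the line x. It is an arbitrary choice, on which chart_dom,
   norm_coord and chart do not depend. *)
Definition hom_coord (R : realType) (n : nat) (x : proj_space R n) :
    'rV[Cplx R]_n.+1 :=
  vpick (val x).

Definition chart_dom (R : realType) (n : nat) (i : 'I_n.+1) :
    set (proj_space R n) :=
  [set x | hom_coord x 0 i != 0].

(* homogeneous coordinates of x scaled so that the i-th one is 1 *)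
Definition norm_coord (R : realType) (n : nat) (i : 'I_n.+1)
    (x : proj_space R n) : 'rV[Cplx R]_n.+1 :=
  (hom_coord x 0 i)^-1 *: hom_coord x.

(* the affine chart (x_j / x_i)_(j != i) *)
Definition chart (R : realType) (n : nat) (i : 'I_n.+1)
    (x : proj_space R n) : 'rV[Cplx R]_n :=
  col' i (norm_coord i x).

(* Requiring f w to stay in the chart domain for w near z expresses the
   continuity of f. *)
Definition holomorphic_map (R : realType) (p n : nat)
    (f : 'rV[Cplx R]_p -> proj_space R n) : Prop :=
  forall (z : 'rV[Cplx R]_p) (i : 'I_n.+1), chart_dom i (f z) ->
    (\forall w \near z, chart_dom i (f w)) /\
    holomorphic_near (fun w => chart i (f w)) z.

Definition maximal_rank (R : realType) (p n : nat)
    (f : 'rV[Cplx R]_p -> proj_space R n) : Prop :=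
  exists (z : 'rV[Cplx R]_p) (i : 'I_n.+1), chart_dom i (f z) /\
    \rank ('J (fun w => chart i (f w)) z) = minn p n.

Definition linearly_nondegenerate (R : realType) (p n : nat)
    (f : 'rV[Cplx R]_p -> proj_space R n) : Prop :=
  forall H : hyperplane R n, ~ (range f `<=` points_of H).

Definition general_position (R : realType) (n q : nat)
    (H : 'I_q -> hyperplane R n) : Prop :=
  forall S : {set 'I_q}, #|S| = n.+1 ->
    \bigcap_(i in [set` S]) points_of (H i) = set0.

Definition analytic_set (R : realType) (p : nat) (A : set 'rV[Cplx R]_p) :
    Prop :=
  forall z : 'rV[Cplx R]_p,
    exists (k : nat) (g : 'I_k -> 'rV[Cplx R]_p -> Cplx R),
      (forall j, holomorphic_near (g j) z) /\
      (\forall w \near z, A w <-> forall j, g j w = 0).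

Definition irreducible_analytic_set (R : realType) (p : nat)
    (A : set 'rV[Cplx R]_p) : Prop :=
  [/\ analytic_set A, A !=set0 &
      forall A1 A2 : set 'rV[Cplx R]_p, analytic_set A1 -> analytic_set A2 ->
        A = A1 `|` A2 -> A = A1 \/ A = A2].

Definition irreducible_component (R : realType) (p : nat)
    (A E : set 'rV[Cplx R]_p) : Prop :=
  [/\ irreducible_analytic_set E, E `<=` A &
      forall E' : set 'rV[Cplx R]_p, irreducible_analytic_set E' ->
        E `<=` E' -> E' `<=` A -> E' = E].

(* divisibility in the ring of germs of holomorphic functions at z *)
Definition divides_near (R : realType) (p : nat) (z : 'rV[Cplx R]_p)
    (h g : 'rV[Cplx R]_p -> Cplx R) : Prop :=
  exists2 k : 'rV[Cplx R]_p -> Cplx R, holomorphic_near k z &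
    \forall w \near z, g w = h w * k w.

Definition vanishes_near (R : realType) (p : nat) (z : 'rV[Cplx R]_p)
    (E : set 'rV[Cplx R]_p) (g : 'rV[Cplx R]_p -> Cplx R) : Prop :=
  \forall w \near z, E w -> g w = 0.

(* h generates the ideal of germs at z vanishing on E: it is a reduced local
   equation of the hypersurface E at z *)
Definition local_equation (R : realType) (p : nat) (z : 'rV[Cplx R]_p)
    (E : set 'rV[Cplx R]_p) (h : 'rV[Cplx R]_p -> Cplx R) : Prop :=
  [/\ holomorphic_near h z, vanishes_near z E h &
      forall g : 'rV[Cplx R]_p -> Cplx R,
        holomorphic_near g z -> vanishes_near z E g -> divides_near z h g].

(* The order of g along E: the largest m such that h^m divides g at z, for a
   local equation h of E at a point z of E. For E irreducible it does not depend
   on z and h. *)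
Definition order_along (R : realType) (p : nat) (z : 'rV[Cplx R]_p)
    (E : set 'rV[Cplx R]_p) (g : 'rV[Cplx R]_p -> Cplx R) (m : nat) : Prop :=
  exists h : 'rV[Cplx R]_p -> Cplx R,
    [/\ local_equation z E h,
        divides_near z (fun w => h w ^+ m) g &
        ~ divides_near z (fun w => h w ^+ m.+1) g].

Definition linear_equation (R : realType) (n : nat) (H : hyperplane R n)
    (a : 'cV[Cplx R]_n.+1) : Prop :=
  forall x : 'rV[Cplx R]_n.+1, (x \in val H) = (x *m a == 0).

(* m E is a term of the divisor f^*H. In the i-th chart H has the local
   equation (sum_j a_j x_j) / x_i. *)
Definition pullback_divisor_term (R : realType) (p n : nat)
    (f : 'rV[Cplx R]_p -> proj_space R n) (H : hyperplane R n)
    (E : set 'rV[Cplx R]_p) (m : nat) : Prop :=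
  irreducible_component (f @^-1` points_of H) E /\
  exists (z : 'rV[Cplx R]_p) (i : 'I_n.+1) (a : 'cV[Cplx R]_n.+1),
    [/\ E z, chart_dom i (f z), linear_equation H a &
        order_along z E (fun w => (norm_coord i (f w) *m a) 0 0) m].

(* [None] stands for mu = oo. *)
Definition completely_ramified (R : realType) (p n : nat)
    (f : 'rV[Cplx R]_p -> proj_space R n) (H : hyperplane R n)
    (mu : option nat) : Prop :=
  ~ (range f `<=` points_of H) /\
  match mu with
  | None => range f `&` points_of H = set0
  | Some m =>
      (exists E, pullback_divisor_term f H E m) /\
      (forall E k, pullback_divisor_term f H E k -> (m <= k)%N)
  end.

Definition kappa (p n : nat) : nat :=
  if (p < n)%N then (n.+1 - p)%N else 1%N.

Definition kappa_over (R : realType) (p n : nat) (mu : option nat) : R :=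
  if mu is Some m then (kappa p n)%:R / m%:R else 0.

(* Main.v *)
From HB Require Import structures.
Require Import Defs.
From mathcomp Require Import all_boot all_order all_algebra.
From mathcomp Require Import complex perm.
From mathcomp Require Import all_classical all_reals all_analysis.
From mathcomp Require Import ring lra zify.
Set Implicit Arguments.
Unset Strict Implicit.
Unset Printing Implicit Defensive.
Import Order.TTheory GRing.Theory Num.Theory.
Import numFieldNormedType.Exports.
Local Open Scope classical_set_scope.
Local Open Scope ring_scope.

(** Suppose that the sum exceeds n + 1. The contradiction comes from a holomorphic object of
    negative degree attached to f and a rescaling argument; no characteristic or counting functions
    enter.

    Maximal rank and linear nondegeneracy provide a generalized Wronskian W of homogeneous
    coordinates of f that is not identically zero and uses derivatives of order at most kappa
    ([frame_kappa], [minimal_wronskian]). Its total order is taken minimal, so that W is multiplied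
    by the (n+1)-st power of the factor when the coordinates are rescaled ([wronsk_scale]). Let G_j
    be the linear form of H_j evaluated along f, N a common multiple of the mu_j, and M_j the
    integer N (1 - kappa / mu_j), truncated at 0. Where G_j vanishes to order k >= mu_j, its column
    in W vanishes to order at least k - kappa, and by general position at most n forms vanish
    together; hence the product of the G_j^M_j divides W^N ([quotient_local]). With the exponents
    lowered by one, the quotient Phi also vanishes wherever a form with positive M_j does. For N
    large enough the degree of Phi in the coordinates is -D with D > 0, so Phi times the D-th power
    of a linear form in f is an entire function ([Psi_exists]).

    The main estimate ([local_bound]): if on a ball of radius d about z the entire functions coming
    from the coordinates are at most a constant times |Phi z|, then |Phi z| d^K is bounded, where K
    is N times the total order of W. Indeed Phi, and with it each G_j of positive exponent, has no
    zero on a comparable ball, and Harnack's inequality bounds |D G_j|^N by |G_j|^(N-1)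
    ([harnack_Dw]); expanding W as a determinant in suitable forms bounds Phi. Maximizing the size
    of Phi times the K-th power of the distance to the sphere of radius r produces such balls
    ([Phi_zero]), and large r forces Phi = 0, hence W = 0.

    The ramification hypothesis concerns irreducible components of the preimage, so local analytic
    geometry is needed. Divisibility of germs is reduced to the smooth points of the zero set
    ([hol_div_generic]), and through such a point passes an irreducible component, the closure of a
    component of the regular locus, whose multiplicity is the order of G_j there ([regular_term]).
    The function theory behind this starts from Goursat's theorem on squares; several variables are
    treated through complex lines and integrals with a parameter. *)

Arguments Cplx : simpl never.

(** * Real and imaginary parts, and norms with real values *)

Section RealNorm.
Variable R : realType.
Local Notation C := (Cplx R).

Definition re (z : C) : R := complex.Re (z : R[i]).
Definition im (z : C) : R := complex.Im (z : R[i]).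
Definition rc (x : R) : C := (Complex x 0 : R[i]).
Definition ii : C := (Complex 0 1 : R[i]).

Lemma rcE x : rc x = real_complex R x. Proof. by []. Qed.
Lemma reD x y : re (x + y) = re x + re y.
Proof. by case: x => a b; case: y => c d. Qed.
Lemma imD x y : im (x + y) = im x + im y.
Proof. by case: x => a b; case: y => c d. Qed.
Lemma reN x : re (- x) = - re x. Proof. by case: x. Qed.
Lemma imN x : im (- x) = - im x. Proof. by case: x. Qed.
Lemma reB x y : re (x - y) = re x - re y. Proof. by rewrite reD reN. Qed.
Lemma imB x y : im (x - y) = im x - im y. Proof. by rewrite imD imN. Qed.
Lemma reM x y : re (x * y) = re x * re y - im x * im y.
Proof. by case: x => a b; case: y => c d. Qed.
Lemma imM x y : im (x * y) = re x * im y + im x * re y.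
Proof. by case: x => a b; case: y => c d. Qed.
Lemma re0 : re 0 = 0. Proof. by []. Qed.
Lemma im0 : im 0 = 0. Proof. by []. Qed.
Lemma re1 : re 1 = 1. Proof. by []. Qed.
Lemma im1 : im 1 = 0. Proof. by []. Qed.
Lemma re_rc x : re (rc x) = x. Proof. by []. Qed.
Lemma im_rc x : im (rc x) = 0. Proof. by []. Qed.
Lemma reii : re ii = 0. Proof. by []. Qed.
Lemma imii : im ii = 1. Proof. by []. Qed.

Lemma C_ext (x y : C) : re x = re y -> im x = im y -> x = y.
Proof. by case: x => a b; case: y => c d; rewrite /re /im /= => -> ->. Qed.

Lemma rcD x y : rc (x + y) = rc x + rc y.
Proof. exact: rmorphD (real_complex R) x y. Qed.
Lemma rcB x y : rc (x - y) = rc x - rc y.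
Proof. exact: rmorphB (real_complex R) x y. Qed.
Lemma rcN x : rc (- x) = - rc x.
Proof. exact: rmorphN (real_complex R) x. Qed.
Lemma rcM x y : rc (x * y) = rc x * rc y.
Proof. exact: rmorphM (real_complex R) x y. Qed.
Lemma rc0 : rc 0 = 0. Proof. by []. Qed.
Lemma rc1 : rc 1 = 1. Proof. by []. Qed.
Lemma rcV x : rc (x^-1) = (rc x)^-1.
Proof. exact: fmorphV (real_complex R) x. Qed.
Lemma rcX x n : rc (x ^+ n) = rc x ^+ n.
Proof. exact: rmorphXn (real_complex R) n x. Qed.
Lemma rc_nat n : rc n%:R = n%:R.
Proof. exact: rmorph_nat (real_complex R) n. Qed.
Lemma rc_sum n (F : 'I_n -> R) : rc (\sum_(i < n) F i) = \sum_(i < n) rc (F i).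
Proof. exact: (raddf_sum (real_complex R)). Qed.
Lemma rcI : injective rc. Proof. by move=> x y [->]. Qed.
Lemma rc_eq0 x : (rc x == 0) = (x == 0).
Proof. by rewrite -rc0 (inj_eq rcI). Qed.
Lemma ii2 : ii * ii = -1.
Proof. by apply: C_ext; rewrite ?reM ?imM /re /im /=; ring. Qed.
Lemma CE (z : C) : z = rc (re z) + ii * rc (im z).
Proof.
by apply: C_ext; rewrite ?reD ?imD ?reM ?imM ?reii ?imii ?re_rc ?im_rc; ring.
Qed.
Lemma re_sum n (F : 'I_n -> C) : re (\sum_(i < n) F i) = \sum_(i < n) re (F i).
Proof. by elim/big_ind2: _ => // x y z t <- <-; rewrite reD. Qed.
Lemma im_sum n (F : 'I_n -> C) : im (\sum_(i < n) F i) = \sum_(i < n) im (F i).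
Proof. by elim/big_ind2: _ => // x y z t <- <-; rewrite imD. Qed.
Lemma re_rcM a z : re (rc a * z) = a * re z.
Proof. by rewrite reM re_rc im_rc; ring. Qed.
Lemma im_rcM a z : im (rc a * z) = a * im z.
Proof. by rewrite imM re_rc im_rc; ring. Qed.

(* The norm of a complex normed module takes values in C; [nrm] is the same
   norm as a real number. *)
Definition nrm (V : normedModType C) (v : V) : R := re `|v|.

Section Nrm.
Variable V : normedModType C.
Implicit Types u v w : V.

Lemma nrmE v : `|v| = rc (nrm v).
Proof.
have := normr_ge0 v; rewrite /nrm; case: (`|v|) => a b.
by rewrite lecE /= => /andP[/eqP -> _].
Qed.
Lemma nrm_ge0 v : 0 <= nrm v.
Proof. by have := normr_ge0 v; rewrite nrmE lecE /= => /andP[]. Qed.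
Lemma le_rc (x y : R) : (rc x <= rc y) = (x <= y).
Proof. by rewrite lecE /= eqxx. Qed.
Lemma lt_rc (x y : R) : (rc x < rc y) = (x < y).
Proof. by rewrite ltcE /= eqxx. Qed.
Lemma nrm0 : nrm (0 : V) = 0. Proof. by rewrite /nrm normr0. Qed.
Lemma nrm_eq0 v : (nrm v == 0) = (v == 0).
Proof. by rewrite -[v == 0]normr_eq0 nrmE rc_eq0. Qed.
Lemma nrm_gt0 v : (0 < nrm v) = (v != 0).
Proof. by rewrite lt_neqAle nrm_ge0 andbT eq_sym nrm_eq0. Qed.
Lemma nrmN v : nrm (- v) = nrm v. Proof. by rewrite /nrm normrN. Qed.
Lemma nrmB u v : nrm (u - v) = nrm (v - u). Proof. by rewrite -nrmN opprB. Qed.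
Lemma nrmD u v : nrm (u + v) <= nrm u + nrm v.
Proof. by have := ler_normD u v; rewrite !nrmE -rcD le_rc. Qed.
Lemma nrm_le_sub u v w : nrm (u - w) <= nrm (u - v) + nrm (v - w).
Proof.
by have := nrmD (u - v) (v - w); rewrite addrA subrK.
Qed.
Lemma nrm_sub_ge u v : nrm u - nrm v <= nrm (u - v).
Proof. by have := nrmD (u - v) v; rewrite subrK; lra. Qed.
Lemma nrm_add_ge u v : nrm u - nrm v <= nrm (u + v).
Proof. by have := nrm_sub_ge u (- v); rewrite opprK nrmN. Qed.
End Nrm.

Lemma nrmC (z : C) : nrm z = Num.sqrt (re z ^+ 2 + im z ^+ 2).
Proof. by rewrite /nrm normc_def. Qed.
Lemma nrmCsq (z : C) : nrm z ^+ 2 = re z ^+ 2 + im z ^+ 2.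
Proof. by rewrite nrmC sqr_sqrtr // addr_ge0 // sqr_ge0. Qed.

Lemma nrmZ (V : normedModType C) (a : C) (v : V) :
  nrm (a *: v) = nrm a * nrm v.
Proof. by apply: rcI; rewrite rcM -!nrmE normrZ. Qed.
Lemma nrmM (a b : C) : nrm (a * b) = nrm a * nrm b.
Proof. by apply: rcI; rewrite rcM -!nrmE normrM. Qed.
Lemma nrm1 : nrm (1 : C) = 1. Proof. by rewrite /nrm normr1. Qed.
Lemma nrmV (a : C) : nrm a^-1 = (nrm a)^-1.
Proof. by apply: rcI; rewrite rcV -!nrmE normfV. Qed.
Lemma nrm_div (a b : C) : nrm (a / b) = nrm a / nrm b.
Proof. by rewrite nrmM nrmV. Qed.
Lemma nrmX (a : C) n : nrm (a ^+ n) = nrm a ^+ n.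
Proof. by apply: rcI; rewrite rcX -!nrmE normrX. Qed.
Lemma nrm_rc (x : R) : nrm (rc x) = `|x|.
Proof. by rewrite nrmC re_rc im_rc expr0n addr0 sqrtr_sqr. Qed.
Lemma nrm_nat n : nrm (n%:R : C) = n%:R.
Proof. by rewrite -rc_nat nrm_rc ger0_norm // ler0n. Qed.
Lemma nrmii : nrm ii = 1.
Proof. by rewrite nrmC reii imii expr0n add0r expr1n sqrtr1. Qed.
Lemma le_re (z : C) : `|re z| <= nrm z.
Proof. by rewrite nrmC -sqrtr_sqr ler_wsqrtr // lerDl sqr_ge0. Qed.
Lemma le_im (z : C) : `|im z| <= nrm z.
Proof. by rewrite nrmC -sqrtr_sqr ler_wsqrtr // lerDr sqr_ge0. Qed.
Lemma nrm_le_reim (z : C) : nrm z <= `|re z| + `|im z|.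
Proof.
rewrite {1}(CE z); apply: le_trans (nrmD _ _) _.
by rewrite nrmM nrmii mul1r !nrm_rc.
Qed.
Lemma nrm_sum (V : normedModType C) n (F : 'I_n -> V) :
  nrm (\sum_(i < n) F i) <= \sum_(i < n) nrm (F i).
Proof.
elim/big_ind2: _ => //; first by rewrite nrm0.
by move=> x1 x2 y1 y2 h1 h2; apply: le_trans (nrmD _ _) _; apply: lerD.
Qed.
Lemma nrm_prod n (F : 'I_n -> C) :
  nrm (\prod_(i < n) F i) = \prod_(i < n) nrm (F i).
Proof. by elim/big_ind2: _ => //; [rewrite nrm1 | move=> x y z t <- <-; rewrite nrmM]. Qed.

(** A positive element of [C] is real, so the radii of [nbhs_normP] can be taken in [R]. *)
Lemma nbhs_nrm (V : normedModType C) (z : V) (P : V -> Prop) :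
  (\forall w \near z, P w) <->
  exists2 r : R, 0 < r & forall w, nrm (w - z) < r -> P w.
Proof.
split.
  move/nbhs_normP => [e e0 he].
  have e0' : 0 < (e : C) by [].
  move: e0' he; case: e {e0} => a b /=; rewrite ltcE /= => /andP[/eqP hb a0] he.
  move: he; rewrite hb => he.
  exists a => // w hw; apply: he.
  by rewrite /ball_ /= -opprB normrN nrmE -[Complex a 0]/(rc a) lt_rc.
case=> r r0 hr; apply/nbhs_normP; exists (rc r).
  by rewrite /= -rc0 lt_rc.
by move=> w /=; rewrite -opprB normrN nrmE lt_rc => /hr.
Qed.

(** Working form of complex derivability in a direction: limits in [C] become real inequalities
    without division by [h]. *)
Lemma derivable_nrm (V : normedModType C) (f : V -> C) (x v : V) (d : C) :
  (derivable f x v /\ 'D_v f x = d) <->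
  (forall e : R, 0 < e -> exists2 r : R, 0 < r & forall h : C, nrm h < r ->
    nrm (f (x + h *: v) - f x - h * d) <= e * nrm h).
Proof.
split.
  move=> [df <-] e e0.
  have : (fun h : C => h^-1 *: ((f \o shift x) (h *: v) - f x)) @ 0^' --> 'D_v f x.
    exact: df.
  move/cvgr_dist_le => /(_ (rc e)); rewrite -{1}rc0 lt_rc => /(_ e0).
  rewrite /dnbhs /within /= => hh.
  have [r r0 hr] := (proj1 (@nbhs_nrm C 0 _)) hh.
  exists r => // h hlt.
  have [->|h0] := eqVneq h 0.
    by rewrite scale0r addr0 subrr mul0r subr0 nrm0 mulr0.
  have /hr/(_ h0) : nrm (h - 0 : C) < r by rewrite subr0.
  rewrite nrmE le_rc => H.
  have -> : f (x + h *: v) - f x - h * 'D_v f x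
    = - (h * ('D_v f x - h^-1 *: (f (h *: v + x) - f x))).
    have hs (y : C) : h * (h^-1 *: y) = y.
      by rewrite -[_ *: y]/(h^-1 * y) mulrA mulfV // mul1r.
    by rewrite mulrBr hs opprB (addrC x).
  rewrite nrmN nrmM mulrC; apply: ler_wpM2r; [exact: nrm_ge0 | exact: H].
move=> H.
suff cv : (fun h : C => h^-1 *: ((f \o shift x) (h *: v) - f x)) @ 0^' --> d.
  by split; [exact: cvgP cv | exact: cvg_lim cv].
apply/cvgrPdist_le => e e0.
have [e' e'0 ee'] : exists2 e' : R, 0 < e' & e = rc e'.
  move: e0; case: e => a b; rewrite ltcE /= => /andP[/eqP -> a0].
  by exists a.
have [r r0 hr] := H _ e'0.
rewrite /dnbhs /within /=; apply: (proj2 (@nbhs_nrm C 0 _)); exists r => // h.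
rewrite subr0 => hlt h0.
rewrite nrmE ee' le_rc.
have hn : 0 < nrm h by rewrite nrm_gt0.
have := hr _ hlt.
have -> : f (x + h *: v) - f x - h * d
    = - (h * (d - h^-1 *: (f (h *: v + x) - f x))).
    have hs (y : C) : h * (h^-1 *: y) = y.
      by rewrite -[_ *: y]/(h^-1 * y) mulrA mulfV // mul1r.
    by rewrite mulrBr hs opprB (addrC x).
by rewrite nrmN nrmM mulrC ler_pM2r.
Qed.

End RealNorm.

(** * Integration over the unit interval by dyadic sums *)

Section Integral.
Variable R : realType.
Local Notation C := (Cplx R).

(** Compactness of the unit interval, in the form that later gives uniform continuity, the mean
    value inequality, connectedness and uniform radii. With [c] the supremum of the points reachable
    from 0, the local hypothesis at [c] makes some point beyond [c] reachable unless [c] is 1. *)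
Lemma cousin (P : R -> R -> Prop) :
  (forall a m b, a <= m -> m <= b -> P a m -> P m b -> P a b) ->
  (forall t, 0 <= t <= 1 -> exists2 d : R, 0 < d &
     forall a b, 0 <= a -> a <= t -> t <= b -> b <= 1 -> b - a < d -> P a b) ->
  P 0 1.
Proof.
move=> Pm Pl.
pose S : set R := [set x | 0 <= x <= 1 /\ P 0 x].
have S0 : S 0.
  split; first by rewrite lexx ler01.
  have [|d d0 H] := Pl 0; first by rewrite lexx ler01.
  by apply: H; rewrite ?lexx ?ler01 // subrr.
have Sub : has_ubound S by exists 1 => x [/andP[_ ->]].
have Ssup : has_sup S by split => //; exists 0.
set c := sup S.
have c0 : 0 <= c by apply: ub_le_sup.
have c1 : c <= 1 by apply: ge_sup => [|x [/andP[]]] //; exists 0.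
have [|d d0 H] := Pl c; first by rewrite c0.
have d20 : 0 < d / 2 by lra.
have [x [/andP[x0 x1] Px] xc] := sup_adherent d20 Ssup.
have xlec : x <= c by apply: ub_le_sup => //; split => //; rewrite x0.
pose b := Num.min 1 (c + d / 4).
have cb : c <= b by rewrite /b le_min c1 /=; lra.
have b1 : b <= 1 by rewrite /b ge_min lexx.
have bd : b <= c + d / 4 by rewrite /b ge_min lexx orbT.
have Pb : P 0 b.
  apply: (Pm 0 x b) => //; first by lra.
  by apply: H => //; move: xc; rewrite -/c; lra.
have Sb : S b by split => //; rewrite b1 andbT; lra.
have bc : b <= c by apply: ub_le_sup.
suff <- : b = 1 by [].
move: bc; rewrite /b; case: (leP 1 (c + d / 4)) => //; lra.
Qed.

Definition cvs (u : nat -> C) (l : C) : Prop :=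
  forall e : R, 0 < e -> exists N, forall n, (N <= n)%N -> nrm (u n - l) < e.

(** The limit is the supremum of the eventual lower bounds of the sequence. *)
Lemma cauchy_real (u : nat -> R) :
  (forall e : R, 0 < e -> exists N, forall m n, (N <= m)%N -> (N <= n)%N ->
     `|u m - u n| < e) ->
  exists l, forall e : R, 0 < e -> exists N, forall n, (N <= n)%N -> `|u n - l| < e.
Proof.
move=> H.
pose S : set R := [set x | exists N, forall n, (N <= n)%N -> x <= u n].
have bnd e : 0 < e -> exists N, S (u N - e) /\ (forall x, S x -> x <= u N + e) /\
   (forall n, (N <= n)%N -> `|u n - u N| < e).
  move=> e0; have [N HN] := H e e0; exists N; split.
    by exists N => n Nn; have := HN _ _ (leqnn N) Nn; rewrite ltr_norml; lra.
  split; last by move=> n Nn; exact: HN.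
  move=> x [M HM]; have := HM _ (leq_maxl M N).
  by have := HN _ _ (leq_maxr M N) (leqnn N); rewrite ltr_norml; lra.
have [N1 [S1 [U1 _]]] := bnd 1 ltr01.
have Ssup : has_sup S by split; [exists (u N1 - 1)|exists (u N1 + 1)].
exists (sup S) => e e0.
have e20 : 0 < e / 2 by lra.
have [N [SN [UN CN]]] := bnd _ e20.
exists N => n Nn; have := CN _ Nn; rewrite !ltr_norml => ?.
have : u N - e / 2 <= sup S by apply: ub_le_sup => //; case: Ssup.
have : sup S <= u N + e / 2 by apply: ge_sup => //; case: Ssup.
by lra.
Qed.

Lemma cauchy_cvs (u : nat -> C) :
  (forall e : R, 0 < e -> exists N, forall m n, (N <= m)%N -> (N <= n)%N ->
     nrm (u m - u n) < e) -> exists l, cvs u l.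
Proof.
move=> H.
have [|a Ha] := @cauchy_real (fun n => re (u n)).
  move=> e /H[N HN]; exists N => m n Nm Nn; rewrite -reB.
  by apply: le_lt_trans (le_re _) _; apply: HN.
have [|b Hb] := @cauchy_real (fun n => im (u n)).
  move=> e /H[N HN]; exists N => m n Nm Nn; rewrite -imB.
  by apply: le_lt_trans (le_im _) _; apply: HN.
exists (rc a + ii R * rc b) => e e0.
have e20 : 0 < e / 2 by lra.
have [N1 H1] := Ha _ e20; have [N2 H2] := Hb _ e20.
exists (maxn N1 N2) => n; rewrite geq_max => /andP[n1 n2].
apply: le_lt_trans (nrm_le_reim _) _.
rewrite reB imB reD imD reM imM !re_rc !im_rc !reii !imii.
have := H1 _ n1; have := H2 _ n2.
by rewrite !mul0r !mul1r !subr0 !add0r !addr0; lra.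
Qed.

Lemma cvs_unique u l l' : cvs u l -> cvs u l' -> l = l'.
Proof.
move=> H H'; apply/eqP; rewrite -subr_eq0 -nrm_eq0; apply/negPn/negP => n0.
have e0 : 0 < nrm (l - l') / 2 by apply: divr_gt0; rewrite ?ltr0n // lt_neqAle eq_sym n0 nrm_ge0.
have [N HN] := H _ e0; have [M HM] := H' _ e0.
have := HN _ (leq_maxl N M); have := HM _ (leq_maxr N M).
have := nrm_le_sub l (u (maxn N M)) l'.
by rewrite (nrmB l (u _)); lra.
Qed.

Lemma cvs_cst c : cvs (fun=> c) c.
Proof. by move=> e e0; exists 0%N => n _; rewrite subrr nrm0. Qed.
Lemma cvsD u v l m : cvs u l -> cvs v m -> cvs (fun n => u n + v n) (l + m).
Proof.
move=> H H' e e0; have e20 : 0 < e / 2 by lra.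
have [N HN] := H _ e20; have [M HM] := H' _ e20.
exists (maxn N M) => n; rewrite geq_max => /andP[/HN h1 /HM h2].
have -> : u n + v n - (l + m) = (u n - l) + (v n - m) by ring.
by apply: le_lt_trans (nrmD _ _) _; lra.
Qed.
Lemma cvsZ c u l : cvs u l -> cvs (fun n => c * u n) (c * l).
Proof.
move=> H e e0; have n1 : 0 < nrm c + 1 by have := nrm_ge0 c; lra.
have [N HN] := H _ (divr_gt0 e0 n1).
exists N => n /HN; rewrite -mulrBr nrmM ltr_pdivlMr // => h.
have := nrm_ge0 (u n - l); have := nrm_ge0 c; nra.
Qed.
Lemma cvs_shift u l : cvs u l -> cvs (fun n => u n.+1) l.
Proof. by move=> H e /H[N HN]; exists N => n Nn; apply: HN; apply: leqW. Qed.
Lemma cvs_bound u l a M : cvs u l -> (forall n, nrm (u n - a) <= M) ->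
  nrm (l - a) <= M.
Proof.
move=> H HM; rewrite leNgt; apply/negP => lt.
have e0 : 0 < nrm (l - a) - M by lra.
have [N /(_ _ (leqnn N))] := H _ e0.
have := HM N; have := nrm_le_sub l (u N) a.
by rewrite (nrmB l (u N)); lra.
Qed.

(** Left-endpoint Riemann sum with [2 ^ m] pieces. Dyadic subdivisions are stable under halving the
    interval ([rsumS]), which allows inductions on [m]. *)
Definition rsum (phi : R -> C) (m : nat) : C :=
  rc ((2 ^+ m)^-1) * \sum_(k < 2 ^ m) phi (k%:R / 2 ^+ m).

(** The value is 0 by default when the sums diverge; for continuous integrands [int01_cvs]
    identifies the limit. *)
Definition int01 (phi : R -> C) : C := xget 0 [set l | cvs (rsum phi) l].

Definition cont01 (phi : R -> C) : Prop := forall t, 0 <= t <= 1 ->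
  forall e : R, 0 < e -> exists2 d : R, 0 < d & forall s, 0 <= s <= 1 ->
    `|s - t| < d -> nrm (phi s - phi t) < e.

Lemma unif01 phi : cont01 phi -> forall e : R, 0 < e ->
  exists2 d : R, 0 < d & forall s t, 0 <= s <= 1 -> 0 <= t <= 1 ->
    `|s - t| < d -> nrm (phi s - phi t) < e.
Proof.
move=> H e e0.
pose P a b := exists2 d : R, 0 < d & forall s t, a <= s <= b -> 0 <= t <= 1 ->
    0 <= s <= 1 -> `|s - t| < d -> nrm (phi s - phi t) < e.
suff [d d0 Hd] : P 0 1 by exists d => // s t s1 t1; apply: Hd.
apply: cousin.
  move=> a m b am mb [d d0 Hd] [d' d'0 Hd'].
  exists (Num.min d d') => [|s t /andP[s1 s2] t1 s01]; first by rewrite lt_min d0.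
  rewrite lt_min => /andP[l1 l2].
  have [sm|ms] := leP s m; first by apply: Hd => //; rewrite s1.
  by apply: Hd' => //; rewrite s2 ltW.
move=> t t01; have e20 : 0 < e / 2 by lra.
have [d d0 Hd] := H t t01 _ e20.
exists (d / 2) => [|a b a0 at_ tb b1 ba]; first by lra.
exists (d / 2) => [|s r sab r01 s01 sr]; first by lra.
have h1 : nrm (phi s - phi t) < e / 2 by apply: Hd => //; rewrite ltr_norml; lra.
have h2 : nrm (phi r - phi t) < e / 2.
  by apply: Hd => //; move: sr; rewrite !ltr_norml; lra.
by have := nrm_le_sub (phi s) (phi t) (phi r); rewrite (nrmB (phi t)); lra.
Qed.

Lemma pow2_gt0 m : 0 < 2 ^+ m :> R. Proof. by rewrite exprn_gt0 // ltr0n. Qed.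

Lemma rsumS phi m : rsum phi m.+1 =
  rc (2^-1) * (rsum (fun t => phi (t / 2)) m + rsum (fun t => phi ((1 + t) / 2)) m).
Proof.
rewrite /rsum; have e : (2 ^ m.+1 = 2 ^ m + 2 ^ m)%N by rewrite expnS mul2n addnn.
rewrite e big_split_ord /= -mulrDr mulrA -rcM; have p0 := gt_eqF (pow2_gt0 m).
congr (rc _ * (_ + _)); first by rewrite exprS; field; rewrite p0.
  by apply: eq_bigr => i _; congr phi; rewrite exprS; field; rewrite p0.
apply: eq_bigr => i _; congr phi; rewrite exprS natrD natrX; field; by rewrite p0.
Qed.

Lemma dyad01 m (k : 'I_(2 ^ m)) : 0 <= (k%:R : R) / 2 ^+ m <= 1.
Proof.
apply/andP; split; first by rewrite divr_ge0 ?ler0n // ltW // pow2_gt0.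
rewrite ler_pdivrMr ?pow2_gt0 // mul1r -natrX ler_nat ltnW //.
Qed.

Lemma rsum_bound phi a M m : (forall t, 0 <= t <= 1 -> nrm (phi t - a) <= M) ->
  nrm (rsum phi m - a) <= M.
Proof.
move=> H.
have -> : rsum phi m - a = rc ((2 ^+ m)^-1) * \sum_(k < 2 ^ m) (phi (k%:R / 2 ^+ m) - a).
  rewrite sumrB mulrBr sumr_const card_ord -[a *+ _]mulr_natl mulrA; congr (_ - _).
  rewrite -rc_nat -rcM natrX mulVf ?mul1r //; apply: lt0r_neq0; exact: pow2_gt0.
have p0 : 0 <= (2 ^+ m)^-1 :> R by rewrite invr_ge0 ltW // pow2_gt0.
rewrite nrmM nrm_rc (ger0_norm p0).
rewrite ler_pdivrMl ?pow2_gt0 //.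
apply: le_trans (nrm_sum _) _.
apply: (@le_trans _ _ (\sum_(k < 2 ^ m) M)).
  by apply: ler_sum => i _; apply: H; apply: dyad01.
by rewrite sumr_const card_ord -[M *+ _]mulr_natl natrX.
Qed.

(** By [rsumS] a sum is the mean of the sums over the two halves, on which the hypothesis holds at
    the previous scale. At scale 0 the coarse sum is the single value [phi 0]. *)
Lemma rsum_cauchy m j e (phi : R -> C) :
  (forall s t, 0 <= s <= 1 -> 0 <= t <= 1 -> `|s - t| <= (2 ^+ m)^-1 ->
     nrm (phi s - phi t) <= e) ->
  nrm (rsum phi (m + j) - rsum phi m) <= e.
Proof.
elim: m phi => [|m IH] phi H.
  have -> : rsum phi 0 = phi 0.
    by rewrite /rsum expn0 big_ord1 expr0 invr1 /= mulr1 rc1 mul1r.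
  apply: rsum_bound => t t01; apply: H => //; first by rewrite lexx ler01.
  rewrite expr0 invr1 ler_norml; lra.
rewrite addSn !rsumS -mulrBr.
set a := rsum _ (m + j); set b := rsum _ (m + j); set c := rsum _ m; set d := rsum _ m.
have -> : a + b - (c + d) = (a - c) + (b - d) by ring.
rewrite nrmM nrm_rc ger0_norm ?invr_ge0 //.
have h2 : (2 ^+ m.+1)^-1 = (2 ^+ m)^-1 / 2 :> R by rewrite exprS invfM mulrC.
have h1 : nrm (a - c) <= e.
  apply: IH => s t s1 t1 st; apply: H; rewrite ?h2; [lra|lra|].
  by rewrite -mulrBl normrM (@ger0_norm _ 2^-1) //; lra.
have h3 : nrm (b - d) <= e.
  apply: IH => s t s1 t1 st; apply: H; rewrite ?h2; [lra|lra|].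
  have -> : (1 + s) / 2 - (1 + t) / 2 = (s - t) / 2 by lra.
  by rewrite normrM (@ger0_norm _ 2^-1) //; lra.
have := nrmD (a - c) (b - d); lra.
Qed.

Lemma pow2_small (d : R) : 0 < d -> exists m, (2 ^+ m)^-1 < d.
Proof.
move=> d0; have h : 0 <= 1 / d by rewrite divr_ge0 // ltW.
exists (Num.bound (1 / d)).
rewrite -[_^-1]mul1r ltr_pdivrMr ?pow2_gt0 // mulrC -ltr_pdivrMr //.
apply: lt_trans (archi_boundP h) _.
by rewrite -natrX ltr_nat ltn_expl.
Qed.

Lemma int01_cvs phi : cont01 phi -> cvs (rsum phi) (int01 phi).
Proof.
move=> H.
have [l Hl] : exists l, cvs (rsum phi) l.
  apply: cauchy_cvs => e e0; have e20 : 0 < e / 4 by lra.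
  have [d d0 Hd] := unif01 H e20.
  have [m Hm] := pow2_small d0.
  have K j : nrm (rsum phi (m + j) - rsum phi m) <= e / 4.
    apply: rsum_cauchy => s t s1 t1 st; apply/ltW/Hd => //; lra.
  exists m => i j mi mj.
  have := K (i - m)%N; have := K (j - m)%N; rewrite !subnKC // => h1 h2.
  have := nrm_le_sub (rsum phi i) (rsum phi m) (rsum phi j).
  by rewrite (nrmB (rsum phi m)); lra.
by rewrite /int01; case: xgetP => [x -> //|/(_ l)].
Qed.

Lemma int01_eq phi l : cont01 phi -> cvs (rsum phi) l -> int01 phi = l.
Proof. by move=> H; apply: cvs_unique; apply: int01_cvs. Qed.

Lemma rsum_ext phi psi m : (forall t, 0 <= t <= 1 -> phi t = psi t) ->
  rsum phi m = rsum psi m.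
Proof.
by move=> H; rewrite /rsum; congr (_ * _); apply: eq_bigr => i _; apply: H; apply: dyad01.
Qed.

Lemma int01_ext phi psi : (forall t, 0 <= t <= 1 -> phi t = psi t) ->
  int01 phi = int01 psi.
Proof.
move=> H; rewrite /int01; congr xget; apply/funext => l /=; congr cvs.
by apply/funext => m; apply: rsum_ext.
Qed.

Lemma cont01D phi psi : cont01 phi -> cont01 psi -> cont01 (fun t => phi t + psi t).
Proof.
move=> H H' t t01 e e0; have e20 : 0 < e / 2 by lra.
have [d d0 Hd] := H t t01 _ e20; have [d' d'0 Hd'] := H' t t01 _ e20.
exists (Num.min d d') => [|s s01]; first by rewrite lt_min d0.
rewrite lt_min => /andP[/(Hd _ s01) h1 /(Hd' _ s01) h2].
have -> : phi s + psi s - (phi t + psi t) = (phi s - phi t) + (psi s - psi t) by ring.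
by apply: le_lt_trans (nrmD _ _) _; lra.
Qed.

Lemma cont01Z c phi : cont01 phi -> cont01 (fun t => c * phi t).
Proof.
move=> H t t01 e e0; have n1 : 0 < nrm c + 1 by have := nrm_ge0 c; lra.
have [d d0 Hd] := H t t01 _ (divr_gt0 e0 n1).
exists d => // s s01 /(Hd _ s01); rewrite -mulrBr nrmM ltr_pdivlMr // => h.
have := nrm_ge0 (phi s - phi t); have := nrm_ge0 c; nra.
Qed.

Lemma int01D phi psi : cont01 phi -> cont01 psi ->
  int01 (fun t => phi t + psi t) = int01 phi + int01 psi.
Proof.
move=> H H'; apply: int01_eq; first exact: cont01D.
have <- : (fun n => rsum phi n + rsum psi n) = rsum (fun t => phi t + psi t).
  by apply/funext => n; rewrite /rsum big_split mulrDr.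
exact: (cvsD (int01_cvs H) (int01_cvs H')).
Qed.

Lemma int01Z c phi : cont01 phi -> int01 (fun t => c * phi t) = c * int01 phi.
Proof.
move=> H; apply: int01_eq; first exact: cont01Z.
have <- : (fun n => c * rsum phi n) = rsum (fun t => c * phi t).
  by apply/funext => n; rewrite /rsum -mulr_sumr mulrCA.
exact: (cvsZ c (int01_cvs H)).
Qed.

Lemma int01_near phi a M : cont01 phi ->
  (forall t, 0 <= t <= 1 -> nrm (phi t - a) <= M) -> nrm (int01 phi - a) <= M.
Proof. by move=> H HM; have := @cvs_bound (rsum phi) (int01 phi) a M (int01_cvs H); apply => n; apply: rsum_bound HM. Qed.

Lemma int01_bound phi M : cont01 phi ->
  (forall t, 0 <= t <= 1 -> nrm (phi t) <= M) -> nrm (int01 phi) <= M.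
Proof.
move=> H HM; rewrite -[int01 phi]subr0; apply: int01_near => // t t1.
by rewrite subr0; apply: HM.
Qed.

Lemma int01_cst c : int01 (fun=> c) = c.
Proof.
apply/eqP; rewrite -subr_eq0 -nrm_eq0 eq_le nrm_ge0 andbT.
apply: int01_near => [t _ e e0|t _]; last by rewrite subrr nrm0.
by exists 1 => // s _ _; rewrite subrr nrm0.
Qed.

Lemma cont01_half1 phi : cont01 phi -> cont01 (fun t => phi (t / 2)).
Proof.
move=> H t t01 e e0; have t2 : 0 <= t / 2 <= 1 by lra.
have [d d0 Hd] := H _ t2 _ e0; exists d => // s s01 st; apply: Hd; first by lra.
by move: st; rewrite !ltr_norml; lra.
Qed.
Lemma cont01_half2 phi : cont01 phi -> cont01 (fun t => phi ((1 + t) / 2)).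
Proof.
move=> H t t01 e e0; have t2 : 0 <= (1 + t) / 2 <= 1 by lra.
have [d d0 Hd] := H _ t2 _ e0; exists d => // s s01 st; apply: Hd; first by lra.
by move: st; rewrite !ltr_norml; lra.
Qed.

Lemma int01_half phi : cont01 phi -> int01 phi =
  rc (2^-1) * (int01 (fun t => phi (t / 2)) + int01 (fun t => phi ((1 + t) / 2))).
Proof.
move=> H; apply: int01_eq => //.
have h := cvsZ (rc (2^-1)) (cvsD (int01_cvs (cont01_half1 H)) (int01_cvs (cont01_half2 H))).
have K : (fun n => rc 2^-1 * (rsum (fun t => phi (t / 2)) n + rsum (fun t => phi ((1 + t) / 2)) n))
   = fun n => rsum phi n.+1 by apply/funext => n; rewrite rsumS.
rewrite K in h; move=> e /h[N HN]; exists N.+1 => -[//|n]; rewrite ltnS; exact: HN.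
Qed.

Lemma cont01_rc (a : R) : cont01 (fun t => rc (a * t)).
Proof.
move=> t _ e e0; have n1 : 0 < `|a| + 1 by have := normr_ge0 a; lra.
exists (e / (`|a| + 1)) => [|s _]; first exact: divr_gt0.
rewrite -rcB nrm_rc -mulrBr normrM ltr_pdivlMr // => h.
have := normr_ge0 a; have := normr_ge0 (s - t); nra.
Qed.

(** Halving gives I = (I/2 + 1/2 + I/2) / 2, which determines I. *)
Lemma int01_id : int01 (fun t => rc t) = rc (2^-1).
Proof.
have c1 : cont01 (fun t => rc t).
  by move=> t t1 e e0; have [d d0 Hd] := cont01_rc 1 t1 e0; exists d => // s s1 /(Hd _ s1); rewrite !mul1r.
have cc c : cont01 (fun=> c) by move=> t _ e e0; exists 1 => // s _ _; rewrite subrr nrm0.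
have := int01_half c1.
have -> : (fun t : R => rc (t / 2)) = (fun t : R => rc (2^-1) * rc t).
  by apply/funext => t; rewrite -rcM mulrC.
have -> : (fun t : R => rc ((1 + t) / 2)) = (fun t : R => rc (2^-1) + rc (2^-1) * rc t).
  by apply/funext => t; rewrite -rcM -rcD; congr rc; ring.
rewrite int01D ?int01Z //; last exact: cont01Z.
rewrite int01_cst; set I := int01 _ => E.
apply: C_ext.
  by have := congr1 (@re R) E; rewrite re_rcM !reD re_rcM !re_rc; lra.
by have := congr1 (@im R) E; rewrite im_rcM !imD im_rcM !im_rc; lra.
Qed.

End Integral.

(** * Goursat's theorem for squares *)

Section Goursat.
Variable R : realType.
Local Notation C := (Cplx R).
Local Notation ii := (ii R).

Definition contAt (f : C -> C) (z : C) : Prop := forall e : R, 0 < e ->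
  exists2 d : R, 0 < d & forall w, nrm (w - z) < d -> nrm (f w - f z) < e.

(** Contour integral along the segment from [a] to [a + v]. *)
Definition seg (f : C -> C) (a v : C) : C :=
  v * int01 (fun t => f (a + rc t * v)).

(** Contour integral around the square with corner [c] and sides [h] and [ii * h]; the last two
    edges are traversed backwards. *)
Definition sq (f : C -> C) (c h : C) : C :=
  seg f c h + seg f (c + h) (ii * h) - seg f (c + ii * h) h - seg f c (ii * h).

(** The square centred at 0; for real [s] its half-side is [s]. *)
Definition csq (f : C -> C) (s : C) : C := sq f (- (s + ii * s)) (s + s).

Lemma cont_seg f a v : (forall t : R, 0 <= t <= 1 -> contAt f (a + rc t * v)) ->
  cont01 (fun t => f (a + rc t * v)).
Proof.
move=> H t t01 e e0; have [d d0 Hd] := H t t01 e e0.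
have n1 : 0 < nrm v + 1 by have := nrm_ge0 v; lra.
exists (d / (nrm v + 1)) => [|s s01]; first exact: divr_gt0.
rewrite ltr_pdivlMr // => st; apply: Hd.
have -> : a + rc s * v - (a + rc t * v) = rc (s - t) * v by rewrite rcB; ring.
rewrite nrmM nrm_rc; apply: le_lt_trans st; apply: ler_wpM2l => //; lra.
Qed.

Lemma seg_half f a k : (forall t : R, 0 <= t <= 1 -> contAt f (a + rc t * (k + k))) ->
  seg f a (k + k) = seg f a k + seg f (a + k) k.
Proof.
move=> /cont_seg H; rewrite /seg int01_half //.
have h2 : rc 2^-1 * 2 = 1 :> C by rewrite -(rc_nat R 2) -rcM mulVf ?rc1 // pnatr_eq0.
have -> : int01 (fun t => f (a + rc (t / 2) * (k + k))) = int01 (fun t => f (a + rc t * k)).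
  apply: int01_ext => t _; congr (f (_ + _)).
  by rewrite rcM -mulrA -mulr2n -[k *+ 2]mulr_natl (mulrA _ 2) h2 mul1r.
have -> : int01 (fun t => f (a + rc ((1 + t) / 2) * (k + k))) = int01 (fun t => f (a + k + rc t * k)).
  apply: int01_ext => t _; congr f; rewrite -addrA; congr (_ + _).
  by rewrite rcM -mulrA -mulr2n -[k *+ 2]mulr_natl (mulrA _ 2) h2 mul1r rcD rc1 mulrDl mul1r.
rewrite -mulrDr mulrA; congr (_ * _).
by rewrite -mulr2n -[k *+ 2]mulr_natl mulrAC [2 * _]mulrC h2 mul1r.
Qed.

Lemma seg_bound f a v M : (forall t : R, 0 <= t <= 1 -> contAt f (a + rc t * v)) ->
  (forall t : R, 0 <= t <= 1 -> nrm (f (a + rc t * v)) <= M) ->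
  nrm (seg f a v) <= nrm v * M.
Proof.
move=> /cont_seg H HM; rewrite nrmM; apply: ler_wpM2l; first exact: nrm_ge0.
exact: int01_bound.
Qed.

Lemma segD f g a v : (forall t : R, 0 <= t <= 1 -> contAt f (a + rc t * v)) ->
  (forall t : R, 0 <= t <= 1 -> contAt g (a + rc t * v)) ->
  seg (fun w => f w + g w) a v = seg f a v + seg g a v.
Proof. by move=> /cont_seg H /cont_seg H'; rewrite /seg int01D // mulrDr. Qed.

Lemma segZ c f a v : (forall t : R, 0 <= t <= 1 -> contAt f (a + rc t * v)) ->
  seg (fun w => c * f w) a v = c * seg f a v.
Proof. by move=> /cont_seg H; rewrite /seg int01Z // mulrCA. Qed.

Lemma contAt_cst c z : contAt (fun=> c) z.
Proof. by move=> e e0; exists 1 => // w _; rewrite subrr nrm0. Qed.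
Lemma contAt_id z : contAt id z.
Proof. by move=> e e0; exists e. Qed.
Lemma contAtD f g z : contAt f z -> contAt g z -> contAt (fun w => f w + g w) z.
Proof.
move=> H H' e e0; have e20 : 0 < e / 2 by lra.
have [d d0 Hd] := H _ e20; have [d' d'0 Hd'] := H' _ e20.
exists (Num.min d d') => [|w]; first by rewrite lt_min d0.
rewrite lt_min => /andP[/Hd h1 /Hd' h2].
have -> : f w + g w - (f z + g z) = (f w - f z) + (g w - g z) by ring.
by apply: le_lt_trans (nrmD _ _) _; lra.
Qed.
Lemma contAtZ c f z : contAt f z -> contAt (fun w => c * f w) z.
Proof.
move=> H e e0; have n1 : 0 < nrm c + 1 by have := nrm_ge0 c; lra.
have [d d0 Hd] := H _ (divr_gt0 e0 n1).
exists d => // w /Hd; rewrite -mulrBr nrmM ltr_pdivlMr // => h.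
have := nrm_ge0 (f w - f z); have := nrm_ge0 c; nra.
Qed.

Lemma seg_aff al be a v : seg (fun w => al + be * w) a v =
  v * (al + be * a) + be * (v * v) * rc 2^-1.
Proof.
have cr : cont01 (fun t : R => rc t).
  by move=> t t1 e e0; have [d d0 Hd] := @cont01_rc R 1 t t1 e e0; exists d => // s s1 /(Hd _ s1); rewrite !mul1r.
have cc (c : C) : @cont01 R (fun=> c) by move=> t _ e e0; exists 1 => // s _ _; rewrite subrr nrm0.
rewrite /seg; have -> : (fun t : R => al + be * (a + rc t * v)) =
    (fun t : R => (al + be * a) + be * v * rc t) by apply/funext => t; ring.
rewrite int01D ?int01Z //; last exact: cont01Z.
by rewrite int01_cst int01_id; ring.
Qed.

Lemma sq_aff al be c h : sq (fun w => al + be * w) c h = 0.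
Proof.
rewrite /sq !seg_aff.
have -> : h * (al + be * c) + be * (h * h) * rc 2^-1 +
  (ii * h * (al + be * (c + h)) + be * (ii * h * (ii * h)) * rc 2^-1) -
  (h * (al + be * (c + ii * h)) + be * (h * h) * rc 2^-1) -
  (ii * h * (al + be * c) + be * (ii * h * (ii * h)) * rc 2^-1) = 0 by ring.
by [].
Qed.

Lemma derivable_1 (f : C -> C) (z : C) : derivable f z 1 -> exists d : C, forall e : R, 0 < e ->
  exists2 r : R, 0 < r & forall w, nrm (w - z) < r ->
    nrm (f w - f z - (w - z) * d) <= e * nrm (w - z).
Proof.
move=> H; exists ('D_1 f z) => e e0.
have [r r0 Hr] := (proj1 (derivable_nrm f z 1 ('D_1 f z))) (conj H erefl) e e0.
exists r => // w /Hr; rewrite -[_ *: 1]/(_ * 1) mulr1.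
by rewrite [z + _]addrC subrK.
Qed.

Lemma derivable_contAt (f : C -> C) (z : C) : derivable f z 1 -> contAt f z.
Proof.
move=> /derivable_1[d Hd] e e0; have [r r0 Hr] := Hd 1 ltr01.
have n1 : 0 < nrm d + 1 by have := nrm_ge0 d; lra.
exists (Num.min r (e / (nrm d + 1))) => [|w].
  by rewrite lt_min r0 divr_gt0.
rewrite lt_min ltr_pdivlMr // => /andP[/Hr h1 h2].
have -> : f w - f z = (f w - f z - (w - z) * d) + (w - z) * d by ring.
apply: le_lt_trans (nrmD _ _) _; rewrite nrmM; lra.
Qed.

(** If [P] failed on the unit square, repeated quartering would give nested bad squares shrinking to
    a point, and the second hypothesis at that point makes the small ones good. *)
Lemma bisect2 (P : R -> R -> R -> Prop) :
  (forall x y s, 0 < s -> P x y (s / 2) -> P (x + s / 2) y (s / 2) ->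
     P x (y + s / 2) (s / 2) -> P (x + s / 2) (y + s / 2) (s / 2) -> P x y s) ->
  (forall x y, 0 <= x <= 1 -> 0 <= y <= 1 -> exists2 d : R, 0 < d &
     forall a b s, 0 < s -> s < d -> a <= x <= a + s -> b <= y <= b + s ->
     0 <= a -> a + s <= 1 -> 0 <= b -> b + s <= 1 -> P a b s) ->
  P 0 0 1.
Proof.
move=> Pm Pl; apply: contrapT => nP.
(* The first quarter on which [P] fails; the fourth is the default, since by [Pm] some quarter of a
   bad square is bad. *)
pose next (q : R * R * R) : R * R * R := let: (x, y, s) := q in
  if pselect (P x y (s / 2)) then
  if pselect (P (x + s / 2) y (s / 2)) then
  if pselect (P x (y + s / 2) (s / 2)) then (x + s / 2, y + s / 2, s / 2)
  else (x, y + s / 2, s / 2) else (x + s / 2, y, s / 2) else (x, y, s / 2).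
pose u n := iter n next (0, 0, 1).
pose X n := (u n).1.1; pose Y n := (u n).1.2; pose S n := (u n).2.
have uS n : u n.+1 = next (X n, Y n, S n).
  by rewrite /u iterS -/(u n) /X /Y /S; case: (u n) => [[]].
have SE n : S n = (2 ^+ n)^-1.
  elim: n => [|n IH]; first by rewrite /S /= expr0 invr1.
  have -> : S n.+1 = S n / 2.
    by rewrite {1}/S uS /next; do 3?[case: pselect => ? //=].
  by rewrite IH exprS invfM mulrC.
have S0 n : 0 < S n by rewrite SE invr_gt0 pow2_gt0.
have st n : (X n.+1, Y n.+1, S n.+1) = next (X n, Y n, S n).
  by rewrite -uS /X /Y /S; case: (u n.+1) => [[]].
have XY n : [/\ X n <= X n.+1, X n.+1 + S n.+1 <= X n + S n,
    Y n <= Y n.+1 & Y n.+1 + S n.+1 <= Y n + S n].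
  have := st n; rewrite /next; have := S0 n; do 3?[case: pselect => ?];
    by move=> s0 [-> -> ->]; clear -s0; split; lra.
have bad n : ~ P (X n) (Y n) (S n).
  elim: n => [//|n IH]; have := st n; rewrite /next.
  case: pselect => p1; last by move=> [-> -> ->].
  case: pselect => p2; last by move=> [-> -> ->].
  case: pselect => p3; last by move=> [-> -> ->].
  by move=> [-> -> ->] p4; apply: IH; apply: Pm.
have mono n j : [/\ X n <= X (n + j)%N, X (n + j)%N + S (n + j)%N <= X n + S n,
    Y n <= Y (n + j)%N & Y (n + j)%N + S (n + j)%N <= Y n + S n].
  elim: j => [|j [h1 h2 h3 h4]]; first by rewrite addn0.
  by rewrite addnS; have [] := XY (n + j)%N; clear -h1 h2 h3 h4; split; lra.
have XUb n m : X m <= X n + S n.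
  have [h|h] := leqP n m.
    have [_ h2 _ _] := mono n (m - n)%N; have := S0 m; move: h2; rewrite subnKC //; lra.
  have [h1 _ _ _] := mono m (n - m)%N; have := S0 n; move: h1; rewrite subnKC ?(ltnW h) //; lra.
have YUb n m : Y m <= Y n + S n.
  have [h|h] := leqP n m.
    have [_ _ _ h2] := mono n (m - n)%N; have := S0 m; move: h2; rewrite subnKC //; lra.
  have [_ _ h1 _] := mono m (n - m)%N; have := S0 n; move: h1; rewrite subnKC ?(ltnW h) //; lra.
have hsX : has_sup (range X).
  by split; [exists (X 0%N), 0%N | exists (X 0%N + S 0%N) => _ [m _ <-]].
have hsY : has_sup (range Y).
  by split; [exists (Y 0%N), 0%N | exists (Y 0%N + S 0%N) => _ [m _ <-]].
have hx n : X n <= sup (range X) <= X n + S n.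
  apply/andP; split; first by apply: ub_le_sup; [case: hsX | exists n].
  by apply: ge_sup => [|_ [m _ <-]] //; case: hsX.
have hy n : Y n <= sup (range Y) <= Y n + S n.
  apply/andP; split; first by apply: ub_le_sup; [case: hsY | exists n].
  by apply: ge_sup => [|_ [m _ <-]] //; case: hsY.
have E0 : (X 0%N = 0) * (Y 0%N = 0) * (S 0%N = 1) by [].
have := hx 0%N; have := hy 0%N; rewrite !E0 add0r => y01 x01.
have [d d0 Hd] := Pl _ _ x01 y01.
have [n Hn] := pow2_small d0.
have [h1 h2 h3 h4] := mono 0%N n.
by apply: (bad n); apply: Hd => //; rewrite ?SE //; move: h1 h2 h3 h4; rewrite add0n !E0 -?SE; lra.
Qed.

Definition inSQ (c h w : C) : Prop :=
  exists x y : R, [/\ 0 <= x <= 1, 0 <= y <= 1 & w = c + (rc x + ii * rc y) * h].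

Lemma rc_half2 (k : C) : rc 2^-1 * (k + k) = k.
Proof.
have h2 : rc 2^-1 * 2 = 1 :> C by rewrite -(rc_nat R 2) -rcM mulVf ?rc1 // pnatr_eq0.
by rewrite -mulr2n -[k *+ 2]mulr_natl mulrA h2 mul1r.
Qed.

Lemma inSQ_segs (c h : C) (t : R) : 0 <= t <= 1 ->
  [/\ inSQ c h (c + rc t * h), inSQ c h (c + h + rc t * (ii * h)),
      inSQ c h (c + ii * h + rc t * h) & inSQ c h (c + rc t * (ii * h))].
Proof.
move=> t1; have h0 : 0 <= (0 : R) <= 1 by rewrite lexx ler01.
have h1 : 0 <= (1 : R) <= 1 by rewrite lexx ler01.
by split; [exists t, 0|exists 1, t|exists t, 1|exists 0, t]; split => //;
  rewrite ?rc0 ?rc1; ring.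
Qed.

Lemma half01 (x : R) : 0 <= x <= 1 -> (0 <= x / 2 <= 1) /\ (0 <= (1 + x) / 2 <= 1).
Proof. by lra. Qed.

Lemma inSQ_quad (c k w : C) :
  [\/ inSQ c k w, inSQ (c + k) k w, inSQ (c + ii * k) k w | inSQ (c + k + ii * k) k w] ->
  inSQ c (k + k) w.
Proof.
have D (x : R) : rc (x / 2) * (k + k) = rc x * k by rewrite rcM -mulrA rc_half2.
by case=> -[x [y [/half01[x1 x2] /half01[y1 y2] ->]]];
  [exists (x / 2), (y / 2)|exists ((1 + x) / 2), (y / 2)|
   exists (x / 2), ((1 + y) / 2)|exists ((1 + x) / 2), ((1 + y) / 2)]; split => //;
  rewrite [in RHS]mulrDl -[ii * _ * (k + k)]mulrA !D ?rcD ?rc1; ring.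
Qed.

Lemma sq_quad f c k : (forall w, inSQ c (k + k) w -> contAt f w) ->
  sq f c (k + k) = sq f c k + sq f (c + k) k + sq f (c + ii * k) k
    + sq f (c + k + ii * k) k.
Proof.
move=> H.
have hh (t : R) : 0 <= t <= 1 -> 0 <= t <= 1 by [].
have h12 : 0 <= (2^-1 : R) <= 1 by lra.
have K1 t : 0 <= t <= 1 -> contAt f (c + rc t * (k + k)).
  by move=> t1; apply: H; have [] := inSQ_segs c (k + k) t1.
have K2 t : 0 <= t <= 1 -> contAt f (c + (k + k) + rc t * (ii * k + ii * k)).
  by move=> t1; rewrite -mulrDr; apply: H; have [] := inSQ_segs c (k + k) t1.
have K3 t : 0 <= t <= 1 -> contAt f (c + ii * (k + k) + rc t * (k + k)).
  by move=> t1; apply: H; have [] := inSQ_segs c (k + k) t1.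
have K4 t : 0 <= t <= 1 -> contAt f (c + rc t * (ii * k + ii * k)).
  by move=> t1; rewrite -mulrDr; apply: H; have [] := inSQ_segs c (k + k) t1.
have E1 : c + (k + k) = c + k + k by rewrite addrA.
have E2 : c + ii * (k + k) = c + ii * k + ii * k by rewrite mulrDr addrA.
have E3 : c + k + ii * k = c + ii * k + k by rewrite addrAC.
have E4 : c + k + k + ii * k = c + k + ii * k + k by rewrite (addrAC _ (ii * k)).
rewrite /sq [ii * (k + k)]mulrDr (seg_half K1) (seg_half K2) (addrA c (ii * k)).
rewrite -E2 (seg_half K3) (seg_half K4) E1 E2.
rewrite (addrAC (c + k) k (ii * k)) (addrAC c k (ii * k)) (addrAC (c + ii * k) (ii * k) k).
ring.
Qed.

Lemma sq_bound f c h M : (forall w, inSQ c h w -> contAt f w) ->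
  (forall w, inSQ c h w -> nrm (f w) <= M) -> nrm (sq f c h) <= 4 * (nrm h * M).
Proof.
move=> Hc HM; rewrite /sq.
have nh : nrm (ii * h) = nrm h by rewrite nrmM nrmii mul1r.
have S a v : (forall t : R, 0 <= t <= 1 -> inSQ c h (a + rc t * v)) ->
    nrm (seg f a v) <= nrm v * M.
  by move=> H; apply: seg_bound => t /H; [exact: Hc|exact: HM].
have B1 : nrm (seg f c h) <= nrm h * M by apply: S => t /(inSQ_segs c h)[].
have B2 : nrm (seg f (c + h) (ii * h)) <= nrm h * M.
  by rewrite -nh; apply: S => t /(inSQ_segs c h)[].
have B3 : nrm (seg f (c + ii * h) h) <= nrm h * M by apply: S => t /(inSQ_segs c h)[].
have B4 : nrm (seg f c (ii * h)) <= nrm h * M.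
  by rewrite -nh; apply: S => t /(inSQ_segs c h)[].
move: B1 B2 B3 B4; set s1 := seg _ _ _; set s2 := seg _ _ _.
set s3 := seg _ _ _; set s4 := seg _ _ _ => B1 B2 B3 B4.
have := nrmD (s1 + s2 - s3) (- s4); have := nrmD (s1 + s2) (- s3); have := nrmD s1 s2.
rewrite !nrmN => D1 D2 D3; lra.
Qed.

Lemma sqD f g c h : (forall w, inSQ c h w -> contAt f w) ->
  (forall w, inSQ c h w -> contAt g w) ->
  sq (fun w => f w + g w) c h = sq f c h + sq g c h.
Proof.
move=> Hf Hg; have S a v : (forall t : R, 0 <= t <= 1 -> inSQ c h (a + rc t * v)) ->
    seg (fun w => f w + g w) a v = seg f a v + seg g a v.
  by move=> H; apply: segD => t /H; [exact: Hf|exact: Hg].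
rewrite /sq (S c h); last by move=> t /(inSQ_segs c h)[].
rewrite (S (c + h)); last by move=> t /(inSQ_segs c h)[].
rewrite (S (c + ii * h)); last by move=> t /(inSQ_segs c h)[].
rewrite (S c (ii * h)); last by move=> t /(inSQ_segs c h)[].
by ring.
Qed.

(** The affine part of [f] at [z] integrates to 0 by [sq_aff], so only the remainder contributes. *)
Lemma sq_local f c h z d M : (forall w, inSQ c h w -> contAt f w) ->
  (forall w, inSQ c h w -> nrm (f w - f z - (w - z) * d) <= M) ->
  nrm (sq f c h) <= 4 * (nrm h * M).
Proof.
move=> Hc HM; pose A w := (f z - z * d) + d * w.
have cA w : contAt A w.
  by apply: contAtD; [exact: contAt_cst | apply: contAtZ; exact: contAt_id].
have cr w : inSQ c h w -> contAt (fun w => f w + -1 * A w) w.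
  by move=> /Hc cf; apply: contAtD => //; apply: contAtZ.
have -> : f = (fun w => A w + (f w + -1 * A w)) by apply/funext => w; ring.
rewrite sqD // sq_aff add0r; apply: sq_bound => // w /HM.
by have -> : f w + -1 * A w = f w - f z - (w - z) * d by rewrite /A; ring.
Qed.

(** It is enough to bound the integral by [e] times the squared side, for every [e]. This bound is
    additive under quartering, so by [bisect2] it need only hold on small squares around each point,
    where [sq_local] applies. *)
Lemma goursat (f : C -> C) (c h : C) :
  (forall w, inSQ c h w -> derivable f w 1) -> sq f c h = 0.
Proof.
move=> Hd.
have Hc w : inSQ c h w -> contAt f w by move=> /Hd; exact: derivable_contAt.
suff H e : 0 < e -> nrm (sq f c h) <= e * nrm h ^+ 2.
  apply/eqP; rewrite -nrm_eq0 eq_le nrm_ge0 andbT leNgt; apply/negP => l0.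
  have n0 : 0 < nrm h ^+ 2 + 1 by have := sqr_ge0 (nrm h); lra.
  have e0 : 0 < nrm (sq f c h) / (2 * (nrm h ^+ 2 + 1)).
    by apply: divr_gt0 => //; lra.
  have := H _ e0; have := sqr_ge0 (nrm h).
  move: n0 l0; set N := nrm h ^+ 2; set s := nrm _ => n0 l0 N0.
  rewrite leNgt => /negP; apply.
  rewrite mulrAC ltr_pdivrMr; last lra.
  by clear -n0 l0 N0; nra.
move=> e0.
pose pt (x y : R) : C := c + (rc x + ii * rc y) * h.
pose P (a b s : R) := (forall w, inSQ (pt a b) (rc s * h) w -> inSQ c h w) ->
  nrm (sq f (pt a b) (rc s * h)) <= e * (s * nrm h) ^+ 2.
suff P1 : P 0 0 1.
  move: P1; rewrite /P /pt rc0 rc1 mulr0 addr0 mul0r addr0 !mul1r; exact.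
apply: bisect2.
  move=> x y s s0; set k := rc (s / 2) * h.
  have Ek : rc s * h = k + k by rewrite /k -mulrDl -rcD; congr (rc _ * _); clear; lra.
  have E1 : pt (x + s / 2) y = pt x y + k by rewrite /pt /k rcD; ring.
  have E2 : pt x (y + s / 2) = pt x y + ii * k by rewrite /pt /k rcD; ring.
  have E3 : pt (x + s / 2) (y + s / 2) = pt x y + k + ii * k.
    by rewrite /pt /k !rcD; ring.
  rewrite /P E1 E2 E3 Ek -/k => p1 p2 p3 p4 Hin.
  have q1 := p1 (fun w hw => Hin w (inSQ_quad (Or41 _ _ _ hw))).
  have q2 := p2 (fun w hw => Hin w (inSQ_quad (Or42 _ _ _ hw))).
  have q3 := p3 (fun w hw => Hin w (inSQ_quad (Or43 _ _ _ hw))).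
  have q4 := p4 (fun w hw => Hin w (inSQ_quad (Or44 _ _ _ hw))).
  rewrite sq_quad; last by move=> w /Hin /Hc.
  have T a b c' d : nrm (a + b + c' + d : C) <= nrm a + nrm b + nrm c' + nrm d.
    by have := nrmD (a + b + c') d; have := nrmD (a + b) c'; have := nrmD a b; clear; lra.
  apply: le_trans (T _ _ _ _) _.
  have -> : e * (s * nrm h) ^+ 2 = e * (s / 2 * nrm h) ^+ 2 + e * (s / 2 * nrm h) ^+ 2
     + e * (s / 2 * nrm h) ^+ 2 + e * (s / 2 * nrm h) ^+ 2 by field.
  by do 3?apply: lerD.
move=> x y x1 y1.
have sz : inSQ c h (pt x y) by exists x, y.
have [d Hd1] := derivable_1 (Hd _ sz).
(* Points of the small square are within twice its side of [pt x y], and [sq_local] brings a factor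
   4; [e / 8] compensates both. *)
have e8 : 0 < e / 8 by clear -e0; lra.
have [r r0 Hr] := Hd1 _ e8.
have n1 : 0 < 2 * (nrm h + 1) by have := nrm_ge0 h; clear; lra.
exists (r / (2 * (nrm h + 1))) => [|a b s s0]; first exact: divr_gt0.
rewrite ltr_pdivlMr // => sr ax by_ _ _ _ _ Hin.
have near w : inSQ (pt a b) (rc s * h) w -> nrm (w - pt x y) <= 2 * (s * nrm h).
  case=> u [v [u1 v1 ->]].
  have -> : pt a b + (rc u + ii * rc v) * (rc s * h) - pt x y =
     (rc (a + u * s - x) + ii * rc (b + v * s - y)) * h.
    by rewrite /pt !rcB !rcD !rcM; ring.
  rewrite nrmM mulrA; apply: ler_wpM2r; first exact: nrm_ge0.
  apply: le_trans (nrmD _ _) _; rewrite nrmM nrmii mul1r !nrm_rc.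
  have : `|a + u * s - x| <= s by rewrite ler_norml; clear -s0 ax u1; nra.
  have : `|b + v * s - y| <= s by rewrite ler_norml; clear -s0 by_ v1; nra.
  by clear; lra.
have nsh : nrm (rc s * h) = s * nrm h by rewrite nrmM nrm_rc ger0_norm // ltW.
have -> : e * (s * nrm h) ^+ 2 = 4 * (nrm (rc s * h) * (e / 8 * (2 * (s * nrm h)))).
  by rewrite nsh; field.
apply: (@sq_local _ _ _ (pt x y) d) => w hw; first by apply/Hc/Hin.
apply: le_trans (Hr _ _) _.
  by apply: le_lt_trans (near _ hw) _; have := nrm_ge0 h; clear -sr s0; nra.
by apply: ler_wpM2l; [exact: ltW | exact: near].
Qed.

End Goursat.

(** * Cauchy's integral formulas on centred squares *)

Section CauchyFormula.
Variable R : realType.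
Local Notation C := (Cplx R).
Local Notation ii := (ii R).

Lemma re_inv (w : C) : re w^-1 = re w / (re w ^+ 2 + im w ^+ 2).
Proof. by case: w. Qed.
Lemma im_inv (w : C) : im w^-1 = - im w / (re w ^+ 2 + im w ^+ 2).
Proof. by case: w => a b; rewrite mulNr. Qed.

Lemma derivable_inv (z : C) : z != 0 -> derivable (fun w : C => w^-1) z 1.
Proof. by move=> z0; apply: derivableV => //; exact: derivable_id. Qed.

Lemma derivableMf (f g : C -> C) z : derivable f z 1 -> derivable g z 1 ->
  derivable (fun w => f w * g w) z 1.
Proof. by move=> hf hg; have := derivableM hf hg; exact. Qed.

Lemma derivableDf (f g : C -> C) z : derivable f z 1 -> derivable g z 1 ->
  derivable (fun w => f w + g w) z 1.
Proof. by move=> hf hg; have := derivableD hf hg; exact. Qed.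

Lemma derivable_subr (a z : C) : derivable (fun w : C => w - a) z 1.
Proof.
by have := derivableDf (@derivable_id _ _ z 1) (@derivable_cst _ _ _ (- a) z 1); exact.
Qed.

Lemma derivableVf (f : C -> C) z : f z != 0 -> derivable f z 1 ->
  derivable (fun w => (f w)^-1) z 1.
Proof. by move=> fz hf; have := derivableV fz hf; exact. Qed.

(** [P] on a closed annulus. The boundary of the square of half-side [s] lies between the radii [s]
    and [2 * s] ([csq_edges]), which is how contour integrals are estimated. *)
Definition ann (a b : R) (P : C -> Prop) : Prop :=
  forall w, a <= nrm w -> nrm w <= b -> P w.

Lemma csq_edges (s : R) (t : R) : 0 < s -> 0 <= t <= 1 ->
  forall w, [\/ w = - (rc s + ii * rc s) + rc t * (rc s + rc s),
    w = - (rc s + ii * rc s) + (rc s + rc s) + rc t * (ii * (rc s + rc s)),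
    w = - (rc s + ii * rc s) + ii * (rc s + rc s) + rc t * (rc s + rc s) |
    w = - (rc s + ii * rc s) + rc t * (ii * (rc s + rc s))] -> s <= nrm w <= 2 * s.
Proof.
move=> s0 t1 w H.
have h (x y : R) : `|x| <= s -> `|y| <= s -> `|x| = s \/ `|y| = s ->
    w = rc x + ii * rc y -> s <= nrm w <= 2 * s.
  move=> xs ys xy ->; apply/andP; split.
    have := le_re (rc x + ii * rc y); have := le_im (rc x + ii * rc y).
    rewrite reD imD reM imM !re_rc !im_rc reii imii !mul0r !mul1r subr0 !add0r !addr0.
    by case: xy => ->.
  by apply: le_trans (nrmD _ _) _; rewrite nrmM nrmii mul1r !nrm_rc; lra.
have ts : `|(2 * t - 1) * s| <= s by rewrite ler_norml; clear -s0 t1; nra.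
have ns : `|s| = s by rewrite ger0_norm // ltW.
have ns' : `|- s| = s by rewrite normrN.
have es : s <= s by [].
have e2 : rc 2 = 2 :> C by rewrite rc_nat.
by case: H => E; [apply: (h ((2 * t - 1) * s) (- s))|apply: (h s ((2 * t - 1) * s))|
  apply: (h ((2 * t - 1) * s) s)|apply: (h (- s) ((2 * t - 1) * s))];
  rewrite ?ns ?ns' //; try (by left); try (by right); rewrite E ?(rcM, rcN, rcB, rc1, e2); ring.
Qed.

Lemma csq_seg (s : R) (P : C -> Prop) : 0 < s -> ann s (2 * s) P ->
  [/\ forall t : R, 0 <= t <= 1 -> P (- (rc s + ii * rc s) + rc t * (rc s + rc s)),
    forall t : R, 0 <= t <= 1 -> P (- (rc s + ii * rc s) + (rc s + rc s) + rc t * (ii * (rc s + rc s))),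
    forall t : R, 0 <= t <= 1 -> P (- (rc s + ii * rc s) + ii * (rc s + rc s) + rc t * (rc s + rc s)) &
    forall t : R, 0 <= t <= 1 -> P (- (rc s + ii * rc s) + rc t * (ii * (rc s + rc s)))].
Proof.
move=> s0 H; split => t t1; (have E := csq_edges s0 t1;
 match goal with |- P ?w => have /andP[] := E w ltac:(by [apply: Or41|apply: Or42|apply: Or43|apply: Or44]) end; exact: H).
Qed.

Lemma csq_bound f (s M : R) : 0 < s -> ann s (2 * s) (contAt f) ->
  ann s (2 * s) (fun w => nrm (f w) <= M) -> nrm (csq f (rc s)) <= 8 * (s * M).
Proof.
move=> s0 /(csq_seg s0)[c1 c2 c3 c4] /(csq_seg s0)[m1 m2 m3 m4]; rewrite /csq /sq.
have n1 : nrm (rc s + rc s) = 2 * s by rewrite -rcD nrm_rc ger0_norm; lra.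
have n2 : nrm (ii * (rc s + rc s)) = 2 * s by rewrite nrmM nrmii mul1r.
have B1 := seg_bound c1 m1; have B2 := seg_bound c2 m2.
have B3 := seg_bound c3 m3; have B4 := seg_bound c4 m4.
rewrite ?n1 ?n2 in B1 B2 B3 B4; clear c1 c2 c3 c4 m1 m2 m3 m4.
move: B1 B2 B3 B4; set s1 := seg _ _ _; set s2 := seg _ _ _.
set s3 := seg _ _ _; set s4 := seg _ _ _ => B1 B2 B3 B4.
have := nrmD (s1 + s2 - s3) (- s4); have := nrmD (s1 + s2) (- s3); have := nrmD s1 s2.
rewrite !nrmN => D1 D2 D3; clear -B1 B2 B3 B4 D1 D2 D3; lra.
Qed.

Lemma csqD f g (s : R) : 0 < s -> ann s (2 * s) (contAt f) -> ann s (2 * s) (contAt g) ->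
  csq (fun w => f w + g w) (rc s) = csq f (rc s) + csq g (rc s).
Proof.
move=> s0 /(csq_seg s0)[c1 c2 c3 c4] /(csq_seg s0)[d1 d2 d3 d4]; rewrite /csq /sq.
by rewrite (segD c1 d1) (segD c2 d2) (segD c3 d3) (segD c4 d4); ring.
Qed.

Lemma csqZ c f (s : R) : 0 < s -> ann s (2 * s) (contAt f) ->
  csq (fun w => c * f w) (rc s) = c * csq f (rc s).
Proof.
move=> s0 /(csq_seg s0)[c1 c2 c3 c4]; rewrite /csq /sq.
by rewrite (segZ c c1) (segZ c c2) (segZ c c3) (segZ c c4); ring.
Qed.

Lemma csq_ext f g (s : R) : 0 < s -> ann s (2 * s) (fun w => f w = g w) ->
  csq f (rc s) = csq g (rc s).
Proof.
move=> s0 /(csq_seg s0)[c1 c2 c3 c4]; rewrite /csq /sq /seg.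
by rewrite (int01_ext c1) (int01_ext c2) (int01_ext c3) (int01_ext c4).
Qed.

Lemma csq_goursat (f : C -> C) (s : R) : 0 < s ->
  (forall w, nrm w <= 2 * s -> derivable f w 1) -> csq f (rc s) = 0.
Proof.
move=> s0 H; apply: goursat => w [x [y [x1 y1 ->]]]; apply: H.
have -> : - (rc s + ii * rc s) + (rc x + ii * rc y) * (rc s + rc s) =
    rc ((2 * x - 1) * s) + ii * rc ((2 * y - 1) * s).
  have e2 : rc 2 = 2 :> C by rewrite rc_nat.
  by rewrite ?(rcM, rcB, rc1, e2); ring.
apply: le_trans (nrmD _ _) _; rewrite nrmM nrmii mul1r !nrm_rc.
have : `|(2 * x - 1) * s| <= s by rewrite ler_norml; clear -s0 x1; nra.
have : `|(2 * y - 1) * s| <= s by rewrite ler_norml; clear -s0 y1; nra.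
by clear; lra.
Qed.

(* The contour over the square of half-side 2k minus that over the square of
   half-side k is the sum of the contours of the 12 outer cells of a 4 x 4 grid. *)
Lemma csq_ring (f : C -> C) (k : R) : 0 < k ->
  ann k (4 * k) (fun w => derivable f w 1) -> csq f (rc (2 * k)) = csq f (rc k).
Proof.
move=> k0 Hd.
pose K := rc k; pose g (i j : nat) : C := (i%:R - 2 + ii * (j%:R - 2)) * K.
have gx i j : g i j + K = g i.+1 j by rewrite /g -(addn1 i) natrD; ring.
have gy i j : g i j + ii * K = g i j.+1 by rewrite /g -(addn1 j) natrD; ring.
have pt (x y : R) : `|x| <= 2 -> `|y| <= 2 -> 1 <= `|x| \/ 1 <= `|y| ->
    derivable f ((rc x + ii * rc y) * K) 1.
  move=> x2 y2 xy; apply: Hd; rewrite nrmM nrm_rc (gtr0_norm k0).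
    rewrite ler_peMl ?(ltW k0) //.
    have := le_re (rc x + ii * rc y); have := le_im (rc x + ii * rc y).
    rewrite reD imD reM imM !re_rc !im_rc reii imii !mul0r !mul1r subr0 !add0r !addr0.
    by case: xy; clear; lra.
  rewrite ler_pM2r //; apply: le_trans (nrmD _ _) _.
  by rewrite nrmM nrmii mul1r !nrm_rc; clear -x2 y2; lra.
(* The cells whose two indices are both 1 or 2 make up the inner square. *)
pose bad i := (i == 1%N) || (i == 2%N).
have cell i j w : (i < 4)%N -> (j < 4)%N -> ~~ (bad i && bad j) -> inSQ (g i j) K w ->
    derivable f w 1.
  move=> i4 j4 nb [x [y [x1 y1 ->]]].
  have -> : g i j + (rc x + ii * rc y) * K = (rc (i%:R - 2 + x) + ii * rc (j%:R - 2 + y)) * K.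
    by rewrite /g !(rc_nat, rcN, rcD); ring.
  have bd (m : nat) (t : R) : (m < 4)%N -> 0 <= t <= 1 -> `|m%:R - 2 + t| <= 2 /\
      (~~ bad m -> 1 <= `|m%:R - 2 + t|).
    move=> m4 t1; have n2 : `|m%:R - 2 + t| <= 2.
      rewrite ler_norml; have := ler0n R m.
      have : m%:R <= 3 :> R by rewrite ler_nat -ltnS.
      by clear -t1; lra.
    split => //; case: m m4 {n2} => [|[|[|[|//]]]] //= _ _.
      by rewrite ler_normr; apply/orP; right; clear -t1; lra.
    by rewrite ler_normr; apply/orP; left; clear -t1; lra.
  have [a1 a2] := bd _ _ i4 x1; have [b1 b2] := bd _ _ j4 y1.
  by apply: pt => //; move: nb; rewrite negb_and => /orP[/a2|/b2]; [left|right].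
have S0 i j : (i < 4)%N -> (j < 4)%N -> ~~ (bad i && bad j) -> sq f (g i j) K = 0.
  by move=> i4 j4 nb; apply: goursat => w; apply: cell.
pose E i j := seg f (g i j) K; pose V i j := seg f (g i j) (ii * K).
have SE i j : (i < 4)%N -> (j < 4)%N -> ~~ (bad i && bad j) ->
    E i j + V i.+1 j - E i j.+1 - V i j = 0.
  by move=> i4 j4 nb; rewrite -(S0 i j) // /sq gx gy.
have hE i j (t x : R) : g i j + rc t * (rc x * K) = (rc (i%:R - 2 + t * x) + ii * rc (j%:R - 2)) * K.
  by rewrite /g !(rc_nat, rcN, rcD, rcM); ring.
have hV i j (t x : R) : g i j + rc t * (ii * (rc x * K)) = (rc (i%:R - 2) + ii * rc (j%:R - 2 + t * x)) * K.
  by rewrite /g !(rc_nat, rcN, rcD, rcM); ring.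
have K2 : K + K = rc 2 * K by rewrite rc_nat; ring.
have K4 : K + K + (K + K) = rc 4 * K by rewrite rc_nat; ring.
have lt0 (t : R) (x : R) : 0 <= x -> 0 <= t <= 1 -> 0 <= t * x <= x.
  by clear; move=> ? ?; nra.
have cE i j (x : R) : 0 <= x -> (i%:R + x <= 4) -> (j < 5)%N -> (j%:R <= 1 :> R) \/ (3 <= j%:R :> R) ->
   forall t : R, 0 <= t <= 1 -> contAt f (g i j + rc t * (rc x * K)).
  move=> x0 ix j5 jj t /(lt0 _ _ x0) tx; rewrite hE; apply/derivable_contAt/pt.
  - by rewrite ler_norml; have := ler0n R i; clear -tx ix x0; lra.
  - by rewrite ler_norml; have := ler0n R j; have h4 : (j%:R : R) <= 4; [by rewrite ler_nat -ltnS|clear -h4; lra].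
  - right; rewrite ler_normr; apply/orP; case: jj => ?; [right|left]; lra.
have cV i j (x : R) : 0 <= x -> (j%:R + x <= 4) -> (i < 5)%N -> (i%:R <= 1 :> R) \/ (3 <= i%:R :> R) ->
   forall t : R, 0 <= t <= 1 -> contAt f (g i j + rc t * (ii * (rc x * K))).
  move=> x0 ix j5 jj t /(lt0 _ _ x0) tx; rewrite hV; apply/derivable_contAt/pt.
  - by rewrite ler_norml; have := ler0n R i; have h4 : (i%:R : R) <= 4; [by rewrite ler_nat -ltnS|clear -h4; lra].
  - by rewrite ler_norml; have := ler0n R j; clear -tx ix x0; lra.
  - left; rewrite ler_normr; apply/orP; case: jj => ?; [right|left]; lra.
have E2 i j : (i < 3)%N -> (j < 5)%N -> (j%:R <= 1 :> R) \/ (3 <= j%:R :> R) ->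
    seg f (g i j) (K + K) = E i j + E i.+1 j.
  move=> i3 j5 jj; rewrite seg_half ?gx // K2; apply: cE => //.
  have : i%:R <= 2 :> R by rewrite ler_nat -ltnS. by clear; lra.
have E4 j : (j < 5)%N -> (j%:R <= 1 :> R) \/ (3 <= j%:R :> R) ->
    seg f (g 0 j) (K + K + (K + K)) = E 0 j + E 1 j + E 2 j + E 3 j.
  move=> j5 jj; rewrite seg_half; first by rewrite addrA !gx !E2 // !addrA.
  by rewrite K4; apply: cE => //; rewrite add0r.
have V2 i j : (j < 3)%N -> (i < 5)%N -> (i%:R <= 1 :> R) \/ (3 <= i%:R :> R) ->
    seg f (g i j) (ii * (K + K)) = V i j + V i j.+1.
  move=> i3 j5 jj; rewrite mulrDr seg_half ?gy // -mulrDr K2; apply: cV => //.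
  have : j%:R <= 2 :> R by rewrite ler_nat -ltnS. by clear; lra.
have V4 i : (i < 5)%N -> (i%:R <= 1 :> R) \/ (3 <= i%:R :> R) ->
    seg f (g i 0) (ii * (K + K + (K + K))) = V i 0 + V i 1 + V i 2 + V i 3.
  move=> j5 jj; rewrite mulrDr seg_half; first by rewrite mulrDr addrA !gy -mulrDr !V2 // !addrA.
  by rewrite -mulrDr K4; apply: cV => //; rewrite add0r.
have C4 : csq f (rc (2 * k)) = E 0 0 + E 1 0 + E 2 0 + E 3 0
     + (V 4 0 + V 4 1 + V 4 2 + V 4 3) - (E 0 4 + E 1 4 + E 2 4 + E 3 4)
     - (V 0 0 + V 0 1 + V 0 2 + V 0 3).
  have -> : rc (2 * k) = K + K by rewrite K2 -rcM.
  rewrite /csq /sq; have -> : - (K + K + ii * (K + K)) = g 0 0 by rewrite /g; ring.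
  have -> : g 0 0 + (K + K + (K + K)) = g 4 0 by rewrite !addrA !gx.
  have -> : g 0 0 + ii * (K + K + (K + K)) = g 0 4 by rewrite !mulrDr !addrA !gy.
  by rewrite !E4 ?V4 //; by [left; rewrite ?ler0n ?ler01|right; rewrite ler_nat].
have C2 : csq f (rc k) = E 1 1 + E 2 1 + (V 3 1 + V 3 2) - (E 1 3 + E 2 3) - (V 1 1 + V 1 2).
  rewrite /csq /sq -/K; have -> : - (K + ii * K) = g 1 1 by rewrite /g; ring.
  have -> : g 1 1 + (K + K) = g 3 1 by rewrite !addrA !gx.
  have -> : g 1 1 + ii * (K + K) = g 1 3 by rewrite !mulrDr !addrA !gy.
  by rewrite !E2 ?V2 //; by [left; rewrite ?ler0n ?lexx|right; rewrite ler_nat].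
apply: subr0_eq; rewrite C4 C2.
(* Edges shared by two outer cells cancel, and each parenthesis is the contour of one outer cell. *)
transitivity ((E 0 0 + V 1 0 - E 0 1 - V 0 0) + (E 1 0 + V 2 0 - E 1 1 - V 1 0)
  + (E 2 0 + V 3 0 - E 2 1 - V 2 0) + (E 3 0 + V 4 0 - E 3 1 - V 3 0)
  + (E 0 1 + V 1 1 - E 0 2 - V 0 1) + (E 3 1 + V 4 1 - E 3 2 - V 3 1)
  + (E 0 2 + V 1 2 - E 0 3 - V 0 2) + (E 3 2 + V 4 2 - E 3 3 - V 3 2)
  + (E 0 3 + V 1 3 - E 0 4 - V 0 3) + (E 1 3 + V 2 3 - E 1 4 - V 1 3)
  + (E 2 3 + V 3 3 - E 2 4 - V 2 3) + (E 3 3 + V 4 3 - E 3 4 - V 3 3)).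
  clear; ring.
by rewrite !SE // !addr0.
Qed.

Lemma csq_shrink (f : C -> C) (s : R) n : 0 < s ->
  (forall w, 0 < nrm w -> nrm w <= 2 * s -> derivable f w 1) ->
  csq f (rc (s / 2 ^+ n)) = csq f (rc s).
Proof.
move=> s0 H; elim: n => [|n IH]; first by rewrite expr0 divr1.
have p0 := pow2_gt0 R n; have q0 : 0 < s / 2 ^+ n.+1 by rewrite divr_gt0 // pow2_gt0.
have e : 2 * (s / 2 ^+ n.+1) = s / 2 ^+ n by rewrite exprS; field; rewrite gt_eqF.
rewrite -IH -e csq_ring // => w w1 w2; apply: H; first exact: lt_le_trans w1.
apply: le_trans w2 _.
have : s / 2 ^+ n <= s by rewrite ler_pdivrMr // ler_peMr ?(ltW s0) // -natrX ler1n expn_gt0.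
by lra.
Qed.

Lemma csq_grow (f : C -> C) (s : R) n : 0 < s ->
  (forall w, s <= nrm w -> derivable f w 1) ->
  csq f (rc (s * 2 ^+ n)) = csq f (rc s).
Proof.
move=> s0 H; elim: n => [|n IH]; first by rewrite expr0 mulr1.
have p1 : 1 <= 2 ^+ n :> R by rewrite -natrX ler1n expn_gt0.
have -> : s * 2 ^+ n.+1 = 2 * (s * 2 ^+ n) by rewrite exprS; ring.
rewrite csq_ring //; first by apply: mulr_gt0 => //; lra.
by move=> w w1 _; apply: H; apply: le_trans w1; rewrite ler_peMr // ltW.
Qed.

(** Stands for 2 pi i; it is never evaluated, only shown to be nonzero. *)
Definition c0 : C := csq (fun w : C => w^-1) (rc 1).

Lemma contAt_inv (z : C) : z != 0 -> contAt (fun w : C => w^-1) z.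
Proof. by move=> z0; apply/derivable_contAt/derivable_inv. Qed.

Lemma nrm_neq0 (w : C) (a : R) : 0 < a -> a <= nrm w -> w != 0.
Proof. by move=> a0 aw; rewrite -nrm_gt0; exact: lt_le_trans aw. Qed.

Lemma csq_inv (s : R) : 0 < s -> csq (fun w : C => w^-1) (rc s) = c0.
Proof.
move=> s0; rewrite /c0 /csq /sq.
have A1 : ann (1 : R) (2 * 1) (contAt (fun w : C => w^-1)).
  by move=> w w1 _; apply: contAt_inv; apply: nrm_neq0 w1.
have [c1 c2 c3 c4] := csq_seg ltr01 A1.
have S a v : (forall t : R, 0 <= t <= 1 -> contAt (fun w : C => w^-1) (a + rc t * v)) ->
    seg (fun w : C => w^-1) (rc s * a) (rc s * v) = seg (fun w : C => w^-1) a v.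
  move=> /cont_seg H; rewrite /seg.
  have -> : (fun t : R => (rc s * a + rc t * (rc s * v))^-1) =
      (fun t : R => (rc s)^-1 * (a + rc t * v)^-1).
    by apply/funext => t; rewrite -invfM; congr (_^-1); ring.
  rewrite int01Z // mulrACA mulfV ?mul1r //.
  by rewrite rc_eq0 gt_eqF.
rewrite -(S _ _ c1) -(S _ _ c2) -(S _ _ c3) -(S _ _ c4) rc1.
by congr (_ + _ - _ - _); congr seg; ring.
Qed.

Lemma int01_re_ge phi m : cont01 phi -> (forall t : R, 0 <= t <= 1 -> m <= re (phi t)) ->
  m <= re (int01 phi).
Proof.
move=> H Hm; rewrite leNgt; apply/negP => lt.
have e0 : 0 < m - re (int01 phi) by lra.
have [N /(_ _ (leqnn N))] := int01_cvs H e0; set x := rsum phi N => h.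
have : m <= re x.
  rewrite /x /rsum re_rcM re_sum ler_pdivlMl ?pow2_gt0 //.
  apply: (@le_trans _ _ (\sum_(k < 2 ^ N) m)).
    by rewrite sumr_const card_ord -[m *+ _]mulr_natl natrX.
  by apply: ler_sum => i _; apply: Hm; apply: dyad01.
have := le_lt_trans (le_re _) h; rewrite reB ltr_norml; lra.
Qed.

(** After multiplication by [- ii], the integrand on each of the four sides has real part 2 / (1 +
    y^2) >= 1. *)
Lemma c0_neq0 : c0 != 0.
Proof.
suff : 4 <= re (- ii * c0) by apply: contraTneq => ->; rewrite mulr0 re0 -ltNge ltr0n.
rewrite /c0 /csq /sq.
have A1 : ann (1 : R) (2 * 1) (contAt (fun w : C => w^-1)).
  by move=> w w1 _; apply: contAt_inv; apply: nrm_neq0 w1.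
have [c1 c2 c3 c4] := csq_seg ltr01 A1.
have S c a v : (forall t : R, 0 <= t <= 1 -> contAt (fun w : C => w^-1) (a + rc t * v)) ->
   (forall t : R, 0 <= t <= 1 -> 1 <= re (c * v * (a + rc t * v)^-1)) ->
   1 <= re (c * seg (fun w : C => w^-1) a v).
  move=> /cont_seg H Hm; rewrite /seg mulrA -int01Z //; apply: int01_re_ge => //.
  exact: cont01Z.
have q (x y : R) : x ^+ 2 = 1 -> -1 <= y <= 1 -> 1 <= 2 / (x ^+ 2 + y ^+ 2).
  move=> x2 y1; have := sqr_ge0 y => y0; rewrite x2 ler_pdivlMr; last lra.
  by clear -y1 y0; nra.
have tt (t : R) : 0 <= t <= 1 -> -1 <= 2 * t - 1 <= 1 by clear; lra.
have B1 : 1 <= re (- ii * seg (fun w : C => w^-1) (- (rc 1 + ii * rc 1)) (rc 1 + rc 1)).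
  apply: S => // t /tt t1; apply: le_trans (q (-1) (2 * t - 1) _ t1) _; first by ring.
  rewrite !(reM, imM, re_inv, im_inv, reD, imD, reN, imN, re_rc, im_rc, reii, imii).
  by rewrite le_eqVlt; apply/orP; left; apply/eqP; field; repeat (apply/andP; split); clear -t1; apply: lt0r_neq0; nra.
have B2 : 1 <= re (- ii * seg (fun w : C => w^-1) (- (rc 1 + ii * rc 1) + (rc 1 + rc 1)) (ii * (rc 1 + rc 1))).
  apply: S => // t /tt t1; apply: le_trans (q 1 (2 * t - 1) _ t1) _; first by ring.
  rewrite !(reM, imM, re_inv, im_inv, reD, imD, reN, imN, re_rc, im_rc, reii, imii).
  by rewrite le_eqVlt; apply/orP; left; apply/eqP; field; repeat (apply/andP; split); clear -t1; apply: lt0r_neq0; nra.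
have B3 : 1 <= re (ii * seg (fun w : C => w^-1) (- (rc 1 + ii * rc 1) + ii * (rc 1 + rc 1)) (rc 1 + rc 1)).
  apply: S => // t /tt t1; apply: le_trans (q 1 (2 * t - 1) _ t1) _; first by ring.
  rewrite !(reM, imM, re_inv, im_inv, reD, imD, reN, imN, re_rc, im_rc, reii, imii).
  by rewrite le_eqVlt; apply/orP; left; apply/eqP; field; repeat (apply/andP; split); clear -t1; apply: lt0r_neq0; nra.
have B4 : 1 <= re (ii * seg (fun w : C => w^-1) (- (rc 1 + ii * rc 1)) (ii * (rc 1 + rc 1))).
  apply: S => // t /tt t1; apply: le_trans (q (-1) (2 * t - 1) _ t1) _; first by ring.
  rewrite !(reM, imM, re_inv, im_inv, reD, imD, reN, imN, re_rc, im_rc, reii, imii).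
  by rewrite le_eqVlt; apply/orP; left; apply/eqP; field; repeat (apply/andP; split); clear -t1; apply: lt0r_neq0; nra.
move: B1 B2 B3 B4; set s1 := seg _ _ _; set s2 := seg _ _ _.
set s3 := seg _ _ _; set s4 := seg _ _ _ => B1 B2 B3 B4.
have -> : - ii * (s1 + s2 - s3 - s4) = - ii * s1 + - ii * s2 + ii * s3 + ii * s4 by ring.
by rewrite !reD; clear -B1 B2 B3 B4; lra.
Qed.

Lemma small_pow (a e : R) : 0 < a -> 0 < e -> exists n, a / 2 ^+ n < e.
Proof.
move=> a0 e0; have [n Hn] := pow2_small (divr_gt0 e0 a0).
by exists n; move: Hn; rewrite ltr_pdivlMr // mulrC.
Qed.

(* The value and the derivative at the centre of a square are determined on its
   boundary: the singular part of the integrand is estimated on shrinking squares. *)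
Lemma csq_sing0 (g : C -> C) (s : R) : 0 < s ->
  (forall w, 0 < nrm w -> nrm w <= 2 * s -> derivable g w 1) ->
  (forall e : R, 0 < e -> exists2 r : R, 0 < r &
     forall w, 0 < nrm w -> nrm w < r -> nrm w * nrm (g w) <= e) ->
  csq g (rc s) = 0.
Proof.
move=> s0 dg H.
apply/eqP; rewrite -nrm_eq0 eq_le nrm_ge0 andbT leNgt; apply/negP => l0.
have [r r0 gb] := H _ (divr_gt0 l0 (ltr0n R 16) : 0 < _).
have [m Hm] := small_pow s0 (divr_gt0 r0 (ltr0n R 4) : 0 < _).
have q0 : 0 < s / 2 ^+ m by rewrite divr_gt0 // pow2_gt0.
have qs : s / 2 ^+ m <= s.
  by rewrite ler_pdivrMr ?pow2_gt0 // ler_peMr ?(ltW s0) // -natrX ler1n expn_gt0.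
have cg : ann (s / 2 ^+ m) (2 * (s / 2 ^+ m)) (contAt g).
  move=> w w1 w2; apply: derivable_contAt; apply: dg; first exact: lt_le_trans w1.
  by clear -w2 qs; lra.
have B : ann (s / 2 ^+ m) (2 * (s / 2 ^+ m))
    (fun w => nrm (g w) <= nrm (csq g (rc s)) / 16 / (s / 2 ^+ m)).
  move=> w w1 w2; rewrite ler_pdivlMr //.
  apply: le_trans (gb w _ _); last by clear -w2 Hm r0; lra.
    by rewrite mulrC; apply: ler_wpM2r => //; exact: nrm_ge0.
  exact: lt_le_trans w1.
have X := csq_bound q0 cg B; rewrite csq_shrink // in X.
move: q0 X; set S := s / _ => q0; set n := nrm _ in l0 *.
have -> : 8 * (S * (n / 16 / S)) = n / 2 by field; rewrite gt_eqF.
by clear -l0; lra.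
Qed.

(** Counterpart of [csq_sing0] at infinity: the integrals over the squares of half-side [s * 2 ^+ n]
    all agree, and the decay of order |w|^-2 makes them tend to 0. *)
Lemma csq_singoo (g : C -> C) (s M : R) : 0 < s ->
  (forall w, s <= nrm w -> derivable g w 1) ->
  (forall w, s <= nrm w -> nrm w ^+ 2 * nrm (g w) <= M) ->
  csq g (rc s) = 0.
Proof.
move=> s0 dg H.
apply/eqP; rewrite -nrm_eq0 eq_le nrm_ge0 andbT leNgt; apply/negP => l0.
have M0 : 0 <= M.
  have := H (rc s); rewrite nrm_rc ger0_norm ?(ltW s0) // => /(_ (lexx _)).
  by apply: le_trans; rewrite mulr_ge0 ?nrm_ge0 ?sqr_ge0.
have M1 : 0 < 16 * (M + 1) by clear -M0; lra.
have [n Hn] := small_pow (M1 : 0 < _) (mulr_gt0 s0 l0 : 0 < _).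
have q0 : 0 < s * 2 ^+ n by rewrite mulr_gt0 // pow2_gt0.
have qs : s <= s * 2 ^+ n by rewrite ler_peMr ?(ltW s0) // -natrX ler1n expn_gt0.
have cg : ann (s * 2 ^+ n) (2 * (s * 2 ^+ n)) (contAt g).
  by move=> w w1 w2; apply: derivable_contAt; apply: dg; apply: le_trans w1.
have B : ann (s * 2 ^+ n) (2 * (s * 2 ^+ n))
    (fun w => nrm (g w) <= (M + 1) / (s * 2 ^+ n) ^+ 2).
  move=> w w1 w2; rewrite ler_pdivlMr ?exprn_gt0 //.
  apply: (@le_trans _ _ M); last by rewrite lerDl ler01.
  apply: le_trans (H w _); last exact: le_trans w1.
  rewrite mulrC; apply: ler_wpM2r; first exact: nrm_ge0.
  by rewrite lerXn2r ?nnegrE ?(ltW q0) ?nrm_ge0.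
have X := csq_bound q0 cg B; rewrite csq_grow // in X.
have p0 := pow2_gt0 R n.
have E : 8 * (s * 2 ^+ n * ((M + 1) / (s * 2 ^+ n) ^+ 2)) = 8 * (M + 1) / 2 ^+ n / s.
  by field; rewrite !gt_eqF.
rewrite E ler_pdivlMr // in X.
move: X Hn M0 (mulr_gt0 s0 l0); set y := (2 ^+ n)^-1; set x := nrm _ => X Hn M0 l1.
by clear -X Hn l1; nra.
Qed.

(** After subtraction of [f 0 / w] the integrand is o(1 / |w|) at 0, so [csq_sing0] applies. For
    [cauchy1] two Taylor terms are subtracted in the same way. *)
Lemma cauchy0 (f : C -> C) (s : R) : 0 < s ->
  (forall w, nrm w <= 2 * s -> derivable f w 1) ->
  csq (fun w => f w / w) (rc s) = c0 * f 0.
Proof.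
move=> s0 Hf.
have h0 : nrm (0 : C) <= 2 * s by rewrite nrm0; lra.
pose g w := f w / w + (- f 0) * w^-1.
have E : csq g (rc s) = csq (fun w => f w / w) (rc s) - f 0 * c0.
  rewrite /g csqD // ?csqZ ?csq_inv ?mulNr //.
  - by move=> w w1 w2; apply: contAt_inv; apply: nrm_neq0 w1.
  - move=> w w1 w2; apply/derivable_contAt/derivableMf; first exact: Hf.
    by apply: derivable_inv; apply: nrm_neq0 w1.
  - move=> w w1 w2; apply: contAtZ; apply: contAt_inv; exact: nrm_neq0 w1.
suff G0 : csq g (rc s) = 0.
  by move: E; rewrite G0 => /eqP; rewrite eq_sym subr_eq0 mulrC => /eqP.
apply: csq_sing0 => // [w w0 ws|e e0].
  rewrite nrm_gt0 in w0; apply: derivableDf; first by apply: derivableMf; [exact: Hf|exact: derivable_inv].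
  by apply: derivableMf; [exact: derivable_cst|exact: derivable_inv].
have [r r0 Hr] := derivable_contAt (Hf 0 h0) e0.
exists r => // w w0 wr; have := Hr w; rewrite subr0 => /(_ wr) H.
have -> : g w = (f w - f 0) / w by rewrite /g; ring.
rewrite nrm_div mulrC divfK ?gt_eqF //; exact: ltW.
Qed.

Lemma csq_inv2 (s : R) : 0 < s -> csq (fun w : C => w^-1 * w^-1) (rc s) = 0.
Proof.
move=> s0; apply: (@csq_singoo _ _ 1) => // w sw.
  by apply: derivableMf; apply: derivable_inv; apply: nrm_neq0 sw.
by rewrite nrmM nrmV -expr2 exprVn divff // expf_neq0 // gt_eqF // (lt_le_trans s0).
Qed.

Lemma cauchy1 (f : C -> C) (s : R) : 0 < s ->
  (forall w, nrm w <= 2 * s -> derivable f w 1) ->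
  csq (fun w => f w * (w^-1 * w^-1)) (rc s) = c0 * 'D_1 f 0.
Proof.
move=> s0 Hf.
have h0 : nrm (0 : C) <= 2 * s by rewrite nrm0; lra.
set d := 'D_1 f 0.
pose g w := f w * (w^-1 * w^-1) + ((- f 0) * (w^-1 * w^-1) + (- d) * w^-1).
have cI w : s <= nrm w -> contAt (fun w : C => w^-1) w.
  by move=> w1; apply: contAt_inv; apply: nrm_neq0 w1.
have dI2 w : w != 0 -> derivable (fun w : C => w^-1 * w^-1) w 1.
  by move=> w1; apply: derivableMf; exact: derivable_inv.
have cI2 w : s <= nrm w -> contAt (fun w : C => w^-1 * w^-1) w.
  by move=> w1; apply/derivable_contAt/dI2; exact: nrm_neq0 w1.
have E : csq g (rc s) = csq (fun w => f w * (w^-1 * w^-1)) (rc s) - d * c0.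
  rewrite /g csqD //; first last.
  - by move=> w w1 w2; apply: contAtD; apply: contAtZ; [exact: cI2|exact: cI].
  - move=> w w1 w2; apply/derivable_contAt/derivableMf; first exact: Hf.
    by apply: dI2; apply: nrm_neq0 w1.
  rewrite csqD //.
  + by rewrite !csqZ ?csq_inv ?csq_inv2 ?mulr0 ?add0r ?mulNr // => w w1 w2; first [exact: cI|exact: cI2].
  + by move=> w w1 w2; apply: contAtZ; first [exact: cI|exact: cI2].
  + by move=> w w1 w2; apply: contAtZ; first [exact: cI|exact: cI2].
suff G0 : csq g (rc s) = 0.
  by move: E; rewrite G0 => /eqP; rewrite eq_sym subr_eq0 mulrC => /eqP.
apply: csq_sing0 => // [w w0 ws|e e0].
  rewrite nrm_gt0 in w0; apply: derivableDf; first by apply: derivableMf; [exact: Hf|exact: dI2].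
  by apply: derivableDf; apply: derivableMf; [exact: derivable_cst|exact: dI2|exact: derivable_cst|exact: derivable_inv].
have [r r0 Hr] := (proj1 (derivable_nrm f 0 1 d)) (conj (Hf 0 h0) erefl) e e0.
exists r => // w w0 /Hr; rewrite add0r -[_ *: 1]/(_ * 1) mulr1 => H.
have wn : w != 0 by rewrite -nrm_gt0.
have -> : g w = (f w - f 0 - w * d) / (w * w) by rewrite /g; field.
rewrite nrm_div nrmM mulrC -mulrA invfM -mulrA (mulVf (lt0r_neq0 w0)) mulr1.
by rewrite ler_pdivrMr.
Qed.

(** The difference from [w^-1] decays like |w|^-2, so [csq_singoo] applies. *)
Lemma csq_inv_shift (s : R) (th : C) : nrm th < s ->
  csq (fun w : C => (w - th)^-1) (rc s) = c0.
Proof.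
move=> ts; have s0 : 0 < s by apply: le_lt_trans ts; exact: nrm_ge0.
have wt w : s <= nrm w -> (w != 0) * (w - th != 0).
  move=> sw; split; first exact: nrm_neq0 sw.
  rewrite -nrm_gt0; have := nrm_sub_ge w th; lra.
have dT w : s <= nrm w -> derivable (fun w : C => (w - th)^-1) w 1.
  by move=> /wt[_ w0]; apply: derivableVf => //; exact: derivable_subr.
pose g (w : C) := (w - th)^-1 + -1 * w^-1.
have dg w : s <= nrm w -> derivable g w 1.
  move=> sw; apply: derivableDf; first exact: dT.
  by apply: derivableMf; [exact: derivable_cst|apply: derivable_inv; case: (wt w sw)].
have : csq g (rc s) = 0.
  have D0 : 0 < s - nrm th by lra.
  apply: (@csq_singoo _ _ (s * nrm th / (s - nrm th))) => // w sw.
  have [w0 w1] := wt w sw.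
  have -> : g w = th / (w * (w - th)) by rewrite /g; field; rewrite w0 w1.
  rewrite nrm_div nrmM.
  have n0 : 0 < nrm w by rewrite nrm_gt0.
  have n1 : 0 < nrm (w - th) by rewrite nrm_gt0.
  have -> : nrm w ^+ 2 * (nrm th / (nrm w * nrm (w - th))) = nrm w * nrm th / nrm (w - th).
    by field; rewrite !gt_eqF.
  rewrite ler_pdivrMr // mulrAC ler_pdivlMr // mulrAC [leRHS]mulrAC.
  apply: ler_wpM2r; first exact: nrm_ge0.
  have := nrm_sub_ge w th; have := nrm_ge0 th; clear -sw s0; nra.
rewrite /g csqD //; first last.
- by move=> w w1 _; apply: contAtZ; apply: contAt_inv; case: (wt w w1).
- by move=> w w1 _; apply/derivable_contAt/dT.
rewrite csqZ ?csq_inv //; last by move=> w w1 _; apply: contAt_inv; case: (wt w w1).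
by move=> /eqP; rewrite mulN1r subr_eq0 => /eqP.
Qed.

(** The residue needed for power sums of zeros in [logderiv_sum]. The induction uses w^(j+1) = w^j
    (w - th) + th w^j, whose first part contributes an entire function. *)
Lemma csq_pow_shift (s : R) (th : C) j : nrm th < s ->
  csq (fun w : C => w ^+ j * (w - th)^-1) (rc s) = c0 * th ^+ j.
Proof.
move=> ts; have s0 : 0 < s by apply: le_lt_trans ts; exact: nrm_ge0.
have wt w : s <= nrm w -> w - th != 0.
  by move=> sw; rewrite -nrm_gt0; have := nrm_sub_ge w th; lra.
have dX k w : derivable (fun w : C => w ^+ k) w 1.
  elim: k => [|k IH]; first exact: derivable_cst.
  have -> : (fun w : C => w ^+ k.+1) = (fun w => w * w ^+ k) by apply/funext => ?; rewrite exprS.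
  by have := derivableMf (@derivable_id _ _ w 1) IH; exact.
have dT w : s <= nrm w -> derivable (fun w : C => (w - th)^-1) w 1.
  by move=> /wt w0; apply: derivableVf => //; exact: derivable_subr.
elim: j => [|j IH].
  rewrite expr0 mulr1 -(csq_inv_shift ts); apply: csq_ext => // w _ _.
  by rewrite expr0 mul1r.
have -> : csq (fun w : C => w ^+ j.+1 * (w - th)^-1) (rc s) =
   csq (fun w : C => w ^+ j + th * (w ^+ j * (w - th)^-1)) (rc s).
  by apply: csq_ext => // w w1 _; rewrite exprS; field; exact: wt.
have cT k : ann s (2 * s) (contAt (fun w : C => w ^+ k * (w - th)^-1)).
  by move=> w w1 _; apply/derivable_contAt/derivableMf; [exact: dX|exact: dT].
rewrite csqD //; last by move=> w w1 w2; apply: contAtZ; exact: cT.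
  rewrite csq_goursat // add0r csqZ // IH exprS; ring.
by move=> w _ _; apply/derivable_contAt/dX.
Qed.

End CauchyFormula.

(** * Cauchy estimates and Taylor remainders in one variable *)

Section OneVar.
Variable R : realType.
Local Notation C := (Cplx R).

(* phi is complex differentiable and bounded by M on the closed disc of radius
   rho around a. *)
Definition dholB (phi : C -> C) (a : C) (rho M : R) : Prop :=
  forall w, nrm (w - a) <= rho -> derivable phi w 1 /\ nrm (phi w) <= M.

Lemma derivableBf (f g : C -> C) z : derivable f z 1 -> derivable g z 1 ->
  derivable (fun w => f w - g w) z 1.
Proof. by move=> hf hg; have := derivableB hf hg; exact. Qed.

Lemma deriveBf (f g : C -> C) z : derivable f z 1 -> derivable g z 1 ->
  'D_1 (fun w => f w - g w) z = 'D_1 f z - 'D_1 g z.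
Proof. by move=> hf hg; have := deriveB hf hg; exact. Qed.

Lemma derive_mulr_cst (c t : C) :
  derivable (fun t : C => t * c) t 1 /\ 'D_1 (fun t : C => t * c) t = c.
Proof.
apply/derivable_nrm => e e0; exists 1 => // h _.
rewrite -[_ *: 1]/(_ * 1) mulr1 (_ : _ - _ - _ = 0); last by ring.
by rewrite nrm0 mulr_ge0 ?nrm_ge0 // ltW.
Qed.

(** Constant of the Cauchy estimate: the factor 8 of [csq_bound], on the square of half-side
    [rho / 2]. *)
Definition K1 : R := 16 / nrm (c0 R).
Lemma c0_gt0 : 0 < nrm (c0 R). Proof. by rewrite nrm_gt0 c0_neq0. Qed.
Lemma K1_gt0 : 0 < K1. Proof. by apply: divr_gt0 => //; exact: c0_gt0. Qed.

Lemma derivable_shift (f : C -> C) (a w d : C) :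
  derivable f (a + w) 1 /\ 'D_1 f (a + w) = d <->
  derivable (fun t => f (a + t)) w 1 /\ 'D_1 (fun t => f (a + t)) w = d.
Proof.
by split=> H; apply/derivable_nrm => e e0; have [r r0 Hr] := (proj1 (derivable_nrm _ _ _ _)) H e e0;
  exists r => // h /Hr; rewrite addrA.
Qed.

Lemma one_cauchy phi a rho M : 0 < rho -> dholB phi a rho M ->
  nrm ('D_1 phi a) <= K1 * M / rho.
Proof.
move=> r0 H; pose f t := phi (a + t).
have ar t : nrm t <= rho -> derivable phi (a + t) 1 /\ nrm (phi (a + t)) <= M.
  by move=> tr; apply: H; rewrite addrC addKr.
have df t : nrm t <= rho -> derivable f t 1.
  by move=> /ar[h _]; have [] := (proj1 (derivable_shift phi a t _)) (conj h erefl).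
have DE : 'D_1 f 0 = 'D_1 phi a.
  have [h _] : derivable phi (a + 0) 1 /\ nrm (phi (a + 0)) <= M.
    by apply: ar; rewrite nrm0 ltW.
  by have [_] := (proj1 (derivable_shift phi a 0 _)) (conj h erefl); rewrite addr0.
have s0 : 0 < rho / 2 by lra.
have e2 : 2 * (rho / 2) = rho by field.
have H1 := @cauchy1 _ f _ s0; rewrite e2 DE in H1; have {}H1 := H1 df.
have wn (w : C) : rho / 2 <= nrm w -> w != 0 by exact: nrm_neq0 s0.
have B : nrm (csq (fun w => f w * (w^-1 * w^-1)) (rc (rho / 2))) <= 8 * (rho / 2 * (M * (2 / rho) ^+ 2)).
  apply: csq_bound => // w w1; rewrite e2 => w2.
    apply: derivable_contAt; apply: derivableMf; first exact: df.
    by apply: derivableMf; apply: derivable_inv; exact: wn.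
  have [_ h] := ar _ w2; rewrite !nrmM !nrmV -expr2.
  apply: ler_pM => //; rewrite ?sqr_ge0 ?nrm_ge0 //.
  rewrite lerXn2r ?nnegrE ?invr_ge0 ?nrm_ge0 ?divr_ge0 ?(ltW r0) //.
  by rewrite -[2 / rho]invf_div lef_pV2 ?posrE // (lt_le_trans s0).
move: B; rewrite H1 nrmM -ler_pdivlMl ?c0_gt0 //.
suff -> : (nrm (c0 R))^-1 * (8 * (rho / 2 * (M * (2 / rho) ^+ 2))) = K1 * M / rho by [].
by rewrite /K1; field; rewrite !gt_eqF ?c0_gt0.
Qed.

(** With [L + e] in place of [L] the bound holds on short pieces by derivability and is additive
    over pieces, so [cousin] gives it on the whole segment. *)
Lemma mvi (phi : C -> C) (a h : C) (L : R) :
  (forall t : R, 0 <= t <= 1 -> derivable phi (a + rc t * h) 1 /\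
     nrm ('D_1 phi (a + rc t * h)) <= L) ->
  nrm (phi (a + h) - phi a) <= nrm h * L.
Proof.
move=> H.
suff K e : 0 < e -> nrm (phi (a + h) - phi a) <= nrm h * (L + e).
  rewrite leNgt; apply/negP => lt.
  have n1 : 0 < 2 * (nrm h + 1) by have := nrm_ge0 h; lra.
  have dlt : 0 < nrm (phi (a + h) - phi a) - nrm h * L by lra.
  have := K _ (divr_gt0 dlt n1); move: dlt n1; set x := nrm (_ - _); set y := nrm h.
  move=> dlt n1; have y0 : 0 <= y by exact: nrm_ge0.
  have : y * ((x - y * L) / (2 * (y + 1))) <= (x - y * L) / 2.
    rewrite mulrA ler_pdivrMr //; clear -dlt y0; nra.
  clear -dlt; lra.
move=> e0.
pose P (s t : R) := 0 <= s -> t <= 1 -> s <= t ->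
  nrm (phi (a + rc t * h) - phi (a + rc s * h)) <= (t - s) * (nrm h * (L + e)).
suff P1 : P 0 1.
  by have := P1 (lexx _) (lexx _) ler01; rewrite subr0 mul1r rc1 mul1r rc0 mul0r addr0.
apply: cousin.
  move=> s m t sm mt P1 P2 s0 t1 st.
  have h1 := P1 s0 (le_trans mt t1) sm; have h2 := P2 (le_trans s0 sm) t1 mt.
  apply: le_trans (nrm_le_sub _ (phi (a + rc m * h)) _) _.
  by clear -h1 h2; lra.
move=> t t1; have [dt Lt] := H t t1.
have [r r0 Hr] := (proj1 (derivable_nrm _ _ _ _)) (conj dt erefl) e e0.
have n1 : 0 < nrm h + 1 by have := nrm_ge0 h; lra.
exists (r / (nrm h + 1)) => [|s u s0 st tu u1]; first exact: divr_gt0.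
rewrite ltr_pdivlMr // => us _ _ _.
have near x : 0 <= x -> x <= u - s -> forall b, nrm b = x * nrm h ->
    nrm (phi (a + rc t * h + b) - phi (a + rc t * h)) <= x * (nrm h * (L + e)).
  move=> x0 xus b bE.
  have br : nrm b < r.
    by rewrite bE; apply: le_lt_trans us; have := nrm_ge0 h; clear -x0 xus; nra.
  have := Hr _ br; rewrite -[_ *: 1]/(b * 1) mulr1; set X := phi _ - phi _ => h1.
  have -> : X = (X - b * 'D_1 phi (a + rc t * h)) + b * 'D_1 phi (a + rc t * h) by ring.
  apply: le_trans (nrmD _ _) _; rewrite nrmM.
  have : nrm b * nrm ('D_1 phi (a + rc t * h)) <= nrm b * L.
    by apply: ler_wpM2l => //; exact: nrm_ge0.
  move: h1; rewrite bE; clear; lra.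
have h1 := near (u - t) ltac:(clear -tu; lra) ltac:(clear -st; lra) (rc (u - t) * h).
have h2 := near (t - s) ltac:(clear -st; lra) ltac:(clear -tu; lra) (rc (s - t) * h).
have := h1 ltac:(by rewrite nrmM nrm_rc ger0_norm // subr_ge0).
have := h2 ltac:(by rewrite nrmM nrm_rc ler0_norm ?opprB // subr_le0).
have -> : a + rc t * h + rc (s - t) * h = a + rc s * h by rewrite rcB; ring.
have -> : a + rc t * h + rc (u - t) * h = a + rc u * h by rewrite rcB; ring.
move=> g1 g2; apply: le_trans (nrm_le_sub _ (phi (a + rc t * h)) _) _.
by rewrite (nrmB (phi (a + rc t * h))); clear -g1 g2; lra.
Qed.

Lemma dholB_sub phi a b rho rho' M : dholB phi a rho M -> nrm (b - a) + rho' <= rho ->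
  dholB phi b rho' M.
Proof.
move=> H ba w wb; apply: H; have := nrm_le_sub w b a; lra.
Qed.

Lemma one_lip phi a rho M w : 0 < rho -> dholB phi a rho M -> nrm (w - a) <= rho / 2 ->
  nrm (phi w - phi a) <= 2 * K1 * M / rho * nrm (w - a).
Proof.
move=> r0 H wa; have := @mvi phi a (w - a) (2 * K1 * M / rho); rewrite [a + (w - a)]addrC subrK [nrm (w - a) * _]mulrC.
apply => t t1.
have tw : nrm (rc t * (w - a)) <= rho / 2.
  rewrite nrmM nrm_rc; have := nrm_ge0 (w - a); have : `|t| <= 1 by rewrite ler_norml; lra.
  have := normr_ge0 t; clear -wa; nra.
have tE : a + rc t * (w - a) - a = rc t * (w - a) by rewrite addrC addKr.
split; first by have [] // := H (a + rc t * (w - a)); rewrite tE; lra.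
have r20 : 0 < rho / 2 by lra.
have := @one_cauchy phi (a + rc t * (w - a)) (rho / 2) M r20.
have -> : K1 * M / (rho / 2) = 2 * K1 * M / rho by field; rewrite gt_eqF.
by apply; apply: dholB_sub H _; rewrite tE; lra.
Qed.

Definition K2 : R := 16 * K1 * K1.
Lemma K2_gt0 : 0 < K2. Proof. by have k0 := K1_gt0; apply: mulr_gt0 => //; apply: mulr_gt0. Qed.

(** The derivative is Lipschitz: apply the Cauchy estimate to the difference [chi] of a translate of
    [phi] and [phi], whose size is controlled by [one_lip]. The mean value inequality then turns
    this into a quadratic remainder. *)
Lemma one_taylor2 phi a rho M w : 0 < rho -> dholB phi a rho M -> nrm (w - a) <= rho / 4 ->
  nrm (phi w - phi a - (w - a) * 'D_1 phi a) <= K2 * M / rho ^+ 2 * nrm (w - a) ^+ 2.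
Proof.
move=> r0 H wa.
have r40 : 0 < rho / 4 by lra.
have r20 : 0 < rho / 2 by lra.
have DL u : nrm (u - a) <= rho / 4 ->
    nrm ('D_1 phi u - 'D_1 phi a) <= K2 * M / rho ^+ 2 * nrm (u - a).
  move=> ua; pose chi t := phi (u - a + t) - phi t.
  have dphi t : nrm (t - a) <= rho -> derivable phi t 1 by move=> /H[].
  have dsh : forall t, nrm (t - a) <= rho / 4 -> derivable (fun t => phi (u - a + t)) t 1 /\
      'D_1 (fun t => phi (u - a + t)) t = 'D_1 phi (u - a + t).
    move=> t ta; apply: (proj1 (derivable_shift _ _ _ _)); split => //.
    apply: dphi; have := nrmD (u - a) (t - a); rewrite addrA; lra.
  have h0 : nrm (a - a) <= rho / 4 by rewrite subrr nrm0; lra.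
  have Dchi : 'D_1 chi a = 'D_1 phi u - 'D_1 phi a.
    have [d1 d2] := dsh a h0; have da : derivable phi a 1 by apply: dphi; rewrite subrr nrm0 ltW.
    by rewrite /chi (deriveBf d1 da) d2 subrK.
  rewrite -Dchi.
  apply: le_trans (@one_cauchy chi a (rho / 4) (2 * K1 * M / (rho / 2) * nrm (u - a)) _ _) _ => //.
    move=> t ta; split.
      by have [d1 _] := dsh t ta; apply: (derivableBf d1); apply: dphi; lra.
    have := @one_lip phi t (rho / 2) M (u - a + t) r20.
    rewrite addrK; apply; last lra.
    by apply: dholB_sub H _; lra.
  have -> : K1 * (2 * K1 * M / (rho / 2) * nrm (u - a)) / (rho / 4) = K2 * M / rho ^+ 2 * nrm (u - a).
    by rewrite /K2; field; rewrite gt_eqF.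
  exact: lexx.
have M0 : 0 <= M.
  by have [_] := H a ltac:(by rewrite subrr nrm0 ltW); apply: le_trans; exact: nrm_ge0.
pose psi t := phi t - t * 'D_1 phi a.
have dpsi t : nrm (t - a) <= rho -> derivable psi t 1 /\ 'D_1 psi t = 'D_1 phi t - 'D_1 phi a.
  move=> /H[d1 _].
  have [d2 d3] := derive_mulr_cst ('D_1 phi a) t.
  by split; [exact: derivableBf d1 d2|rewrite (deriveBf d1 d2) d3].
have -> : phi w - phi a - (w - a) * 'D_1 phi a = psi w - psi a by rewrite /psi; ring.
have := @mvi psi a (w - a) (K2 * M / rho ^+ 2 * nrm (w - a)).
rewrite (addrC a) subrK expr2 mulrCA; apply => t t1.
have tE : a + rc t * (w - a) - a = rc t * (w - a) by rewrite addrC addKr.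
have tw : nrm (a + rc t * (w - a) - a) <= nrm (w - a).
  rewrite tE nrmM nrm_rc; have := nrm_ge0 (w - a); have : `|t| <= 1 by rewrite ler_norml; lra.
  have := normr_ge0 t; clear; nra.
have [d1 ->] := dpsi (a + rc t * (w - a)) ltac:(lra); split => //.
apply: le_trans (DL _ _) _; first lra.
apply: ler_wpM2l => //; rewrite divr_ge0 ?sqr_ge0 // mulr_ge0 // ltW // K2_gt0 //.
Qed.

(* The quadratic remainder is uniform, so a pointwise limit of uniformly bounded
   holomorphic functions is holomorphic. *)
Lemma dhol_limit (F : nat -> C -> C) (phi : C -> C) a rho M : 0 < rho ->
  (forall m, dholB (F m) a rho M) ->
  (forall w, nrm (w - a) <= rho -> cvs (fun m => F m w) (phi w)) ->
  derivable phi a 1.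
Proof.
move=> r0 H Hl.
have h0 : nrm (a - a) <= rho by rewrite subrr nrm0 ltW.
have M0 : 0 <= M by have [_] := H 0%N a h0; apply: le_trans; exact: nrm_ge0.
pose B := K2 * M / rho ^+ 2.
have B0 : 0 <= B by rewrite divr_ge0 ?sqr_ge0 // mulr_ge0 // ltW // K2_gt0.
have T m h : nrm h <= rho / 4 ->
    nrm (F m (a + h) - F m a - h * 'D_1 (F m) a) <= B * nrm h ^+ 2.
  by move=> hr; have := @one_taylor2 (F m) a rho M (a + h) r0 (H m); rewrite (addrC a h) addrK; apply.
have [d Hd] : exists d, cvs (fun m => 'D_1 (F m) a) d.
  apply: cauchy_cvs => e e0.
  (* Difference quotients are compared at one fixed step [x], chosen so that the two quadratic
     remainders add up to at most [e * x / 4]. *)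
  pose x := Num.min (rho / 4) (e / (8 * (B + 1))).
  have B1 : 0 < 8 * (B + 1) by lra.
  have x0 : 0 < x by rewrite /x lt_min; apply/andP; split; [lra|exact: divr_gt0].
  have xr : x <= rho / 4 by rewrite /x ge_min lexx.
  have xe : x * (8 * (B + 1)) <= e by rewrite -ler_pdivlMr // /x ge_min lexx orbT.
  have nx : nrm (rc x) = x by rewrite nrm_rc ger0_norm // ltW.
  have l1 := Hl (a + rc x) ltac:(by rewrite (addrC a) addrK nx; lra).
  have l2 := Hl a h0.
  have e80 : 0 < e * x / 16 by rewrite divr_gt0 // mulr_gt0.
  have [N1 H1] := l1 _ e80; have [N2 H2] := l2 _ e80.
  exists (maxn N1 N2) => m n; rewrite !geq_max => /andP[m1 m2] /andP[n1 n2].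
  have T1 := T m (rc x); have T2 := T n (rc x); rewrite nx in T1 T2.
  have {}T1 := T1 xr; have {}T2 := T2 xr.
  have := H1 _ m1; have := H2 _ m2; have := H1 _ n1; have := H2 _ n2.
  set p := F n a in T2 *; set q := F n _ in T2 *; set r := F m a in T1 *; set s := F m _ in T1 *.
  set u := phi a; set v := phi _ => g1 g2 g3 g4.
  rewrite -(ltr_pM2l x0) -nx -nrmM.
  have RI (y dm dn p' q' r' s' u' v' : C) : y * (dm - dn) =
     (q' - p' - y * dn) - (s' - r' - y * dm) + ((s' - v') - (r' - u')) - ((q' - v') - (p' - u')).
    by clear; ring.
  have TT (y1 y2 y3 y4 y5 y6 : C) : nrm (y1 - y2 + (y3 - y4) - (y5 - y6)) <=
      nrm y1 + nrm y2 + nrm y3 + nrm y4 + nrm y5 + nrm y6.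
    have := nrmD (y1 - y2 + (y3 - y4)) (- (y5 - y6)); have := nrmD (y1 - y2) (y3 - y4).
    have := nrmD y1 (- y2); have := nrmD y3 (- y4); have := nrmD y5 (- y6).
    rewrite !nrmN; clear; lra.
  rewrite (RI _ _ _ p q r s u v); move: ('D_1 (F m) a) ('D_1 (F n) a) T1 T2 => dm dn T1 T2.
  clearbody p q r s u v.
  apply: le_lt_trans (TT _ _ _ _ _ _) _; rewrite nx.
  move: T1 T2 g1 g2 g3 g4 => T1 T2 g1 g2 g3 g4.
  apply: (@le_lt_trans _ _ (B * x ^+ 2 + B * x ^+ 2 + e * x / 4)).
    move: T1 T2 g1 g2 g3 g4; clear.
    move: (nrm _) (nrm _) (nrm _) (nrm _) (nrm _) (nrm _) => a1 a2 a3 a4 a5 a6; lra.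
  by clear -xe x0 B0 e0; nra.
apply: (fun x => proj1 (proj2 (derivable_nrm phi a 1 d) x)) => e e0.
exists (Num.min (rho / 4) (e / (B + 1))) => [|h].
  rewrite lt_min; apply/andP; split; [lra|apply: divr_gt0 => //; lra].
rewrite lt_min => /andP[h1]; rewrite ltr_pdivlMr => [h2|]; last lra.
rewrite -[_ *: 1]/(_ * 1) mulr1.
have hr : nrm (a + h - a) <= rho by rewrite (addrC a) addrK; lra.
have L := cvsD (cvsD (Hl _ hr) (cvsZ (-1) (Hl _ h0))) (cvsZ (- h) Hd).
rewrite (_ : _ - _ - _ = phi (a + h) + -1 * phi a + - h * d - 0); last by ring.
apply: le_trans (_ : B * nrm h ^+ 2 <= _); last first.
  have n0 := nrm_ge0 h; rewrite expr2 mulrA; apply: ler_wpM2r => //; clear -h2 n0; lra.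
apply: (cvs_bound L) => m.
have -> : F m (a + h) + -1 * F m a + - h * 'D_1 (F m) a - 0 = F m (a + h) - F m a - h * 'D_1 (F m) a by ring.
by apply: T; lra.
Qed.

End OneVar.

(** * Holomorphic functions on a complex normed space *)

Section Hol.
Variable R : realType.
Local Notation C := (Cplx R).
Variable V : normedModType C.
Implicit Types (f g : V -> C) (z w v h : V).

Definition germ (z : V) (P : V -> Prop) : Prop :=
  exists2 r : R, 0 < r & forall w, nrm (w - z) < r -> P w.

Lemma germ_near z (P : V -> Prop) : (\forall w \near z, P w) <-> germ z P.
Proof. exact: nbhs_nrm. Qed.
Lemma germ_self z (P : V -> Prop) : germ z P -> P z.
Proof. by case=> r r0; apply; rewrite subrr nrm0. Qed.
Lemma germ_all z (P : V -> Prop) : (forall w, P w) -> germ z P.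
Proof. by move=> H; exists 1. Qed.
Lemma germ_imp z (P Q : V -> Prop) : (forall w, P w -> Q w) -> germ z P -> germ z Q.
Proof. by move=> PQ [r r0 H]; exists r => // w /H /PQ. Qed.
Lemma germ_and z (P Q : V -> Prop) : germ z P -> germ z Q -> germ z (fun w => P w /\ Q w).
Proof.
move=> [r r0 H] [s s0 K]; exists (Num.min r s); first by rewrite lt_min r0.
by move=> w; rewrite lt_min => /andP[/H ? /K ?].
Qed.
Lemma germ_open z (P : V -> Prop) : germ z P -> germ z (fun w => germ w P).
Proof.
move=> [r r0 H]; exists (r / 2) => [|w wz]; first lra.
exists (r / 2) => [|u uw]; first lra.
by apply: H; have := nrm_le_sub u w z; lra.
Qed.
Lemma germ_ball z r w (P : V -> Prop) : (forall w, nrm (w - z) < r -> P w) ->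
  nrm (w - z) < r -> germ w P.
Proof.
move=> H wz; exists (r - nrm (w - z)) => [|u uw]; first lra.
by apply: H; have := nrm_le_sub u w z; lra.
Qed.

Lemma germ_seq (T : eqType) (s : seq T) z (P : T -> V -> Prop) :
  (forall x, x \in s -> germ z (P x)) -> germ z (fun w => forall x, x \in s -> P x w).
Proof.
elim: s => [|a s IH] H; first exact: germ_all.
have H1 := H a (mem_head _ _).
have H2 := IH (fun x xs => H x (mem_behead (s := a :: s) xs)).
apply: germ_imp (germ_and H1 H2) => w [pa ps] x; rewrite inE => /orP[/eqP ->//|]; exact: ps.
Qed.
Lemma germ_fin (T : finType) z (P : T -> V -> Prop) :
  (forall x, germ z (P x)) -> germ z (fun w => forall x, P x w).
Proof.
move=> H; apply: germ_imp (@germ_seq T (enum T) z P (fun x _ => H x)) => w Hw x.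
by apply: Hw; rewrite mem_enum.
Qed.

Lemma line_der f z u (a d : C) :
  (derivable f (z + a *: u) u /\ 'D_u f (z + a *: u) = d) <->
  (derivable (fun t : C => f (z + t *: u)) a 1 /\ 'D_1 (fun t : C => f (z + t *: u)) a = d).
Proof.
by split=> H; apply/derivable_nrm => e e0; have [r r0 Hr] := (proj1 (derivable_nrm _ _ _ _)) H e e0;
  exists r => // h /Hr; rewrite -[h *: 1]/(h * 1) mulr1 scalerDl addrA.
Qed.

Lemma derivable_ext f g z v : germ z (fun w => f w = g w) -> derivable f z v ->
  derivable g z v /\ 'D_v g z = 'D_v f z.
Proof.
move=> [r r0 H] df; apply/derivable_nrm => e e0.
have [s s0 K] := (proj1 (derivable_nrm _ _ _ _)) (conj df erefl) e e0.
have n1 : 0 < nrm v + 1 by have := nrm_ge0 v; lra.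
exists (Num.min s (r / (nrm v + 1))) => [|h]; first by rewrite lt_min s0 divr_gt0.
rewrite lt_min ltr_pdivlMr // => /andP[h1 h2].
rewrite -!H; first exact: K.
  by rewrite subrr nrm0.
rewrite (addrC z) addrK nrmZ; have := nrm_ge0 h; clear -h2; lra.
Qed.

Definition holB f z (r M : R) : Prop :=
  forall w, nrm (w - z) < r -> nrm (f w) <= M /\ forall v, derivable f w v.
(** Local boundedness and derivability in every direction. By [holomorphic_nearE] this is Frechet
    differentiability near [z], but it is easier to check for integrals and quotients. *)
Definition hol f z : Prop :=
  exists M, germ z (fun w => nrm (f w) <= M /\ forall v, derivable f w v).

Lemma holP f z : hol f z <-> exists r M, 0 < r /\ holB f z r M.
Proof. by split; [move=> [M [r r0 H]]; exists r, M|move=> [r [M [r0 H]]]; exists M, r]. Qed.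

Lemma holB_hol f z r M : 0 < r -> holB f z r M -> forall w, nrm (w - z) < r -> hol f w.
Proof.
move=> r0 H w wz; apply/holP; exists (r - nrm (w - z)), M; split; first lra.
by move=> u uw; apply: H; have := nrm_le_sub u w z; lra.
Qed.
Lemma holB_sub f z w r s M : holB f z r M -> nrm (w - z) + s <= r -> holB f w s M.
Proof. by move=> H wz u uw; apply: H; have := nrm_le_sub u w z; lra. Qed.
Lemma hol_open f z : hol f z -> germ z (hol f).
Proof. by move=> /holP[r [M [r0 H]]]; exists r => //; exact: holB_hol H. Qed.

Lemma hol_ext f g z : germ z (fun w => f w = g w) -> hol f z -> hol g z.
Proof.
move=> /germ_open E [M H]; exists M; apply: germ_imp (germ_and E H) => w [e [b d]].
split; first by rewrite -(germ_self e).
by move=> v; have [] := derivable_ext e (d v).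
Qed.

Lemma holB_line f z r M w v rho : holB f z r M -> nrm (w - z) + rho * nrm v < r ->
  dholB (fun t : C => f (w + t *: v)) 0 rho M.
Proof.
move=> H wr t; rewrite subr0 => tr.
have [b d] : nrm (f (w + t *: v)) <= M /\ forall u, derivable f (w + t *: v) u.
  apply: H; have := nrmD (w - z) (t *: v); rewrite addrAC nrmZ.
  have := nrm_ge0 v; clear -tr wr; nra.
by split; [have [] := (proj1 (line_der f w v t _)) (conj (d v) erefl)|].
Qed.

(** Estimates in several variables come from complex lines: on the line in direction [h] the bound
    [M] is available for parameters up to [r / (2 * nrm h)], while the increment [h] has parameter
    1. *)
Lemma holB_lip f z r M h : 0 < r -> holB f z r M -> nrm h <= r / 4 ->
  nrm (f (z + h) - f z) <= 4 * K1 R * M / r * nrm h.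
Proof.
move=> r0 H hr.
have [->|h0] := eqVneq h 0; first by rewrite addr0 subrr !nrm0 mulr0.
have n0 : 0 < nrm h by rewrite nrm_gt0.
have p0 : 0 < r / (2 * nrm h) by rewrite divr_gt0 // mulr_gt0.
have L : dholB (fun t : C => f (z + t *: h)) 0 (r / (2 * nrm h)) M.
  apply: (holB_line H); rewrite subrr nrm0 add0r.
  have -> : r / (2 * nrm h) * nrm h = r / 2 by field; rewrite gt_eqF.
  lra.
have := one_lip (w := 1) p0 L; rewrite subr0 nrm1 scale1r scale0r addr0 mulr1.
have -> : 2 * K1 R * M / (r / (2 * nrm h)) = 4 * K1 R * M / r * nrm h by field; rewrite !gt_eqF.
apply; have -> : r / (2 * nrm h) / 2 = (r / 4) / nrm h by field; rewrite gt_eqF.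
by rewrite ler_pdivlMr // mul1r.
Qed.

Lemma holB_taylor f z r M h : 0 < r -> holB f z r M -> nrm h <= r / 8 ->
  nrm (f (z + h) - f z - 'D_h f z) <= 4 * K2 R * M / r ^+ 2 * nrm h ^+ 2.
Proof.
move=> r0 H hr.
have [->|h0] := eqVneq h 0.
  by rewrite addr0 subrr derive0 subr0 !nrm0 expr0n mulr0.
have n0 : 0 < nrm h by rewrite nrm_gt0.
have p0 : 0 < r / (2 * nrm h) by rewrite divr_gt0 // mulr_gt0.
have L : dholB (fun t : C => f (z + t *: h)) 0 (r / (2 * nrm h)) M.
  apply: (holB_line H); rewrite subrr nrm0 add0r.
  have -> : r / (2 * nrm h) * nrm h = r / 2 by field; rewrite gt_eqF.
  lra.
have := one_taylor2 (w := 1) p0 L; rewrite subr0 nrm1 scale1r scale0r addr0 mul1r expr1n mulr1.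
have [_ d] := H z ltac:(by rewrite subrr nrm0).
have [_ ->] := (proj1 (line_der f z h 0 ('D_h f z))) ltac:(by rewrite scale0r addr0).
have -> : K2 R * M / (r / (2 * nrm h)) ^+ 2 = 4 * K2 R * M / r ^+ 2 * nrm h ^+ 2 by field; rewrite !gt_eqF.
apply; have -> : r / (2 * nrm h) / 4 = (r / 8) / nrm h by field; rewrite gt_eqF.
by rewrite ler_pdivlMr // mul1r.
Qed.

Lemma hol_cont f z : hol f z -> forall e : R, 0 < e -> germ z (fun w => nrm (f w - f z) < e).
Proof.
move=> /holP[r [M [r0 H]]] e e0.
have M0 : 0 <= M by have [] := H z ltac:(by rewrite subrr nrm0) => + _; apply: le_trans; exact: nrm_ge0.
pose L := 4 * K1 R * M / r.
have L0 : 0 <= L by rewrite divr_ge0 ?(ltW r0) // mulr_ge0 // mulr_ge0 // ltW // K1_gt0.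
exists (Num.min (r / 4) (e / (L + 1))) => [|w].
  by rewrite lt_min; apply/andP; split; [|apply: divr_gt0 => //]; clear -r0 L0; lra.
rewrite lt_min => /andP[w1]; rewrite ltr_pdivlMr => [w2|]; last by clear -L0; lra.
 have := holB_lip r0 H (ltW w1); rewrite [z + _]addrC subrK -/L.
have := nrm_ge0 (w - z); clear -w2 L0; nra.
Qed.

Lemma hol_neq0 f z : hol f z -> f z != 0 -> germ z (fun w => f w != 0).
Proof.
move=> /hol_cont H; rewrite -nrm_gt0 => /H; apply: germ_imp => w.
by rewrite -nrm_gt0 => h; have := nrm_sub_ge (f z) (f w); rewrite nrmB; lra.
Qed.

Lemma hol_derivable f z v : hol f z -> derivable f z v.
Proof. by move=> [M /germ_self[_]]; apply. Qed.
Arguments hol_derivable {f z} v _.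

Lemma hol_cst c z : hol (fun=> c) z.
Proof. by exists (nrm c); apply: germ_all => w; split => // v; exact: derivable_cst. Qed.

Lemma holD f g z : hol f z -> hol g z -> hol (fun w => f w + g w) z.
Proof.
move=> [M H] [N K]; exists (M + N); apply: germ_imp (germ_and H K) => w [[b d] [b' d']].
split; first by apply: le_trans (nrmD _ _) _; exact: lerD.
by move=> v; have := derivableD (d v) (d' v); exact.
Qed.

Lemma holM f g z : hol f z -> hol g z -> hol (fun w => f w * g w) z.
Proof.
move=> [M H] [N K]; exists (M * N); apply: germ_imp (germ_and H K) => w [[b d] [b' d']].
split; first by rewrite nrmM; apply: ler_pM => //; exact: nrm_ge0.
by move=> v; have := derivableM (d v) (d' v); exact.
Qed.

Lemma holZ c f z : hol f z -> hol (fun w => c * f w) z.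
Proof. by move=> H; exact: (holM (hol_cst c z) H). Qed.
Lemma holN f z : hol f z -> hol (fun w => - f w) z.
Proof.
by move=> /(@holZ (-1)); apply: hol_ext; apply: germ_all => w; rewrite mulN1r.
Qed.
Lemma holB2 f g z : hol f z -> hol g z -> hol (fun w => f w - g w) z.
Proof. by move=> H /holN K; exact: (holD H K). Qed.
Lemma holX f n z : hol f z -> hol (fun w => f w ^+ n) z.
Proof.
move=> H; elim: n => [|n IH]; first exact: (hol_cst 1).
apply: hol_ext (holM H IH); apply: germ_all => w; by rewrite exprS.
Qed.
Lemma hol_sum (I : Type) (s : seq I) (P : pred I) (F : I -> V -> C) z :
  (forall i, P i -> hol (F i) z) -> hol (fun w => \sum_(i <- s | P i) F i w) z.
Proof.
move=> H; elim: s => [|i s IH].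
  by apply: hol_ext (hol_cst 0 z); apply: germ_all => w; rewrite big_nil.
case Pi: (P i).
  by apply: hol_ext (holD (H i Pi) IH); apply: germ_all => w; rewrite big_cons Pi.
by apply: hol_ext IH; apply: germ_all => w; rewrite big_cons Pi.
Qed.
Lemma hol_prod (I : Type) (s : seq I) (P : pred I) (F : I -> V -> C) z :
  (forall i, P i -> hol (F i) z) -> hol (fun w => \prod_(i <- s | P i) F i w) z.
Proof.
move=> H; elim: s => [|i s IH].
  by apply: hol_ext (hol_cst 1 z); apply: germ_all => w; rewrite big_nil.
case Pi: (P i).
  by apply: hol_ext (holM (H i Pi) IH); apply: germ_all => w; rewrite big_cons Pi.
by apply: hol_ext IH; apply: germ_all => w; rewrite big_cons Pi.
Qed.
Lemma holV f z : hol f z -> f z != 0 -> hol (fun w => (f w)^-1) z.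
Proof.
move=> H f0; have n0 : 0 < nrm (f z) by rewrite nrm_gt0.
have [M K] := H.
exists (2 / nrm (f z)); have e0 : 0 < nrm (f z) / 2 by lra.
apply: germ_imp (germ_and K (hol_cont H e0)) => w [[_ d] b].
have fw : nrm (f z) / 2 < nrm (f w).
  by have := nrm_sub_ge (f z) (f w); rewrite nrmB; lra.
have fw0 : 0 < nrm (f w) by lra.
split; first by rewrite nrmV -[2 / _]invf_div lef_pV2 ?posrE // ltW.
by move=> v; have := @derivableV _ _ f w v ltac:(by rewrite -nrm_gt0) (d v); exact.
Qed.
Lemma hol_div f g z : hol f z -> hol g z -> g z != 0 -> hol (fun w => f w / g w) z.
Proof. by move=> H K g0; exact: (holM H (holV K g0)). Qed.

Lemma hol_det n (A : 'I_n -> 'I_n -> V -> C) z : (forall i j, hol (A i j) z) ->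
  hol (fun w => \det (\matrix_(i, j) A i j w)) z.
Proof.
move=> H.
have : hol (fun w => \sum_(s : 'S_n) (-1) ^+ s * \prod_i A i (s i) w) z.
  by apply: hol_sum => s _; apply: holZ; apply: hol_prod => i _.
apply: hol_ext; apply: germ_all => w; rewrite /determinant.
by apply: eq_bigr => s _; congr (_ * _); apply: eq_bigr => i _; rewrite mxE.
Qed.

(* Functions of several variables obtained by integrating over a parameter. *)
Lemma derivable_sumf n (F : 'I_n -> C -> C) (a : C) : (forall i, derivable (F i) a 1) ->
  derivable (fun t => \sum_(i < n) F i t) a 1.
Proof.
elim: n F => [|n IH] F H.
  have -> : (fun t => \sum_(i < 0) F i t) = (fun=> 0) by apply/funext => t; rewrite big_ord0.
  exact: derivable_cst.
have -> : (fun t => \sum_(i < n.+1) F i t) = (fun t => \sum_(i < n) F (widen_ord (leqnSn n) i) t + F ord_max t).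
  by apply/funext => t; rewrite big_ord_recr.
by apply: derivableDf; [apply: IH|].
Qed.

(** On a complex line the integral is the limit of its dyadic sums, which are holomorphic with the
    same bound, so [dhol_limit] applies. *)
Lemma int01_hol (F : V -> R -> C) z r M :
  (forall t : R, 0 <= t <= 1 -> holB (fun w => F w t) z r M) ->
  (forall w, nrm (w - z) < r -> cont01 (F w)) ->
  holB (fun w => int01 (F w)) z r M.
Proof.
move=> H Hc w wz; have B t : 0 <= t <= 1 -> nrm (F w t) <= M by move=> t1; have [] := H t t1 w wz.
split; first by apply: int01_bound => //; exact: Hc.
move=> v; pose rho := (r - nrm (w - z)) / (2 * (nrm v + 1)).
have v0 := nrm_ge0 v; have v1 : 0 < 2 * (nrm v + 1) by lra.
have rho0 : 0 < rho by apply: divr_gt0 => //; lra.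
have rv : rho * nrm v < r - nrm (w - z).
  rewrite /rho mulrAC ltr_pdivrMr //; clear -wz v0; nra.
have HL (t : R) : 0 <= t <= 1 -> dholB (fun x : C => F (w + x *: v) t) 0 rho M.
  move=> t1; apply: (holB_line (H t t1)); clear -rv; lra.
suff : derivable (fun x : C => int01 (F (w + x *: v))) 0 1.
  move=> d; have [] := (proj2 (line_der (fun w => int01 (F w)) w v 0 _)) (conj d erefl).
  by rewrite scale0r addr0.
apply: (@dhol_limit R (fun m x => rsum (F (w + x *: v)) m) _ 0 rho M) => // [m x xr|x xr].
  split.
    apply: derivableMf; first exact: derivable_cst.
    by apply: derivable_sumf => i; have [] := HL _ (@dyad01 R _ i) x xr.
  rewrite -[rsum _ _]subr0; apply: rsum_bound => t t1; rewrite subr0.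
  by have [] := HL _ t1 x xr.
apply: int01_cvs; apply: Hc.
have := nrmD (w - z) (x *: v); rewrite addrAC nrmZ; rewrite subr0 in xr; clear -rv xr v0; nra.
Qed.

Lemma csq_hol (Q : V -> C -> C) z (s r M : R) : 0 < s -> 0 < r ->
  (forall t : C, s <= nrm t -> nrm t <= 2 * s -> holB (fun w => Q w t) z r M) ->
  (forall w, nrm (w - z) < r -> ann s (2 * s) (contAt (Q w))) ->
  holB (fun w => csq (Q w) (rc s)) z r (8 * (s * M)).
Proof.
move=> s0 r0 H Hc w wz; have zz : nrm (z - z) < r by rewrite subrr nrm0.
split; first by apply: csq_bound => //; [exact: Hc|move=> t t1 t2; have [] := H t t1 t2 w wz].
have HA : ann s (2 * s) (fun t => holB (fun w => Q w t) z r M) by move=> t; exact: H.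
have [h1 h2 h3 h4] := csq_seg s0 HA.
have hs a u : (forall t : R, 0 <= t <= 1 -> holB (fun w => Q w (a + rc t * u)) z r M) ->
    (forall w, nrm (w - z) < r -> forall t : R, 0 <= t <= 1 -> contAt (Q w) (a + rc t * u)) ->
    hol (fun w => seg (Q w) a u) w.
  move=> Hh Hk; have K := @int01_hol (fun w t => Q w (a + rc t * u)) z r M Hh
    (fun w' w'z => cont_seg (Hk w' w'z)).
  exact: (holZ u (holB_hol r0 K wz)).
have E : hol (fun w => csq (Q w) (rc s)) w.
  have k1 := hs _ _ h1 (fun w' w'z => let: And4 c1 c2 c3 c4 := csq_seg s0 (Hc w' w'z) in c1).
  have k2 := hs _ _ h2 (fun w' w'z => let: And4 c1 c2 c3 c4 := csq_seg s0 (Hc w' w'z) in c2).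
  have k3 := hs _ _ h3 (fun w' w'z => let: And4 c1 c2 c3 c4 := csq_seg s0 (Hc w' w'z) in c3).
  have k4 := hs _ _ h4 (fun w' w'z => let: And4 c1 c2 c3 c4 := csq_seg s0 (Hc w' w'z) in c4).
  exact: (holB2 (holB2 (holD k1 k2) k3) k4).
move=> v; exact: (hol_derivable v E).
Qed.

Definition K3 (v : V) : R := 32 * (nrm v + 1) / nrm (c0 R).
Lemma K3_gt0 v : 0 < K3 v.
Proof. by apply: divr_gt0; [have := nrm_ge0 v; lra|exact: c0_gt0]. Qed.

(** By [cauchy1] the derivative is a Cauchy integral in direction [v], and [csq_hol] makes it
    holomorphic in the base point. *)
Lemma holB_derive f z r M v : 0 < r -> holB f z r M ->
  holB ('D_v f) z (r / 2) (K3 v * M / r).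
Proof.
move=> r0 H; have v0 := nrm_ge0 v; have v1 : 0 < 4 * (nrm v + 1) by lra.
pose s := r / (4 * (nrm v + 1)); have s0 : 0 < s by apply: divr_gt0.
have sv : 2 * s * nrm v < r / 2.
  rewrite /s mulrAC mulrA ltr_pdivrMr //; clear -r0 v0; nra.
have tv (t : C) w : nrm t <= 2 * s -> nrm (w - z) < r / 2 -> nrm (w + t *: v - z) < r.
  move=> t2 wz; have := nrmD (w - z) (t *: v); rewrite addrAC nrmZ.
  clear -t2 wz sv v0; nra.
pose Q w (t : C) := f (w + t *: v) * (t^-1 * t^-1).
have DL w : nrm (w - z) < r / 2 -> forall t : C, nrm t <= 2 * s -> derivable (fun t : C => f (w + t *: v)) t 1.
  move=> wz t ts; have [_ d] := H _ (tv t w ts wz).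
  by have [] := (proj1 (line_der f w v t _)) (conj (d v) erefl).
have E w : nrm (w - z) < r / 2 -> 'D_v f w = (c0 R)^-1 * csq (Q w) (rc s).
  move=> wz; rewrite (cauchy1 s0 (DL w wz)) mulrA mulVf ?c0_neq0 // mul1r.
  have [_ d] := H w ltac:(clear -wz r0; lra).
  have [_ ->] := (proj1 (line_der f w v 0 ('D_v f w))) ltac:(by rewrite scale0r addr0).
  by [].
have HQ : holB (fun w => csq (Q w) (rc s)) z (r / 2) (8 * (s * (M * (s^-1 * s^-1)))).
  apply: csq_hol => // [|t t1 t2 w wz|w wz t t1 t2].
  - lra.
  - have [b d] := H _ (tv t w t2 wz).
    have t0 : t != 0 by exact: nrm_neq0 t1.
    have tn : nrm t^-1 <= s^-1 by rewrite nrmV lef_pV2 ?posrE // (lt_le_trans s0).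
    split.
      rewrite !nrmM; apply: ler_pM => //; rewrite ?mulr_ge0 ?nrm_ge0 //.
      by apply: ler_pM => //; exact: nrm_ge0.
    move=> u; have hu : hol (fun w => f (w + t *: v)) w.
      exists M; exists (r - nrm (w + t *: v - z)) => [|x xw]; first by have := tv t w t2 wz; lra.
      have xz : nrm (x + t *: v - z) < r.
        have := nrm_le_sub (x + t *: v) (w + t *: v) z; rewrite opprD addrACA subrr addr0.
        by clear -xw; lra.
      have [b' d'] := H _ xz; split; [exact: b'|move=> u'].
      apply: (fun y => proj1 (proj2 (derivable_nrm _ _ _ ('D_u' f (x + t *: v))) y)) => e e0.
      have [q q0 Hq] := (proj1 (derivable_nrm _ _ _ _)) (conj (d' u') erefl) e e0.
      by exists q => [//|h /Hq]; rewrite (addrAC x).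
    by have := hol_derivable u (holM hu (hol_cst (t^-1 * t^-1) w)).
  - apply: derivable_contAt; apply: derivableMf; first exact: DL.
    by apply: derivableMf; apply: derivable_inv; exact: nrm_neq0 t1.
have r20 : 0 < r / 2 by lra.
have HE : forall w, nrm (w - z) < r / 2 -> germ w (fun w => (c0 R)^-1 * csq (Q w) (rc s) = 'D_v f w).
  by move=> w wz; apply: germ_ball wz => x /E ->.
have MB : nrm (c0 R)^-1 * (8 * (s * (M * (s^-1 * s^-1)))) = K3 v * M / r.
  rewrite nrmV /K3 /s; field; rewrite !gt_eqF ?c0_gt0 //=.
  by clear -v0; lra.
move=> w wz; have [b d] := HQ w wz; split.
  by rewrite -MB E // nrmM; apply: ler_wpM2l => //; exact: nrm_ge0.
move=> u; have h := holZ (c0 R)^-1 (holB_hol r20 HQ wz).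
by have [] := derivable_ext (HE w wz) (hol_derivable u h).
Qed.

Lemma hol_derive f z v : hol f z -> hol ('D_v f) z.
Proof.
move=> /holP[r [M [r0 H]]]; apply/holP; exists (r / 2), (K3 v * M / r).
by split; [lra|exact: holB_derive].
Qed.

Lemma deriveZv f z v (a : C) : derivable f z v ->
  derivable f z (a *: v) /\ 'D_(a *: v) f z = a * 'D_v f z.
Proof.
move=> d; apply/derivable_nrm => e e0; have n1 : 0 < nrm a + 1 by have := nrm_ge0 a; lra.
have [r r0 Hr] := (proj1 (derivable_nrm _ _ _ _)) (conj d erefl) _ (divr_gt0 e0 n1).
exists (r / (nrm a + 1)) => [|h]; first exact: divr_gt0.
rewrite ltr_pdivlMr // => hr.
have hr' : nrm (h * a) < r by rewrite nrmM; have := nrm_ge0 h; clear -hr; nra.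
have := Hr _ hr'; rewrite scalerA -mulrA => H; apply: le_trans H _.
rewrite nrmM mulrAC ler_pdivrMr //; have := nrm_ge0 h; clear -e0; move: (nrm h) (nrm a) => x y; nra.
Qed.

(** Additivity in the direction is not built into [hol]. The step [y (u + v)] is split into [y u]
    followed by [y v]; the quadratic remainder at the intermediate point and the continuity of
    ['D_v f] control the error as [y] tends to 0. *)
Lemma deriveDv f z u v : hol f z -> 'D_(u + v) f z = 'D_u f z + 'D_v f z.
Proof.
move=> Hf; have [r [M [r0 H]]] := (proj1 (holP f z)) Hf.
have Hv := hol_derive v Hf.
apply/eqP; rewrite -subr_eq0 -nrm_eq0 eq_le nrm_ge0 andbT leNgt; apply/negP => l0.
set X := nrm _ in l0.
have e0 : 0 < X / 8 by lra.
have [r1 r10 D1] := (proj1 (derivable_nrm _ _ _ _)) (conj (hol_derivable (u + v) Hf) erefl) _ e0.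
have [r2 r20 D2] := (proj1 (derivable_nrm _ _ _ _)) (conj (hol_derivable u Hf) erefl) _ e0.
have [r3 r30 D3] := hol_cont Hv e0.
have M0 : 0 <= M by have [] := H z ltac:(by rewrite subrr nrm0) => + _; apply: le_trans; exact: nrm_ge0.
have n0 : 0 < nrm u + nrm v + 1 by have := nrm_ge0 u; have := nrm_ge0 v; lra.
pose B := 4 * K2 R * M / (r / 2) ^+ 2 * nrm v ^+ 2.
have B0 : 0 <= B.
  rewrite mulr_ge0 ?sqr_ge0 // divr_ge0 ?sqr_ge0 // mulr_ge0 // mulr_ge0 // ltW // K2_gt0 //.
pose x := Num.min (Num.min r1 r2) (Num.min (Num.min (r / 16) r3 / (nrm u + nrm v + 1)) (X / (8 * (B + 1)))).
have B1 : 0 < 8 * (B + 1) by lra.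
have x0 : 0 < x.
  by rewrite /x !lt_min r10 r20 /= divr_gt0 ?lt_min ?r30 ?andbT //=; [exact: divr_gt0|lra].
pose y := x / 2; have y0 : 0 < y by rewrite /y; lra.
have yx : y < x by rewrite /y; lra.
have ny : nrm (rc y) = y by rewrite nrm_rc ger0_norm // ltW.
have y1 : y < r1 by apply: lt_le_trans yx _; rewrite /x !ge_min lexx.
have y2 : y < r2 by apply: lt_le_trans yx _; rewrite /x !ge_min lexx orbT.
have : y < Num.min (r / 16) r3 / (nrm u + nrm v + 1) by apply: lt_le_trans yx _; rewrite /x !ge_min lexx !orbT.
rewrite ltr_pdivlMr // lt_min => /andP[y3 y4].
have : y < X / (8 * (B + 1)) by apply: lt_le_trans yx _; rewrite /x !ge_min lexx !orbT.
rewrite ltr_pdivlMr // => y5.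
have nu := nrm_ge0 u; have nv := nrm_ge0 v.
have yu : y * nrm u <= y * (nrm u + nrm v + 1) by apply: ler_wpM2l; [exact: ltW|lra].
have yv : y * nrm v <= y * (nrm u + nrm v + 1) by apply: ler_wpM2l; [exact: ltW|lra].
have zu : nrm (z + rc y *: u - z) = y * nrm u by rewrite addrC addKr nrmZ ny.
have H' : holB f (z + rc y *: u) (r / 2) M.
  by apply: holB_sub H _; rewrite zu; clear -yu y3 r0; lra.
have T := @holB_taylor f (z + rc y *: u) (r / 2) M (rc y *: v) ltac:(lra) H'.
have [_ DE] := deriveZv (rc y) (proj2 (H' (z + rc y *: u) ltac:(by rewrite subrr nrm0; lra)) v).
rewrite DE nrmZ ny in T; have {}T := T ltac:(clear -yv y3 r0; lra).
rewrite [(y * _) ^+ 2]exprMn [y ^+ 2 * _]mulrC mulrA -/B in T.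
have T1 := D1 (rc y) ltac:(by rewrite ny); have T2 := D2 (rc y) ltac:(by rewrite ny).
have T3 := D3 (z + rc y *: u) ltac:(by rewrite zu; clear -yu y4; lra).
rewrite ny in T1 T2.
have E : rc y * ('D_(u + v) f z - ('D_u f z + 'D_v f z)) =
   (f (z + rc y *: u + rc y *: v) - f (z + rc y *: u) - rc y * 'D_v f (z + rc y *: u))
   - (f (z + rc y *: (u + v)) - f z - rc y * 'D_(u + v) f z)
   + (f (z + rc y *: u) - f z - rc y * 'D_u f z)
   + rc y * ('D_v f (z + rc y *: u) - 'D_v f z).
  have RI (k a b c d p q r' : C) : k * (a - (b + c)) = (p - q - k * d) - (p - r' - k * a)
      + (q - r' - k * b) + k * (d - c) by clear; ring.
  have -> : z + rc y *: (u + v) = z + rc y *: u + rc y *: v by rewrite scalerDr addrA.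
  exact: RI.
have : y * X <= y * (y * B + X / 8 + X / 8 + X / 8).
  rewrite -{1}ny -nrmM E.
  have TT (a b c d : C) : nrm (a - b + c + d) <= nrm a + nrm b + nrm c + nrm d.
    have := nrmD (a - b + c) d; have := nrmD (a - b) c; have := nrmD a (- b).
    rewrite nrmN; clear; lra.
  apply: le_trans (TT _ _ _ _) _; rewrite nrmM ny.
  have T3' : y * nrm ('D_v f (z + rc y *: u) - 'D_v f z) <= y * (X / 8).
    by apply: ler_wpM2l; exact: ltW.
  apply: le_trans (lerD (lerD (lerD T T1) T2) T3') _.
  clear; clearbody y B X; clear x.
  have -> : y * (y * B + X / 8 + X / 8 + X / 8) = B * y ^+ 2 + X / 8 * y + X / 8 * y + y * (X / 8) by ring.
  exact: lexx.
rewrite ler_pM2l //; clear -y5 B0 y0 l0; clearbody y B X; clear x; have : y * B <= X / 8 by lra.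
by lra.
Qed.

Lemma derive_le f z r M v : 0 < r -> holB f z r M -> nrm ('D_v f z) <= 2 * K1 R * M / r * nrm v.
Proof.
move=> r0 H; have [_ d] := H z ltac:(by rewrite subrr nrm0).
have [->|v0] := eqVneq v 0; first by rewrite derive0 !nrm0 mulr0.
have n0 : 0 < nrm v by rewrite nrm_gt0.
have p0 : 0 < r / (2 * nrm v) by rewrite divr_gt0 // mulr_gt0.
have L : dholB (fun t : C => f (z + t *: v)) 0 (r / (2 * nrm v)) M.
  apply: (holB_line H); rewrite subrr nrm0 add0r.
  have -> : r / (2 * nrm v) * nrm v = r / 2 by field; rewrite gt_eqF.
  lra.
have := one_cauchy p0 L.
have [_ ->] := (proj1 (line_der f z v 0 ('D_v f z))) ltac:(by rewrite scale0r addr0).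
by have -> : K1 R * M / (r / (2 * nrm v)) = 2 * K1 R * M / r * nrm v by field; rewrite !gt_eqF.
Qed.

Lemma differentiable_hol f z : (\forall w \near z, differentiable f w) -> hol f z.
Proof.
move=> /germ_near H; have d := germ_self H.
have c : {for z, continuous f} by exact: differentiable_continuous.
exists (nrm (f z) + 1).
have : germ z (fun w => nrm (f w - f z) < 1).
  apply/germ_near; move/cvgr_dist_lt : c => /(_ (rc 1) _) c.
  have {}c := c ltac:(by rewrite -rc0 lt_rc ltr01).
  near=> w; have : `|f z - f w| < rc 1 by near: w.
  by rewrite -opprB normrN nrmE lt_rc.
move=> B; apply: germ_imp (germ_and H B) => w [dw bw]; split.
  by have := nrm_sub_ge (f w) (f z); lra.
by move=> v; exact: diff_derivable.
Unshelve. all: by end_near. Qed.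

End Hol.
Arguments hol_derivable {R V f z} v _.

(** * Frechet differentiability, substitution of graphs, connectedness *)

Section HolDiff.
Variable R : realType.
Local Notation C := (Cplx R).
Variable V : normedModType C.
Implicit Types (f g : V -> C) (z w v h : V).

Lemma hol_differentiable f z : hol f z -> differentiable f z.
Proof.
move=> Hf; have [r [M [r0 H]]] := (proj1 (holP f z)) Hf.
pose D h : C := 'D_h f z.
have lin : linear D.
  move=> a u v; rewrite /D deriveDv //.
  by have [_ ->] := deriveZv a (hol_derivable u Hf).
pose L : {linear V -> C} := HB.pack D (GRing.isLinear.Build C V C *:%R D lin).
have M0 : 0 <= M by have [] := H z ltac:(by rewrite subrr nrm0) => + _; apply: le_trans; exact: nrm_ge0.
have k1 := K1_gt0 R; have k2 := K2_gt0 R.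
pose B := 2 * K1 R * M / r; pose B2 := 4 * K2 R * M / r ^+ 2.
have B0 : 0 <= B by rewrite divr_ge0 ?(ltW r0) // mulr_ge0 // mulr_ge0 // ltW.
have B20 : 0 <= B2 by rewrite divr_ge0 ?sqr_ge0 // mulr_ge0 // mulr_ge0 // ltW.
have LB h : nrm (L h) <= B * nrm h by exact: (derive_le h r0 H).
have Lc : continuous L.
  move=> x; apply/cvgrPdist_lt => e e0.
  have [e' e'0 ee'] : exists2 e' : R, 0 < e' & e = rc e'.
    by move: e0; case: e => a b; rewrite ltcE /= => /andP[/eqP -> a0]; exists a.
  have B1 : 0 < B + 1 by lra.
  apply: (proj2 (@nbhs_nrm R V x _)); exists (e' / (B + 1)); first exact: divr_gt0.
  move=> w; rewrite ltr_pdivlMr // => wx.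
  rewrite nrmE ee' lt_rc -raddfB; apply: le_lt_trans (LB _) _.
  by rewrite nrmB; have := nrm_ge0 (w - x); clear -wx; lra.
have E : f \o shift z = cst (f z) + L +o_ 0 id.
  apply/eqaddoP => e e0.
  have [e' e'0 ee'] : exists2 e' : R, 0 < e' & e = rc e'.
    by move: e0; case: e => a b; rewrite ltcE /= => /andP[/eqP -> a0]; exists a.
  have B1 : 0 < B2 + 1 by lra.
  apply: (proj2 (@nbhs_nrm R V 0 _)); exists (Num.min (r / 8) (e' / (B2 + 1))) => [|h].
    by rewrite lt_min; apply/andP; split; [lra|exact: divr_gt0].
  rewrite subr0 lt_min => /andP[h1]; rewrite ltr_pdivlMr // => h2.
  have T := holB_taylor r0 H (ltW h1).
  have -> : (f \o shift z - (cst (f z) + L)) h = f (z + h) - f z - 'D_h f z.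
    by rewrite fctE /= fctE /= opprD addrA (addrC h).
  rewrite ee' !nrmE -rcM le_rc; apply: le_trans T _; rewrite -/B2 expr2 mulrA.
  apply: ler_wpM2r; first exact: nrm_ge0.
  have := nrm_ge0 h; clear -h2; lra.
have DE := diff_unique Lc E.
by apply/diff_locallyP; rewrite DE; split.
Qed.

Lemma holomorphic_nearE f z : holomorphic_near f z <-> hol f z.
Proof.
split; first exact: differentiable_hol.
by move=> /hol_open H; apply/germ_near; apply: germ_imp H => w; exact: hol_differentiable.
Qed.

(* Chain rule along the graph of a scalar function. *)
Lemma derivable_graph f (th : V -> C) (u w v : V) : hol f (w + th w *: u) ->
  derivable th w v -> derivable (fun x => f (x + th x *: u)) w v.
Proof.
move=> Hf dth; have [r [M [r0 H]]] := (proj1 (holP _ _)) Hf.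
set p := w + th w *: u in Hf H; pose t := 'D_v th w.
pose d := 'D_(v + t *: u) f p.
have M0 : 0 <= M by have [] := H p ltac:(by rewrite subrr nrm0) => + _; apply: le_trans; exact: nrm_ge0.
have k1 := K1_gt0 R; have k2 := K2_gt0 R.
pose B := 2 * K1 R * M / r; pose B2 := 4 * K2 R * M / r ^+ 2.
have B0 : 0 <= B by rewrite divr_ge0 ?(ltW r0) // mulr_ge0 // mulr_ge0 // ltW.
have B20 : 0 <= B2 by rewrite divr_ge0 ?sqr_ge0 // mulr_ge0 // mulr_ge0 // ltW.
suff : derivable (fun x => f (x + th x *: u)) w v /\ 'D_v (fun x => f (x + th x *: u)) w = d by case.
apply/derivable_nrm => e e0.
pose A := nrm v + nrm t * nrm u + nrm u + 1.
have A0 : 0 < A by rewrite /A; have := nrm_ge0 v; have := nrm_ge0 u; have := mulr_ge0 (nrm_ge0 t) (nrm_ge0 u); lra.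
pose e1 := Num.min 1 (e / (2 * (B + 1) * A)).
have BA : 0 < 2 * (B + 1) * A by apply: mulr_gt0 => //; lra.
have e10 : 0 < e1 by rewrite /e1 lt_min ltr01; exact: divr_gt0.
have e11 : e1 <= 1 by rewrite /e1 ge_min lexx.
have e1e : e1 * (2 * (B + 1) * A) <= e by rewrite -ler_pdivlMr // /e1 ge_min lexx orbT.
have [q q0 Hq] := (proj1 (derivable_nrm _ _ _ _)) (conj dth erefl) _ e10.
have C0 : 0 < 2 * (B2 + 1) * A ^+ 2 by rewrite mulr_gt0 ?exprn_gt0 //; lra.
exists (Num.min q (Num.min (r / (8 * A)) (e / (2 * (B2 + 1) * A ^+ 2)))) => [|h].
  by rewrite !lt_min q0 !divr_gt0 // mulr_gt0.
rewrite !lt_min => /and3P[h1]; rewrite ltr_pdivlMr ?mulr_gt0 // => h2.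
rewrite ltr_pdivlMr // => h3.
have := Hq _ h1; rewrite -/t; set y := th (w + h *: v) - th w - h * t => Hy.
have h0 := nrm_ge0 h.
pose k := h *: v + (h * t + y) *: u.
have kE : w + h *: v + th (w + h *: v) *: u = p + k.
  have -> : th (w + h *: v) = th w + (h * t + y) by rewrite /y; ring.
  by rewrite [(th w + _) *: u]scalerDl /p /k addrACA.
have kE2 : k = h *: (v + t *: u) + y *: u by rewrite /k scalerDl scalerDr scalerA addrA.
have kn : nrm k <= A * nrm h.
  apply: le_trans (nrmD _ _) _; rewrite !nrmZ.
  have h5 : nrm (h * t + y) <= nrm h * nrm t + e1 * nrm h.
    by apply: le_trans (nrmD _ _) _; rewrite nrmM; lra.
  have := nrm_ge0 u; rewrite /A; have := ler_wpM2r (nrm_ge0 u) h5.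
  have := mulr_ge0 h0 (nrm_ge0 u); clear -e11 h0 e10; nra.
have T := holB_taylor r0 H (_ : nrm k <= r / 8).
have {}T := T ltac:(rewrite ler_pdivlMr //; clear -kn h2 A0 h0; nra).
rewrite kE.
have DkE : 'D_k f p = h * d + y * 'D_u f p.
  rewrite kE2 (deriveDv _ _ Hf).
  have [_ ->] := deriveZv h (hol_derivable (v + t *: u) Hf).
  by have [_ ->] := deriveZv y (hol_derivable u Hf).
rewrite DkE -/B2 in T.
have DB : nrm ('D_u f p) <= B * nrm u by exact: (derive_le u r0 H).
have -> : f (p + k) - f (w + th w *: u) - h * d =
   (f (p + k) - f p - (h * d + y * 'D_u f p)) + y * 'D_u f p 
  by rewrite -/p; clear; move: ('D_u f p) d => c d'; ring.
apply: le_trans (nrmD _ _) _; rewrite (nrmM y).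
have uA : nrm u <= A by rewrite /A; clear; have := nrm_ge0 v; have := mulr_ge0 (nrm_ge0 t) (nrm_ge0 u); clearbody t; lra.
have P1 : nrm y * nrm ('D_u f p) <= e / 2 * nrm h.
  apply: le_trans (_ : (e1 * nrm h) * (B * A) <= _).
    apply: ler_pM => //; try exact: nrm_ge0.
    by apply: le_trans DB _; apply: ler_wpM2l.
  have : e1 * (B * A) <= e / 2 by clear -e1e e10 A0; nra.
  move=> h6; rewrite mulrAC; exact: ler_wpM2r.
have P2 : B2 * nrm k ^+ 2 <= e / 2 * nrm h.
  apply: le_trans (_ : B2 * (A * nrm h) ^+ 2 <= _).
    by apply: ler_wpM2l => //; rewrite lerXn2r ?nnegrE ?nrm_ge0 // mulr_ge0 // ltW.
  have : B2 * A ^+ 2 * nrm h <= e / 2 by clear -h3 h0 A0; have := exprn_gt0 2 A0; nra.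
  by move=> h6; rewrite exprMn mulrA expr2 mulrA; apply: ler_wpM2r.
move: T P1 P2; clear; move: (nrm (_ - _)) (nrm y * _) (B2 * _) (nrm h) => a b c g; lra.
Qed.

Lemma hol_graph f (th : V -> C) (u z : V) : hol f (z + th z *: u) -> hol th z ->
  hol (fun x => f (x + th x *: u)) z.
Proof.
move=> Hf Ht; have [r [M [r0 H]]] := (proj1 (holP _ _)) Hf; exists M.
have u1 : 0 < nrm u + 1 by have := nrm_ge0 u; lra.
have e0 : 0 < r / 2 / (nrm u + 1) by apply: divr_gt0 => //; lra.
have [s s0 Hs] := germ_and (hol_open Ht) (hol_cont Ht e0).
exists (Num.min s (r / 2)) => [|w]; first by rewrite lt_min s0 /=; lra.
rewrite lt_min => /andP[/Hs[hw]]; rewrite ltr_pdivlMr // => tw wz.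
have pw : nrm (w + th w *: u - (z + th z *: u)) < r.
  have -> : w + th w *: u - (z + th z *: u) = (w - z) + (th w - th z) *: u.
    by rewrite scalerBl opprD addrACA.
  apply: le_lt_trans (nrmD _ _) _; rewrite nrmZ; have := nrm_ge0 (th w - th z); clear -tw wz; lra.
have [b _] := H _ pw; split; first exact: b.
by move=> v; apply: derivable_graph; [exact: (holB_hol r0 H)|exact: hol_derivable].
Qed.

(** Connectedness for locally constant properties, through [cousin]; [clopen_ball] and [clopen_all]
    reduce to it along segments. *)
Lemma clopen_seg (P : R -> Prop) :
  (forall t : R, 0 <= t <= 1 -> exists2 d : R, 0 < d & forall a b : R,
     `|a - t| < d -> `|b - t| < d -> P a -> P b) -> P 0 -> P 1.
Proof.
move=> H; pose Q (a b : R) := (P a <-> P b).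
suff : Q 0 1 by case.
apply: cousin; first by move=> a m b _ _ [h1 h2] [h3 h4]; split=> ?; [apply/h3/h1|apply/h2/h4].
move=> t /H[d d0 Hd]; exists d => // a b a0 at_ tb b1 ba.
have h1 : `|a - t| < d by rewrite ltr_norml; lra.
have h2 : `|b - t| < d by rewrite ltr_norml; lra.
by split; exact: Hd.
Qed.

Lemma clopen_ball (P : V -> Prop) z r :
  (forall w, nrm (w - z) < r -> exists2 d : R, 0 < d & forall a b,
     nrm (a - w) < d -> nrm (b - w) < d -> P a -> P b) ->
  forall x y, nrm (x - z) < r -> nrm (y - z) < r -> P x -> P y.
Proof.
move=> H x y xz yz Px; pose g (t : R) := x + rc t *: (y - x).
suff : P (g 1) by rewrite /g rc1 scale1r addrC subrK.
apply: (clopen_seg (P := fun t => P (g t))); last by rewrite /g rc0 scale0r addr0.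
move=> t t1.
have gt : nrm (g t - z) < r.
  have -> : g t - z = rc (1 - t) *: (x - z) + rc t *: (y - z).
    have cvx (s : C) (a b : V) : (1 - s) *: a + s *: b = a + s *: (b - a).
      by rewrite scalerBl scale1r scalerBr -addrA; congr (_ + _); rewrite addrC.
    by rewrite rcB rc1 cvx opprB addrA subrK /g addrAC.
  apply: le_lt_trans (nrmD _ _) _; rewrite !nrmZ !nrm_rc ger0_norm ?(ger0_norm (_ : 0 <= t)); try lra.
  have [m [m1 m2 m3]] : exists m, [/\ nrm (x - z) <= m, nrm (y - z) <= m & m < r].
    by exists (Num.max (nrm (x - z)) (nrm (y - z))); rewrite !le_max !lexx orbT gt_max xz yz.
  by clear -t1 m1 m2 m3; nra.
have [d d0 Hd] := H _ gt.
have n1 : 0 < nrm (y - x) + 1 by have := nrm_ge0 (y - x); lra.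
exists (d / (nrm (y - x) + 1)); first exact: divr_gt0.
have gg (a b : R) : g a - g b = rc (a - b) *: (y - x).
  by rewrite /g opprD addrACA subrr add0r rcB scalerBl.
move=> a b; rewrite !ltr_pdivlMr // => ha hb; apply: Hd; rewrite gg nrmZ nrm_rc.
  by have := normr_ge0 (a - t); clear -ha; lra.
by have := normr_ge0 (b - t); clear -hb; lra.
Qed.

Lemma clopen_all (P : V -> Prop) :
  (forall w, exists2 d : R, 0 < d & forall a b,
     nrm (a - w) < d -> nrm (b - w) < d -> P a -> P b) ->
  forall x y, P x -> P y.
Proof.
move=> H x y; apply: (@clopen_ball P x (nrm (y - x) + 1)) => //.
  by rewrite subrr nrm0; have := nrm_ge0 (y - x); lra.
lra.
Qed.

End HolDiff.

(** * The fundamental theorem of calculus and division by a graph function *)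

Section FTC.
Variable R : realType.
Local Notation C := (Cplx R).
Local Notation ii := (ii R).

(** The hypothesis is a derivative with a uniform quadratic remainder: the dyadic sum telescopes to
    [G 1 - G 0] with [2 ^ m] errors of size [B / 4 ^ m]. *)
Lemma re_ftc (G : R -> R) (g : R -> C) (B d : R) : 0 < d -> cont01 g ->
  (forall s t, 0 <= s <= 1 -> 0 <= t <= 1 -> `|t - s| < d ->
     `|G t - G s - (t - s) * re (g s)| <= B * (t - s) ^+ 2) ->
  re (int01 g) = G 1 - G 0.
Proof.
move=> d0 cg H.
have B0 : 0 <= B.
  pose t := Num.min (d / 2) 1.
  have t0 : 0 < t by rewrite /t lt_min ltr01 andbT; lra.
  have t1 : t <= 1 by rewrite /t ge_min lexx orbT.
  have td : t < d by apply: (@le_lt_trans _ _ (d / 2)); [rewrite /t ge_min lexx|lra].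
  have := H 0 t; rewrite subr0 lexx ler01 (ltW t0) t1 ger0_norm ?(ltW t0) // => /(_ isT isT td).
  move/(le_trans (normr_ge0 _)); rewrite pmulr_lge0 // exprn_gt0 //.
have E m : (2 ^+ m)^-1 < d -> `|re (rsum g m) - (G 1 - G 0)| <= B / 2 ^+ m.
  move=> md; have p0 := pow2_gt0 R m; pose x (k : nat) : R := k%:R / 2 ^+ m.
  have -> : G 1 - G 0 = \sum_(k < 2 ^ m) (G (x k.+1) - G (x k)).
    rewrite -(big_mkord xpredT (fun k => G (x k.+1) - G (x k))) telescope_sumr //.
    by rewrite /x mul0r natrX divff // gt_eqF.
  rewrite /rsum re_rcM re_sum mulr_sumr -sumrB.
  apply: le_trans (ler_norm_sum _ _ _) _.
  apply: (@le_trans _ _ (\sum_(k < 2 ^ m) B * ((2 ^+ m)^-1) ^+ 2)).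
    apply: ler_sum => k _.
    have dx : x k.+1 - x k = (2 ^+ m)^-1.
      by rewrite /x -mulrBl -addn1 natrD addrC addKr mul1r.
    have x1 : 0 <= x k.+1 <= 1.
      rewrite /x divr_ge0 ?(ltW p0) //= ler_pdivrMr // mul1r -natrX ler_nat ltn_ord //.
    have := H (x k) (x k.+1) (@dyad01 R m k) x1; rewrite dx ger0_norm ?invr_ge0 ?(ltW p0) // => /(_ md).
    by rewrite distrC.
  rewrite sumr_const card_ord -[_ *+ _]mulr_natl natrX.
  by rewrite le_eqVlt; apply/orP; left; apply/eqP; field; rewrite gt_eqF.
apply/eqP; rewrite -subr_eq0 -normr_eq0 eq_le normr_ge0 andbT leNgt; apply/negP => l0.
set X := `|_| in l0.
have e0 : 0 < X / 2 by lra.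
have [N HN] := int01_cvs cg e0.
have [m1 Hm1] := pow2_small d0.
have B1 : 0 < 2 * (B + 1) by lra.
have [m2 Hm2] := pow2_small (divr_gt0 l0 B1).
pose m := (N + m1 + m2)%N.
have le2 j : (j <= m)%N -> (2 ^+ m)^-1 <= (2 ^+ j)^-1 :> R.
  by move=> jm; rewrite lef_pV2 ?posrE ?pow2_gt0 // ler_weXn2l // ler1n.
have h1 := HN m ltac:(rewrite /m -addnA; exact: leq_addr).
have h2 := E m (le_lt_trans (le2 m1 ltac:(rewrite /m; lia)) Hm1).
have h3 : B / 2 ^+ m < X / 2.
  have := le_lt_trans (le2 m2 ltac:(rewrite /m; lia)) Hm2; rewrite ltr_pdivlMr // => h.
  have : 0 < (2 ^+ m)^-1 :> R by rewrite invr_gt0 pow2_gt0.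
  clear -h; move: (2 ^+ m)^-1 h => y h y0; lra.
have h4 := le_lt_trans (le_re _) h1; rewrite reB in h4.
have : X <= `|re (int01 g) - re (rsum g m)| + `|re (rsum g m) - (G 1 - G 0)|.
  exact: ler_distD.
by rewrite distrC; clear -h2 h3 h4; lra.
Qed.

Lemma ftc (G : R -> C) (g : R -> C) (B d : R) : 0 < d -> cont01 g ->
  (forall s t, 0 <= s <= 1 -> 0 <= t <= 1 -> `|t - s| < d ->
     nrm (G t - G s - rc (t - s) * g s) <= B * (t - s) ^+ 2) ->
  int01 g = G 1 - G 0.
Proof.
move=> d0 cg H; apply: C_ext.
  rewrite reB; apply: (re_ftc (G := fun t => re (G t)) d0 cg) => s t s1 t1 st.
  by apply: le_trans (H s t s1 t1 st); rewrite -re_rcM -!reB; exact: le_re.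
have imE z : im z = re (- ii * z) by rewrite reM reN imN reii imii; ring.
rewrite imE -int01Z //.
rewrite (re_ftc (G := fun t => im (G t)) (B := B) d0 (cont01Z _ cg)).
  by rewrite imB.
move=> s t s1 t1 st; rewrite -imE.
by apply: le_trans (H s t s1 t1 st); rewrite -im_rcM -!imB; exact: le_im.
Qed.

Variable V : normedModType C.

Lemma hol_ftc (f : V -> C) z r M h : 0 < r -> holB f z r M -> nrm h <= r / 16 ->
  int01 (fun t => 'D_h f (z + rc t *: h)) = f (z + h) - f z.
Proof.
move=> r0 H hr; have h0 := nrm_ge0 h.
have r20 : 0 < r / 2 by lra.
have Hs (s : R) : 0 <= s <= 1 -> holB f (z + rc s *: h) (r / 2) M.
  move=> s1; apply: holB_sub H _; rewrite [z + _]addrC addrK nrmZ nrm_rc ger0_norm; last lra.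
  clear -s1 hr h0 r0; nra.
have cg : cont01 (fun t => 'D_h f (z + rc t *: h)).
  move=> t t1 e e0.
  have [q q0 Hq] := hol_cont (hol_derive h (holB_hol r20 (Hs t t1) (w := z + rc t *: h) ltac:(by rewrite subrr nrm0))) e0.
  have n1 : 0 < nrm h + 1 by lra.
  exists (q / (nrm h + 1)) => [|s s1]; first exact: divr_gt0.
  rewrite ltr_pdivlMr // => st; apply: Hq.
  rewrite opprD addrACA subrr add0r -scalerBl -rcB nrmZ nrm_rc.
  by have := normr_ge0 (s - t); clear -st; lra.
rewrite (ftc (G := fun t => f (z + rc t *: h)) (B := 4 * K2 R * M / (r / 2) ^+ 2 * nrm h ^+ 2) ltr01 cg).
  by rewrite rc1 rc0 scale1r scale0r addr0.
move=> s t s1 t1 st.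
have tE : z + rc t *: h = z + rc s *: h + rc (t - s) *: h.
  by rewrite rcB scalerBl -addrA; congr (_ + _); rewrite addrC subrK.
have tn : nrm (rc (t - s) *: h) = `|t - s| * nrm h by rewrite nrmZ nrm_rc.
have := @holB_taylor _ _ f (z + rc s *: h) (r / 2) M (rc (t - s) *: h) r20 (Hs s s1).
have [_ d] := Hs s s1 (z + rc s *: h) ltac:(by rewrite subrr nrm0).
have [_ ->] := deriveZv (rc (t - s)) (d h).
rewrite -tE tn => T; apply: le_trans (T _) _.
  have : `|t - s| <= 1 by exact: ltW.
  have := normr_ge0 (t - s); clear -hr h0 r0; nra.
by rewrite [(_ * nrm h) ^+ 2]exprMn real_normK ?num_real // (mulrC ((t - s) ^+ 2)) mulrA.
Qed.

(* If g vanishes on the graph {w + th w u}, then th divides g. *)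
Lemma hol_div_graph (g th : V -> C) (u x : V) : hol g x -> hol th x -> th x = 0 ->
  germ x (fun w => g (w + th w *: u) = 0) ->
  exists2 c : V -> C, hol c x & germ x (fun w => g w = th w * c w).
Proof.
move=> Hg Ht t0 Hz; have [r [M [r0 H]]] := (proj1 (holP _ _)) Hg.
have u1 : 0 < nrm u + 1 by have := nrm_ge0 u; lra.
have e0 : 0 < r / 64 / (nrm u + 1) by apply: divr_gt0 => //; lra.
have [s s0 Hs] := germ_and (hol_open Ht) (hol_cont Ht e0).
pose q := Num.min s (r / 8).
have q0 : 0 < q by rewrite /q lt_min s0 /=; lra.
have qs : q <= s by rewrite /q ge_min lexx.
have qr : q <= r / 8 by rewrite /q ge_min lexx orbT.
have tu w : nrm (w - x) < q -> nrm (th w) * nrm u <= r / 64.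
  move=> wx; have [_] := Hs w (lt_le_trans wx qs); rewrite t0 subr0 ltr_pdivlMr //.
  have := nrm_ge0 (th w); clear; lra.
have Hd := holB_derive u r0 H.
(* Hadamard's formula: as [g] vanishes at [w + th w *: u], the value [g w] is minus [th w] times the
   integral of [F w]. *)
pose F w (t : R) := 'D_u g (w + (rc t * th w) *: u).
have pt w (t : R) : nrm (w - x) < q -> 0 <= t <= 1 -> nrm (w + (rc t * th w) *: u - x) < r / 4.
  move=> wx t1; have := nrmD (w - x) ((rc t * th w) *: u); rewrite addrAC nrmZ nrmM nrm_rc ger0_norm; last lra.
  have := tu w wx; have := mulr_ge0 (nrm_ge0 (th w)) (nrm_ge0 u); rewrite -mulrA.
  by move: wx qr t1 r0; clear; move: (_ * nrm u) => y; nra.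
have r20 : 0 < r / 2 by lra.
have r42 : r / 4 < r / 2 by lra.
have r4r : r / 4 < r by lra.
have HF : holB (fun w => int01 (F w)) x q (K3 u * M / r).
  apply: int01_hol => [t t1 w wx|w wx].
    have p := pt w t wx t1; have [b _] := Hd _ (lt_trans p r42); split; first exact: b.
    have [ht _] := Hs w (lt_le_trans wx qs) => v.
    have hp := holB_hol r20 Hd (lt_trans p r42).
    exact: (derivable_graph (th := fun w => rc t * th w) hp (hol_derivable v (holZ (rc t) ht))).
  move=> t t1 e e0'.
  have [d d0 Hdd] := hol_cont (holB_hol r20 Hd (lt_trans (pt w t wx t1) r42)) e0'.
  have n1 : 0 < nrm (th w) * nrm u + 1 by have := mulr_ge0 (nrm_ge0 (th w)) (nrm_ge0 u); lra.
  exists (d / (nrm (th w) * nrm u + 1)) => [|t' t1']; first exact: divr_gt0.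
  rewrite ltr_pdivlMr // => tt; apply: Hdd.
  rewrite opprD addrACA subrr add0r -scalerBl -mulrBl -rcB nrmZ nrmM nrm_rc -mulrA.
  by have := normr_ge0 (t' - t); clear -tt; lra.
exists (fun w => - int01 (F w)).
  by apply: holN; apply: (holB_hol q0 HF); rewrite subrr nrm0.
have Hq : germ x (fun w => nrm (w - x) < q) by exists q.
apply: germ_imp (germ_and Hz Hq) => w [gz wx].
have Hw : holB g w (r / 2) M by apply: holB_sub H _; clear -wx qr r0; clearbody q; lra.
have hr : nrm (th w *: u) <= r / 2 / 16 by rewrite nrmZ; have := tu w wx; clear -r0; lra.
have := hol_ftc r20 Hw hr; rewrite gz sub0r => E.
have -> : g w = - int01 (fun t => 'D_(th w *: u) g (w + rc t *: (th w *: u))) by rewrite E opprK.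
rewrite mulrN -int01Z; last first.
  move=> t t1 e e0'.
  have [d d0 Hdd] := hol_cont (holB_hol r20 Hd (lt_trans (pt w t wx t1) r42)) e0'.
  have n1 : 0 < nrm (th w) * nrm u + 1 by have := mulr_ge0 (nrm_ge0 (th w)) (nrm_ge0 u); lra.
  exists (d / (nrm (th w) * nrm u + 1)) => [|t' t1']; first exact: divr_gt0.
  rewrite ltr_pdivlMr // => tt; apply: Hdd.
  rewrite opprD addrACA subrr add0r -scalerBl -mulrBl -rcB nrmZ nrmM nrm_rc -mulrA.
  by have := normr_ge0 (t' - t); clear -tt; lra.
congr (- _); apply: int01_ext => t t1; rewrite /F scalerA.
have p := pt w t wx t1.
by have [_ ->] := deriveZv (th w) (hol_derivable u (holB_hol r0 H (lt_trans p r4r))).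
Qed.

End FTC.

(** * Inequalities on dense sets and zeros in one variable *)

Section Dense.
Variable R : realType.
Local Notation C := (Cplx R).
Variable V : normedModType C.
Implicit Types (f g P D : V -> C) (z : V).

Lemma nonzero_exists f z (Q : V -> Prop) : ~ germ z (fun w => f w = 0) -> germ z Q ->
  exists w, f w != 0 /\ Q w.
Proof.
move=> nz [r r0 HQ]; apply: contrapT => H; apply: nz; exists r => // w wr.
by apply: contrapT => fw; apply: H; exists w; split; [exact/eqP|exact: HQ].
Qed.

(** By continuity, as [z] is a limit of points where [D] is nonzero. With [C1 = 0] it acts as a
    uniqueness principle. *)
Lemma le_dense D g P z (C1 : R) : hol g z -> hol P z -> ~ germ z (fun w => D w = 0) ->
  germ z (fun w => D w != 0 -> nrm (g w) <= C1 * nrm (P w)) -> nrm (g z) <= C1 * nrm (P z).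
Proof.
move=> Hg HP nD H; rewrite leNgt; apply/negP => lt.
pose d := nrm (g z) - C1 * nrm (P z).
have dE : d = nrm (g z) - C1 * nrm (P z) by [].
have d0 : 0 < d by rewrite dE; lra.
have d20 : 0 < d / 2 / (`|C1| + 1) by rewrite divr_gt0 //; have := normr_ge0 C1; lra.
have d40 : 0 < d / 4 by lra.
have [x [Dx [h [g1]]]] := nonzero_exists nD (germ_and H (germ_and (hol_cont Hg d40) (hol_cont HP d20))).
have {}h := h Dx; rewrite ltr_pdivlMr; last by have := normr_ge0 C1; lra.
move=> p1.
have s1 := nrm_sub_ge (P x) (P z); have s2 := nrm_sub_ge (P z) (P x); rewrite (nrmB (P z)) in s2.
have : `|C1 * (nrm (P x) - nrm (P z))| <= `|C1| * nrm (P x - P z).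
  by rewrite normrM; apply: ler_wpM2l => //; rewrite ler_norml; lra.
rewrite ler_norml => /andP[_ k1].
have s3 := nrm_sub_ge (g z) (g x); rewrite nrmB in s3.
have := normr_ge0 C1; have := nrm_ge0 (P x - P z).
clear -k1 p1 h dE g1 s3 d0; clearbody d; nra.
Qed.
End Dense.

Section OneVarZeros.
Variable R : realType.
Local Notation C := (Cplx R).

Lemma dhol_hol (f : C -> C) (a : C) (r : R) : 0 < r ->
  (forall w, nrm (w - a) < r -> derivable f w 1) -> hol f a.
Proof.
move=> r0 H; have d0 := H a ltac:(by rewrite subrr nrm0).
have [s s0 Hs] := derivable_contAt d0 ltr01.
exists (nrm (f a) + 1); exists (Num.min r s) => [|w]; first by rewrite lt_min r0.
rewrite lt_min => /andP[/H dw /Hs bw]; split; first by have := nrm_sub_ge (f w) (f a); lra.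
move=> v; have -> : v = v *: (1 : C) by rewrite -[_ *: _]/(v * 1) mulr1.
by have [] := deriveZv v dw.
Qed.

Definition dD (f : C -> C) (rho : R) : Prop := forall w, nrm w < rho -> derivable f w 1.

Lemma dD_hol f rho a : dD f rho -> nrm a < rho -> hol f a.
Proof.
move=> H ar; apply: (@dhol_hol _ _ (rho - nrm a)); first lra.
by move=> w wa; apply: H; have := nrm_sub_ge w a; lra.
Qed.
Lemma hol_dD f (rho : R) : (forall a, nrm a < rho -> hol f a) -> dD f rho.
Proof. by move=> H w /H; exact: hol_derivable. Qed.

(** Near [a] the quotient comes from [hol_div_graph] with the graph function [a - w], whose graph
    [w + (a - w)] is the constant [a]. *)
Lemma dD_div f rho a : dD f rho -> nrm a < rho -> f a = 0 ->
  exists2 g, dD g rho & forall w, f w = (w - a) * g w.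
Proof.
move=> Hf ar fa; have Ha := dD_hol Hf ar.
pose th (w : C) := a - w.
have Ht : hol th a.
  apply: (@dhol_hol _ _ 1) => // w _.
have [||c Hc E] := @hol_div_graph R C f th 1 a Ha Ht.
- by rewrite /th subrr.
- by apply: germ_all => w; rewrite /th -[_ *: _]/((a - w) * 1) mulr1 addrC subrK.
(* The sign at [a] is due to [hol_div_graph] dividing by [a - w]. *)
pose g w := if w == a then - c a else f w / (w - a).
exists g; last first.
  move=> w; rewrite /g; case: eqVneq => [->|wa]; first by rewrite subrr mul0r fa.
  by rewrite mulrC divfK // subr_eq0.
apply: hol_dD => b br; have [->|ba] := eqVneq b a.
  apply: hol_ext (holN Hc); apply: germ_imp E => w Ew; rewrite /g; case: eqVneq => [->//|wa].
  by rewrite Ew /th; field; rewrite subr_eq0.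
have Hb := dD_hol Hf br.
have Hs : hol (fun w : C => w - a) b by apply: (@dhol_hol _ _ 1) => // w _; exact: derivable_subr.
have b0 : b - a != 0 by rewrite subr_eq0.
apply: hol_ext (hol_div Hb Hs b0); apply: germ_imp (hol_neq0 Hs b0) => w.
by rewrite /g subr_eq0 => /negPf ->.
Qed.

Lemma cauchy0_bound (f : C -> C) (s M : R) : 0 < s ->
  (forall w, nrm w <= 2 * s -> derivable f w 1) ->
  ann s (2 * s) (fun w => nrm (f w) <= M) -> nrm (f 0) <= 8 / nrm (c0 R) * M.
Proof.
move=> s0 Hf HM.
have E := cauchy0 s0 Hf.
have B : nrm (csq (fun w => f w / w) (rc s)) <= 8 * (s * (M / s)).
  apply: csq_bound => // w w1 w2.
    apply: derivable_contAt; apply: derivableMf; first exact: Hf.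
    by apply: derivable_inv; exact: nrm_neq0 w1.
  rewrite nrm_div; apply: ler_pM; rewrite ?invr_ge0 ?nrm_ge0 ?HM //.
  by rewrite lef_pV2 ?posrE // (lt_le_trans s0).
move: B; rewrite E nrmM [s * _]mulrC divfK ?gt_eqF // mulrC => B.
by rewrite mulrAC ler_pdivlMr ?c0_gt0.
Qed.

(** If every power of [w] divides [f], the bounds on the quotients make |f a| smaller than a
    constant times the [k]-th power of 8 |a| / rho < 1, for all [k]. Otherwise the last possible
    power leaves a quotient nonzero at 0. *)
Lemma dD_order f (rho M : R) : 0 < rho -> dD f rho -> (forall w, nrm w < rho -> nrm (f w) <= M) ->
  (forall w, nrm w < rho / 8 -> f w = 0) \/
  exists k g, [/\ dD g rho, g 0 != 0 & forall w, f w = w ^+ k * g w].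
Proof.
move=> r0 Hf HM.
have [H|/existsNP[k Hk]] := pselect (forall k, exists2 g, dD g rho & forall w, f w = w ^+ k * g w).
  left=> a ar.
  have M0 : 0 <= M by apply: le_trans (HM 0 _); rewrite ?nrm0 // nrm_ge0.
  have aE : nrm a * 8 < rho by lra.
  pose K := 8 / nrm (c0 R) * M.
  have K0 : 0 <= K by rewrite mulr_ge0 // divr_ge0 // nrm_ge0.
  (* The boundary of the square of half-side [rho / 4] around [a] avoids the disc of radius
     [rho / 8] about 0, so the [k]-th quotient is at most [M * (8 / rho) ^+ k] on it. *)
  have B k : nrm (f a) <= K * (8 * nrm a / rho) ^+ k.
    have [g Hg E] := H k.
    have := @cauchy0_bound (fun w => g (a + w)) (rho / 4) (M * (8 / rho) ^+ k) ltac:(lra).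
    rewrite addr0 => T.
    have bg : nrm (g a) <= 8 / nrm (c0 R) * (M * (8 / rho) ^+ k).
      apply: T => w w1.
        have [|h _] := (proj1 (derivable_shift g a w ('D_1 g (a + w)))) => //.
        by split => //; apply: Hg; have := nrmD a w; lra.
      move=> w2; have aw : rho / 8 < nrm (a + w) by have := nrm_add_ge w a; rewrite (addrC w a); lra.
      have aw0 : 0 < nrm (a + w) by lra.
      have := HM (a + w) ltac:(have := nrmD a w; lra).
      rewrite E nrmM nrmX => h.
      have p0 : 0 < nrm (a + w) ^+ k by rewrite exprn_gt0.
      rewrite -ler_pdivlMl // in h; apply: le_trans h _; rewrite mulrC; apply: ler_wpM2l => //.
      rewrite -exprVn; apply: lerXn2r; rewrite ?nnegrE ?invr_ge0 ?nrm_ge0 ?divr_ge0 ?(ltW r0) //.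
      by rewrite -[8 / rho]invf_div lef_pV2 ?posrE ?divr_gt0 // ltW.
    rewrite E nrmM nrmX; have := ler_wpM2l (exprn_ge0 k (nrm_ge0 a)) bg.
    move=> h; apply: le_trans h _.
    have -> : 8 * nrm a / rho = nrm a * (8 / rho) by ring.
    rewrite [(nrm a * _) ^+ k]exprMn /K; clear; move: (nrm a ^+ k) (8 / nrm (c0 R)) ((8 / rho) ^+ k) => x y z.
    have -> : x * (y * (M * z)) = y * M * (x * z) by ring.
    exact: lexx.
  apply/eqP; rewrite -nrm_eq0 eq_le nrm_ge0 andbT leNgt; apply/negP => f0.
  pose x := 8 * nrm a / rho.
  have x0 : 0 <= x by rewrite divr_ge0 ?(ltW r0) // mulr_ge0 // nrm_ge0.
  have x1 : `|x| < 1 by rewrite ger0_norm // /x ltr_pdivrMr // mul1r; lra.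
  have K1p : 0 < K + 1 by lra.
  have := @cvg_expr R x x1; move/cvgr_dist_lt => /(_ _ (divr_gt0 f0 K1p)) [n _ Hn].
  have := Hn n (leqnn n) => /=; rewrite sub0r normrN ger0_norm ?exprn_ge0 // ltr_pdivlMr // => h.
  have := B n; rewrite -/x; have := exprn_ge0 n x0; move: h; clear.
  by move: (x ^+ n) => y; lra.
right.
have [k0 Hk0 Hmin] : exists2 k0, (~ exists2 g, dD g rho & forall w, f w = w ^+ k0 * g w) &
    forall j, (j < k0)%N -> exists2 g, dD g rho & forall w, f w = w ^+ j * g w.
  elim/ltn_ind: k Hk => k IH Hk.
  have [h|/existsNP[j /not_implyP[jk Hj]]] := pselect (forall j, (j < k)%N -> exists2 g, dD g rho & forall w, f w = w ^+ j * g w).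
    by exists k.
  exact: IH jk Hj.
case: k0 Hk0 Hmin => [|k0] Hk0 Hmin.
  by case: Hk0; exists f => // w; rewrite expr0 mul1r.
have [g Hg E] := Hmin k0 (ltnSn _); exists k0, g; split => //.
apply/negP => /eqP g0; apply: Hk0.
have [|g' Hg' E'] := dD_div Hg _ g0; first by rewrite nrm0.
by exists g' => // w; rewrite E E' subr0 exprSr mulrA.
Qed.

(** Roots may repeat. They are divided out one at a time, and [le_dense] cancels the factor [x - a]
    from the remaining bounds, including those at [a] itself. *)
Lemma dD_div_list f rho (rs : seq C) (U : C -> C) : dD f rho -> dD U rho ->
  (forall a, a \in rs -> nrm a < rho) ->
  (forall a, a \in rs -> exists C1, germ a (fun w => nrm (f w) <= C1 * nrm (\prod_(b <- rs) (w - b) * U w))) ->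
  exists2 g, dD g rho & forall w, f w = \prod_(a <- rs) (w - a) * g w.
Proof.
move=> + HU; elim: rs f => [|a rs IH] f Hf Hrs HB.
  by exists f => // w; rewrite big_nil mul1r.
have ar : nrm a < rho by apply: Hrs; rewrite mem_head.
have fa : f a = 0.
  have [C1 /germ_self] := HB a (mem_head _ _); rewrite big_cons subrr !mul0r nrm0 mulr0 => h.
  by apply/eqP; rewrite -nrm_eq0 eq_le h nrm_ge0.
have [g Hg E] := dD_div Hf ar fa.
have Hrs' b : b \in rs -> nrm b < rho by move=> br; apply: Hrs; rewrite inE br orbT.
have [|g' Hg' E'] := IH g Hg Hrs'; last by exists g' => // w; rewrite E E' big_cons mulrA.
move=> b br; have [C1 Hb] := HB b ltac:(by rewrite inE br orbT); exists C1.
have Hr : germ b (fun w => nrm w < rho).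
  have := Hrs' b br; exists (rho - nrm b) => [|x xa]; [lra|have := nrm_sub_ge x b; lra].
apply: germ_imp (germ_and Hr (germ_open Hb)) => w [wr Hw].
apply: (@le_dense _ _ (fun x => x - a) g (fun w => \prod_(b <- rs) (w - b) * U w) w C1).
- exact: dD_hol Hg wr.
- apply: holM; last exact: dD_hol HU wr.
  by apply: hol_prod => c _; apply: (@dhol_hol _ _ 1) => // x _; exact: derivable_subr.
- move=> [e e0 He]; have h0 := He w ltac:(by rewrite subrr nrm0); have {h0}wa : w = a by apply/eqP; rewrite -subr_eq0 h0.
  have ne : nrm (rc (e / 2)) = e / 2 by rewrite nrm_rc ger0_norm; lra.
  have := He (w + rc (e / 2)); rewrite wa [a + _]addrC addrK ne => /(_ ltac:(lra)) h.
  by move: ne; rewrite h nrm0; lra.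
- apply: germ_imp Hw => x; rewrite subr_eq0 big_cons E -!mulrA !nrmM mulrCA => h xa.
  by move: h; rewrite ler_pM2l // nrm_gt0 subr_eq0.
Qed.

End OneVarZeros.

(** * Local zeros along a direction, as in Weierstrass preparation *)

Section Roots.
Variable R : realType.
Local Notation C := (Cplx R).
Variable V : normedModType C.
Implicit Types (f P B : V -> C) (z v u : V).

Lemma holB_dD f z r M v rho : holB f z r M -> rho * nrm v < r ->
  dD (fun t : C => f (z + t *: v)) rho /\ forall t : C, nrm t < rho -> nrm (f (z + t *: v)) <= M.
Proof.
move=> H hr.
have K : dholB (fun t : C => f (z + t *: v)) 0 rho M.
  by apply: (holB_line H); rewrite subrr nrm0 add0r.
by split => t /ltW tr; have [] := K t ltac:(by rewrite subr0).
Qed.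

(** Identity theorem: vanishing near a point is locally constant in the ball, by [dD_order] on the
    complex line through two nearby points. *)
Lemma hol_zero_ball f z r : (forall w, nrm (w - z) < r -> hol f w) ->
  forall w0, nrm (w0 - z) < r -> germ w0 (fun w => f w = 0) ->
  forall w, nrm (w - z) < r -> f w = 0.
Proof.
move=> Hf w0 w0r Hz w wr.
suff : germ w (fun w => f w = 0) by exact: germ_self.
apply: (clopen_ball (P := fun w => germ w (fun w => f w = 0)) _ w0r wr Hz).
move=> {wr}w wr; have [s [M [s0 H]]] := (proj1 (holP _ _)) (Hf w wr).
exists (s / 64) => [|a b aw bw Ha]; first lra.
exists (s / 64) => [|x xb]; first lra.
pose v := x - a.
have vn : nrm v < 3 * (s / 64).
  have := nrm_le_sub x b a; have := nrm_le_sub b w a; rewrite (nrmB w a) /v; lra.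
have Ha' : holB f a (s / 2) M by apply: holB_sub H _; lra.
(* Parameter radius 9: the point [x] has parameter 1, inside the range [9 / 8] covered by the first
   case of [dD_order]. *)
have [d1 d2] := @holB_dD f a (s / 2) M v 9 Ha' ltac:(lra).
have [|K|[k [g [Hg g0 E]]]] := dD_order _ d1 d2; first lra.
  by have := K 1; rewrite nrm1 scale1r /v addrC subrK; apply; lra.
have n09 : nrm (0 : C) < 9 by rewrite nrm0; lra.
have [q q0 Hq] := hol_neq0 (dD_hol Hg n09) g0.
have [p p0 Hp] := Ha.
have n1 : 0 < nrm v + 1 by have := nrm_ge0 v; lra.
pose e := Num.min (q / 2) (p / 2 / (nrm v + 1)).
have e0 : 0 < e by rewrite /e lt_min !divr_gt0.
have eq_ : e < q by apply: (@le_lt_trans _ _ (q / 2)); [rewrite /e ge_min lexx|lra].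
have ep : e * (nrm v + 1) <= p / 2 by rewrite -ler_pdivlMr // /e ge_min lexx orbT.
have ne : nrm (rc e) = e by rewrite nrm_rc ger0_norm // ltW.
have := Hp (a + rc e *: v); rewrite [a + _]addrC addrK nrmZ ne => h.
have {}h := h ltac:(clear -ep p0 e0; clearbody e; lra).
have := E (rc e); rewrite [a + _]addrC h => /esym/eqP; rewrite mulf_eq0 expf_eq0 rc_eq0 gt_eqF // andbF /=.
by have := Hq (rc e); rewrite subr0 ne => /(_ eq_)/negPf ->.
Qed.

Lemma hol_nonzero_open f z : hol f z -> ~ germ z (fun w => f w = 0) ->
  germ z (fun w => ~ germ w (fun w => f w = 0)).
Proof.
move=> /hol_open[r r0 H] nz; exists r => // w wr Hw; apply: nz; exists r => // x xr.
exact: (hol_zero_ball H wr Hw).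
Qed.

Lemma hol_mul_nonzero f (g : V -> C) z : hol f z -> hol g z ->
  ~ germ z (fun w => f w = 0) -> ~ germ z (fun w => g w = 0) ->
  ~ germ z (fun w => f w * g w = 0).
Proof.
move=> Hf Hg nf ng K.
have [w [fw [Kw [ngw Hw]]]] := nonzero_exists nf
  (germ_and (germ_open K) (germ_and (hol_nonzero_open Hg ng) (hol_open Hf))).
apply: ngw; apply: germ_imp (germ_and Kw (hol_neq0 Hw fw)) => x [/eqP].
by rewrite mulf_eq0 => /orP[/eqP->|/eqP-> //]; rewrite eqxx.
Qed.

(** The restriction of [P] to the line through [z] in direction [u] has a zero of exact order [k] at
    [z]. *)
Definition ordline P z u (k : nat) : Prop := exists rho (g : C -> C),
  [/\ 0 < rho, dD g rho, g 0 != 0 & forall t : C, nrm t < rho -> P (z + t *: u) = t ^+ k * g t].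

Lemma ordline_exists P z : hol P z -> ~ germ z (fun w => P w = 0) ->
  exists u k, ordline P z u k.
Proof.
move=> /holP[r [M [r0 H]]] nz.
have [w [Pw wr]] : exists w, P w != 0 /\ nrm (w - z) < r / 16.
  by apply: (nonzero_exists nz); exists (r / 16) => //; lra.
have [d1 d2] := @holB_dD P z r M (w - z) 9 H ltac:(lra).
have [|K|[k [g [Hg g0 E]]]] := dD_order _ d1 d2; first lra.
  have := K 1; rewrite nrm1 scale1r addrC subrK => Pw0.
  by rewrite Pw0 ?eqxx // in Pw; lra.
by exists (w - z), k, 9, g; split => // t _.
Qed.

(** Weierstrass data: [rts z] lists with multiplicity the zeros [t] of [P (z + t *: u)] with |t| < 4
    s. There are [k] of them, all below [s], and their power sums are holomorphic in [z]. The base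
    point ranges over a full ball of [V], not over a complement of [u]; moving it along [u]
    translates the roots ([rts_shift]). *)
Definition rootsys P z0 u (k : nat) (s d : R) (rts : V -> seq C) : Prop :=
  [/\ 0 < s /\ 0 < d,
    exists2 m : R, 0 < m & forall z (t : C), nrm (z - z0) < d -> s <= nrm t ->
      nrm t < 4 * s -> m <= nrm (P (z + t *: u)),
    exists M, forall z (t : C), nrm (z - z0) < d -> nrm t < 4 * s ->
      hol P (z + t *: u) /\ nrm (P (z + t *: u)) <= M,
    forall z, nrm (z - z0) < d -> [/\ size (rts z) = k, forall a, a \in rts z -> nrm a < s &
      exists U, [/\ dD U (4 * s), forall t : C, nrm t < 4 * s -> U t != 0 &
        forall t : C, nrm t < 4 * s -> P (z + t *: u) = \prod_(a <- rts z) (t - a) * U t]] &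
    forall j z, nrm (z - z0) < d -> hol (fun w => \sum_(a <- rts w) a ^+ j) z].

(** Weighted argument principle: each root contributes by [csq_pow_shift], and the zero-free factor
    [U] contributes 0 by Goursat's theorem. *)
Lemma logderiv_sum (f U : C -> C) (s : R) (rs : seq C) j : 0 < s ->
  dD f (4 * s) -> dD U (4 * s) -> (forall t : C, nrm t < 4 * s -> U t != 0) ->
  (forall a, a \in rs -> nrm a < s) ->
  (forall t, nrm t < 4 * s -> f t = \prod_(a <- rs) (t - a) * U t) ->
  csq (fun t : C => t ^+ j * ('D_1 f t / f t)) (rc s) = c0 R * \sum_(a <- rs) a ^+ j.
Proof.
move=> s0 + HU U0; have s4 : 2 * s < 4 * s by lra.
have dX k (w : C) : derivable (fun w : C => w ^+ k) w 1.
  elim: k => [|k IH]; first exact: derivable_cst.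
  have -> : (fun w : C => w ^+ k.+1) = (fun w => w * w ^+ k) by apply/funext => ?; rewrite exprS.
  by have := derivableMf (@derivable_id _ _ w 1) IH; exact.
have dL (g : C -> C) (w : C) : dD g (4 * s) -> nrm w < 4 * s -> g w != 0 ->
    derivable (fun t : C => t ^+ j * ('D_1 g t / g t)) w 1.
  move=> Hg wr gw; apply: derivableMf; first exact: dX.
  have hg := dD_hol Hg wr.
  have := hol_derivable (1 : C) (hol_div (hol_derive (1 : C) hg) hg gw); exact.
elim: rs f => [|a rs IH] f Hf Hrs E.
  rewrite big_nil mulr0; apply: csq_goursat => // w ws.
  have wr : nrm w < 4 * s by lra.
  apply: dL => //; rewrite E // big_nil mul1r; exact: U0.
have as_ : nrm a < s by apply: Hrs; rewrite mem_head.
pose f1 (t : C) := \prod_(b <- rs) (t - b) * U t.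
have Hf1 : dD f1 (4 * s).
  apply: hol_dD => b br; apply: holM; last exact: dD_hol HU br.
  by apply: hol_prod => c _; apply: (@dhol_hol _ _ _ 1) => // x _; exact: derivable_subr.
have Hrs' b : b \in rs -> nrm b < s by move=> br; apply: Hrs; rewrite inE br orbT.
have nz (t : C) : s <= nrm t -> nrm t < 4 * s -> (t - a != 0) * (f1 t != 0).
  move=> st ts; have ne b : nrm b < s -> t - b != 0.
    by move=> bs; rewrite -nrm_gt0; have := nrm_sub_ge t b; lra.
  split; first exact: ne.
  rewrite mulf_neq0 ?U0 // prodf_seq_neq0; apply/allP => b /Hrs' /ne //.
rewrite big_cons mulrDr -(IH f1 Hf1 Hrs') // -(csq_pow_shift j as_).
have ca : ann s (2 * s) (contAt (fun t : C => t ^+ j * (t - a)^-1)).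
  move=> w w1 w2; have [wa _] := nz w w1 ltac:(lra).
  have dV := @derivableVf R (fun x : C => x - a) w wa (@derivable_subr _ a w).
  have := derivable_contAt (derivableMf (dX j w) dV); exact.
rewrite -csqD //; last first.
  move=> w w1 w2; have wr : nrm w < 4 * s by lra.
  have [_ f1w] := nz w w1 wr.
  have := derivable_contAt (dL f1 w Hf1 wr f1w); exact.
apply: csq_ext => // t t1 t2; have tr : nrm t < 4 * s by lra.
have [ta f1t] := nz t t1 tr.
have near : germ t (fun x => (x - a) * f1 x = f x).
  exists (4 * s - nrm t) => [|x xt]; first lra.
  rewrite E; last by have := nrm_sub_ge x t; lra.
  by rewrite big_cons mulrA.
have d1 : derivable (fun x : C => x - a) t 1 by exact: derivable_subr.
have D1 : 'D_1 (fun x : C => x - a) t = 1.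
  have := deriveBf (@derivable_id _ _ t 1) (@derivable_cst _ _ _ a t 1).
  by rewrite derive_id derive_cst subr0; exact.
have [_ ->] := derivable_ext near (derivableMf d1 (Hf1 t tr)).
have -> : 'D_1 (fun x : C => (x - a) * f1 x) t = (t - a) * 'D_1 f1 t + f1 t.
  by have := deriveM d1 (Hf1 t tr); rewrite D1 -[_ *: 1]/(_ * 1) mulr1; exact.
rewrite -(germ_self near); field; by rewrite ta f1t.
Qed.

Lemma sum_expr0 (rs : seq C) : \sum_(a <- rs) a ^+ 0 = (size rs)%:R.
Proof.
elim: rs => [|a rs IH]; first by rewrite big_nil.
by rewrite big_cons IH expr0 /= -natr1 addrC.
Qed.

(** At most [k] roots can be split off, so a longest factorization exists. The power sums of its
    roots are contour integrals by [logderiv_sum], hence holomorphic, and the exponent 0 gives the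
    number of roots. *)
Lemma roots_near P z0 u k : hol P z0 -> ordline P z0 u k -> forall e : R, 0 < e ->
  exists s d rts, [/\ s <= e, d <= e & rootsys P z0 u k s d rts].
Proof.
move=> /holP[r [M [r0 H]]] [rho [g [rho0 Hg g0 Eg]]] e e0.
have r42 : r / 4 < r / 2 by lra.
have r4r : r / 4 < r by lra.
have u1 : 0 < nrm u + 1 by have := nrm_ge0 u; lra.
have M0 : 0 <= M by have [] := H z0 ltac:(by rewrite subrr nrm0) => + _; apply: le_trans; exact: nrm_ge0.
pose m := nrm (g 0) / 2; have m0 : 0 < m by rewrite /m divr_gt0 // nrm_gt0.
have hg0 : hol g 0 by apply: (dD_hol Hg); rewrite nrm0.
have [s1 s10 Hs1] := hol_cont hg0 m0.
pose s := Num.min (Num.min e (s1 / 8)) (Num.min (rho / 8) (r / 64 / (nrm u + 1))).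
have s0 : 0 < s by rewrite /s !lt_min e0 !divr_gt0.
have se : s <= e by rewrite /s !ge_min lexx.
have ss1 : s <= s1 / 8 by rewrite /s !ge_min lexx orbT.
have sr : s <= rho / 8 by rewrite /s !ge_min lexx !orbT.
have su : s * (nrm u + 1) <= r / 64 by rewrite -ler_pdivlMr // /s !ge_min lexx !orbT.
clearbody s.
have gm (t : C) : nrm t < 4 * s -> m <= nrm (g t).
  move=> ts; have := Hs1 t; rewrite subr0 => /(_ ltac:(lra)).
  by have := nrm_sub_ge (g 0) (g t); rewrite nrmB /m; lra.
have tu (t : C) : nrm t < 4 * s -> nrm (t *: u) <= r / 16.
  move=> ts; rewrite nrmZ; have := nrm_ge0 u; have := nrm_ge0 t; clear -su ts s0; nra.
pose L := 4 * K1 R * M / (r / 2).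
have k1 := K1_gt0 R.
have L0 : 0 <= L by rewrite divr_ge0 ?divr_ge0 ?(ltW r0) // mulr_ge0 // mulr_ge0 // ltW.
pose A := 8 / nrm (c0 R) * (M * (2 / s) ^+ k.+1).
have A0 : 0 <= A.
  by rewrite !mulr_ge0 ?exprn_ge0 ?invr_ge0 ?nrm_ge0 // divr_ge0 // ltW.
(* So small that [k.+1] roots of modulus below [tau] would make |P| at parameter [tau] smaller than
   the lower bound [mt / 2]. *)
pose tau := Num.min (s / 4) (m / (2 ^+ k.+3 * (A + 1))).
have A1 : 0 < 2 ^+ k.+3 * (A + 1) by rewrite mulr_gt0 ?pow2_gt0 //; lra.
have tau0 : 0 < tau.
  by rewrite /tau lt_min; apply/andP; split; apply: divr_gt0 => //; exact: A1.
have taus : tau <= s / 4 by rewrite /tau ge_min lexx.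
have tauA : tau * (2 ^+ k.+3 * (A + 1)) <= m by rewrite -ler_pdivlMr // /tau ge_min lexx orbT.
clearbody tau.
pose mt := m * tau ^+ k; have mt0 : 0 < mt by rewrite mulr_gt0 // exprn_gt0.
have AE : A = 8 / nrm (c0 R) * (M * (2 / s) ^+ k.+1) by [].
clearbody A.
pose d1 := Num.min (r / 16) (mt / (4 * (L + 1))).
have L1 : 0 < 4 * (L + 1) by lra.
have d10 : 0 < d1 by rewrite /d1 lt_min !divr_gt0.
have d1r : d1 <= r / 16 by rewrite /d1 ge_min lexx.
have d1L : L * d1 < mt / 2.
  have : d1 * (4 * (L + 1)) <= mt by rewrite -ler_pdivlMr // /d1 ge_min lexx orbT.
  clear -d10 mt0 L0; clearbody d1 mt L; nra.
clearbody d1.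
have ball z (t : C) : nrm (z - z0) < d1 -> nrm t < 4 * s -> nrm (z + t *: u - z0) < r / 4.
  move=> zd ts; have := nrmD (z - z0) (t *: u); rewrite addrAC; have := tu t ts; lra.
have lower z (t : C) : nrm (z - z0) < d1 -> tau <= nrm t -> nrm t < 4 * s -> mt / 2 <= nrm (P (z + t *: u)).
  move=> zd tt ts.
  have H' : holB P (z0 + t *: u) (r / 2) M.
    by apply: holB_sub H _; rewrite [z0 + _]addrC addrK; have := tu t ts; lra.
  have := @holB_lip _ _ P (z0 + t *: u) (r / 2) M (z - z0) ltac:(lra) H' ltac:(lra).
  have -> : z0 + t *: u + (z - z0) = z + t *: u by rewrite addrC addrA subrK.
  rewrite -/L => lip.
  have : L * nrm (z - z0) <= L * d1 by apply: ler_wpM2l => //; exact: ltW.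
  have : mt <= nrm (P (z0 + t *: u)).
    rewrite Eg; last lra.
    rewrite nrmM nrmX mulrC; apply: ler_pM; rewrite ?(ltW m0) ?exprn_ge0 ?(ltW tau0) //.
      exact: gm.
    by rewrite lerXn2r ?nnegrE ?nrm_ge0 ?(ltW tau0).
  have := nrm_sub_ge (P (z0 + t *: u)) (P (z + t *: u)); rewrite nrmB; move: lip d1L; clear; lra.
have Hz z : nrm (z - z0) < d1 -> dD (fun t : C => P (z + t *: u)) (4 * s) /\
    forall t : C, nrm t < 4 * s -> nrm (P (z + t *: u)) <= M.
  move=> zd; have Hz : holB P z (r / 2) M by apply: holB_sub H _; lra.
  by apply: (holB_dD Hz); have := nrm_ge0 u; clear -su s0 r0; nra.
have zero_small z (a : C) : nrm (z - z0) < d1 -> nrm a < 4 * s -> P (z + a *: u) = 0 -> nrm a < tau.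
  by move=> zd as_ Pa; rewrite ltNge; apply/negP => ta; have := lower z a zd ta as_; rewrite Pa nrm0; lra.
pose fact z (rs : seq C) (U : C -> C) := [/\ dD U (4 * s), forall a, a \in rs -> nrm a < 4 * s &
   forall t : C, nrm t < 4 * s -> P (z + t *: u) = \prod_(a <- rs) (t - a) * U t].
have fact_small z (rs : seq C) (U : C -> C) : nrm (z - z0) < d1 -> fact z rs U -> forall a, a \in rs -> nrm a < tau.
  move=> zd [HU Hrs E] a ars; apply: (zero_small z) => //; first exact: Hrs.
  rewrite E ?Hrs //; apply/eqP; rewrite mulf_eq0; apply/orP; left.
  by rewrite prodf_seq_eq0; apply/hasP; exists a => //=; rewrite subrr.
have fact_le z (rs : seq C) (U : C -> C) : nrm (z - z0) < d1 -> fact z rs U -> (size rs <= k)%N.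
  move=> zd F0; rewrite leqNgt; apply/negP => kr.
  have [rs' [U' [F' sz]]] : exists rs' U', fact z rs' U' /\ size rs' = k.+1.
    exists (take k.+1 rs), (fun t => \prod_(a <- drop k.+1 rs) (t - a) * U t); split; last first.
      by rewrite size_takel.
    have [HU Hrs E] := F0; split.
    - apply: hol_dD => b br; apply: holM; last exact: dD_hol HU br.
      by apply: hol_prod => c _; apply: (@dhol_hol _ _ _ 1) => // x _; exact: derivable_subr.
    - by move=> a /mem_take; exact: Hrs.
    - by move=> t /E ->; rewrite mulrA -big_cat cat_take_drop.
  have small := fact_small _ _ _ zd F'.
  have [HU Hrs E] := F'.
  have nt : nrm (rc tau) = tau by rewrite nrm_rc ger0_norm // ltW.
  have UB : nrm (U' (rc tau)) <= A.
    have := @cauchy0_bound R (fun w => U' (rc tau + w)) s (M * (2 / s) ^+ k.+1) s0.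
    rewrite [rc tau + 0]addr0 -AE; apply.
      move=> w w2.
      have [|h _] := (proj1 (derivable_shift U' (rc tau) w ('D_1 U' (rc tau + w)))) => //.
      by split => //; apply: HU; have := nrmD (rc tau) w; rewrite nt; lra.
    move=> w w1 w2; have wr : nrm (rc tau + w) < 4 * s by have := nrmD (rc tau) w; rewrite nt; lra.
    have [_ /(_ _ wr)] := Hz z zd; rewrite E // nrmM => B1.
    have P1 : (s / 2) ^+ k.+1 <= nrm (\prod_(a <- rs') (rc tau + w - a)).
      rewrite -sz; elim: rs' small {F' Hrs E sz B1} => [|a rs' IH] small.
        by rewrite big_nil nrm1 expr0.
      rewrite big_cons nrmM exprS; apply: ler_pM; rewrite ?exprn_ge0 ?divr_ge0 ?(ltW s0) //.
        have := nrm_sub_ge (rc tau + w) a; have := nrm_add_ge w (rc tau).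
        rewrite [w + _]addrC nt; have := small a (mem_head _ _); lra.
      by apply: IH => b br; apply: small; rewrite inE br orbT.
    have s20 : 0 < (s / 2) ^+ k.+1 by rewrite exprn_gt0 // divr_gt0.
    have -> : M * (2 / s) ^+ k.+1 = M / (s / 2) ^+ k.+1 by rewrite -exprVn invf_div.
    rewrite ler_pdivlMr //; apply: le_trans _ B1; rewrite mulrC.
    by apply: ler_wpM2r => //; exact: nrm_ge0.
  have PB : nrm (\prod_(a <- rs') (rc tau - a)) <= (2 * tau) ^+ k.+1.
    rewrite -sz; elim: rs' small {F' Hrs E sz UB} => [|a rs' IH] small.
      by rewrite big_nil nrm1 expr0.
    rewrite big_cons nrmM exprS; apply: ler_pM; rewrite ?nrm_ge0 //.
      by have := nrmD (rc tau) (- a); rewrite nrmN nt; have := small a (mem_head _ _); lra.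
    by apply: IH => b br; apply: small; rewrite inE br orbT.
  have := lower z (rc tau) zd; rewrite nt => /(_ (lexx _) ltac:(lra)).
  rewrite E ?nt; last lra.
  rewrite nrmM => lw.
  have : nrm (\prod_(a <- rs') (rc tau - a)) * nrm (U' (rc tau)) <= (2 * tau) ^+ k.+1 * A.
    by apply: ler_pM => //; exact: nrm_ge0.
  have E2 : (2 * tau) ^+ k.+1 * A = tau ^+ k * (tau * (2 ^+ k.+1 * A)) by rewrite exprMn !exprS; ring.
  have E3 : tau * (2 ^+ k.+1 * A) <= m / 4.
    have E4 : 2 ^+ k.+3 = 4 * 2 ^+ k.+1 :> R by rewrite !exprS; ring.
    move: tauA; rewrite E4; have : 0 < tau * 2 ^+ k.+1 by rewrite mulr_gt0 ?pow2_gt0.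
    clear; move: (2 ^+ k.+1) => y h1 h2; lra.
  rewrite E2 => h; have := le_trans lw (le_trans h (ler_wpM2l (exprn_ge0 k (ltW tau0)) E3)).
  have tk : 0 < m * tau ^+ k by exact: mt0.
  by rewrite /mt; clear -tk; lra.
(* The cofactor of a longest factorization has no zero, because [dD_div] could split it off. *)
have fact_ex z : nrm (z - z0) < d1 -> exists rs U, fact z rs U /\ forall t : C, nrm t < 4 * s -> U t != 0.
  move=> zd; pose Q (n : nat) := `[< exists rs U, fact z rs U /\ size rs = n >].
  have Q0 : exists n, Q n.
    exists 0%N; apply/asboolP; exists [::], (fun t => P (z + t *: u)); split => //; split => //.
      by have [] := Hz z zd.
    by move=> t _; rewrite big_nil mul1r.
  have Qk n : Q n -> (n <= k)%N by move=> /asboolP[rs [U [F <-]]]; exact: fact_le F.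
  case: (ex_maxnP Q0 Qk) => n /asboolP[rs [U [F sz]]] Hmax.
  exists rs, U; split => // t ts; apply/negP => /eqP Ut.
  have [HU Hrs E] := F; have [g' Hg' E'] := dD_div HU ts Ut.
  have : Q n.+1.
    apply/asboolP; exists (t :: rs), g'; split; last by rewrite /= sz.
    split => // [a|x xs]; first by rewrite inE => /orP[/eqP->//|]; exact: Hrs.
    by rewrite E // E' big_cons mulrCA mulrA.
  by move/Hmax; rewrite ltnn.
have /choice [rts0 Hrts] : forall z, exists rs, nrm (z - z0) < d1 ->
    exists U : C -> C, fact z rs U /\ forall t : C, nrm t < 4 * s -> U t != 0.
  move=> z; have [zd|zd] := ltP (nrm (z - z0)) d1; last by exists [::] => h; lra.
  by have [rs [U h]] := fact_ex z zd; exists rs => _; exists U.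
pose p j z := (c0 R)^-1 * csq (fun t : C => t ^+ j * ('D_u P (z + t *: u) / P (z + t *: u))) (rc s).
have pE j z : nrm (z - z0) < d1 -> forall rs U, fact z rs U -> (forall t : C, nrm t < 4 * s -> U t != 0) ->
    p j z = \sum_(a <- rs) a ^+ j.
  move=> zd rs U F U0; have [HU _ E] := F; have [dz _] := Hz z zd.
  have small a : a \in rs -> nrm a < s by move=> /(fact_small _ _ _ zd F); lra.
  have := @logderiv_sum (fun t => P (z + t *: u)) U s rs j s0 dz HU U0 small E.
  rewrite /p => K; apply: (mulfI (c0_neq0 R)); rewrite -K mulrA mulfV ?c0_neq0 // mul1r.
  apply: (csq_ext s0) => t t1 t2.
  have tr : nrm t < 4 * s by lra.
  have [_ hd] := H _ (lt_trans (ball z t zd tr) r4r).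
  have [_ K'] := (proj1 (line_der P z u t _)) (conj (hd u) erefl).
  by rewrite K'.
have r20 : 0 < r / 2 by lra.
have HD := holB_derive u r0 H.
have pH j : holB (p j) z0 d1 (nrm (c0 R)^-1 * (8 * (s * ((2 * s) ^+ j * (K3 u * M / r / (mt / 2)))))).
  have : holB (fun z => csq (fun t : C => t ^+ j * ('D_u P (z + t *: u) / P (z + t *: u))) (rc s)) z0 d1
      (8 * (s * ((2 * s) ^+ j * (K3 u * M / r / (mt / 2))))).
    have P0 z (t : C) : nrm (z - z0) < d1 -> s <= nrm t -> nrm t <= 2 * s -> mt / 2 <= nrm (P (z + t *: u)).
      by move=> zd t1 t2; apply: lower => //; lra.
    apply: csq_hol => // [t t1 t2 z zd|z zd t t1 t2].
      have tr : nrm t < 4 * s by lra.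
      have b := ball z t zd tr.
      have pl := P0 z t zd t1 t2; have pg : 0 < nrm (P (z + t *: u)) by lra.
      split.
        rewrite nrmM nrmX nrm_div; apply: ler_pM; rewrite ?exprn_ge0 ?mulr_ge0 ?invr_ge0 ?nrm_ge0 //.
          by rewrite lerXn2r ?nnegrE ?nrm_ge0 // mulr_ge0 // ltW.
        apply: ler_pM; rewrite ?invr_ge0 ?nrm_ge0 //.
          by have [] := HD _ (lt_trans b r42).
        by rewrite lef_pV2 ?posrE //; lra.
      have hp := holB_hol r0 H (lt_trans b r4r).
      have hdp := holB_hol r20 HD (lt_trans b r42).
      have tr_hol f : hol f (z + t *: u) -> hol (fun x => f (x + t *: u)) z.
        by move=> hf; apply: (hol_graph (th := fun=> t) hf (hol_cst t z)).
      have pn : P (z + t *: u) != 0 by rewrite -nrm_gt0.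
      move=> v; exact: (hol_derivable v (holZ (t ^+ j) (hol_div (tr_hol _ hdp) (tr_hol _ hp) pn))).
    have tr : nrm t < 4 * s by lra.
    have b := ball z t zd tr.
    have pl := P0 z t zd t1 t2; have pg : P (z + t *: u) != 0 by rewrite -nrm_gt0; lra.
    have hp := holB_hol r0 H (lt_trans b r4r).
    have hdp := holB_hol r20 HD (lt_trans b r42).
    have ln f : hol f (z + t *: u) -> derivable (fun t : C => f (z + t *: u)) t 1.
      by move=> hf; have [] := (proj1 (line_der f z u t _)) (conj (hol_derivable u hf) erefl).
    apply: derivable_contAt; apply: derivableMf.
      elim: (j) => [|n IH]; first exact: derivable_cst.
      have -> : (fun w : C => w ^+ n.+1) = (fun w => w * w ^+ n) by apply/funext => ?; rewrite exprS.
      by have := derivableMf (@derivable_id _ _ t 1) IH; exact.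
    have := derivableMf (ln _ hdp) (@derivableVf R (fun w : C => P (z + w *: u)) t pg (ln _ hp)); exact.
  move=> K w wd; have [b d] := K w wd; split; first by rewrite nrmM; apply: ler_wpM2l => //; exact: nrm_ge0.
  by move=> v; exact: (hol_derivable v (holZ (c0 R)^-1 (holB_hol d10 K wd))).
have z00 : nrm (z0 - z0) < d1 by rewrite subrr nrm0.
have p0k : p 0%N z0 = k%:R.
  rewrite (pE 0%N z0 z00 (nseq k 0) g).
  - by rewrite sum_expr0 size_nseq.
  - split; first by move=> w ws; apply: Hg; lra.
      by move=> a; rewrite mem_nseq => /andP[_ /eqP ->]; rewrite nrm0; lra.
    move=> t ts; rewrite Eg; last lra.
    by rewrite big_nseq iter_mulr mulr1 subr0.
  - by move=> t ts; rewrite -nrm_gt0; have := gm t ts; lra.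
(* [p 0] counts roots: it is continuous, takes natural values near [z0] and equals [k] at [z0]. *)
have [d2 d20 Hd2] := hol_cont (holB_hol d10 (pH 0%N) z00) ltr01.
pose d := Num.min (Num.min d1 d2) e.
have d0 : 0 < d by rewrite /d !lt_min d10 d20.
have dd1 w : nrm (w - z0) < d -> nrm (w - z0) < d1 by rewrite /d !lt_min => /andP[/andP[]].
have dd2 w : nrm (w - z0) < d -> nrm (w - z0) < d2 by rewrite /d !lt_min => /andP[/andP[]].
exists s, d, rts0; split => //; first by rewrite /d ge_min lexx orbT.
split => //.
- by exists (mt / 2) => [|z t /dd1 zd t1 t2]; [lra|apply: lower => //; lra].
- exists M => z t /dd1 zd ts; split; last by have [_] := Hz z zd; apply.
  by apply: (holB_hol r0 H); have := ball z t zd ts; lra.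
- move=> z zd; have [U [F U0]] := Hrts z (dd1 z zd); split.
  + have := Hd2 z (dd2 z zd); rewrite p0k (pE 0%N z (dd1 z zd) _ _ F U0).
    rewrite sum_expr0 -(rc_nat R) -(rc_nat R k) -rcB nrm_rc.
    move: (size _) => n; rewrite ltr_norml; clear => /andP[h1 h2].
    have : (n < k.+1)%N by rewrite -(ltr_nat R) -addn1 natrD; move: h1 h2; clear; lra.
    have : (k < n.+1)%N by rewrite -(ltr_nat R) -addn1 natrD; move: h1 h2; clear; lra.
    by clear; lia.
  + by move=> a /(fact_small _ _ _ (dd1 z zd) F); lra.
  + by have [HU _ E] := F; exists U.
- move=> j z zd; apply: hol_ext (holB_hol d10 (pH j) (dd1 z zd)).
  apply: (@germ_ball _ _ z0 d); last exact: zd.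
  move=> w wd; have [U [F U0]] := Hrts w (dd1 w wd); exact: (pE j w (dd1 w wd) _ _ F U0).
Qed.

End Roots.

(** * Division of holomorphic germs *)

Section Div.
Variable R : realType.
Local Notation C := (Cplx R).
Variable V : normedModType C.
Implicit Types (f P B : V -> C) (z v u : V).

Lemma hol_shift f z v : hol f (z + v) -> hol (fun w => f (w + v)) z.
Proof.
move=> Hf; have -> : (fun w => f (w + v)) = (fun w => f (w + (fun=> 1) w *: v)).
  by apply/funext => w; rewrite scale1r.
by apply: (@hol_graph _ _ f (fun=> 1) v z); [rewrite scale1r|exact: hol_cst].
Qed.

Lemma hol_line f z u (t : C) : hol f (z + t *: u) -> derivable (fun t : C => f (z + t *: u)) t 1.
Proof.
by move=> hf; have [] := (proj1 (line_der f z u t _)) (conj (hol_derivable u hf) erefl).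
Qed.

(** On each line in direction [u] the bound lets all roots of [P] be divided out of [B]
    ([dD_div_list]). The value of the quotient at the base point is then a Cauchy integral over a
    contour where [P] is bounded below, hence holomorphic in the base point. *)
Lemma hol_div_le P B z0 (C1 : R) : hol P z0 -> ~ germ z0 (fun w => P w = 0) -> hol B z0 ->
  germ z0 (fun w => nrm (B w) <= C1 * nrm (P w)) ->
  exists2 Q, hol Q z0 & germ z0 (fun w => B w = Q w * P w).
Proof.
move=> HP nz HB Hle; have [u [k o]] := ordline_exists HP nz.
have [M' HB'] := HB; have [r r0 H] := germ_and HB' Hle.
have u1 : 0 < nrm u + 1 by have := nrm_ge0 u; lra.
have [|s [d [rts [se de [[s0 d0] [m m0 Hm] [M HM] Hrts _]]]]] :=
  @roots_near _ _ P z0 u k HP o (r / 8 / (nrm u + 1)); first by rewrite !divr_gt0.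
have su : s * (nrm u + 1) <= r / 8 by rewrite -ler_pdivlMr.
have du : d * (nrm u + 1) <= r / 8 by rewrite -ler_pdivlMr.
have {du}dr : d <= r / 8 by have := nrm_ge0 u; clear -du r0 d0; nra.
have ball z (t : C) : nrm (z - z0) < d -> nrm t < 4 * s -> nrm (z + t *: u - z0) < r.
  move=> zd ts; have := nrmD (z - z0) (t *: u); rewrite addrAC nrmZ.
  have := nrm_ge0 u; have := nrm_ge0 t; clear -su dr r0 s0 zd ts; nra.
have HBh w : nrm (w - z0) < r -> hol B w.
  by move=> wr; apply: (@holB_hol _ _ B z0 r M') => // x /H[].
pose Q z := (c0 R)^-1 * csq (fun t : C => B (z + t *: u) / P (z + t *: u) / t) (rc s).
have s24 (t : C) : nrm t <= 2 * s -> nrm t < 4 * s by lra.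
have Pn z (t : C) : nrm (z - z0) < d -> s <= nrm t -> nrm t < 4 * s -> P (z + t *: u) != 0.
  by move=> zd t1 t2; rewrite -nrm_gt0; exact: lt_le_trans m0 (Hm z t zd t1 t2).
exists Q.
  have : holB (fun z => csq (fun t : C => B (z + t *: u) / P (z + t *: u) / t) (rc s)) z0 d (8 * (s * (M' / m / s))).
    apply: csq_hol => // [t t1 t2 z zd|z zd t t1 t2].
      have b := ball z t zd (s24 t t2); have [[b1 b2] b3] := H _ b; split.
        rewrite !nrm_div; apply: ler_pM; rewrite ?mulr_ge0 ?invr_ge0 ?nrm_ge0 //.
          apply: ler_pM; rewrite ?invr_ge0 ?nrm_ge0 // lef_pV2 ?posrE //; first by apply: Hm => //; exact: s24.
          by rewrite nrm_gt0; apply: Pn => //; exact: s24.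
        by rewrite lef_pV2 ?posrE //; exact: lt_le_trans t1.
      move=> v; have [hp _] := HM z t zd (s24 t t2).
      have h1 := hol_div (hol_shift (HBh _ b)) (hol_shift hp) (Pn z t zd t1 (s24 t t2)).
      exact: (hol_derivable v (holM h1 (hol_cst t^-1 z))).
    have b := ball z t zd (s24 t t2); have [hp _] := HM z t zd (s24 t t2).
    have t0 : t != 0 by exact: nrm_neq0 t1.
    have h1 := @derivableVf _ (fun t : C => P (z + t *: u)) t (Pn z t zd t1 (s24 t t2)) (hol_line hp).
    have h2 := @derivableVf _ (fun t : C => t) t t0 (@derivable_id _ _ t 1).
    have := derivable_contAt (derivableMf (derivableMf (hol_line (HBh _ b)) h1) h2); exact.
  move=> K; have zz : nrm (z0 - z0) < d by rewrite subrr nrm0.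
  exact: (holZ (c0 R)^-1 (holB_hol d0 K zz)).
exists d => // z zd; have [_ Hr [U [HU U0 HP']]] := Hrts z zd.
have dB : dD (fun t : C => B (z + t *: u)) (4 * s).
  by move=> t ts; apply: hol_line; apply: HBh; exact: ball.
have rs4 a : a \in rts z -> nrm a < 4 * s by move=> /Hr; lra.
have [|g Hg Eg] := @dD_div_list _ _ (4 * s) (rts z) U dB HU rs4.
  move=> a /rs4 ar; exists C1, (4 * s - nrm a) => [|t ta]; first lra.
  have ts : nrm t < 4 * s by have := nrm_sub_ge t a; lra.
  by rewrite -HP' //; have [_] := H _ (ball z t zd ts).
pose q (t : C) := g t / U t.
have Hq t : nrm t <= 2 * s -> derivable q t 1.
  move=> ts; have tr := s24 t ts.
  have := derivableMf (Hg t tr) (@derivableVf _ U t (U0 t tr) (HU t tr)); exact.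
have Eq (t : C) : nrm t < 4 * s -> B (z + t *: u) = q t * P (z + t *: u).
  by move=> ts; rewrite Eg HP' // /q mulrCA divfK ?U0.
have := Eq 0; rewrite scale0r addr0 nrm0 => -> //; last lra.
congr (_ * _); rewrite /Q.
have <- : csq (fun t : C => q t / t) (rc s) = csq (fun t : C => B (z + t *: u) / P (z + t *: u) / t) (rc s).
  apply: (csq_ext s0) => t t1 t2; rewrite Eq; last exact: s24.
  by rewrite mulfK //; apply: Pn => //; exact: s24.
by rewrite (cauchy0 s0 Hq) mulrA mulVf ?c0_neq0 // mul1r.
Qed.
End Div.

(** * Hankel determinants and the number of distinct roots *)

Section Hankel.
Variable F : fieldType.
Implicit Types rs : seq F.

(** Applied to power sums it is a generalized discriminant: zero with fewer than [nu] distinct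
    roots, and nonzero over a numeric field with exactly [nu]. *)
Definition hankel (nu : nat) (ps : nat -> F) := \det (\matrix_(i < nu, j < nu) ps (i + j)%N).

Lemma power_sum_undup rs j : \sum_(a <- rs) a ^+ j = \sum_(a <- undup rs) (count_mem a rs)%:R * a ^+ j.
Proof.
rewrite -big_undup_iterop_count; apply: eq_bigr => a _.
by rewrite mulr_natl; case: (count_mem a rs) => // n; rewrite Monoid.iteropE /= mulrS; elim: n => //= n IH; rewrite mulrS IH.
Qed.

(** Grouping equal roots gives Vandermonde times the diagonal of multiplicities times transposed
    Vandermonde. *)
Lemma hankel_factor nu rs (m := size (undup rs)) (W : 'M[F]_(nu, m) := \matrix_(i, l) (undup rs)`_l ^+ i) :
  \matrix_(i < nu, j < nu) (\sum_(a <- rs) a ^+ (i + j)) =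
  W *m diag_mx (\row_l (count_mem (undup rs)`_l rs)%:R) *m W^T.
Proof.
apply/matrixP => i j; rewrite !mxE power_sum_undup (big_nth 0) big_mkord; apply: eq_bigr => l _.
by rewrite mul_mx_diag !mxE exprD mulrA [_%:R * _]mulrC.
Qed.

Lemma hankel_lt nu rs : (size (undup rs) < nu)%N -> hankel nu (fun j => \sum_(a <- rs) a ^+ j) = 0.
Proof.
move=> lt; apply/eqP/negPn/negP => D; have : row_free (\matrix_(i < nu, j < nu) (\sum_(a <- rs) a ^+ (i + j))).
  by rewrite row_free_unit unitmxE unitfE.
rewrite /row_free hankel_factor -mulmxA => /eqP E.
by have := mulmx_max_rank (\matrix_(i < nu, l < size (undup rs)) (undup rs)`_l ^+ i)
  (diag_mx (\row_l (count_mem (undup rs)`_l rs)%:R) *m (\matrix_(i < nu, l < size (undup rs)) (undup rs)`_l ^+ i)^T);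
  rewrite E leqNgt lt.
Qed.
End Hankel.

Lemma hankel_eq (F : numFieldType) (rs : seq F) :
  hankel (size (undup rs)) (fun j => \sum_(a <- rs) a ^+ j) != 0.
Proof.
rewrite /hankel hankel_factor !det_mulmx det_tr det_diag.
have V : \det (\matrix_(i < size (undup rs), l < size (undup rs)) (undup rs)`_l ^+ i) != 0.
  have -> : \matrix_(i < size (undup rs), l < size (undup rs)) (undup rs)`_l ^+ i =
      Vandermonde (size (undup rs)) (\row_(l < size (undup rs)) (undup rs)`_l).
    by apply/matrixP => i j; rewrite !mxE.
  rewrite det_Vandermonde; apply/prodf_neq0 => i _; apply/prodf_neq0 => j ij.
  by rewrite !mxE subr_eq0 nth_uniq ?undup_uniq // gtn_eqF.
rewrite !mulf_neq0 //; apply/prodf_neq0 => l _; rewrite mxE pnatr_eq0 -lt0n -has_count has_pred1.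
by rewrite -mem_undup mem_nth.
Qed.

(** * Smooth points of zero sets and clusters of roots *)

Section Cluster.
Variable R : realType.
Local Notation C := (Cplx R).
Variable V : normedModType C.
Implicit Types (f P B th : V -> C) (z v u x : V).

(** Germ of a smooth hypersurface at [x] transversal to [u]: [th w] is the displacement along [u]
    from [w] to the zero set of [th], and [w + th w *: u] is the projection onto it. *)
Definition SH x th u : Prop := [/\ hol th x, th x = 0 &
  exists2 r : R, 0 < r & forall w (t : C), nrm (w - x) < r -> nrm t < r -> th (w + t *: u) = th w - t].

Section RootSys.
Variables (P : V -> C) (z0 u : V) (k : nat) (s d : R) (rts : V -> seq C).
Hypothesis RS : rootsys P z0 u k s d rts.

Lemma rts_root z (t : C) : nrm (z - z0) < d -> nrm t < 4 * s -> (P (z + t *: u) == 0) = (t \in rts z).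
Proof.
move=> zd ts; have [_ _ _ H _] := RS; have [_ _ [U [_ U0 ->]]] := H z zd; rewrite //.
rewrite mulf_eq0 (negPf (U0 t ts)) orbF prodf_seq_eq0; apply/hasP/idP => [[a ar]|tr].
  by rewrite /= subr_eq0 => /eqP ->.
by exists t => //=; rewrite subrr.
Qed.

(** At parameter 0, [P z] is, up to sign, the product of the roots times [U 0]; Cauchy bounds for
    [U] and for its inverse give the two inequalities. *)
Lemma rootsys_bounds : exists A, 0 < A /\ forall z, nrm (z - z0) < d ->
  nrm (P z) <= A * nrm (\prod_(a <- rts z) a) /\ nrm (\prod_(a <- rts z) a) <= A * nrm (P z).
Proof.
have [[s0 d0] [m m0 Hm] [M HM] H _] := RS.
have s32 : 0 < 3 / 2 * s by lra.
have c08 : 0 <= 8 / nrm (c0 R) by rewrite divr_ge0 ?nrm_ge0.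
pose A1 := 8 / nrm (c0 R) * (M * (2 / s) ^+ k).
pose A2 := 8 / nrm (c0 R) * ((5 * s) ^+ k / m).
exists (`|A1| + `|A2| + 1); split.
  by have := normr_ge0 A1; have := normr_ge0 A2; lra.
move=> z zd; have [sz Hr [U [HU U0 HP]]] := H z zd.
have n0 : nrm (0 : C) < 4 * s by rewrite nrm0; lra.
have P0 : P z = \prod_(a <- rts z) (0 - a) * U 0 by have := HP 0 n0; rewrite scale0r addr0.
have nP : nrm (\prod_(a <- rts z) (0 - a)) = nrm (\prod_(a <- rts z) a).
  elim: (rts z) => [|a l IH]; first by rewrite !big_nil.
  by rewrite !big_cons !nrmM IH sub0r nrmN.
have rng (w : C) : 3 / 2 * s <= nrm w -> nrm w <= 2 * (3 / 2 * s) -> s <= nrm w /\ nrm w < 4 * s by move=> ? ?; split; lra.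
have lo (w : C) (l : seq C) : 3 / 2 * s <= nrm w -> (forall a, a \in l -> nrm a < s) ->
    (s / 2) ^+ size l <= nrm (\prod_(a <- l) (w - a)).
  move=> ws; elim: l => [|a l IH] Hl; first by rewrite big_nil nrm1 expr0.
  rewrite big_cons nrmM /= exprS; apply: ler_pM; rewrite ?exprn_ge0 ?divr_ge0 ?(ltW s0) //.
    by have := nrm_sub_ge w a; have := Hl a (mem_head _ _); lra.
  by apply: IH => b bl; apply: Hl; rewrite inE bl orbT.
have hi (w : C) (l : seq C) : nrm w < 4 * s -> (forall a, a \in l -> nrm a < s) ->
    nrm (\prod_(a <- l) (w - a)) <= (5 * s) ^+ size l.
  move=> ws; elim: l => [|a l IH] Hl; first by rewrite big_nil nrm1 expr0.
  rewrite big_cons nrmM /= exprS; apply: ler_pM; rewrite ?nrm_ge0 //.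
    by have := nrmD w (- a); rewrite nrmN; have := Hl a (mem_head _ _); lra.
  by apply: IH => b bl; apply: Hl; rewrite inE bl orbT.
have s2k : 0 < (s / 2) ^+ k by rewrite exprn_gt0 // divr_gt0.
have U1 : nrm (U 0) <= A1.
  apply: (@cauchy0_bound _ U (3 / 2 * s)) => // [w ws|w w1 w2]; first by apply: HU; lra.
  have [w3 w4] := rng w w1 w2; have [_] := HM z w zd w4; rewrite HP // nrmM => b.
  have -> : M * (2 / s) ^+ k = M / (s / 2) ^+ k by rewrite -exprVn invf_div.
  rewrite ler_pdivlMr //; apply: le_trans _ b; rewrite mulrC; apply: ler_wpM2r; first exact: nrm_ge0.
  by rewrite -sz; exact: lo.
have U2 : nrm (U 0)^-1 <= A2.
  apply: (@cauchy0_bound _ (fun w => (U w)^-1) (3 / 2 * s)) => // [w ws|w w1 w2].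
    have ws' : nrm w < 4 * s by lra.
    have := @derivableVf _ U w (U0 w ws') (HU w ws'); exact.
  have [w3 w4] := rng w w1 w2; have := Hm z w zd w3 w4; rewrite HP // nrmM nrmV => b.
  have Uw : 0 < nrm (U w) by rewrite nrm_gt0 U0.
  rewrite ler_pdivlMr // mulrC ler_pdivrMr //; apply: le_trans b _.
  by apply: ler_wpM2r; [exact: nrm_ge0|rewrite -sz; exact: hi].
have Up : 0 < nrm (U 0) by rewrite nrm_gt0 U0.
rewrite P0 nrmM nP; have := nrm_ge0 (\prod_(a <- rts z) a); move: (nrm (\prod_(a <- rts z) a)) => y y0.
have := normr_ge0 A1; have := normr_ge0 A2; have := ler_norm A1; have := ler_norm A2 => l2 l1 p2 p1.
split.
  rewrite mulrC; apply: ler_wpM2r => //; lra.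
have : 1 <= A2 * nrm (U 0) by move: U2; rewrite nrmV -div1r ler_pdivrMr.
move=> h; have : A2 * nrm (U 0) <= (`|A1| + `|A2| + 1) * nrm (U 0) by apply: ler_wpM2r; [exact: ltW|lra].
move=> h2; have h3 := le_trans h h2; clear -h3 y0; move: (`|A1| + `|A2| + 1) h3 => A h3.
have : y * 1 <= y * (A * nrm (U 0)) by apply: ler_wpM2l.
by rewrite mulr1 mulrCA.
Qed.

Lemma rts_shift z (t : C) : nrm (z - z0) < d -> nrm (z + t *: u - z0) < d -> nrm t < s ->
  forall b, (b \in rts (z + t *: u)) = (b + t \in rts z).
Proof.
have [[s0 d0] _ _ H _] := RS => zd zd' ts b.
have [_ H1 _] := H z zd; have [_ H2 _] := H _ zd'.
apply/idP/idP => br.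
  have bs := H2 b br; have b4 : nrm b < 4 * s by lra.
  rewrite -(rts_root zd); last by have := nrmD b t; lra.
  by rewrite [b + t]addrC scalerDl addrA (rts_root zd').
have bs := H1 _ br; have b4 : nrm (b + t) < 4 * s by lra.
rewrite -(rts_root zd'); last by have := nrmB (b + t) t; have := nrmD (b + t) (- t); rewrite addrK nrmN; lra.
by rewrite -addrA -scalerDl [t + b]addrC (rts_root zd).
Qed.

Lemma size_rts_shift z (t : C) : nrm (z - z0) < d -> nrm (z + t *: u - z0) < d -> nrm t < s ->
  size (undup (rts (z + t *: u))) = size (undup (rts z)).
Proof.
move=> zd zd' ts; rewrite -(size_map (fun b => b + t) (undup (rts (z + t *: u)))).
apply: perm_size; apply: uniq_perm; rewrite ?undup_uniq //.
  by rewrite map_inj_uniq ?undup_uniq //; exact: addIr.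
move=> b; rewrite mem_undup; apply/mapP/idP => [[a]|br].
  by rewrite mem_undup rts_shift // => ? ->.
by exists (b - t); rewrite ?subrK // mem_undup rts_shift ?subrK.
Qed.
End RootSys.

End Cluster.

Section Cluster.
Variable R : realType.
Local Notation C := (Cplx R).
Variable V : normedModType C.
Implicit Types (f P B th : V -> C) (z v u x : V).

Lemma germ_shift z v (Q : V -> Prop) : germ z Q -> germ (z + v) (fun w => Q (w - v)).
Proof. by move=> [r r0 H]; exists r => // w wr; apply: H; rewrite addrAC -addrA -opprD. Qed.

Lemma germ_lt z z0 (d : R) : nrm (z - z0) < d -> germ z (fun w => nrm (w - z0) < d).
Proof. by move=> zd; apply: (@germ_ball _ _ z0 d). Qed.

Lemma sep_seq (l : seq C) : exists2 e : R, 0 < e & forall a b, a \in l -> b \in l -> a != b -> e < nrm (a - b).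
Proof.
have [|r r0 H] := @germ_seq R C (C * C)%type (allpairs pair l l) 0
    (fun (y : C * C) w => y.1 != y.2 -> nrm w < nrm (y.1 - y.2)).
  move=> [a b] _; have [->|ab] := eqVneq a b; first by apply: germ_all.
  by exists (nrm (a - b)) => [|w]; [rewrite nrm_gt0 subr_eq0|rewrite subr0].
exists (r / 2) => [|a b al bl ab]; first lra.
have nr : nrm (rc (r / 2)) = r / 2 by rewrite nrm_rc ger0_norm; lra.
have := H (rc (r / 2)); rewrite subr0 nr => /(_ ltac:(lra) (a, b)) /=.
by apply => //; apply/allpairsP; exists (a, b).
Qed.

Lemma ordline_dir P x u : hol P x ->
  (forall r : R, 0 < r -> exists t : C, nrm t < r /\ P (x + t *: u) != 0) -> exists k, ordline P x u k.
Proof.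
move=> /holP[r [M [r0 H]]] Hd; have u1 : 0 < nrm u + 1 by have := nrm_ge0 u; lra.
pose rho := r / 2 / (nrm u + 1); have rho0 : 0 < rho by rewrite !divr_gt0.
have hr : rho * nrm u < r.
  have : rho * (nrm u + 1) = r / 2 by rewrite /rho divfK // gt_eqF.
  by have := nrm_ge0 u; clear -rho0 r0; clearbody rho; nra.
have [d1 d2] := holB_dD H hr.
have [K|[k [g [Hg g0 E]]]] := dD_order rho0 d1 d2; last by exists k, rho, g; split => // t _.
have [t [tr]] := Hd (rho / 8) ltac:(by rewrite divr_gt0).
by rewrite K ?eqxx.
Qed.

Lemma ordline_gt0 P x u k : ordline P x u k -> P x = 0 -> (0 < k)%N.
Proof.
move=> [rho [g [rho0 _ g0 E]]] Px; case: k E => // E.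
by have := E 0; rewrite scale0r addr0 nrm0 Px expr0 mul1r => /(_ rho0) h; rewrite -h eqxx in g0.
Qed.

Lemma SH_neq0 x th u : SH x th u -> forall r : R, 0 < r -> exists t : C, nrm t < r /\ th (x + t *: u) != 0.
Proof.
move=> [_ t0 [r' r'0 H]] r r0; pose m := Num.min r r'.
have m0 : 0 < m by rewrite /m lt_min r0.
have nm : nrm (rc (m / 2)) = m / 2 by rewrite nrm_rc ger0_norm; lra.
have mr : m <= r by rewrite /m ge_min lexx.
have mr' : m <= r' by rewrite /m ge_min lexx orbT.
exists (rc (m / 2)); rewrite H ?subrr ?nrm0 ?nm //; try lra.
by split; [lra|rewrite t0 sub0r oppr_eq0 -nrm_gt0 nm; lra].
Qed.

Lemma germ_line x u (Q : V -> Prop) : germ x Q -> exists2 r : R, 0 < r & forall t : C, nrm t < r -> Q (x + t *: u).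
Proof.
move=> [r r0 H]; have u1 : 0 < nrm u + 1 by have := nrm_ge0 u; lra.
exists (r / (nrm u + 1)) => [|t]; first exact: divr_gt0.
rewrite ltr_pdivlMr // => tr; apply: H; rewrite [x + _]addrC addrK nrmZ.
by have := nrm_ge0 t; lra.
Qed.

Lemma SH_X_neq0 x th u k : SH x th u -> ~ germ x (fun w => th w ^+ k = 0).
Proof.
move=> S /(germ_line u)[r r0 H]; have [t [tr]] := SH_neq0 S r0.
by have /eqP := H t tr; rewrite expf_eq0 => /andP[_ ->].
Qed.

Lemma rts_nseq P x u k s d rts (b : C) w : rootsys P x u k s d rts -> nrm (w - x) < d ->
  (forall c, c \in rts w -> c = b) -> rts w = nseq k b.
Proof.
move=> [_ _ _ H _] wd Hb; have [<- _ _] := H w wd.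
by apply/all_pred1P/allP => c /Hb -> /=.
Qed.

(** A single root of multiplicity [k] is the first power sum divided by [k], hence holomorphic. *)
Lemma SH_of_roots P x u k s d rts : rootsys P x u k s d rts -> (0 < k)%N -> P x = 0 ->
  germ x (fun w => exists b, forall c, c \in rts w -> c = b) ->
  exists th, [/\ SH x th u, germ x (fun w => P w = 0 <-> th w = 0) & germ x (fun w => rts w = nseq k (th w))].
Proof.
move=> RS k0 Px Hb; have [[s0 d0] _ _ H Hp] := RS.
have xd : nrm (x - x) < d by rewrite subrr nrm0.
pose th w := k%:R^-1 * \sum_(a <- rts w) a ^+ 1.
have kn : k%:R != 0 :> C by rewrite pnatr_eq0 -lt0n.
have E : germ x (fun w => nrm (w - x) < d /\ rts w = nseq k (th w)).
  apply: germ_imp (germ_and (germ_lt xd) Hb) => w [wd [b wb]]; split => //.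
  have := rts_nseq RS wd wb => e; rewrite e; congr nseq.
  by rewrite /th e big_nseq iter_addr addr0 expr1 -[b *+ k]mulr_natl mulKf.
have P0 : germ x (fun w => P w = 0 <-> th w = 0).
  apply: germ_imp E => w [wd e]; have n0 : nrm (0 : C) < 4 * s by rewrite nrm0; lra.
  have := rts_root RS wd n0; rewrite scale0r addr0 e mem_nseq k0 /= => h.
  by split => [/eqP|h']; [rewrite h => /eqP|apply/eqP; rewrite h h' eqxx].
exists th; split => //; last by apply: germ_imp E => w [].
have th0 : th x = 0 by apply/(germ_self P0).
have Ht : hol th x by apply: holZ; exact: Hp.
split => //; have [r r0 Hr] := germ_and (germ_open E) (hol_cont Ht s0).
have u1 : 0 < nrm u + 1 by have := nrm_ge0 u; lra.
have [q q0 Hq] : exists2 q : R, 0 < q & forall w (t : C), nrm (w - x) < q -> nrm t < q -> nrm (w + t *: u - x) < r.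
  exists (r / 2 / (nrm u + 1)) => [|w t]; first by rewrite !divr_gt0.
  rewrite !ltr_pdivlMr // => wq tq; have := nrmD (w - x) (t *: u); rewrite addrAC nrmZ.
  have := nrm_ge0 t; have := nrm_ge0 (w - x); have := nrm_ge0 u; clear -wq tq r0; nra.
exists (Num.min (Num.min q r) s) => [|w t]; first by rewrite !lt_min q0 r0 s0.
rewrite !lt_min => /andP[/andP[wq wr] _] /andP[/andP[tq _] ts].
have [/germ_self[wd e] ths] := Hr w wr.
have [/germ_self[wd' e'] _] := Hr _ (Hq w t wq tq).
have := rts_shift RS wd wd' ts (th w - t); rewrite e e' !mem_nseq k0 subrK eqxx /= => /eqP <- //.
Qed.

(** All the roots of [g] along [u] equal [th w], so [g] and a power of [th] bound each other by
    [rootsys_bounds], and [hol_div_le] divides each by the other. *)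
Lemma SH_order x th u g : SH x th u -> hol g x -> ~ germ x (fun w => g w = 0) ->
  germ x (fun w => g w = 0 -> th w = 0) ->
  exists k c, [/\ hol c x, c x != 0 & germ x (fun w => g w = th w ^+ k * c w)].
Proof.
move=> S Hg ng Hz; have [Ht t0 [r r0 Hr]] := S.
have [k o] : exists k, ordline g x u k.
  apply: ordline_dir => // e e0; have [e' e'0 He] := germ_line u Hz.
  have [|t [te tt]] := @SH_neq0 x th u S (Num.min e e'); first by rewrite lt_min e0.
  move: te; rewrite lt_min => /andP[te te']; exists t; split => //.
  by apply: contra_neq tt => /(He t te').
have u1 : 0 < nrm u + 1 by have := nrm_ge0 u; lra.
have [r2 r20 Hr2] := Hz.
have [|s [d [rts [se de RS]]]] :=
  @roots_near _ _ g x u k Hg o (Num.min r (r2 / 2 / (nrm u + 1))); first by rewrite lt_min r0 !divr_gt0.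
move: se de; rewrite !le_min !ler_pdivlMr // => /andP[sr su] /andP[dr du].
have [[s0 d0] _ _ Hrts _] := RS.
have E : germ x (fun w => rts w = nseq k (th w) /\ nrm (w - x) < d).
  have xd : nrm (x - x) < d by rewrite subrr nrm0.
  apply: germ_imp (germ_lt xd) => w wd; split => //; apply: (rts_nseq RS wd) => c cr.
  have [_ /(_ c cr) cs _] := Hrts w wd.
  have := rts_root RS wd (t := c); rewrite cr => /(_ ltac:(lra)) /eqP gc.
  have near : nrm (w + c *: u - x) < r2.
    have := nrmD (w - x) (c *: u); rewrite addrAC nrmZ.
    have := nrm_ge0 u; have := nrm_ge0 c; clear -su du wd cs s0 d0; nra.
  have wr : nrm (w - x) < r by exact: lt_le_trans wd dr.
  have cr' : nrm c < r by exact: lt_le_trans cs sr.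
  have := Hr2 _ near gc; rewrite Hr // => /eqP.
  by rewrite subr_eq0 => /eqP.
have [A [A0 HA]] := rootsys_bounds RS.
have E2 : germ x (fun w => nrm (g w) <= A * nrm (th w ^+ k) /\ nrm (th w ^+ k) <= A * nrm (g w)).
  by apply: germ_imp E => w [e wd]; have := HA w wd; rewrite e big_nseq iter_mulr mulr1.
have nt := @SH_X_neq0 x th u k S.
have [c Hc Ec] := hol_div_le (holX k Ht) nt Hg (germ_imp (fun w h => proj1 h) E2).
have [c' Hc' Ec'] := hol_div_le Hg ng (holX k Ht) (germ_imp (fun w h => proj2 h) E2).
exists k, c; split => //; last by apply: germ_imp Ec => w ->; rewrite mulrC.
(* The two quotients are mutually inverse where [th] is nonzero, hence at [x]; so [c x] is
   nonzero. *)
have : nrm (c' x * c x - 1) <= 0 * nrm (g x).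
  apply: (@le_dense _ _ (fun w => th w ^+ k) (fun w => c' w * c w - 1) g x 0 _ Hg nt).
    by have := holB2 (holM Hc' Hc) (hol_cst 1 x); exact.
  apply: germ_imp (germ_and Ec Ec') => w [e1 e2] tw.
  by move: e2; rewrite e1 mulrA -{1}[th w ^+ k]mul1r => /(mulIf tw) <-; rewrite subrr nrm0 mul0r.
rewrite mul0r => h; have /eqP : nrm (c' x * c x - 1) = 0 by apply/eqP; rewrite eq_le h nrm_ge0.
rewrite nrm_eq0 subr_eq0 => /eqP h1; apply: contra_eq_neq h1 => ->.
by rewrite mulr0 eq_sym oner_eq0.
Qed.
End Cluster.

Section Cluster2.
Variable R : realType.
Local Notation C := (Cplx R).
Variable V : normedModType C.
Implicit Types (f P B th : V -> C) (z v u x : V).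

(** Near [z1] every root [a] is continued by a nonempty cluster of roots, and clusters of different
    roots stay apart. As there are no more distinct roots than clusters, each cluster is one
    multiple root, to which [SH_of_roots] applies. *)
Lemma root_cluster P z0 u k s d rts z1 : rootsys P z0 u k s d rts -> nrm (z1 - z0) < d ->
  germ z1 (fun z => (size (undup (rts z)) <= size (undup (rts z1)))%N) ->
  exists th : C -> V -> C,
    (forall a, a \in rts z1 -> SH (z1 + a *: u) (th a) u /\
       germ (z1 + a *: u) (fun w => P w = 0 <-> th a w = 0)) /\
    germ z1 (fun z => perm_eq (undup (rts z)) [seq a + th a (z + a *: u) | a <- undup (rts z1)]).
Proof.
move=> RS z1d Hmax; have [[s0 d0] [m m0 Hm] [M HM] Hrts _] := RS.
have [sz1 Hs1 _] := Hrts z1 z1d.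
pose S := undup (rts z1).
have SE a : (a \in S) = (a \in rts z1) by rewrite mem_undup.
have [e' e'0 He'] := sep_seq S.
pose e := Num.min s (e' / 4).
have e0 : 0 < e by rewrite /e lt_min s0 divr_gt0.
have es : e <= s by rewrite /e ge_min lexx.
have ee : 4 * e <= e'.
  have : e <= e' / 4 by rewrite /e ge_min lexx orbT.
  by lra.
clearbody e.
have s4 (t : C) : nrm t < s -> nrm t < 4 * s by move=> ?; lra.
have /choice[W HW] : forall a : C, exists y : nat * R * R * (V -> seq C), a \in S ->
   [/\ (0 < y.1.1.1)%N, y.1.1.2 <= e & rootsys P (z1 + a *: u) u y.1.1.1 y.1.1.2 y.1.2 y.2].
  move=> a; have [aS|] := boolP (a \in S); last by exists (0%N, 0, 0, fun=> [::]).
  have ar := Hs1 a ltac:(by rewrite -SE).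
  have [hP _] := HM z1 a z1d (s4 a ar).
  have Pa : P (z1 + a *: u) = 0 by apply/eqP; rewrite (rts_root RS z1d (s4 a ar)) -SE.
  have [|k' o] := @ordline_dir _ _ P (z1 + a *: u) u hP.
    move=> r r0; pose q := Num.min (Num.min r s) e'.
    have q0 : 0 < q by rewrite /q !lt_min r0 s0.
    have qr : q <= r by rewrite /q !ge_min lexx.
    have qs : q <= s by rewrite /q !ge_min lexx orbT.
    have qe : q <= e' by rewrite /q ge_min lexx orbT.
    clearbody q; have nq : nrm (rc (q / 2)) = q / 2 by rewrite nrm_rc ger0_norm; lra.
    exists (rc (q / 2)); split; first by rewrite nq; lra.
    rewrite -addrA -scalerDl (rts_root RS z1d); last by have := nrmD a (rc (q / 2)); rewrite nq; lra.
    apply/negP; rewrite -SE => bS.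
    have [E|ne] := eqVneq (a + rc (q / 2)) a.
      by move: nq; rewrite -[rc _](addKr a) E addNr nrm0; lra.
    by have := He' _ _ bS aS ne; rewrite addrAC subrr add0r nq; lra.
  have k'0 := ordline_gt0 o Pa.
  have [s' [d' [rts' [h1 _ RS']]]] := roots_near hP o e0.
  by exists (k', s', d', rts').
pose G z := nrm (z - z0) < d /\ (size (undup (rts z)) <= size S)%N /\
  forall a, a \in S -> nrm (z - z1) < (W a).1.2.
have gG : germ z1 G.
  apply: germ_and; first exact: germ_lt.
  apply: germ_and => //; apply: germ_seq => a aS; apply: germ_lt; rewrite subrr nrm0.
  by have [_ _ [[]]] := HW a aS.
(* A root in the cluster of [a], measured from [a]; [one] shows that it is the only one. *)
pose beta z a := head 0 ((W a).2 (z + a *: u)).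
have bnd z a b : G z -> a \in S -> b \in (W a).2 (z + a *: u) -> nrm b < e /\ a + b \in rts z.
  move=> [zd [_ zW]] aS br; have [_ se RS'] := HW a aS; have [_ _ _ H' _] := RS'.
  have zd' : nrm (z + a *: u - (z1 + a *: u)) < (W a).1.2 by rewrite opprD addrACA subrr addr0 zW.
  have [_ /(_ b br) bs _] := H' _ zd'; split; first exact: lt_le_trans bs se.
  have as_ : nrm a < s by apply: Hs1; rewrite -SE.
  have b4 : nrm b < 4 * (W a).1.1.2 by have := nrm_ge0 b; lra.
  rewrite -(rts_root RS zd); last by have := nrmD a b; lra.
  by rewrite scalerDl addrA (rts_root RS' zd' b4).
have betaP z a : G z -> a \in S -> beta z a \in (W a).2 (z + a *: u).
  move=> [zd [_ zW]] aS; have [k0 se RS'] := HW a aS; have [_ _ _ H' _] := RS'.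
  have zd' : nrm (z + a *: u - (z1 + a *: u)) < (W a).1.2 by rewrite opprD addrACA subrr addr0 zW.
  have [sz _ _] := H' _ zd'; rewrite /beta; move: sz.
  by case: ((W a).2 (z + a *: u)) => [|y l] sz; [rewrite -sz in k0|rewrite mem_head].
have sep a a' (b b' : C) : a \in S -> a' \in S -> nrm b < e -> nrm b' < e -> a + b = a' + b' -> a = a'.
  move=> aS aS' be be' E; apply/eqP/negPn/negP => ne; have := He' a a' aS aS' ne.
  have -> : a - a' = b' - b by apply/eqP; rewrite subr_eq addrAC eq_sym subr_eq addrC -E addrC.
  by have := nrmD b' (- b); rewrite nrmN; lra.
have PE z : G z -> perm_eq (undup (rts z)) [seq a + beta z a | a <- S].
  move=> gz; have [_ [szz _]] := gz.
  have uT : uniq [seq a + beta z a | a <- S].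
    rewrite map_inj_in_uniq ?undup_uniq // => a a' aS aS' E.
    have [h1 _] := bnd z a _ gz aS (betaP z a gz aS); have [h2 _] := bnd z a' _ gz aS' (betaP z a' gz aS').
    exact: (sep a a' _ _ aS aS' h1 h2 E).
  have sub : {subset [seq a + beta z a | a <- S] <= undup (rts z)}.
    move=> b /mapP[a aS ->]; rewrite mem_undup.
    by have [_] := bnd z a _ gz aS (betaP z a gz aS).
  have sz' : (size (undup (rts z)) <= size [seq (a + beta z a)%R | a <- S])%N by rewrite size_map.
  have [_ E] := uniq_min_size uT sub sz'.
  by apply: uniq_perm; rewrite ?undup_uniq // => b; rewrite E.
have one z a b : G z -> a \in S -> b \in (W a).2 (z + a *: u) -> b = beta z a.
  move=> gz aS br; have [be] := bnd z a b gz aS br.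
  rewrite -mem_undup (perm_mem (PE z gz)) => /mapP[a' aS' E].
  have [be' _] := bnd z a' _ gz aS' (betaP z a' gz aS').
  by have ea := sep a a' _ _ aS aS' be be' E; move: E; rewrite -ea => /addrI.
have /choice[th Hth] : forall a : C, exists th, a \in S -> [/\ SH (z1 + a *: u) th u,
    germ (z1 + a *: u) (fun w => P w = 0 <-> th w = 0) &
    germ (z1 + a *: u) (fun w => (W a).2 w = nseq (W a).1.1.1 (th w))].
  move=> a; have [aS|] := boolP (a \in S); last by exists (fun=> 0).
  have [k0 se RS'] := HW a aS.
  have ar := Hs1 a ltac:(by rewrite -SE).
  have Pa : P (z1 + a *: u) = 0 by apply/eqP; rewrite (rts_root RS z1d (s4 a ar)) -SE.
  have [|th h] := SH_of_roots RS' k0 Pa; last by exists th.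
  apply: germ_imp (germ_shift (a *: u) gG) => w gw; exists (beta (w - a *: u) a) => c cr.
  by apply: one => //; rewrite subrK.
exists th; split => [a|]; first by rewrite -SE => /Hth[].
have K : germ z1 (fun z => forall a, a \in S -> (W a).2 (z + a *: u) = nseq (W a).1.1.1 (th a (z + a *: u))).
  apply: germ_seq => a /Hth[_ _] /(germ_shift (- (a *: u))); rewrite addrK.
  by apply: germ_imp => z; rewrite opprK.
apply: germ_imp (germ_and gG K) => z [gz Kz]; have := PE z gz.
have -> // : [seq a + beta z a | a <- S] = [seq a + th a (z + a *: u) | a <- undup (rts z1)].
apply/eq_in_map => a aS; congr (_ + _); have := betaP z a gz aS.
by rewrite Kz // mem_nseq => /andP[_ /eqP].
Qed.

End Cluster2.

(** * Divisibility tested at smooth points *)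

Section Generic.
Variable R : realType.
Local Notation C := (Cplx R).
Variable V : normedModType C.
Implicit Types (f P B th : V -> C) (z v u x : V).

(** [nu] is the largest number of distinct roots and [D] the Hankel determinant of that size; the
    identity theorem keeps [D] from vanishing near any point. *)
Lemma rootsys_disc P z0 u k s d rts : rootsys P z0 u k s d rts -> exists (D : V -> C) (nu : nat),
  forall z, nrm (z - z0) < d -> [/\ hol D z, ~ germ z (fun w => D w = 0),
    (size (undup (rts z)) <= nu)%N & (D z != 0) = (size (undup (rts z)) == nu)].
Proof.
move=> RS; have [[s0 d0] _ _ H Hp] := RS.
pose Q n := `[< exists2 z, nrm (z - z0) < d & size (undup (rts z)) = n >].
have Q0 : exists n, Q n.
  by exists (size (undup (rts z0))); apply/asboolP; exists z0 => //; rewrite subrr nrm0.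
have Qk n : Q n -> (n <= k)%N.
  by move=> /asboolP[z zd <-]; have [<- _ _] := H z zd; exact: size_undup.
case: (ex_maxnP Q0 Qk) => nu /asboolP[z1 z1d sz1] Hmax.
pose D w := hankel nu (fun j => \sum_(a <- rts w) a ^+ j).
have Hle z : nrm (z - z0) < d -> (size (undup (rts z)) <= nu)%N.
  by move=> zd; apply: Hmax; apply/asboolP; exists z.
have HD z : nrm (z - z0) < d -> hol D z by move=> zd; apply: hol_det => i j; exact: Hp.
have De z : nrm (z - z0) < d -> (D z != 0) = (size (undup (rts z)) == nu).
  move=> zd; have := Hle z zd; rewrite leq_eqVlt => /orP[/eqP e|lt].
    by rewrite /D -e eqxx hankel_eq.
  by rewrite /D hankel_lt ?eqxx // ltn_eqF.
exists D, nu => z zd; split; [exact: HD| |exact: Hle|exact: De].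
move=> K; have := De z1 z1d; rewrite sz1 eqxx.
by rewrite (hol_zero_ball HD zd K z1d) eqxx.
Qed.

(** Where [D] is nonzero the zeros on the line are smooth points by [root_cluster]; the local bounds
    there allow dividing out the roots, and Cauchy's bound gives |B| <= A |P| with [A] independent
    of the base point. This extends across the zeros of [D] by [le_dense], and [hol_div_le]
    concludes. *)
Lemma hol_div_generic P B z0 : hol P z0 -> ~ germ z0 (fun w => P w = 0) -> hol B z0 ->
  germ z0 (fun w => forall th u, SH w th u -> germ w (fun x => P x = 0 <-> th x = 0) ->
    exists C1, germ w (fun x => nrm (B x) <= C1 * nrm (P x))) ->
  exists2 Q, hol Q z0 & germ z0 (fun w => B w = Q w * P w).
Proof.
move=> HP nz HB Hreg; have [u [k o]] := ordline_exists HP nz.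
have [M' HB'] := HB; have [r r0 H] := germ_and HB' Hreg.
have u1 : 0 < nrm u + 1 by have := nrm_ge0 u; lra.
have [|s [d [rts [se de RS]]]] :=
  @roots_near _ _ P z0 u k HP o (r / 8 / (nrm u + 1)); first by rewrite !divr_gt0.
have [[s0 d0] [m m0 Hm] [M HM] Hrts _] := RS.
have su : s * (nrm u + 1) <= r / 8 by rewrite -ler_pdivlMr.
have du : d * (nrm u + 1) <= r / 8 by rewrite -ler_pdivlMr.
have {du}dr : d <= r / 8 by have := nrm_ge0 u; clear -du r0 d0; nra.
have ball z (t : C) : nrm (z - z0) < d -> nrm t < 4 * s -> nrm (z + t *: u - z0) < r.
  move=> zd ts; have := nrmD (z - z0) (t *: u); rewrite addrAC nrmZ.
  have := nrm_ge0 u; have := nrm_ge0 t; clear -su dr r0 s0 zd ts; nra.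
have HBh w : nrm (w - z0) < r -> hol B w.
  by move=> wr; apply: (@holB_hol _ _ B z0 r M') => // x /H[].
have s24 (t : C) : nrm t <= 2 * s -> nrm t < 4 * s by lra.
have n0 : nrm (0 : C) < 4 * s by rewrite nrm0; lra.
have [D [nu HD]] := rootsys_disc RS.
(* Cauchy bound at the centre from the bound [M' / m] of the quotient on the contour. *)
pose A := 8 / nrm (c0 R) * (M' / m).
have gen z : nrm (z - z0) < d -> D z != 0 -> nrm (B z) <= A * nrm (P z).
  move=> zd; have [_ _ _ ->] := HD z zd => /eqP sz.
  have [_ Hr [U [HU U0 HP']]] := Hrts z zd.
  have [|th [Hth _]] := root_cluster RS zd.
    by rewrite sz; apply: germ_imp (germ_lt zd) => w wd; have [] := HD w wd.
  have rs4 a : a \in rts z -> nrm a < 4 * s by move=> /Hr; lra.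
  have dB : dD (fun t : C => B (z + t *: u)) (4 * s).
    by move=> t ts; apply: hol_line; apply: HBh; exact: ball.
  have [|g Hg Eg] := @dD_div_list _ _ (4 * s) (rts z) U dB HU rs4.
    move=> a ar; have [S E] := Hth a ar; have [_ /(_ _ _ S E)[C1 /(germ_line u)[q q0 Hq]]] := H _ (ball z a zd (rs4 a ar)).
    have a4 := rs4 a ar.
    exists C1, (Num.min q (4 * s - nrm a)) => [|t]; first by rewrite lt_min q0; lra.
    rewrite lt_min => /andP[tq ta].
    have ts : nrm t < 4 * s by have := nrm_sub_ge t a; lra.
    by rewrite -HP' //; have := Hq _ tq; rewrite -addrA -scalerDl [a + _]addrC subrK.
  pose q (t : C) := g t / U t.
  have Hq t : nrm t <= 2 * s -> derivable q t 1.
    move=> ts; have tr := s24 t ts.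
    have := derivableMf (Hg t tr) (@derivableVf _ U t (U0 t tr) (HU t tr)); exact.
  have Eq (t : C) : nrm t < 4 * s -> B (z + t *: u) = q t * P (z + t *: u).
    by move=> ts; rewrite Eg HP' // /q mulrCA divfK ?U0.
  have := Eq 0 n0; rewrite scale0r addr0 => ->; rewrite nrmM; apply: ler_wpM2r; first exact: nrm_ge0.
  apply: (cauchy0_bound s0 Hq) => t t1 t2; have ts := s24 t t2.
  have Pm := Hm z t zd t1 ts; have Pp : 0 < nrm (P (z + t *: u)) by exact: lt_le_trans Pm.
  have [[b _] _] := H _ (ball z t zd ts); rewrite Eq // nrmM in b.
  rewrite ler_pdivlMr //; apply: le_trans b; apply: ler_wpM2l => //; exact: nrm_ge0.
apply: (@hol_div_le _ _ P B z0 A HP nz HB); exists d => // z zd.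
have [_ nD _ _] := HD z zd; have hP : hol P z.
  by have [] := HM z 0 zd n0; rewrite scale0r addr0.
apply: (le_dense _ hP nD); first by apply: HBh; have := ball z 0 zd n0; rewrite scale0r addr0.
by apply: germ_imp (germ_lt zd) => w; exact: gen.
Qed.

End Generic.

(** * Hypersurfaces and clopen parts of the regular locus *)

Section Hypersurface.
Variable R : realType.
Local Notation C := (Cplx R).
Variable V : normedModType C.
Implicit Types (f P B th : V -> C) (z v u x y : V) (A L E : V -> Prop).

Definition hyps A : Prop := forall z, exists g,
  [/\ hol g z, ~ germ z (fun w => g w = 0) & germ z (fun w => A w <-> g w = 0)].
Definition regp A x th u : Prop := SH x th u /\ germ x (fun w => A w <-> th w = 0).
Definition Reg A x : Prop := exists th u, regp A x th u.
(** [L] is open and closed in the regular locus of [A], that is, a union of its quasi-components. *)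
Definition LC A L : Prop := (forall x, L x -> Reg A x) /\
  forall x, Reg A x -> germ x (fun w => A w -> (L w <-> L x)).
Definition clos L z : Prop := forall r : R, 0 < r -> exists w, nrm (w - z) < r /\ L w.

Lemma Reg_in A x : Reg A x -> A x.
Proof. by move=> [th [u [[_ t0 _] E]]]; apply/(germ_self E). Qed.

Lemma SH_open x th u : SH x th u -> germ x (fun w => th w = 0 -> SH w th u).
Proof.
move=> [Ht t0 [r r0 Hr]].
have xr : nrm (x - x) < r / 2 by rewrite subrr nrm0; lra.
apply: germ_imp (germ_and (hol_open Ht) (germ_lt xr)) => w [Hw wr] tw; split => //.
exists (r / 2) => [|y t yr tr]; first lra.
by apply: Hr; have := nrm_le_sub y w x; lra.
Qed.

Lemma Reg_open A x : Reg A x -> germ x (fun w => A w -> Reg A w).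
Proof.
move=> [th [u [S E]]]; apply: germ_imp (germ_and (SH_open S) (germ_open E)) => w [Sw Ew] Aw.
by exists th, u; split => //; apply: Sw; apply/(germ_self Ew).
Qed.

Lemma clos_sub L z : L z -> clos L z.
Proof. by move=> Lz r r0; exists z; rewrite subrr nrm0. Qed.

Lemma clos_germ L z Q : clos L z -> germ z Q -> exists w, L w /\ Q w.
Proof. by move=> cl [r r0 H]; have [w [wr Lw]] := cl r r0; exists w; split => //; exact: H. Qed.

Lemma closP L z : (forall Q, germ z Q -> exists w, L w /\ Q w) -> clos L z.
Proof.
move=> H r r0; have zr : nrm (z - z) < r by rewrite subrr nrm0.
by have [w [Lw wr]] := H _ (germ_lt zr); exists w.
Qed.

Lemma clos_clos L z : clos (clos L) z -> clos L z.
Proof.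
by move=> cl; apply: closP => Q /germ_open gQ; have [w [Lw Qw]] := clos_germ cl gQ; exact: clos_germ Lw Qw.
Qed.

Lemma clos_le L L' z : (forall w, L w -> L' w) -> clos L z -> clos L' z.
Proof. by move=> H cl; apply: closP => Q /(clos_germ cl)[w [Lw Qw]]; exists w; split => //; exact: H. Qed.

Lemma hyps_notin A z : hyps A -> ~ A z -> germ z (fun w => ~ A w).
Proof.
move=> /(_ z)[g [Hg _ E]] nA; have gz : g z != 0 by apply/eqP => h; apply: nA; apply/(germ_self E).
by apply: germ_imp (germ_and E (hol_neq0 Hg gz)) => w [Ew /eqP gw] /Ew.
Qed.

Lemma hyps_closed A z : hyps A -> clos A z -> A z.
Proof.
move=> HA cl; apply: contrapT => nA; have [w [Aw nAw]] := clos_germ cl (hyps_notin HA nA).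
exact: nAw.
Qed.

(** The projection [w + th w *: u] sends a full ball continuously to regular points near [x] and
    fixes the points of [A]. It carries connectedness and the identity theorem from balls over to
    [A]. *)
Lemma reg_chart A x th u (rho : R) : regp A x th u -> 0 < rho -> exists2 r : R, 0 < r & r <= rho /\
  forall w, nrm (w - x) < r -> [/\ hol th w, nrm (w + th w *: u - x) < rho,
    Reg A (w + th w *: u), (A w -> th w = 0) & forall e : R, 0 < e ->
      exists2 d : R, 0 < d & forall y, nrm (y - w) < d -> nrm (y + th y *: u - (w + th w *: u)) < e].
Proof.
move=> [S E] rho0; have [Ht t0 [r r0 Hr]] := S.
have RA : Reg A x by exists th, u.
have [q q0 Hq] := germ_and (Reg_open RA) E.
have u1 : 0 < nrm u + 1 by have := nrm_ge0 u; lra.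
pose m := Num.min rho q; have m0 : 0 < m by rewrite /m lt_min rho0.
have mr : m <= rho by rewrite /m ge_min lexx.
have mq : m <= q by rewrite /m ge_min lexx orbT.
pose e1 := Num.min r (m / 2 / (nrm u + 1)).
have e10 : 0 < e1 by rewrite /e1 lt_min r0 !divr_gt0.
have e1r : e1 <= r by rewrite /e1 ge_min lexx.
have e1m : e1 * (nrm u + 1) <= m / 2 by rewrite -ler_pdivlMr // /e1 ge_min lexx orbT.
clearbody e1 m.
have [d1 d10 Hd1] := germ_and (hol_open Ht) (hol_cont Ht e10).
pose d := Num.min (Num.min d1 r) (m / 2).
have d0 : 0 < d by rewrite /d !lt_min d10 r0 divr_gt0.
have dd1 : d <= d1 by rewrite /d !ge_min lexx.
have dr : d <= r by rewrite /d !ge_min lexx orbT.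
have dm : d <= m / 2 by rewrite /d ge_min lexx orbT.
clearbody d; exists d => //; split; first lra.
move=> w wd; have [hw] := Hd1 w (lt_le_trans wd dd1); rewrite t0 subr0 => te.
have near : nrm (w + th w *: u - x) < m.
  have := nrmD (w - x) (th w *: u); rewrite addrAC nrmZ.
  have := nrm_ge0 u; have := nrm_ge0 (th w); clear -e1m wd dm te e10; nra.
have tg : th (w + th w *: u) = 0.
  by rewrite Hr ?subrr //; [exact: lt_le_trans wd dr|exact: lt_le_trans te e1r].
have [RAg Eg] := Hq _ (lt_le_trans near mq).
have dq : d <= q by lra.
have [_ Ew] := Hq w (lt_le_trans wd dq).
split => //; [exact: lt_le_trans near mr|by apply: RAg; apply/Eg|by move/Ew|].
move=> e e0; have e20 : 0 < e / 2 / (nrm u + 1) by rewrite !divr_gt0.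
have [d2 d20 Hd2] := hol_cont hw e20.
exists (Num.min d2 (e / 2)) => [|y]; first by rewrite lt_min d20 divr_gt0.
rewrite lt_min => /andP[/Hd2]; rewrite ltr_pdivlMr // => h yw.
rewrite opprD addrACA -scalerBl; have := nrmD (y - w) ((th y - th w) *: u); rewrite nrmZ.
by have := nrm_ge0 (th y - th w); lra.
Qed.

(** The pull-back of [L] by the projection of [reg_chart] is locally constant on a ball, hence
    constant. The radius is chosen before [L], which makes arbitrary intersections of clopen sets
    clopen. *)
Lemma LC_ball A x th u : regp A x th u -> exists2 r : R, 0 < r & forall L, LC A L ->
  forall w, nrm (w - x) < r -> A w -> (L w <-> L x).
Proof.
move=> RA; have [r r0 [_ H]] := reg_chart RA ltr01; exists r => // L [L1 L2] w wr Aw.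
pose Q y := L (y + th y *: u).
have xr : nrm (x - x) < r by rewrite subrr nrm0.
have Ax : A x by apply: Reg_in; exists th, u.
have QE y : nrm (y - x) < r -> A y -> (Q y <-> L y).
  by move=> yr Ay; rewrite /Q; have [_ _ _ /(_ Ay) -> _] := H y yr; rewrite scale0r addr0.
have K : forall a b, nrm (a - x) < r -> nrm (b - x) < r -> Q a -> Q b.
  apply: clopen_ball => y yr; have [_ _ Ry _ cy] := H y yr.
  have [e e0 He] := L2 _ Ry; have [d d0 Hd] := cy e e0.
  have yr' : 0 < r - nrm (y - x) by lra.
  exists (Num.min d (r - nrm (y - x))) => [|a b]; first by rewrite lt_min d0.
  rewrite !lt_min => /andP[ad ar] /andP[bd br].
  have Aa c : nrm (c - y) < r - nrm (y - x) -> A (c + th c *: u).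
    move=> cr; have [|_ _ Rc _ _] := H c; last exact: Reg_in.
    by have := nrm_le_sub c y x; lra.
  by rewrite /Q (He _ (Hd a ad) (Aa a ar)) (He _ (Hd b bd) (Aa b br)).
split => h; first by apply/(QE x) => //; apply: (K w x) => //; apply/QE.
by apply/(QE w) => //; apply: (K x w) => //; apply/QE.
Qed.

(** At a zero of [D] the product is O(|D|^2) because [G] is bounded, so its derivatives exist there
    and vanish. *)
Lemma hol_sq_ext (D G : V -> C) z0 (d : R) : (forall z, nrm (z - z0) < d -> hol D z) ->
  (forall z, nrm (z - z0) < d -> D z != 0 -> hol G z) ->
  (forall z, nrm (z - z0) < d -> nrm (G z) <= 1) ->
  forall z, nrm (z - z0) < d -> hol (fun z => if D z == 0 then 0 else D z ^+ 2 * G z) z.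
Proof.
move=> HD HG HM z zd; pose B z := if D z == 0 then 0 else D z ^+ 2 * G z.
have bB w : nrm (w - z0) < d -> nrm (B w) <= nrm (D w) ^+ 2.
  move=> wd; rewrite /B; case: eqP => _; first by rewrite nrm0 exprn_ge0 // nrm_ge0.
  rewrite nrmM nrmX -{2}[_ ^+ 2]mulr1; apply: ler_wpM2l; [by rewrite exprn_ge0 // nrm_ge0|exact: HM].
have [M HM'] := HD z zd; exists (M ^+ 2).
apply: germ_imp (germ_and HM' (germ_lt zd)) => w [[Dw _] wd]; split.
  by apply: le_trans (bB w wd) _; rewrite lerXn2r ?nnegrE ?nrm_ge0 //; apply: le_trans Dw; exact: nrm_ge0.
move=> v; have [Dw0|Dw0] := eqVneq (D w) 0; last first.
  apply: hol_derivable; apply: hol_ext (holM (holX 2 (HD w wd)) (HG w wd Dw0)).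
  by apply: germ_imp (hol_neq0 (HD w wd) Dw0) => y /negPf Dy; rewrite Dy.
suff [] : derivable B w v /\ 'D_v B w = 0 by [].
apply/derivable_nrm => e e0.
have [K1 K10 HK] := (proj1 (@derivable_nrm _ _ D w v ('D_v D w))
  (conj (hol_derivable v (HD w wd)) erefl) 1 ltr01).
have n0 := nrm_ge0 ('D_v D w).
have n1 : 0 < (nrm ('D_v D w) + 1) ^+ 2 by rewrite exprn_gt0 //; lra.
have [r r0 Hr] := germ_line v (germ_lt wd).
exists (Num.min (Num.min K1 r) (e / (nrm ('D_v D w) + 1) ^+ 2)) => [|h].
  by rewrite !lt_min K10 r0 divr_gt0.
rewrite !lt_min ltr_pdivlMr // => /andP[/andP[hK hr] he].
have -> : B w = 0 by rewrite /B Dw0 eqxx.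
rewrite mulr0 !subr0; apply: le_trans (bB _ (Hr h hr)) _.
have := HK h hK; rewrite Dw0 subr0 mul1r => h1.
have h2 : nrm (D (w + h *: v)) <= (nrm ('D_v D w) + 1) * nrm h.
  have := nrmD (D (w + h *: v) - h * 'D_v D w) (h * 'D_v D w); rewrite subrK nrmM; lra.
have hh := nrm_ge0 h; have dd := nrm_ge0 (D (w + h *: v)).
have : nrm (D (w + h *: v)) ^+ 2 <= ((nrm ('D_v D w) + 1) * nrm h) ^+ 2.
  by rewrite lerXn2r ?nnegrE ?mulr_ge0 ?addr_ge0.
move=> h3; apply: le_trans h3 _; rewrite exprMn [nrm h ^+ 2]expr2 mulrA; apply: ler_wpM2r => //.
by rewrite mulrC; exact: ltW.
Qed.
End Hypersurface.

(** * Closures of clopen parts are analytic *)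

Section ClosureAnalytic.
Variable R : realType.
Local Notation C := (Cplx R).
Variable V : normedModType C.
Implicit Types (f P B th : V -> C) (z v u x y : V) (A L E : V -> Prop).

Lemma rootsys_dir P z0 u k s d rts x : rootsys P z0 u k s d rts -> nrm (x - z0) < d ->
  exists k', ordline P x u k'.
Proof.
move=> RS xd; have [[s0 d0] _ [M HM] _ _] := RS.
have n0 : nrm (0 : C) < 4 * s by rewrite nrm0; lra.
have [hP _] := HM x 0 xd n0; rewrite scale0r addr0 in hP.
apply: (ordline_dir hP) => r r0; have [e e0 He] := sep_seq (0 :: rts x).
pose q := Num.min (Num.min r s) e.
have q0 : 0 < q by rewrite /q !lt_min r0 s0.
have qr : q <= r by rewrite /q !ge_min lexx.
have qs : q <= s by rewrite /q !ge_min lexx orbT.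
have qe : q <= e by rewrite /q ge_min lexx orbT.
clearbody q; have nq : nrm (rc (q / 2)) = q / 2 by rewrite nrm_rc ger0_norm; lra.
exists (rc (q / 2)); split; first by rewrite nq; lra.
rewrite (rts_root RS xd); last by rewrite nq; lra.
apply/negP => tr; have := He (rc (q / 2)) 0; rewrite mem_head inE tr orbT subr0 -nrm_gt0 nq.
by move=> /(_ isT isT ltac:(lra)); lra.
Qed.

(* Near any zero of P, some nearby zero lies over the set where D does not vanish. *)
Lemma rootsys_generic_zero P z0 u k s d rts (D : V -> C) nu x (Q : V -> Prop) :
  rootsys P z0 u k s d rts -> nrm (x - z0) < d -> P x = 0 ->
  (forall z, nrm (z - z0) < d -> (D z != 0) = (size (undup (rts z)) == nu)) ->
  ~ germ x (fun w => D w = 0) -> germ x Q ->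
  exists y, [/\ P y = 0, D y != 0 & Q y].
Proof.
move=> RS xd Px HD nD gQ; have [k' o] := rootsys_dir RS xd.
have k'0 := ordline_gt0 o Px; have [[s0 d0] _ [M HM] _ _] := RS.
have n0 : nrm (0 : C) < 4 * s by rewrite nrm0; lra.
have [hP _] := HM x 0 xd n0; rewrite scale0r addr0 in hP.
have [q q0 Hq] := germ_and gQ (germ_lt xd).
have u1 : 0 < nrm u + 1 by have := nrm_ge0 u; lra.
have [|s' [d' [rts' [se de RS']]]] := roots_near hP o (e := Num.min s (q / 2 / (nrm u + 1))).
  by rewrite lt_min s0 !divr_gt0.
have [[s'0 d'0] _ _ H' _] := RS'.
move: se; rewrite le_min ler_pdivlMr // => /andP[ss' su].
have xx : nrm (x - x) < Num.min d' (q / 2) by rewrite subrr nrm0 lt_min d'0 divr_gt0.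
have [z [Dz]] := nonzero_exists nD (germ_lt xx).
rewrite lt_min => /andP[zd' zq].
have [szb Hb _] := H' z zd'; move: szb Hb; case rE: (rts' z) => [|b l] szb Hb.
  by rewrite -szb in k'0.
have bs : nrm b < s' by apply: Hb; rewrite mem_head.
have Pb : P (z + b *: u) = 0.
  by apply/eqP; rewrite (rts_root RS' zd') ?rE ?mem_head //; lra.
have near : nrm (z + b *: u - x) < q.
  have := nrmD (z - x) (b *: u); rewrite addrAC nrmZ.
  have := nrm_ge0 u; have := nrm_ge0 b; clear -su zq bs; nra.
have q2 : q / 2 < q by lra.
have [Qy yd] := Hq _ near; have [_ zd] := Hq z (lt_trans zq q2).
exists (z + b *: u); split => //; rewrite HD // (size_rts_shift RS zd yd (lt_le_trans bs ss')).
by rewrite -HD.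
Qed.

(** Near a zero of a local equation lies another one with [D] nonzero, and [root_cluster] makes it
    regular. *)
Lemma Reg_dense A z Q : hyps A -> A z -> germ z Q -> exists w, Reg A w /\ Q w.
Proof.
move=> HA Az gQ; have [P [HP nz E]] := HA z.
have Pz : P z = 0 by apply/(germ_self E).
have [u [k o]] := ordline_exists HP nz.
have [s [d [rts [_ _ RS]]]] := roots_near HP o ltr01.
have [D [nu HD]] := rootsys_disc RS.
have [[s0 d0] _ _ _ _] := RS.
have zz : nrm (z - z) < d by rewrite subrr nrm0.
have [_ nD _ _] := HD z zz.
have [|y [Py Dy [Qy [Ey yd]]]] := rootsys_generic_zero RS zz Pz (D := D) (nu := nu) _ nD
  (germ_and gQ (germ_and (germ_open E) (germ_lt zz))).
  by move=> w /HD[].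
exists y; split => //; have [_ _ _] := HD y yd; rewrite Dy => /esym/eqP sy.
have [|th [Hth _]] := root_cluster RS yd.
  by rewrite sy; apply: germ_imp (germ_lt yd) => w /HD[].
have n0 : nrm (0 : C) < 4 * s by rewrite nrm0; lra.
have r0 : 0 \in rts y by rewrite -(rts_root RS yd n0) scale0r addr0 Py.
have [S E'] := Hth 0 r0; rewrite scale0r addr0 in S E'.
by exists (th 0), u; split => //; apply: germ_imp (germ_and Ey E') => w [-> ->].
Qed.

(** A local equation is the product [G] of the displacements to the points of [L] on the line
    through [z]. It is bounded, and holomorphic where [D] is nonzero, since the selected roots move
    holomorphically; [hol_sq_ext] followed by division by [D ^+ 2] extends it. At points of [L] with
    [D] nonzero the root 0 is selected, so the extension vanishes on the closure. *)
Lemma clos_analytic A L z0 : hyps A -> LC A L -> exists2 g, hol g z0 & germ z0 (fun w => clos L w <-> g w = 0).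
Proof.
move=> HA HL; have [L1 L2] := HL.
have clA w : clos L w -> A w.
  by move=> cl; apply: (hyps_closed HA); apply: clos_le cl => x /L1; exact: Reg_in.
have [Az0|nA] := pselect (A z0); last first.
  exists (fun=> 1); first exact: hol_cst.
  apply: germ_imp (hyps_notin HA nA) => w nAw; split => [/clA //|/eqP].
  by rewrite oner_eq0.
have [P [HP nz E]] := HA z0; have [r0 r00 Er] := E.
have [u [k o]] := ordline_exists HP nz.
have u1 : 0 < nrm u + 1 by have := nrm_ge0 u; lra.
have [|s [d [rts [se de RS]]]] := roots_near HP o (e := Num.min 1 (r0 / 2 / (nrm u + 1))).
  by rewrite lt_min ltr01 !divr_gt0.
have [[s0 d0] _ _ H _] := RS; have [D [nu HD]] := rootsys_disc RS.
move: se de; rewrite !le_min !ler_pdivlMr // => /andP[s1 su] /andP[_ du].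
have AP z (t : C) : nrm (z - z0) < d -> nrm t < s -> (A (z + t *: u) <-> P (z + t *: u) = 0).
  move=> zd ts; apply: Er; have := nrmD (z - z0) (t *: u); rewrite addrAC nrmZ.
  have := nrm_ge0 u; have := nrm_ge0 t; clear -su du zd ts s0 d0; nra.
have s4 (t : C) : nrm t < s -> nrm t < 4 * s by move=> ?; lra.
have n0s : nrm (0 : C) < s by rewrite nrm0.
(* Product over the distinct roots whose zero of [P] lies in [L]; it is 1 when there are none. *)
pose G z := \prod_(a <- undup (rts z) | `[< L (z + a *: u) >]) (- a).
have gen z : nrm (z - z0) < d -> D z != 0 -> germ z (fun w => (size (undup (rts w)) <= size (undup (rts z)))%N).
  move=> zd Dz; have [_ _ _] := HD z zd; rewrite Dz => /esym/eqP ->.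
  by apply: germ_imp (germ_lt zd) => w /HD[].
have HG z : nrm (z - z0) < d -> D z != 0 -> hol G z.
  move=> zd Dz; have [th [Hth Hperm]] := root_cluster RS zd (gen z zd Dz).
  pose S := undup (rts z).
  have RA a : a \in S -> regp A (z + a *: u) (th a) u.
    rewrite mem_undup => ar; have [Sa Ea] := Hth a ar; split => //.
    have [_ /(_ a ar) as_ _] := H z zd.
    have near : nrm (z + a *: u - z0) < r0.
      have := nrmD (z - z0) (a *: u); rewrite addrAC nrmZ.
      have := nrm_ge0 u; have := nrm_ge0 a; clear -su du zd as_ s0 d0; nra.
    by apply: germ_imp (germ_and Ea (germ_lt near)) => w [<- wr]; exact: Er.
  have K : germ z (fun w => forall a, a \in S -> hol (th a) (w + a *: u) /\
      (L (w + (a + th a (w + a *: u)) *: u) <-> L (z + a *: u))).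
    apply: germ_seq => a aS; have rg := RA a aS.
    have Rx : Reg A (z + a *: u) by exists (th a), u.
    have [e e0 He] := L2 _ Rx; have [r r0' [_ Hr]] := reg_chart rg e0.
    exists r; first exact: r0'.
    move=> w wr; have wr' : nrm (w + a *: u - (z + a *: u)) < r by rewrite opprD addrACA subrr addr0.
    have [hw hn hR _ _] := Hr _ wr'; split; first exact: hw.
    rewrite scalerDl addrA; exact: (He _ hn (Reg_in hR)).
  have eqG : germ z (fun w => \prod_(a <- S | `[< L (z + a *: u) >]) (- (a + th a (w + a *: u))) = G w).
    apply: germ_imp (germ_and Hperm K) => w [pw Kw].
    rewrite /G (perm_big _ pw) /= big_map [RHS]big_seq_cond [LHS]big_seq_cond; apply: eq_bigl => a.
    case aS: (a \in S) => //=; have [_ e] := Kw a aS; by apply/asboolP/asboolP => /e.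
  apply: (hol_ext eqG).
  have : hol (fun w => \prod_(a <- S | (a \in S) && `[< L (z + a *: u) >]) (- (a + th a (w + a *: u)))) z.
    apply: hol_prod => a /andP[aS _]; apply: holN; apply: holD; first exact: hol_cst.
    by apply: hol_shift; have [] := germ_self K a aS.
  by apply: hol_ext; apply: germ_all => w; rewrite [RHS]big_seq_cond.
have MG z : nrm (z - z0) < d -> nrm (G z) <= 1.
  move=> zd; rewrite /G; have [_ Hr _] := H z zd; rewrite big_seq_cond.
  apply: (big_ind (fun c : C => nrm c <= 1)) => [|x y xl yl|a /andP[ar _]]; first by rewrite nrm1.
    by rewrite nrmM -[1]mulr1; apply: ler_pM; rewrite ?nrm_ge0.
  rewrite nrmN; rewrite mem_undup in ar; have := Hr a ar; lra.
have HDh z : nrm (z - z0) < d -> hol D z by move=> /HD[].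
have z00 : nrm (z0 - z0) < d by rewrite subrr nrm0.
have HB := hol_sq_ext HDh HG MG z00.
have [_ nD0 _ _] := HD z0 z00.
have nD2 : ~ germ z0 (fun w => D w ^+ 2 = 0).
  by move=> K; apply: nD0; apply: germ_imp K => w /eqP; rewrite expf_eq0 => /eqP.
have [|g Hg Eg] := @hol_div_le _ _ (fun w => D w ^+ 2) _ z0 1 (holX 2 (HDh _ z00)) nD2 HB.
  apply: germ_imp (germ_lt z00) => w wd; case: eqP => [->|_]; first by rewrite nrm0 mulr_ge0 ?nrm_ge0.
  by rewrite nrmM mulrC; apply: ler_wpM2r; [exact: nrm_ge0|exact: MG].
exists g => //; have gG : germ z0 (fun w => nrm (w - z0) < d /\ (D w != 0 -> g w = G w)).
  apply: germ_imp (germ_and Eg (germ_lt z00)) => w [e wd]; split => // Dw.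
  move: e; rewrite (negPf Dw) mulrC => /(mulIf _) -> //; by rewrite expf_neq0.
apply: germ_imp (germ_and (germ_open gG) (hol_open Hg)) => w [gw hw].
have [wd _] := germ_self gw; have [_ nDw _ _] := HD w wd.
split => [cl|g0].
  apply/eqP/negPn/negP => gw0.
  have [x [Lx [gx xd]]] := clos_germ cl (germ_and (germ_open (germ_and (hol_neq0 hw gw0) gw)) (germ_lt wd)).
  have Rx := L1 x Lx; have Ax := Reg_in Rx.
  have Px : P x = 0 by have := AP x 0 xd n0s; rewrite scale0r addr0 => <-.
  have [_ nDx _ _] := HD x xd.
  have [|y [Py Dy [Ly [[gy [yd Gy]]]]]] := rootsys_generic_zero RS xd Px (D := D) (nu := nu) _ nDx
    (germ_and (L2 x Rx) gx); first by move=> w' /HD[].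
  have Ay : A y by have := AP y 0 yd n0s; rewrite scale0r addr0 => ->.
  have {}Ly : L y by apply/(Ly Ay).
  move/eqP: gy; apply; rewrite Gy // /G; apply/eqP; rewrite prodf_seq_eq0; apply/hasP; exists 0.
    by rewrite mem_undup -(rts_root RS yd (s4 0 n0s)) scale0r addr0 Py.
  by rewrite scale0r addr0 oppr0 eqxx andbT; apply/asboolP.
(* Conversely, where the extension vanishes, |G z| < m^k at nearby [z]; with at most [k] factors
   some selected root is below [m], and it gives a point of [L] nearby. *)
apply: closP => Q [r r0' HQ].
pose m := Num.min 1 (r / 2 / (nrm u + 1)); have m0 : 0 < m by rewrite /m lt_min ltr01 !divr_gt0.
have m1 : m <= 1 by rewrite /m ge_min lexx.
have mu : m * (nrm u + 1) <= r / 2 by rewrite -ler_pdivlMr // /m ge_min lexx orbT.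
clearbody m; have mk : 0 < m ^+ k by rewrite exprn_gt0.
have ww : nrm (w - w) < r / 2 by rewrite subrr nrm0 divr_gt0.
have [z [Dz [zg [[zd /(_ Dz) gz] zw]]]] := nonzero_exists nDw
  (germ_and (hol_cont hw mk) (germ_and gw (germ_lt ww))).
move: zg; rewrite g0 subr0 gz => Gm.
have [a [ar La am]] : exists a, [/\ a \in rts z, L (z + a *: u) & nrm a < m].
  apply: contrapT => no; move: Gm; rewrite ltNge => /negP; apply.
  have [sz _ _] := H z zd.
  have szk : (size (undup (rts z)) <= k)%N by rewrite -sz size_undup.
  apply: le_trans (ler_wiXn2l (ltW m0) m1 szk) _; rewrite /G.
  have : forall a, a \in undup (rts z) -> L (z + a *: u) -> m <= nrm a.
    move=> a; rewrite mem_undup => ar La; rewrite leNgt; apply/negP => am; apply: no; by exists a.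
  elim: (undup (rts z)) => [|a l IH] Hl; first by rewrite big_nil nrm1 expr0.
  have {}IH := IH (fun b bl => Hl b ltac:(by rewrite inE bl orbT)).
  rewrite big_cons; case: asboolP => La /=.
    rewrite nrmM nrmN exprS; apply: ler_pM; rewrite ?exprn_ge0 ?(ltW m0) //.
    by apply: Hl => //; rewrite mem_head.
  by apply: le_trans IH; rewrite exprS ler_piMl // exprn_ge0 // ltW.
exists (z + a *: u); split => //; apply: HQ.
have := nrmD (z - w) (a *: u); rewrite addrAC nrmZ.
have := nrm_ge0 u; have := nrm_ge0 a; clear -mu am zw m0; nra.
Qed.
End ClosureAnalytic.

(** * Irreducible components of a hypersurface *)

Section Components.
Variable R : realType.
Local Notation C := (Cplx R).
Variable V : normedModType C.
Implicit Types (f P B th : V -> C) (z v u x y : V) (A L E : V -> Prop).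

Definition ana E : Prop := forall z, exists k (g : 'I_k -> V -> C),
  (forall j, hol (g j) z) /\ germ z (fun w => E w <-> forall j, g j w = 0).

(** Quasi-component of [x0] in the regular locus, the intersection of the clopen parts containing
    it; [comp_LC] shows that it is clopen itself. *)
Definition qcomp A x0 x : Prop := Reg A x /\ forall L, LC A L -> L x0 -> L x.

Lemma LC_compl A L : LC A L -> LC A (fun x => Reg A x /\ ~ L x).
Proof.
move=> [L1 L2]; split => [x [] //|x Rx].
apply: germ_imp (germ_and (L2 x Rx) (Reg_open Rx)) => w [Lw Rw] Aw; have {}Lw := Lw Aw; have {}Rw := Rw Aw.
by split => -[_ nL]; split => // h; apply: nL; apply/Lw.
Qed.

Lemma comp_LC A x0 : LC A (qcomp A x0).
Proof.
split => [x [] //|x Rx]; have [th [u rg]] := Rx; have [r r0 H] := LC_ball rg.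
have xr : nrm (x - x) < r by rewrite subrr nrm0.
apply: germ_imp (germ_and (germ_lt xr) (Reg_open Rx)) => w [wr Rw] Aw.
by split => -[_ K]; split => [|L HL Lx0]; auto; apply/(H L HL w wr Aw); exact: K.
Qed.

(** The set is open by definition; it is closed by the identity theorem for the equations of [E],
    pulled back through [reg_chart]. *)
Lemma inner_LC A E : ana E -> LC A (fun x => Reg A x /\ germ x (fun w => A w -> E w)).
Proof.
move=> HE; split => [x [] //|x Rx]; have [th [u rg]] := Rx.
have [k [g [Hg Eg]]] := HE x.
have [e e0 He] := germ_and Eg (germ_fin (fun j => hol_open (Hg j))).
have [r r0 [re Hr]] := reg_chart rg e0.
have xr : nrm (x - x) < r by rewrite subrr nrm0.
have [Ex|nEx] := pselect (germ x (fun w => A w -> E w)).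
  by apply: germ_imp (germ_and (germ_open Ex) (Reg_open Rx)) => w [Ew Rw] Aw; split => _; split => //; exact: Rw.
apply: germ_imp (germ_lt xr) => w wr Aw; split => [[_ Hx]|[_ /nEx//]]; case: nEx.
apply: germ_imp (germ_lt xr) => y yr Ay.
have [Ey _] := He y (lt_le_trans yr re); apply/Ey => j.
have fixed a : nrm (a - x) < r -> A a -> a + th a *: u = a.
  by move=> ar Aa; have [_ _ _ /(_ Aa) -> _] := Hr a ar; rewrite scale0r addr0.
rewrite -(fixed y yr Ay).
apply: (@hol_zero_ball _ _ (fun a => g j (a + th a *: u)) x r _ w wr _ y yr).
  move=> a ar; have [ha na _ _ _] := Hr a ar; have [_ hg] := He _ na.
  exact: (hol_graph (hg j) ha).
have [q q0 Hq] := Hx; have [_ _ _ _ /(_ q q0)[d d0 Hd]] := Hr w wr.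
apply: germ_imp (germ_and (germ_lt wr) _) => [a [ar]|]; last by exists d; [exact: d0|exact: Hd].
rewrite (fixed w wr Aw) => aq; have [_ na Ra _ _] := Hr a ar.
have Ea := Hq _ aq (Reg_in Ra); have [Ea' _] := He _ na.
by move: j; apply/Ea'.
Qed.

Lemma ana_clos A L : hyps A -> LC A L -> ana (clos L).
Proof.
move=> HA HL z; have [g Hg E] := clos_analytic z HA HL; exists 1%N, (fun=> g); split => //.
by apply: germ_imp E => w ->; split => [h _|/(_ ord0)].
Qed.

Lemma ana_closed E z : ana E -> clos E z -> E z.
Proof.
move=> /(_ z)[k [g [Hg Eg]]] cl; apply/(germ_self Eg) => j; apply/eqP/negPn/negP => gz.
have [w [Ew [Eg' /eqP]]] := clos_germ cl (germ_and Eg (hol_neq0 (Hg j) gz)).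
by apply; move: (proj1 Eg' Ew j).
Qed.

Lemma anaI E E' : ana E -> ana E' -> ana (fun w => E w /\ E' w).
Proof.
move=> H H' z; have [k [g [Hg Eg]]] := H z; have [k' [g' [Hg' Eg']]] := H' z.
exists (k + k')%N, (fun j w => match fintype.split j with inl i => g i w | inr i => g' i w end); split.
  by move=> j; case: (fintype.split j).
apply: germ_imp (germ_and Eg Eg') => w [-> ->]; split => [[h h'] j|h]; first by case: (fintype.split j).
split => j; first by have := h (lshift k' j); rewrite -[lshift k' j]/(fintype.unsplit (inl j)) fintype.unsplitK.
by have := h (rshift k j); rewrite -[rshift k j]/(fintype.unsplit (inr j)) fintype.unsplitK.
Qed.

Section Component.
Variables (A : V -> Prop) (x0 : V).
Hypotheses (HA : hyps A) (Rx0 : Reg A x0).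

Let K := qcomp A x0.
Let HK : LC A K := comp_LC A x0.

Lemma comp_self : K x0. Proof. by split. Qed.

Lemma comp_near : germ x0 (fun w => A w -> K w).
Proof.
have [_ H] := HK; apply: germ_imp (H x0 Rx0) => w e /e ->; exact: comp_self.
Qed.

Lemma comp_sub w : clos K w -> A w.
Proof. by move=> cl; apply: (hyps_closed HA); apply: clos_le cl => x [/Reg_in]. Qed.

Lemma comp_dichotomy L : LC A L -> (forall x, K x -> L x) \/ ~ L x0.
Proof. by move=> HL; have [h|] := pselect (L x0); [left => x [_]; apply|right]. Qed.

(** By [inner_LC] one of the two sets contains all of [K] unless neither contains [A] near [x0]. In
    that case an equation of [E1] and one of [E2] pull back to nonzero germs with zero product,
    against [hol_mul_nonzero]. *)
Lemma comp_irreducible E1 E2 : ana E1 -> ana E2 -> (forall w, clos K w <-> E1 w \/ E2 w) ->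
  (forall w, clos K w -> E1 w) \/ (forall w, clos K w -> E2 w).
Proof.
move=> H1 H2 HE; have in_E E : ana E -> (forall x, K x -> Reg A x /\ germ x (fun w => A w -> E w)) ->
    forall w, clos K w -> E w.
  move=> anE h w cl; apply: (ana_closed anE); apply: clos_le cl => x Kx.
  have [Rx /germ_self] := h x Kx; apply; exact: Reg_in.
have [/(in_E _ H1)|n1] := comp_dichotomy (inner_LC A H1); first by left.
have [/(in_E _ H2)|n2] := comp_dichotomy (inner_LC A H2); first by right.
exfalso; have [th [u rg]] := Rx0.
have [k1 [g1 [Hg1 Eg1]]] := H1 x0; have [k2 [g2 [Hg2 Eg2]]] := H2 x0.
have [e e0 He] := germ_and (germ_and Eg1 Eg2) (germ_and (germ_and (germ_fin (fun j => hol_open (Hg1 j)))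
  (germ_fin (fun j => hol_open (Hg2 j)))) comp_near).
have [r r0 [re Hr]] := reg_chart rg e0.
have xr : nrm (x0 - x0) < r by rewrite subrr nrm0.
have gam (g : V -> C) : (forall w, nrm (w - x0) < e -> hol g w) -> hol (fun w => g (w + th w *: u)) x0.
  by move=> hg; have [ha na _ _ _] := Hr x0 xr; exact: (hol_graph (hg _ na) ha).
have nz E (k : nat) (g : 'I_k -> V -> C) : ~ (Reg A x0 /\ germ x0 (fun w => A w -> E w)) ->
    (forall w, nrm (w - x0) < e -> (E w <-> forall j, g j w = 0)) ->
    exists j, ~ germ x0 (fun w => g j (w + th w *: u) = 0).
  move=> nE Eg; apply: contrapT => no; apply: nE; split => //.
  have all0 j : germ x0 (fun w => g j (w + th w *: u) = 0) by apply: contrapT => n; apply: no; exists j.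
  apply: germ_imp (germ_and (germ_lt xr) (germ_fin all0)) => w [wr w0] Aw.
  apply/Eg; first exact: lt_le_trans wr re.
  by move=> j; have := w0 j; have [_ _ _ /(_ Aw) -> _] := Hr w wr; rewrite scale0r addr0.
have [j1 nj1] := nz E1 k1 g1 n1 (fun w wr => proj1 (proj1 (He w wr))).
have [j2 nj2] := nz E2 k2 g2 n2 (fun w wr => proj2 (proj1 (He w wr))).
have h1 : hol (fun w => g1 j1 (w + th w *: u)) x0 by apply: gam => w /He[_ [[/(_ j1)]]].
have h2 : hol (fun w => g2 j2 (w + th w *: u)) x0 by apply: gam => w /He[_ [[_ /(_ j2)]]].
apply: (hol_mul_nonzero h1 h2 nj1 nj2); apply: germ_imp (germ_lt xr) => w wr.
have [_ nw Rw _ _] := Hr w wr; have [[e1 e2] [_ Kw]] := He _ nw.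
have [/e1 ->|/e2 ->] := proj1 (HE _) (clos_sub (Kw (Reg_in Rw))); first by rewrite mul0r.
by rewrite mulr0.
Qed.

(** As regular points are dense, [E] is covered by the closures of [K] and of the complementary
    clopen part. The second cannot contain [E], since [x0] is not in it. *)
Lemma comp_maximal E : ana E ->
  (forall E1 E2, ana E1 -> ana E2 -> (forall w, E w <-> E1 w \/ E2 w) ->
     (forall w, E w -> E1 w) \/ (forall w, E w -> E2 w)) ->
  (forall w, clos K w -> E w) -> (forall w, E w -> A w) -> forall w, E w -> clos K w.
Proof.
move=> anE irr KE EA; pose L x := Reg A x /\ ~ K x.
have HL : LC A L := LC_compl HK.
have dec w : A w -> clos K w \/ clos L w.
  move=> Aw; have : clos (Reg A) w by apply: closP => Q gQ; exact: Reg_dense gQ.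
  move=> cl; apply: contrapT => /not_orP[nK nL].
  have far L' : ~ clos L' w -> germ w (fun x => ~ L' x).
    move=> n; apply: contrapT => ng; apply: n => r r0; apply: contrapT => no; apply: ng.
    by exists r => // x xr Lx; apply: no; exists x.
  have [x [Rx [xK xL]]] := clos_germ cl (germ_and (far _ nK) (far _ nL)).
  by apply: xL.
have [w|h|h] := irr _ _ (anaI anE (ana_clos HA HK)) (anaI anE (ana_clos HA HL)).
- split => [Ew|[[]|[]] //]; by have [h|h] := dec w (EA w Ew); [left|right].
- by move=> w /h[].
exfalso; have [_ cl] := h x0 (KE x0 (clos_sub comp_self)).
have [w [[Rw nKw] Kw]] := clos_germ cl comp_near.
by apply: nKw; apply: Kw; exact: Reg_in.
Qed.
End Component.
End Components.

(** * Terms of the pull-back divisor at smooth points *)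

Section Divisor.
Variables (R : realType) (p : nat).
Local Notation C := (Cplx R).
Local Notation V := 'rV[C]_p.
Implicit Types (z v u x y : V) (A E : set V).

Lemma analytic_setE E : analytic_set E <-> ana E.
Proof.
split=> H z; have [k [g [Hg Eg]]] := H z; exists k, g.
  by split => [j|]; [apply/holomorphic_nearE|apply/germ_near].
by split => [j|]; [apply/holomorphic_nearE|apply/germ_near].
Qed.

Lemma comp_component A x : hyps A -> Reg A x -> irreducible_component A (clos (qcomp A x)).
Proof.
move=> HA Rx; have HK : LC A (qcomp A x) := comp_LC A x.
have anE : ana (clos (qcomp A x)) := ana_clos HA HK.
have setsub (E E1 E2 : set V) : E = E1 `|` E2 -> (forall w, E w -> E1 w) -> E = E1.
  by move=> e h; apply/seteqP; split => w; [exact: h|rewrite e; left].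
split.
- split; first by apply/analytic_setE.
    by exists x; exact: (clos_sub (comp_self Rx)).
  move=> E1 E2 /analytic_setE h1 /analytic_setE h2 e.
  have [|h|h] := comp_irreducible Rx h1 h2; first by move=> w; rewrite e.
    by left; exact: (setsub _ _ _ e h).
  by right; rewrite setUC in e; exact: (setsub _ _ _ e h).
- by move=> w; exact: (comp_sub HA).
- move=> E [/analytic_setE hE _ irr] KE EA; apply/seteqP; split => [|w /KE //].
  apply: (comp_maximal HA Rx hE _ KE EA) => E1 E2 h1 h2 e.
  have [|E1e|E2e] := irr E1 E2 (proj2 (analytic_setE _) h1) (proj2 (analytic_setE _) h2).
  + by apply/seteqP; split => w /e.
  + by left => w; rewrite -E1e.
  + by right => w; rewrite -E2e.
Qed.

(** A germ vanishing on [E] vanishes at the projections [w + th w *: u], so [hol_div_graph] divides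
    it by [th]. *)
Lemma SH_local_equation x th u E : SH x th u -> germ x (fun w => E w <-> th w = 0) -> local_equation x E th.
Proof.
move=> [Ht t0 [r r0 Hr]] HE; split; first by apply/holomorphic_nearE.
  by apply/germ_near; apply: germ_imp HE => w e /e.
move=> g /holomorphic_nearE Hg /germ_near gE.
have xr : nrm (x - x) < r by rewrite subrr nrm0.
have u1 : 0 < nrm u + 1 by have := nrm_ge0 u; lra.
have [q q0 Hq] := germ_and gE HE.
have q2 : 0 < q / 2 / (nrm u + 1) by rewrite !divr_gt0.
have q3 : nrm (x - x) < q / 2 by rewrite subrr nrm0 divr_gt0.
have [|c Hc Ec] := @hol_div_graph R _ g th u x Hg Ht t0; last first.
  by exists c; [apply/holomorphic_nearE|apply/germ_near].
apply: germ_imp (germ_and (germ_and (germ_lt xr) (germ_lt q3)) (germ_and (hol_cont Ht r0) (hol_cont Ht q2))) => w.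
rewrite t0 subr0 => -[[wr wq] [tr tq]]; rewrite ltr_pdivlMr // in tq.
have tw : th (w + th w *: u) = 0 by rewrite Hr // subrr.
have near : nrm (w + th w *: u - x) < q.
  have := nrmD (w - x) (th w *: u); rewrite addrAC nrmZ; have := nrm_ge0 (th w); lra.
by have [h1 h2] := Hq _ near; apply: h1; apply/h2.
Qed.

Lemma divides_hol x (h g : V -> C) : divides_near x h g <->
  exists2 c : V -> C, hol c x & germ x (fun w => g w = h w * c w).
Proof.
by split=> -[c Hc Ec]; exists c; [apply/holomorphic_nearE|apply/germ_near|apply/holomorphic_nearE|apply/germ_near].
Qed.

Lemma SH_order_along x th u E (g c : V -> C) k : SH x th u -> germ x (fun w => E w <-> th w = 0) ->
  hol c x -> c x != 0 -> germ x (fun w => g w = th w ^+ k * c w) -> order_along x E g k.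
Proof.
move=> S HE Hc c0 Eg; exists th; split; first exact: SH_local_equation S HE.
  by apply/divides_hol; exists c.
move=> /divides_hol[c' Hc' Ec']; have [Ht t0 _] := S.
have nt := @SH_X_neq0 _ _ x th u k S.
have : nrm (c x - th x * c' x) <= 0 * nrm (c x).
  apply: (@le_dense _ _ (fun w => th w ^+ k) (fun w => c w - th w * c' w) c x 0 _ Hc nt).
    have := holB2 Hc (holM Ht Hc'); exact.
  apply: germ_imp (germ_and Eg Ec') => w [e1 e2] tw; move: e2; rewrite e1 exprSr -mulrA => /(mulfI tw) ->.
  by rewrite subrr nrm0 mul0r.
rewrite t0 mul0r subr0 mul0r => h; have : nrm (c x) = 0 by apply/eqP; rewrite eq_le h nrm_ge0.
by move/eqP; rewrite nrm_eq0 (negPf c0).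
Qed.

Variables (n : nat) (f : V -> proj_space R n) (H : hyperplane R n).

(** Through a regular point passes the irreducible component [clos (qcomp _ x)], which agrees with
    the whole preimage near [x] ([comp_near]); its multiplicity can therefore be read off from the
    factorization by [th]. *)
Lemma regular_term x th u i (a : 'cV[C]_n.+1) k (c : V -> C) :
  hyps (f @^-1` points_of H) -> regp (f @^-1` points_of H) x th u ->
  chart_dom i (f x) -> linear_equation H a ->
  hol c x -> c x != 0 -> germ x (fun w => (norm_coord i (f w) *m a) 0 0 = th w ^+ k * c w) ->
  exists E, pullback_divisor_term f H E k.
Proof.
move=> HA [S E] ci la Hc c0 Eg; have Rx : Reg (f @^-1` points_of H) x by exists th, u.
exists (clos (qcomp (f @^-1` points_of H) x)); split; first exact: comp_component.
exists x, i, a; split => //; first exact: (clos_sub (comp_self Rx)).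
apply: (SH_order_along S _ Hc c0 Eg).
apply: germ_imp (germ_and (comp_near Rx) E) => w [h e]; split.
  by move=> cl; apply/e; exact: (comp_sub HA cl).
by move/e/h; exact: clos_sub.
Qed.
End Divisor.

(** * Harnack's inequality for bounded zero-free functions *)

Section Harnack.
Variable R : realType.
Local Notation C := (Cplx R).

Lemma ln_near (y : R) : `|y| <= 1 / 2 -> `|ln (1 + y) - y| <= 2 * y ^+ 2.
Proof.
rewrite ler_norml => /andP[y1 y2]; have h1 : ln (1 + y) <= y by apply: le_ln1Dx; lra.
have p : 0 < 1 + y by lra.
have : ln (1 + y)^-1 <= (1 + y)^-1 - 1.
  have := @le_ln1Dx R ((1 + y)^-1 - 1); rewrite [1 + (_ - 1)]addrC subrK; apply.
  by rewrite -subr_gt0 opprK subrK invr_gt0.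
rewrite lnV ?posrE // => h2.
have h3 : (1 + y)^-1 * (1 + y) = 1 by rewrite mulVf // gt_eqF.
have h4 : 0 < (1 + y)^-1 by rewrite invr_gt0.
rewrite ler_norml; apply/andP; split; last by have := sqr_ge0 y; lra.
move: h2 h3 h4; move: ((1 + y)^-1) (ln (1 + y)) => v l h2 h3 h4.
have : v <= 2 by nra.
have -> : v = 1 - v * y by lra.
move=> hv; nra.
Qed.

Lemma ln_nrm_near (x : C) : nrm x <= 1 / 8 -> `|ln (nrm (1 + x)) - re x| <= 6 * nrm x ^+ 2.
Proof.
move=> x8; have n0 := nrm_ge0 x; have r1 := le_re x.
pose y := 2 * re x + nrm x ^+ 2.
have yE : nrm (1 + x) ^+ 2 = 1 + y.
  rewrite /y !nrmCsq reD imD [re 1](_ : _ = 1) // [im 1](_ : _ = 0) //; ring.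
have p : 0 < nrm (1 + x) by have := nrm_sub_ge (1 : C) (- x); rewrite opprK nrmN nrm1; lra.
have ya : `|y| <= 9 / 4 * nrm x.
  have := ler_normD (2 * re x) (nrm x ^+ 2); rewrite -/y normrM [`|2|]ger0_norm // [`|_ ^+ 2|]ger0_norm ?exprn_ge0 //.
  move=> h; apply: le_trans h _; clear -r1 n0 x8; rewrite expr2; nra.
have y2 : `|y| <= 1 / 2 by lra.
have := ln_near y2; rewrite -yE lnXn // mulr2n => h.
have yy : y ^+ 2 <= 81 / 16 * nrm x ^+ 2.
  have := lerXn2r 2 (normr_ge0 y) (mulr_ge0 (ltac:(lra) : (0 : R) <= 9 / 4) n0) ya.
  by rewrite real_normK ?num_real // exprMn; lra.
move: h; rewrite !ler_norml => /andP[h1 h2].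
have e : y = 2 * re x + nrm x ^+ 2 by [].
clearbody y; lra.
Qed.

Lemma cont01_bounded (phi : R -> C) : cont01 phi -> exists M, forall t, 0 <= t <= 1 -> nrm (phi t) <= M.
Proof.
move=> H; pose P a b := exists M, forall t, 0 <= t <= 1 -> a <= t <= b -> nrm (phi t) <= M.
have [||M HM] := @cousin R P.
- move=> a m b am mb [M1 H1] [M2 H2]; exists (Num.max M1 M2) => t t01 /andP[at_ tb].
  rewrite le_max; have [tm|tm] := leP t m; first by rewrite H1 // at_.
  by rewrite (H2 t) ?orbT // tb ltW.
- move=> t t01; have [d d0 Hd] := H t t01 1 ltr01; exists d => // a b a0 at_ tb b1 ab.
  exists (nrm (phi t) + 1) => s s01 /andP[as_ sb].
  have := Hd s s01 ltac:(rewrite ltr_norml; lra); have := nrm_sub_ge (phi s) (phi t); lra.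
by exists M => t t01; exact: HM.
Qed.

Section ZeroFree.
Variables (g : C -> C) (rho : R).
Hypotheses (rho0 : 0 < rho) (Hg : dD g rho) (g0 : forall w, nrm w < rho -> g w != 0)
  (g1 : forall w, nrm w < rho -> nrm (g w) <= 1).
Let q (w : C) := 'D_1 g w / g w.
(** Branch of log (g w / g 0), obtained by integrating the logarithmic derivative along the segment
    from 0; only its real part is identified ([reL]). *)
Let L (w : C) := int01 (fun t => w * q (rc t * w)).

Let seg_in (t : R) (w : C) : 0 <= t <= 1 -> nrm w < rho -> nrm (rc t * w) < rho.
Proof.
move=> t01 wr; rewrite nrmM nrm_rc ger0_norm; last by case/andP: t01.
by have := nrm_ge0 w; nra.
Qed.

Let hq w : nrm w < rho -> hol q w.
Proof. by move=> wr; have hg := dD_hol Hg wr; exact: (hol_div (hol_derive (1 : C) hg) hg (g0 wr)). Qed.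

Let contL (w : C) : nrm w < rho -> cont01 (fun t => w * q (rc t * w)).
Proof.
move=> wr; have -> : (fun t => w * q (rc t * w)) = (fun t => w * q (0 + rc t * w)).
  by apply/funext => t; rewrite add0r.
apply: cont01Z; apply: cont_seg => t t01; apply: derivable_contAt.
have := hol_derivable (1 : C) (hq (seg_in t01 wr)); rewrite add0r; exact.
Qed.

(** [int01_hol] requires one radius and one bound for all [t]; [cousin] extracts them from local
    ones. *)
Let tube (w0 : C) : nrm w0 < rho -> exists r M, 0 < r /\ forall t, 0 <= t <= 1 ->
  holB (fun w : C => w * q (rc t * w)) w0 r M.
Proof.
move=> w0r; pose P a b := exists r M, 0 < r /\ forall t, 0 <= t <= 1 -> a <= t <= b ->
  holB (fun w : C => w * q (rc t * w)) w0 r M.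
have [||r [M [r0 HM]]] := @cousin R P.
- move=> a m b am mb [r1 [M1 [r10 H1]]] [r2 [M2 [r20 H2]]].
  exists (Num.min r1 r2), (Num.max M1 M2); split; first by rewrite lt_min r10.
  move=> t t01 /andP[at_ tb] w; rewrite lt_min => /andP[w1 w2].
  have [tm|tm] := leP t m.
    by have [b1 d1] := H1 t t01 ltac:(lra) w w1; split => //; rewrite le_max b1.
  by have [b1 d1] := H2 t t01 ltac:(lra) w w2; split => //; rewrite le_max b1 orbT.
- move=> t t01; have [M [s s0 Hs]] := hq (seg_in t01 w0r).
  have n1 : 0 < nrm w0 + 2 by have := nrm_ge0 w0; lra.
  exists (s / 2 / (nrm w0 + 2)) => [|a b a0 at_ tb b1]; first by rewrite !divr_gt0.
  rewrite ltr_pdivlMr // => ab.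
  exists (Num.min 1 (s / 2)), ((nrm w0 + 1) * `|M|); split; first by rewrite lt_min ltr01 divr_gt0.
  move=> t' t'01 t'ab w; rewrite lt_min => /andP[w1 w2].
  have near : nrm (rc t' * w - rc t * w0) < s.
    have -> : rc t' * w - rc t * w0 = rc t' * (w - w0) + rc (t' - t) * w0 by rewrite rcB; ring.
    have := nrmD (rc t' * (w - w0)) (rc (t' - t) * w0); rewrite !nrmM !nrm_rc.
    have e1 : `|t' - t| * nrm w0 <= (b - a) * (nrm w0 + 2).
      by apply: ler_pM; rewrite ?nrm_ge0 // ?ler_norml; lra.
    have e2 : `|t'| * nrm (w - w0) <= 1 * nrm (w - w0).
      by apply: ler_wpM2r; [exact: nrm_ge0|rewrite ler_norml; lra].
    by lra.
  have [b' d'] := Hs _ near; split.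
    rewrite nrmM; apply: ler_pM; rewrite ?nrm_ge0 //; last exact: le_trans b' (ler_norm _).
    by have := nrm_sub_ge w w0; lra.
  move=> v; have h1 : hol q (rc t' * w).
    exists M; exists (s - nrm (rc t' * w - rc t * w0)) => [|x xr]; first lra.
    by apply: Hs; have := nrm_le_sub x (rc t' * w) (rc t * w0); lra.
  have h2 : hol (fun w : C => q (rc t' * w)) w.
    have hid : hol (fun x : C => (rc t' - 1) * x) w.
      apply: holZ; apply: (@dhol_hol _ _ _ 1) => // x _; exact: derivable_id.
    have e (x : C) : x + ((rc t' - 1) * x) *: (1 : C) = rc t' * x by rewrite -[_ *: 1]/(_ * 1); ring.
    have h1' : hol q (w + ((rc t' - 1) * w) *: (1 : C)) by rewrite e.
    apply: hol_ext (hol_graph h1' hid); apply: germ_all => x; by rewrite e.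
  have h3 : hol (fun w : C => w) w by apply: (@dhol_hol _ _ _ 1) => // x _; exact: derivable_id.
  exact: (hol_derivable v (holM h3 h2)).
by exists r, M; split => // t t01; exact: HM.
Qed.

Let holL (w : C) : nrm w < rho -> hol L w.
Proof.
move=> wr; have [r [M [r0 H]]] := tube wr.
have m0 : 0 < Num.min r (rho - nrm w) by rewrite lt_min r0; lra.
apply: (@holB_hol _ _ L w (Num.min r (rho - nrm w)) M) => //; last by rewrite subrr nrm0.
apply: int01_hol => [t t01 x|x]; rewrite lt_min => /andP[x1 x2]; first exact: H.
by apply: contL; have := nrm_sub_ge x w; lra.
Qed.

Let reL (w : C) : nrm w < rho -> re (L w) = ln (nrm (g w)) - ln (nrm (g 0)).
Proof.
move=> wr; have [M HM] : exists M, forall t, 0 <= t <= 1 -> nrm (g (rc t * w))^-1 <= M.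
  apply: cont01_bounded.
  have -> : (fun t => (g (rc t * w))^-1) = (fun t => (g (0 + rc t * w))^-1) by apply/funext => t; rewrite add0r.
  apply: (@cont_seg _ (fun x : C => (g x)^-1)) => t t01; apply: derivable_contAt; rewrite add0r.
  have tr := seg_in t01 wr; have := @derivableVf _ g (rc t * w) (g0 tr) (Hg tr); exact.
pose de := (rho - nrm w) / 2.
have de0 : 0 < de by rewrite /de; lra.
have T t : 0 <= t <= 1 -> dholB g (rc t * w) de 1.
  move=> t01 x xd; have tn : nrm (rc t * w) <= nrm w.
    by rewrite nrmM nrm_rc ger0_norm; [have := nrm_ge0 w; nra|case/andP: t01].
  have xr : nrm x < rho by have := nrm_sub_ge x (rc t * w); rewrite /de in xd; lra.
  by split; [exact: Hg|exact: g1].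
have deE : 2 * de = rho - nrm w by rewrite /de mulrC divfK.
clearbody de.
have M0 : 0 <= M by have := HM 0 ltac:(by rewrite lexx ler01); apply: le_trans; exact: nrm_ge0.
have w0 := nrm_ge0 w; have k1 := K1_gt0 R; have k2 := K2_gt0 R.
pose A1 := M * (2 * K1 R * 1 / de * nrm w).
pose A2 := M * (K2 R * 1 / de ^+ 2 * nrm w ^+ 2).
have k1' := ltW k1; have k2' := ltW k2; have de' := ltW de0.
have A10 : 0 <= A1.
  by apply: mulr_ge0 => //; apply: mulr_ge0 => //; apply: divr_ge0 => //; rewrite mulr1; exact: mulr_ge0.
have A20 : 0 <= A2.
  apply: mulr_ge0 => //; apply: mulr_ge0; last exact: exprn_ge0.
  by apply: divr_ge0; [rewrite mulr1|exact: exprn_ge0].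
have w1 : 0 < nrm w + 1 by lra.
pose d := Num.min (de / 4 / (nrm w + 1)) (1 / 8 / (A1 + 1)).
have A11 : 0 < A1 + 1 by lra.
have d0 : 0 < d by rewrite /d lt_min; apply/andP; split; apply: divr_gt0 => //; lra.
have := @re_ftc R (fun t => ln (nrm (g (rc t * w)))) (fun t => w * q (rc t * w)) (6 * A1 ^+ 2 + A2) d d0 (contL wr).
rewrite rc1 rc0 mul1r mul0r; apply => s t s01 t01.
rewrite /d lt_min !ltr_pdivlMr // => /andP[std stA].
clear d d0.
have sr := seg_in s01 wr; have tr := seg_in t01 wr.
pose x := (g (rc t * w) - g (rc s * w)) / g (rc s * w).
have xE : 1 + x = g (rc t * w) / g (rc s * w) by rewrite /x; field; exact: g0.
have dE : rc t * w - rc s * w = rc (t - s) * w by rewrite rcB mulrBl.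
have ts0 := normr_ge0 (t - s).
have nd : nrm (rc t * w - rc s * w) = `|t - s| * nrm w by rewrite dE nrmM nrm_rc.
have ndd : nrm (rc t * w - rc s * w) <= de / 4 by rewrite nd; lra.
have x1 : nrm x <= A1 * `|t - s|.
  have ndd2 : nrm (rc t * w - rc s * w) <= de / 2 by lra.
  have := one_lip de0 (T s s01) ndd2; rewrite nd => h.
  rewrite /x nrmM mulrC; apply: le_trans (ler_pM (nrm_ge0 _) (nrm_ge0 _) (HM s s01) h) _.
  by rewrite /A1 le_eqVlt; apply/orP; left; apply/eqP; ring.
have x2 : nrm (x - rc (t - s) * (w * q (rc s * w))) <= A2 * (t - s) ^+ 2.
  have := one_taylor2 de0 (T s s01) ndd; rewrite nd => h.
  have -> : x - rc (t - s) * (w * q (rc s * w)) =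
     (g (rc s * w))^-1 * (g (rc t * w) - g (rc s * w) - (rc t * w - rc s * w) * 'D_1 g (rc s * w)).
    by rewrite /x /q dE; move: ('D_1 g _) => D; field; exact: g0.
  rewrite nrmM; apply: le_trans (ler_pM (nrm_ge0 _) (nrm_ge0 _) (HM s s01) h) _.
  by rewrite exprMn real_normK ?num_real // /A2 le_eqVlt; apply/orP; left; apply/eqP; ring.
have x8 : nrm x <= 1 / 8 by apply: le_trans x1 _; lra.
have gs : 0 < nrm (g (rc s * w)) by rewrite nrm_gt0 g0.
have gt : 0 < nrm (g (rc t * w)) by rewrite nrm_gt0 g0.
have <- : ln (nrm (1 + x)) = ln (nrm (g (rc t * w))) - ln (nrm (g (rc s * w))).
  by rewrite xE nrm_div ln_div ?posrE.
have h1 := ln_nrm_near x8; have h2 := le_re (x - rc (t - s) * (w * q (rc s * w))).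
rewrite reB re_rcM in h2.
have h3 : nrm x ^+ 2 <= A1 ^+ 2 * (t - s) ^+ 2.
  have := lerXn2r 2 (nrm_ge0 x) (mulr_ge0 A10 ts0) x1; rewrite exprMn real_normK ?num_real //; exact.
have h4 := le_trans h2 x2.
have := ler_normD (ln (nrm (1 + x)) - re x) (re x - (t - s) * re (w * q (rc s * w))).
rewrite addrA subrK => h5; apply: le_trans h5 _; lra.
Qed.

(** With [u] = - ln |g 0|, the function [L] vanishes at 0 and has real part at most [u]. On a disc
    shrunk by a factor depending only on [N] this gives |L w| <= u / N, which is the claim after
    taking logarithms. *)
Lemma zero_free_harnack (N : nat) (w : C) : (0 < N)%N ->
  nrm w <= rho / (4 * (K1 R + 1) * (2 * N%:R + 1)) -> nrm (g w) ^+ N <= nrm (g 0) ^+ N.-1.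
Proof.
move=> N0; have N1 : 1 <= N%:R :> R by rewrite ler1n.
have k1 := K1_gt0 R.
have T0 : 0 < 4 * (K1 R + 1) * (2 * N%:R + 1) by rewrite !mulr_gt0 //; lra.
rewrite ler_pdivlMr // => wt; have w0 := nrm_ge0 w.
have T4 : 4 <= 4 * (K1 R + 1) * (2 * N%:R + 1) by nra.
have w4 : nrm w <= rho / 2 / 2 by nra.
have r0 := rho0.
have wr : nrm w < rho by lra.
have z0 : nrm (0 : C) < rho by rewrite nrm0.
pose u := - ln (nrm (g 0)).
have u0 : 0 <= u by rewrite /u oppr_ge0 ln_le0 // g1.
have gp (x : C) : nrm x < rho -> 0 < nrm (g x) by move=> xr; rewrite nrm_gt0 g0.
have Lu (x : C) : nrm x < rho -> re (L x) <= u.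
  by move=> xr; rewrite reL // /u gerDr ln_le0 // g1.
suff H : ln (nrm (g w)) <= - u + u / N%:R.
  rewrite -ler_ln ?posrE ?exprn_gt0 ?gp // !lnXn ?gp // -(mulr_natl (ln (nrm (g w)))) -(mulr_natl (ln (nrm (g 0)))).
  have -> : ln (nrm (g 0)) = - u by rewrite /u opprK.
  have -> : N.-1%:R = N%:R - 1 :> R by rewrite -subn1 natrB.
  have h := ler_wpM2l (ltac:(lra) : 0 <= N%:R :> R) H; apply: le_trans h _.
  by rewrite mulrDr [_ * (u / _)]mulrC divfK ?gt_eqF //; lra.
have LE : ln (nrm (g w)) = re (L w) - u by rewrite reL // /u; lra.
have [u00|up] := leP u 0.
  have -> : u = 0 by lra.
  by rewrite mul0r addr0 oppr0 ln_le0 // g1.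
have L0 : L 0 = 0.
  have -> : L 0 = int01 (fun=> 0) by congr int01; apply/funext => t; rewrite mul0r.
  exact: int01_cst.
(* Borel-Caratheodory: the Moebius map fixing 0 that takes the half-plane of real part at most [u]
   into the unit disc. *)
pose h (x : C) := L x / (rc (2 * u) - L x).
have dn (x : C) : nrm x < rho -> rc (2 * u) - L x != 0.
  move=> xr; apply/eqP => /(congr1 (@re R)); rewrite reB re_rc => e; have := Lu x xr.
  have z : re (0 : C) = 0 by [].
  by rewrite z in e; lra.
have h1 (x : C) : nrm x < rho -> nrm (L x) <= nrm (rc (2 * u) - L x).
  move=> xr; rewrite -(@ler_pXn2r _ 2) ?nnegrE ?nrm_ge0 // !nrmCsq reB imB re_rc im_rc.
  have := Lu x xr; nra.
have Hh : dholB h 0 (rho / 2) 1.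
  move=> x; rewrite subr0 => x2; have xr : nrm x < rho by lra.
  split; last first.
    by rewrite /h nrm_div ler_pdivrMr ?nrm_gt0 ?dn // mul1r; exact: h1.
  have := hol_derivable (1 : C) (hol_div (holL xr) (holB2 (hol_cst (rc (2 * u)) x) (holL xr)) (dn x xr)); exact.
have r20 : 0 < rho / 2 by lra.
have := one_lip r20 Hh (w := w); rewrite subr0 => /(_ w4).
rewrite {2}/h L0 mul0r subr0 /h nrm_div ler_pdivrMr ?nrm_gt0 ?dn // => l1.
have D1 := nrmD (rc (2 * u)) (- L w); rewrite nrmN nrm_rc ger0_norm in D1; last lra.
have et : 2 * K1 R * 1 / (rho / 2) * nrm w <= (2 * N%:R + 1)^-1.
  rewrite -[X in _ <= X]mul1r ler_pdivlMr; last lra.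
  have -> : 2 * K1 R * 1 / (rho / 2) * nrm w * (2 * N%:R + 1) = (nrm w * (4 * K1 R * (2 * N%:R + 1))) / rho by field; lra.
  rewrite ler_pdivrMr // mul1r; apply: le_trans wt; apply: ler_wpM2l => //; nra.
have iN : (2 * N%:R + 1)^-1 * (2 * N%:R + 1) = 1 :> R by rewrite mulVf //; lra.
have iN0 : 0 < (2 * N%:R + 1)^-1 :> R by rewrite invr_gt0; lra.
have l2 : nrm (L w) <= (2 * N%:R + 1)^-1 * (2 * u + nrm (L w)).
  apply: le_trans l1 (le_trans (ler_wpM2r (nrm_ge0 _) et) _); apply: ler_wpM2l => //; exact: ltW.
have l3 : nrm (L w) * N%:R <= u.
  have := ler_wpM2l (ltac:(lra) : 0 <= 2 * N%:R + 1 :> R) l2.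
  by rewrite mulrA [_ * _^-1]mulrC iN mul1r; lra.
have := le_re (L w); rewrite ler_norml => /andP[_ rl].
have : nrm (L w) <= u / N%:R by rewrite ler_pdivlMr //; lra.
by rewrite LE; lra.
Qed.
End ZeroFree.
End Harnack.

(** * Iterated directional derivatives and the Leibniz rule *)

Section Words.
Variable R : realType.
Local Notation C := (Cplx R).
Variable V : normedModType C.
Implicit Types (f g h phi : V -> C) (z v : V) (w : seq V).

Definition Dw w g : V -> C := foldr (fun v h => 'D_v h) g w.

Lemma hol_Dw w g z : hol g z -> hol (Dw w g) z.
Proof. by move=> Hg; elim: w => [|v w IH]; [exact: Hg|exact: (hol_derive v IH)]. Qed.

Lemma derive_germ f g z v : hol f z -> germ z (fun x => f x = g x) -> 'D_v g z = 'D_v f z.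
Proof. by move=> Hf E; have [_] := derivable_ext E (hol_derivable v Hf). Qed.

Lemma derive_mul f g z v : hol f z -> hol g z ->
  'D_v (fun x => f x * g x) z = 'D_v f z * g z + f z * 'D_v g z.
Proof.
move=> Hf Hg; have := deriveM (hol_derivable v Hf) (hol_derivable v Hg).
by rewrite addrC -[_ *: _]/(_ * _) -[X in _ + X]/(_ * _) [g z * _]mulrC; exact.
Qed.

Lemma derive_add f g z v : hol f z -> hol g z ->
  'D_v (fun x => f x + g x) z = 'D_v f z + 'D_v g z.
Proof. by move=> Hf Hg; have := deriveD (hol_derivable v Hf) (hol_derivable v Hg); exact. Qed.

Lemma derive_const (c : C) z v : 'D_v (fun=> c) z = 0.
Proof. exact: derive_cst. Qed.

Lemma derive_sums (I : eqType) (s : seq I) (F : I -> V -> C) z v : (forall i, i \in s -> hol (F i) z) ->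
  'D_v (fun x => \sum_(i <- s) F i x) z = \sum_(i <- s) 'D_v (F i) z.
Proof.
elim: s => [|i s IH] H.
  rewrite big_nil; have -> : (fun x => \sum_(i <- [::]) F i x) = fun=> 0 by apply/funext => x; rewrite big_nil.
  exact: derive_const.
have hs : hol (fun x => \sum_(i <- s) F i x) z.
  have : hol (fun x => \sum_(i <- s | i \in s) F i x) z by apply: hol_sum => j js; apply: H; rewrite inE js orbT.
  by apply: hol_ext; apply: germ_all => x; rewrite [RHS]big_seq.
have hi : hol (F i) z by apply: H; rewrite mem_head.
have -> : (fun x => \sum_(i <- i :: s) F i x) = fun x => F i x + \sum_(i <- s) F i x.
  by apply/funext => x; rewrite big_cons.
have H' : forall j, j \in s -> hol (F j) z by move=> j js; apply: H; rewrite inE js orbT.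
by rewrite (derive_add v hi hs) big_cons (IH H').
Qed.

Lemma Dw_lin n w (F : 'I_n -> V -> C) (c : 'I_n -> C) z : (forall i, hol (F i) z) ->
  germ z (fun x => Dw w (fun y => \sum_i F i y * c i) x = \sum_i Dw w (F i) x * c i).
Proof.
move=> H; elim: w => [|v w IH]; first exact: germ_all.
have Hl : hol (fun y => \sum_i Dw w (F i) y * c i) z.
  by apply: hol_sum => i _; apply: holM; [exact: hol_Dw|exact: hol_cst].
apply: germ_imp (germ_and (germ_open IH) (germ_and (hol_open Hl) (germ_fin (fun i => hol_open (hol_Dw w (H i)))))).
move=> x [E [hl hF]] /=.
have E' : germ x (fun y => \sum_i Dw w (F i) y * c i = Dw w (fun y => \sum_i F i y * c i) y).
  by apply: germ_imp E => y ->.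
rewrite (derive_germ v hl E') derive_sums => [|i _]; last exact: (holM (hF i) (hol_cst (c i) x)).
apply: eq_bigr => i _; rewrite (derive_mul v (hF i) (hol_cst (c i) x)).
by rewrite derive_const mulr0 addr0.
Qed.

Fixpoint Kw w : R := if w is v :: w' then K3 v * Kw w' * 2 ^+ size w' else 1.

Lemma Kw_gt0 w : 0 < Kw w.
Proof. by elim: w => [|v w IH] /=; [exact: ltr01|exact: (mulr_gt0 (mulr_gt0 (K3_gt0 v) IH) (@pow2_gt0 R _))]. Qed.

Lemma holB_Dw w f z r M : 0 < r -> holB f z r M -> holB (Dw w f) z (r / 2 ^+ size w) (Kw w * M / r ^+ size w).
Proof.
move=> r0 H; elim: w => [|v w IH] /=; first by rewrite !expr0 !divr1 mul1r.
have p2 := @pow2_gt0 R (size w).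
have := holB_derive v (divr_gt0 r0 p2) IH.
have -> : r / 2 ^+ size w / 2 = r / 2 ^+ (size w).+1 by rewrite exprSr invfM mulrA.
have -> // : K3 v * (Kw w * M / r ^+ size w) / (r / 2 ^+ size w) = K3 v * Kw w * 2 ^+ size w * M / r ^+ (size w).+1.
have rn : r ^+ size w != 0 by rewrite expf_neq0 // gt_eqF.
have r0' : r != 0 by rewrite gt_eqF.
by rewrite exprS; move: p2 rn; move: (2 ^+ _) (r ^+ _) => a b a0 b0; field; rewrite r0' b0 gt_eqF.
Qed.

Lemma Dw_bound w f z r M : 0 < r -> holB f z r M -> nrm (Dw w f z) <= Kw w * M / r ^+ size w.
Proof.
move=> r0 H; have zz : nrm (z - z) < r / 2 ^+ size w by rewrite subrr nrm0 divr_gt0 // pow2_gt0.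
by have [b _] := @holB_Dw w f z r M r0 H z zz; exact: b.
Qed.

(** Splittings of [w] into complementary subwords; in the Leibniz rule the first one acts on [g],
    the second on [phi]. *)
Fixpoint LW w : seq (seq V * seq V) :=
  if w is v :: w' then [seq (v :: x.1, x.2) | x <- LW w'] ++ [seq (x.1, v :: x.2) | x <- LW w'] else [:: ([::], [::])].

Lemma leibniz w phi g z : hol phi z -> hol g z ->
  germ z (fun y => Dw w (fun x => phi x * g x) y = \sum_(x <- LW w) Dw x.2 phi y * Dw x.1 g y).
Proof.
move=> Hp Hg; elim: w => [|v w IH].
  by apply: germ_all => y; rewrite big_cons big_nil addr0.
have hT (x : seq V * seq V) y : hol phi y -> hol g y -> hol (fun y => Dw x.2 phi y * Dw x.1 g y) y.
  by move=> h1 h2; exact: (holM (hol_Dw _ h1) (hol_Dw _ h2)).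
have Hl y : hol phi y -> hol g y -> hol (fun y => \sum_(x <- LW w) Dw x.2 phi y * Dw x.1 g y) y.
  by move=> h1 h2; apply: hol_sum => x _; exact: hT.
apply: germ_imp (germ_and (germ_open IH) (germ_and (hol_open Hp) (hol_open Hg))) => y [E [hp hg]] /=.
have E' : germ y (fun x => \sum_(x0 <- LW w) Dw x0.2 phi x * Dw x0.1 g x = Dw w (fun x => phi x * g x) x).
  by apply: germ_imp E => x ->.
rewrite (derive_germ v (Hl y hp hg) E') derive_sums => [|x _]; last exact: (hT x y hp hg).
rewrite big_cat /= !big_map -big_split /=; apply: eq_bigr => x _.
by rewrite (derive_mul v (hol_Dw _ hp) (hol_Dw _ hg)) addrC.
Qed.

Lemma LW_head w : exists T, LW w = (w, [::]) :: T /\ forall x, x \in T -> (size x.1 < size w)%N.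
Proof.
elim: w => [|v w [T [E HT]]]; first by exists [::].
rewrite /= E /=; eexists; split; first by [].
move=> x; rewrite mem_cat inE => /orP[/mapP[y yT ->] /=|/orP[/eqP -> //|/mapP[y yT ->] /=]].
  by rewrite ltnS; exact: HT.
by rewrite ltnS ltnW // HT.
Qed.

(** Each derivative lowers the power of [th] by at most one; the truncated subtraction covers the
    case where the power is used up. *)
Lemma Dw_pow th c g z k w : hol th z -> hol c z -> germ z (fun x => g x = th x ^+ k * c x) ->
  exists2 c', hol c' z & germ z (fun x => Dw w g x = th x ^+ (k - size w) * c' x).
Proof.
move=> Ht Hc E; elim: w => [|v w [c' Hc' Ec']]; first by exists c => //; rewrite subn0.
have dX m y : hol th y -> 'D_v (fun x => th x ^+ m) y = m%:R * th y ^+ m.-1 * 'D_v th y.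
  move=> hy; elim: m => [|m IHm].
    by rewrite mul0r mul0r; have -> : (fun x => th x ^+ 0) = fun=> 1 by []; exact: derive_const.
  have -> : (fun x => th x ^+ m.+1) = fun x => th x * th x ^+ m by apply/funext => x; rewrite exprS.
  rewrite (derive_mul v hy (holX m hy)) IHm /=; case: m {IHm} => [|m]; first by rewrite !expr0; ring.
  by rewrite /= -[m.+2%:R]natr1 exprS; ring.
have hX m y : hol th y -> hol (fun x => th x ^+ m) y by move=> h; exact: holX.
case ks : (k - size w)%N => [|m].
  exists ('D_v c'); first exact: hol_derive.
  apply: germ_imp (germ_and (germ_open Ec') (hol_open Hc')) => x [e hc] /=.
  have -> : (k - (size w).+1 = 0)%N by lia.
  rewrite expr0 mul1r; apply: (derive_germ v hc).
  by apply: germ_imp e => y ->; rewrite ks expr0 mul1r.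
exists (fun x => m.+1%:R * 'D_v th x * c' x + th x * 'D_v c' x).
  exact: (holD (holM (holM (hol_cst _ z) (hol_derive v Ht)) Hc') (holM Ht (hol_derive v Hc'))).
apply: germ_imp (germ_and (germ_open Ec') (germ_and (hol_open Hc') (hol_open Ht))) => x [e [hc ht]] /=.
have -> : (k - (size w).+1 = m)%N by lia.
have e' : germ x (fun y => th y ^+ m.+1 * c' y = Dw w g y) by apply: germ_imp e => y ->; rewrite ks.
rewrite (derive_germ v (holM (hX m.+1 x ht) hc) e') (derive_mul v (hX m.+1 x ht) hc).
rewrite (dX _ _ ht) /= exprS; move: ('D_v th x) ('D_v c' x) (th x ^+ m) (m.+1%:R : C) => a b t n.
by rewrite mulrDr !mulrA; congr (_ + _); [rewrite [n * t]mulrC|rewrite [th x * t]mulrC].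
Qed.
End Words.

(** * Jets and generalized Wronskians *)

Section Jets.
Variable R : realType.
Local Notation C := (Cplx R).

(** Differentiating t^(k+1) g gives t^k ((k+1) g + t g'), whose cofactor at 0 is a nonzero multiple
    of [g 0]. *)
Lemma jet_zero_one k (phi g : C -> C) : hol phi 0 -> hol g 0 -> germ 0 (fun t : C => phi t = t ^+ k * g t) ->
  (forall j, iter j (fun h : C -> C => 'D_1 h) phi 0 = 0) -> g 0 = 0.
Proof.
elim: k phi g => [|k IH] phi g Hp Hg E H0.
  by have := germ_self E; rewrite expr0 mul1r => <-; exact: (H0 0%N).
have Hid (x : C) : hol (fun t : C => t) x by apply: (@dhol_hol _ _ _ 1) => // y _; exact: derivable_id.
have K : k.+1%:R * g 0 + 0 * 'D_1 g 0 = 0.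
  apply: (IH ('D_1 phi) (fun t => k.+1%:R * g t + t * 'D_1 g t)).
  - exact: hol_derive.
  - exact: (holD (holZ _ Hg) (holM (Hid 0) (hol_derive (1 : C) Hg))).
  - apply: germ_imp (germ_and (germ_open E) (hol_open Hg)) => t [e hg].
    have e' : germ t (fun x : C => x ^+ k.+1 * g x = phi x) by apply: germ_imp e => x ->.
    have hX m : hol (fun x : C => x ^+ m) t := holX m (Hid t).
    rewrite (derive_germ (1 : C) (holM (hX k.+1) hg) e') (derive_mul (1 : C) (hX k.+1) hg).
    have -> : 'D_1 (fun x : C => x ^+ k.+1) t = k.+1%:R * t ^+ k.
      elim: (k) => [|m IHm].
        by have -> : (fun x : C => x ^+ 1) = id by []; rewrite derive_id expr0 mulr1.
      have -> : (fun x : C => x ^+ m.+2) = fun x => x * x ^+ m.+1 by apply/funext => x; rewrite exprS.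
      rewrite (derive_mul (1 : C) (Hid t) (hX m.+1)) IHm derive_id mul1r -[m.+2%:R]natr1 [t ^+ m.+1]exprS; ring.
    by rewrite exprS; move: ('D_1 g t) (t ^+ k) => a b; ring.
  - by move=> j; have := H0 j.+1; rewrite iterSr.
by move: K; rewrite mul0r addr0 => /eqP; rewrite mulf_eq0 pnatr_eq0 => /eqP.
Qed.

Variable V : normedModType C.
Implicit Types (f g h phi : V -> C) (z v : V) (w : seq V).

Lemma jet_zero h z : hol h z -> (forall w, Dw w h z = 0) -> germ z (fun x => h x = 0).
Proof.
move=> Hh H0; have [r [M [r0 HB]]] := proj1 (holP _ _) Hh.
exists (r / 16) => [|x xr]; first lra.
pose v := x - z; have vr : 9 * nrm v < r by rewrite /v; lra.
have [d1 d2] := holB_dD HB vr.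
have [|K|[k [g [Hg g0 E]]]] := dD_order _ d1 d2; first lra.
  by have := K 1; rewrite scale1r /v [z + _]addrC subrK nrm1; apply; lra.
have n9 : nrm (0 : C) < 9 by rewrite nrm0; lra.
move/eqP: g0; case; apply: (jet_zero_one (phi := fun t : C => h (z + t *: v)) (k := k)).
- exact: dD_hol d1 n9.
- exact: dD_hol Hg n9.
- by apply: germ_all => t; exact: E.
have L j : germ (0 : C) (fun t : C => iter j (fun h : C -> C => 'D_1 h) (fun t : C => h (z + t *: v)) t =
    Dw (nseq j v) h (z + t *: v)).
  elim: j => [|j IH]; first exact: germ_all.
  have n9' : nrm ((0 : C) - 0) < 9 by rewrite subr0.
  apply: germ_imp (germ_and (germ_open IH) (germ_lt n9')) => t [e]; rewrite subr0 => t9 /=.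
  have hz : hol (Dw (nseq j v) h) (z + t *: v).
    apply: hol_Dw; apply: (holB_hol r0 HB); rewrite [z + _]addrC addrK nrmZ.
    by have := nrm_ge0 t; have := nrm_ge0 v; move: t9 vr; clear; nra.
  have [dl dE] := proj1 (line_der _ z v t _) (conj (hol_derivable v hz) erefl).
  have e' : germ t (fun t : C => Dw (nseq j v) h (z + t *: v) =
     iter j (fun h : C -> C => 'D_1 h) (fun t : C => h (z + t *: v)) t) by apply: germ_imp e => s ->.
  by have [_ ->] := derivable_ext e' dl.
by move=> j; rewrite (germ_self (L j)) scale0r addr0.
Qed.

(** Harnack's inequality on lines through [z] gives |g|^N <= A |g z|^(N-1) on a ball of comparable
    radius; the Cauchy estimate with the [N]-th root [M] of the right-hand side is then raised to
    the power [N]. *)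
Lemma harnack_Dw (N : nat) w : (0 < N)%N -> exists2 K : R, 0 < K & forall g z (rho A : R), 0 < rho -> 0 < A ->
  (forall x, nrm (x - z) < rho -> [/\ hol g x, g x != 0 & nrm (g x) <= A]) ->
  nrm (Dw w g z) ^+ N <= K * (A * nrm (g z) ^+ N.-1) / rho ^+ (N * size w).
Proof.
move=> N0; have k1 := K1_gt0 R; have N1 : 1 <= N%:R :> R by rewrite ler1n.
pose T := 4 * (K1 R + 1) * (2 * N%:R + 1); have T0 : 0 < T by rewrite !mulr_gt0 //; lra.
have T1 : 1 <= T by rewrite /T; nra.
exists (Kw w ^+ N * T ^+ (N * size w)); first by rewrite mulr_gt0 // exprn_gt0 // Kw_gt0.
move=> g z rho A rho0 A0 H.
have zz : nrm (z - z) < rho by rewrite subrr nrm0.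
have [_ gz gA] := H z zz.
pose y := A * nrm (g z) ^+ N.-1; have y0 : 0 <= y by rewrite mulr_ge0 ?exprn_ge0 ?nrm_ge0 // ltW.
pose M := y `^ (N%:R^-1).
have MN : M ^+ N = y.
  rewrite -powR_mulrn ?powR_ge0 // -powRrM mulVf ?powRr1 //; by rewrite gt_eqF //; lra.
have M0 : 0 <= M by exact: powR_ge0.
have rT : 0 < rho / T by exact: divr_gt0.
have rT' : rho / T <= rho by rewrite ler_pdivrMr // ler_peMr // ltW.
have HB : holB g z (rho / T) M.
  move=> x xr; have xr' : nrm (x - z) < rho by exact: lt_le_trans xr rT'.
  have [hx _ _] := H x xr'; split; last by move=> v; exact: hol_derivable.
  rewrite -(@ler_pXn2r _ N) ?nnegrE ?nrm_ge0 // MN /y.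
  have [e|xz] := eqVneq x z.
    by rewrite e -(prednK N0) exprS /=; apply: ler_wpM2r; rewrite ?exprn_ge0 ?nrm_ge0.
  have n0 : 0 < nrm (x - z) by rewrite nrm_gt0 subr_eq0.
  have rn : 0 < rho / nrm (x - z) by exact: divr_gt0.
  have inb (t : C) : nrm t < rho / nrm (x - z) -> nrm (z + t *: (x - z) - z) < rho.
    by rewrite ltr_pdivlMr // => tr; rewrite [z + _]addrC addrK nrmZ.
  pose phi (t : C) := (rc A)^-1 * g (z + t *: (x - z)).
  have nA : nrm (rc A)^-1 = A^-1 by rewrite nrmV nrm_rc gtr0_norm.
  have := @zero_free_harnack R phi (rho / nrm (x - z)) rn _ _ _ N 1 N0.
  rewrite nrm1 -/T /phi scale0r addr0 scale1r [z + _]addrC subrK !nrmM nA => K.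
  have {K}K : (A^-1 * nrm (g x)) ^+ N <= (A^-1 * nrm (g z)) ^+ N.-1.
    apply: K => [t tr|t tr|t tr|].
    - have [hg _ _] := H _ (inb t tr).
      have := derivableMf (@derivable_cst _ _ _ (rc A)^-1 t 1) (hol_line hg); exact.
    - have [_ gn _] := H _ (inb t tr); by rewrite mulf_neq0 // invr_neq0 // rc_eq0 gt_eqF.
    - have [_ _ gb] := H _ (inb t tr); by rewrite nrmM nA mulrC ler_pdivrMr // mul1r.
    - rewrite ler_pdivlMr // mul1r ler_pdivlMr //.
      by move: xr; rewrite ltr_pdivlMr // mulrC => /ltW.
  rewrite !exprMn in K; move: K; rewrite -{1}(prednK N0) exprS -mulrA [A^-1 ^+ _ * _]mulrC.
  have Ap : 0 < A^-1 ^+ N.-1 by rewrite exprn_gt0 // invr_gt0.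
  rewrite [X in _ <= X]mulrC mulrA ler_pM2r // => K.
  by move: K; rewrite mulrC ler_pdivrMr // mulrC.
have := Dw_bound w rT HB => D.
have := lerXn2r N (nrm_ge0 _) (le_trans (nrm_ge0 _) D) D => D2; apply: le_trans D2 _.
rewrite expr_div_n exprMn MN -exprM expr_div_n invf_div [(size w * N)%N]mulnC.
by rewrite le_eqVlt; apply/orP; left; apply/eqP; rewrite /y; move: (Kw w ^+ N) (T ^+ _) (rho ^+ _)^-1 (A * _) => a b c d; ring.
Qed.

Definition wronsk m (A : 'I_m -> seq V) (F : V -> 'rV[C]_m) z : C :=
  \det (\matrix_(r, l) Dw (A r) (fun x => F x 0 l) z).

Lemma det_expand m M (c : 'I_m -> 'I_M -> C) (y : 'I_m -> 'I_M -> 'I_m -> C) :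
  \det (\matrix_(r, l) \sum_x c r x * y r x l) =
  \sum_(s : {ffun 'I_m -> 'I_M}) (\prod_r c r (s r)) * \det (\matrix_(r, l) y r (s r) l).
Proof.
rewrite /determinant; under [RHS]eq_bigr => s _ do rewrite mulr_sumr.
rewrite exchange_big; apply: eq_bigr => p _ /=.
under eq_bigr => r _ do rewrite mxE.
rewrite bigA_distr_bigA mulr_sumr; apply: eq_bigr => s _.
rewrite big_split /= mulrCA; congr (_ * (_ * _)); apply: eq_bigr => r _; by rewrite mxE.
Qed.

(** By the Leibniz rule and multilinearity, every term other than the main one is a multiple of a
    Wronskian whose words are no longer row by row and shorter in total, hence zero by
    hypothesis. *)
Lemma wronsk_scale m (A : 'I_m -> seq V) (F : V -> 'rV[C]_m) phi z : hol phi z ->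
  (forall l, hol (fun x => F x 0 l) z) ->
  (forall B : 'I_m -> seq V, (forall r, size (B r) <= size (A r))%N ->
     (\sum_r size (B r) < \sum_r size (A r))%N -> wronsk B F z = 0) ->
  wronsk A (fun x => phi x *: F x) z = phi z ^+ m * wronsk A F z.
Proof.
move=> Hp HF H0.
(* Leibniz expansions of different lengths are padded to the common length [M.+1] by zero
   coefficients [c]. *)
pose M := (\max_r size (LW (A r))).-1.
have LW0 w : (0 < size (LW w))%N by have [T [-> _]] := LW_head w.
pose a r (x : nat) := nth (A r, [::]) (LW (A r)) x.
pose c (r : 'I_m) (x : 'I_M.+1) := if (x < size (LW (A r)))%N then Dw (a r x).2 phi z else 0.
have MM r : (size (LW (A r)) <= M.+1)%N.
  rewrite /M prednK; first by rewrite (leq_bigmax r).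
  by apply: leq_trans (leq_bigmax r); exact: LW0.
have E : \matrix_(r, l) Dw (A r) (fun x => (phi x *: F x) 0 l) z =
   \matrix_(r, l) \sum_(x < M.+1) c r x * Dw (a r x).1 (fun x => F x 0 l) z.
  apply/matrixP => r l; rewrite !mxE.
  have -> : (fun x => (phi x *: F x) 0 l) = fun x => phi x * F x 0 l by apply/funext => x; rewrite mxE.
  rewrite (germ_self (leibniz (A r) Hp (HF l))) (big_nth (A r, [::])) big_mkord.
  rewrite (big_ord_widen M.+1 (fun x => Dw (nth (A r, [::]) (LW (A r)) x).2 phi z *
     Dw (nth (A r, [::]) (LW (A r)) x).1 (fun x0 => F x0 0 l) z)) // big_mkcond.
  by apply: eq_bigr => x _; rewrite /c /a; case: ifP => //; rewrite mul0r.
rewrite /wronsk E (det_expand c (fun r x l => Dw (a r x).1 (fun x => F x 0 l) z)).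
have a0 r : a r 0%N = (A r, [::]) by rewrite /a; have [T [-> _]] := LW_head (A r).
(* Index 0 is, in each row, the term with no derivative on [phi] ([LW_head]). *)
rewrite (bigD1 [ffun=> ord0]) //= [X in _ + X]big1 ?addr0 => [|s s0].
  congr (_ * _); last first.
    by congr (\det _); apply/matrixP => r l; rewrite !mxE ffunE a0.
  rewrite (eq_bigr (fun=> phi z)) ?prodr_const ?card_ord // => r _.
  by rewrite ffunE /c LW0 a0.
have [/forallP K|/forallPn[r]] := boolP [forall r, (s r < size (LW (A r)))%N]; last first.
  by move=> nr; rewrite (bigD1 r) //= /c (negPf nr) !mul0r.
have [r0 sr0] : exists r, s r != ord0.
  apply/existsP; apply: contraR s0; rewrite negb_exists => /forallP h.
  by apply/eqP/ffunP => r; rewrite ffunE; apply/eqP; have := h r; rewrite negbK.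
have le r : (size (a r (s r)).1 <= size (A r))%N /\ (s r != ord0 -> size (a r (s r)).1 < size (A r))%N.
  have := K r; rewrite /a; have [T [-> HT]] := LW_head (A r).
  case: (s r) => [[|x] xM] /=; first by move=> _; split => //; rewrite eqxx.
  by move=> xT; have := HT _ (mem_nth (A r, [::]) xT) => lt; split => // ; exact: ltnW.
have := H0 (fun r => (a r (s r)).1) (fun r => proj1 (le r)); rewrite /wronsk => -> //; first by rewrite mulr0.
rewrite (bigD1 r0) //= [X in (_ < X)%N](bigD1 r0) //=; apply: (@leq_add (_.+1)).
  exact: (proj2 (le r0) sr0).
by apply: leq_sum => r _; exact: (proj1 (le r)).
Qed.
End Jets.

(** * Homogeneous coordinates and linear forms *)

Section Projective.
Variables (R : realType) (n : nat).
Local Notation C := (Cplx R).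
Local Notation U := 'rV[C]_n.+1.

Definition pairing (x : U) (a : 'cV[C]_n.+1) : C := (x *m a) 0 0.

Lemma pairingE x a : pairing x a = \sum_l x 0 l * a l 0.
Proof. by rewrite /pairing mxE. Qed.

Lemma pairing0 x a : (x *m a == 0) = (pairing x a == 0).
Proof.
apply/eqP/eqP => [e|e]; first by rewrite /pairing e mxE.
by apply/matrixP => i j; rewrite !ord1 [RHS]mxE.
Qed.

Lemma pairingZ (c : C) x a : pairing (c *: x) a = c * pairing x a.
Proof. by rewrite /pairing -scalemxAl mxE. Qed.

Lemma dim_lker_col (a : 'cV[C]_n.+1) : a != 0 -> \dim (lker (linfun (mulmxr a) : 'Hom(U, 'rV[C]_1))) = n.
Proof.
move=> a0; pose phi : 'Hom(U, 'rV[C]_1) := linfun (mulmxr a).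
have [l al] : exists l, a l 0 != 0.
  apply/existsP; apply: contraNT a0; rewrite negb_exists => /forallP h.
  by apply/eqP/matrixP => i j; rewrite ord1 mxE; apply/eqP; have := h i; rewrite negbK.
have E : phi (delta_mx 0 l) != 0.
  rewrite lfunE /= -rowE; apply: contra_neq al => /matrixP/(_ 0 0); by rewrite !mxE.
have := limg_ker_dim phi fullv; rewrite capfv dimvf dim_matrix mul1r.
have -> : \dim (phi @: fullv) = 1%N.
  apply/eqP; rewrite eqn_leq; apply/andP; split.
    by have := dimvS (subvf (phi @: fullv)); rewrite dimvf dim_matrix mul1r.
  rewrite lt0n dimv_eq0; apply: contra E => /eqP E; rewrite -memv0 -E; exact: memv_img (memvf _).
by rewrite addn1 => -[].
Qed.

Lemma mem_lker_col (a : 'cV[C]_n.+1) x : (x \in lker (linfun (mulmxr a) : 'Hom(U, 'rV[C]_1))) = (x *m a == 0).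
Proof. by rewrite memv_ker lfunE. Qed.

Lemma hyperplane_of_col (a : 'cV[C]_n.+1) : a != 0 -> exists H : hyperplane R n, linear_equation H a.
Proof.
move=> a0; have d : \dim (lker (linfun (mulmxr a) : 'Hom(U, 'rV[C]_1))) == n by rewrite dim_lker_col.
by exists (exist (fun H : {vspace U} => is_true (\dim H == n)) _ d) => x /=; exact: mem_lker_col.
Qed.

Lemma linear_equation_exists (H : hyperplane R n) : exists2 a, a != 0 & linear_equation H a.
Proof.
case: H => W dW; have dW' := eqP dW.
pose M : 'M[C]_(\dim W, n.+1) := \matrix_(r, l) (vbasis W)`_r 0 l.
have : (0 < \rank (kermx M^T))%N.
  by rewrite mxrank_ker mxrank_tr subn_gt0 ltnS (leq_trans (rank_leq_row M)) // dW'.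
rewrite lt0n mxrank_eq0 => k0.
have [i ki] : exists i, row i (kermx M^T) != 0.
  apply/existsP; apply: contraNT k0; rewrite negb_exists => /forallP h.
  by apply/eqP/row_matrixP => i; rewrite row0; apply/eqP; have := h i; rewrite negbK.
pose a := (row i (kermx M^T))^T.
have a0 : a != 0 by rewrite /a trmx_eq0.
have Ma : M *m a = 0.
  apply: trmx_inj; rewrite trmx_mul trmxK trmx0 -row_mul mulmx_ker row0 //.
exists a => //; have sub : (W <= lker (linfun (mulmxr a) : 'Hom(U, 'rV[C]_1)))%VS.
  rewrite -(span_basis (vbasisP W)); apply/span_subvP => x xb.
  rewrite mem_lker_col; have [r rs <-] := (nthP 0 xb).
  have rd : (r < \dim W)%N by rewrite -(size_tuple (vbasis W)).
  have := congr1 (row (Ordinal rd)) Ma; rewrite row_mul row0 => <-.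
  by apply/eqP; congr (_ *m _); apply/rowP => l; rewrite !mxE.
have E : W = lker (linfun (mulmxr a) : 'Hom(U, 'rV[C]_1)).
  by apply/eqP; rewrite eqEdim sub /=; apply: eq_leq; rewrite dW'; exact: dim_lker_col.
by move=> x /=; rewrite {1}E mem_lker_col.
Qed.

Lemma hom_coord_neq0 (x : proj_space R n) : hom_coord x != 0.
Proof. by case: x => L dL; rewrite /hom_coord vpick0 -dimv_eq0 (eqP dL). Qed.

Lemma val_hom_coord (x : proj_space R n) : val x = <[hom_coord x]>%VS.
Proof.
apply/esym/eqP; rewrite eqEdim -memvE memv_pick dim_vline hom_coord_neq0; case: x => L /= /eqP ->.
by [].
Qed.

Lemma points_ofE (H : hyperplane R n) a x : linear_equation H a ->
  points_of H x <-> pairing (hom_coord x) a = 0.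
Proof.
move=> la; rewrite /points_of /= val_hom_coord -memvE la pairing0.
by split => /eqP.
Qed.

Lemma chart_exists (x : proj_space R n) : exists i, chart_dom i x.
Proof.
apply: contrapT => no; have := hom_coord_neq0 x; move/eqP; apply; apply/rowP => i.
by rewrite [RHS]mxE; apply: contrapT => /eqP h; apply: no; exists i.
Qed.

Lemma norm_coord_self i (x : proj_space R n) : chart_dom i x -> norm_coord i x 0 i = 1.
Proof. by move=> ci; rewrite mxE mulVf. Qed.

Lemma norm_coord_dom i j (x : proj_space R n) : chart_dom i x -> (norm_coord i x 0 j != 0) = (hom_coord x 0 j != 0).
Proof. by move=> ci; rewrite mxE mulf_eq0 invr_eq0 negb_or (ci : hom_coord x 0 i != 0). Qed.

Lemma norm_coord_change i j (x : proj_space R n) : chart_dom i x -> chart_dom j x ->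
  norm_coord j x = (norm_coord i x 0 j)^-1 *: norm_coord i x.
Proof.
move=> ci cj; rewrite /norm_coord !mxE scalerA; congr (_ *: _).
by rewrite invfM invrK mulrC mulrA mulVf // mul1r.
Qed.

Lemma pairing_norm i (x : proj_space R n) a : chart_dom i x ->
  (pairing (norm_coord i x) a == 0) = (pairing (hom_coord x) a == 0).
Proof. by move=> ci; rewrite pairingZ mulf_eq0 invr_eq0 (negPf ci). Qed.

(** A nonzero row killed by these forms would span a point common to [n.+1] of the hyperplanes. *)
Lemma general_position_unit (q : nat) (H : 'I_q -> hyperplane R n) (a : 'I_q -> 'cV[C]_n.+1) (s : 'I_n.+1 -> 'I_q) :
  general_position H -> (forall j, linear_equation (H j) (a j)) -> injective s ->
  (\matrix_(l, r) a (s r) l 0) \in unitmx.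
Proof.
move=> gp la inj; rewrite -row_free_unit; apply/inj_row_free => x x0.
apply/eqP/negPn/negP => xn.
have dx : \dim <[x]>%VS == 1%N by rewrite dim_vline xn.
have cS : #|s @: 'I_n.+1| = n.+1 by rewrite card_imset // card_ord.
have := gp _ cS => /seteqP[+ _] => /(_ (exist (fun L : {vspace U} => is_true (\dim L == 1%N)) _ dx)); apply => j /=.
move=> /imsetP[r _ ->]; rewrite /points_of /= -memvE la.
apply/eqP/matrixP => i k; rewrite !ord1 [RHS]mxE.
have := congr1 (fun M : 'rV[C]_n.+1 => M 0 r) x0; rewrite /= [RHS]mxE => <-.
by rewrite !mxE; apply: eq_bigr => l _; rewrite mxE.
Qed.
End Projective.

(** * The map in affine charts *)

Section MapCoord.
Variables (R : realType) (p n : nat).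
Local Notation C := (Cplx R).
Local Notation V := 'rV[C]_p.
Variable f : V -> proj_space R n.
Hypothesis hf : holomorphic_map f.

Lemma chart_germ i z : chart_dom i (f z) -> germ z (fun w => chart_dom i (f w)).
Proof. by move=> /hf[/germ_near]. Qed.

Lemma hol_coord i l z : chart_dom i (f z) -> hol (fun w => norm_coord i (f w) 0 l) z.
Proof.
move=> ci; have [lE|] := eqVneq l i.
  apply: hol_ext (hol_cst 1 z); apply: germ_imp (chart_germ ci) => w cw.
  by rewrite lE norm_coord_self.
rewrite eq_sym => /unlift_some[j lE _].
have [_ H] := hf ci; apply: differentiable_hol.
apply: filterS H => w dw.
have -> : (fun w => norm_coord i (f w) 0 l) = (fun M : 'rV[C]_n => M 0 j) \o (fun w => chart i (f w)).
  by apply/funext => x; rewrite /= /chart lE [RHS]mxE.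
apply: differentiable_comp => //; exact: differentiable_coord.
Qed.

Lemma hol_pairing i a z : chart_dom i (f z) -> hol (fun w => pairing (norm_coord i (f w)) a) z.
Proof.
move=> ci; have : hol (fun w => \sum_l norm_coord i (f w) 0 l * a l 0) z.
  by apply: hol_sum => l _; exact: (holM (hol_coord l ci) (hol_cst (a l 0) z)).
by apply: hol_ext; apply: germ_all => w; rewrite pairingE.
Qed.

Lemma pairing_germ_all z a : germ z (fun w => pairing (hom_coord (f w)) a = 0) ->
  forall w, pairing (hom_coord (f w)) a = 0.
Proof.
move=> H w; suff : germ w (fun w => pairing (hom_coord (f w)) a = 0) by exact: germ_self.
move: z w H; have := @clopen_all R V (fun w => germ w (fun w => pairing (hom_coord (f w)) a = 0)).
move=> K z w Hz; apply: (K _ z w Hz) => {z w Hz}z; have [i ci] := chart_exists (f z).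
have [r r0 Hr] := germ_and (chart_germ ci) (hol_open (hol_pairing a ci)).
exists r => // b c br cr Hb; have : germ c (fun w => nrm (w - z) < r) by exact: germ_lt.
apply: germ_imp => y yr; have [ciy _] := Hr y yr; apply/eqP; rewrite -(pairing_norm _ ciy); apply/eqP.
apply: (@hol_zero_ball _ _ (fun w => pairing (norm_coord i (f w)) a) z r _ b br _ y yr).
  by move=> x /Hr[].
apply: germ_imp (germ_and Hb (germ_lt br)) => x [xb xr]; have [cix _] := Hr x xr.
by apply/eqP; rewrite (pairing_norm _ cix); apply/eqP.
Qed.
End MapCoord.

(** * Independent jets and the choice of the Wronskian *)

Section InvHol.
Variable R : realType.
Local Notation C := (Cplx R).
Variable V : normedModType C.

Lemma hol_invmx m (N : 'I_m -> 'I_m -> V -> C) z j r : (forall a b, hol (N a b) z) ->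
  \det (\matrix_(a, b) N a b z) != 0 -> hol (fun y => invmx (\matrix_(a, b) N a b y) j r) z.
Proof.
move=> HN D; have HD := hol_det HN.
have Hc : hol (fun y => \adj (\matrix_(a, b) N a b y) j r) z.
  have := @hol_det R V m.-1 (fun a b => N (lift r a) (lift j b)) z (fun a b => HN _ _).
  move/(@holZ _ _ ((-1) ^+ (r + j))); apply: hol_ext; apply: germ_all => y.
  rewrite mxE /cofactor; congr (_ * \det _); by apply/matrixP => a b; rewrite !mxE.
apply: hol_ext (holM (holV HD D) Hc); apply: germ_imp (hol_neq0 HD D) => y Dy.
by rewrite /invmx unitmxE unitfE Dy [RHS]mxE.
Qed.

Lemma col_kernel m k (M : 'M[C]_(m, k)) : (m < k)%N -> exists2 e : 'cV[C]_k, e != 0 & M *m e = 0.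
Proof.
move=> mk; have : (0 < \rank (kermx M^T))%N.
  by rewrite mxrank_ker mxrank_tr subn_gt0 (leq_ltn_trans (rank_leq_row M)).
rewrite lt0n mxrank_eq0 => k0.
have [i ki] : exists i, row i (kermx M^T) != 0.
  apply/existsP; apply: contraNT k0; rewrite negb_exists => /forallP h.
  by apply/eqP/row_matrixP => i; rewrite row0; apply/eqP; have := h i; rewrite negbK.
exists (row i (kermx M^T))^T; first by rewrite trmx_eq0.
by apply: trmx_inj; rewrite trmx_mul trmxK trmx0 -row_mul mulmx_ker row0.
Qed.
End InvHol.

Section Frame.
Variables (R : realType) (p n : nat).
Local Notation C := (Cplx R).
Local Notation V := 'rV[C]_p.
Variable f : V -> proj_space R n.
Hypothesis hf : holomorphic_map f.
Local Notation Fc i l := (fun w => norm_coord i (f w) 0 l).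

Definition jet i (w : seq V) (z : V) : 'rV[C]_n.+1 := \row_l Dw w (Fc i l) z.
Definition jets m (B : 'I_m -> seq V) i z : 'M[C]_(m, n.+1) := \matrix_(r, l) Dw (B r) (Fc i l) z.
Definition frame k m : Prop := exists (B : 'I_m -> seq V) z i,
  [/\ forall r, (size (B r) <= k)%N, chart_dom i (f z) & row_free (jets B i z)].

Lemma jetsE m (B : 'I_m -> seq V) i z r : row r (jets B i z) = jet i (B r) z.
Proof. by apply/rowP => l; rewrite !mxE. Qed.

Lemma frame_extend k m (B : 'I_m -> seq V) z i w : (forall r, (size (B r) <= k)%N) -> (size w <= k)%N ->
  chart_dom i (f z) -> row_free (jets B i z) -> ~~ (jet i w z <= jets B i z)%MS -> frame k m.+1.
Proof.
move=> HB Hw ci fr nin.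
pose B' (r : 'I_m.+1) := if unlift ord_max r is Some r' then B r' else w.
exists B', z, i; split => // [r|]; first by rewrite /B'; case: unliftP.
apply/inj_row_free => x.
have E : x *m jets B' i z = (\row_r x 0 (widen_ord (leqnSn m) r)) *m jets B i z + x 0 ord_max *: jet i w z.
  apply/rowP => l; rewrite !mxE big_ord_recr /=; congr (_ + _).
    apply: eq_bigr => r _; rewrite !mxE; congr (_ * _).
    have -> : widen_ord (leqnSn m) r = lift ord_max r.
      by apply/val_inj; rewrite /= /bump leqNgt ltn_ord add0n.
    by rewrite /B' liftK.
  by rewrite !mxE /B' unlift_none.
rewrite E => /eqP x0.
have xm : x 0 ord_max = 0.
  apply/eqP/negPn/negP => xn; move/negP: nin; apply.
  have -> : jet i w z = (- (x 0 ord_max)^-1 *: \row_r x 0 (widen_ord (leqnSn m) r)) *m jets B i z.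
    move: x0; rewrite addrC addr_eq0 => /eqP /(congr1 (fun v => (x 0 ord_max)^-1 *: v)).
    by rewrite scalerA mulVf // scale1r scalerN -scalemxAl scaleNr.
  exact: submxMl.
move: x0; rewrite xm scale0r addr0 mulmx_free_eq0 // => /eqP/rowP x0.
apply/rowP => r; rewrite [RHS]mxE; case: (unliftP ord_max r) => [r' ->|->] //.
have := x0 r'; rewrite !mxE => <-; congr (x 0 _).
by apply/val_inj; rewrite /= /bump leqNgt ltn_ord add0n.
Qed.

(** Otherwise the span of the [m] jets contains all jets of order at most [k.+1] throughout a ball,
    so it is stable under differentiation and contains all jets. A linear form vanishing on it at
    [z] has zero Taylor series along [f], which puts the image into a hyperplane. *)
Lemma frame_step k m : linearly_nondegenerate f -> frame k m -> (m < n.+1)%N -> frame k.+1 m.+1.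
Proof.
move=> hnd [B [z [i [HB ci fr]]]] mn; apply: contrapT => nF.
have fT : row_full (jets B i z)^T by rewrite /row_full mxrank_tr (eqP fr).
pose sg := fullrankfun fT.
pose N (a b : 'I_m) y := Dw (B a) (Fc i (sg b)) y.
have Nz : \det (\matrix_(a, b) N a b z) != 0.
  have := fullrowsub_unit fT; rewrite -unitmx_tr unitmxE unitfE.
  have -> // : (rowsub (fullrankfun fT) (jets B i z)^T)^T = \matrix_(a, b) N a b z.
  by apply/matrixP => a b; rewrite !mxE.
have hN a b y : chart_dom i (f y) -> hol (N a b) y.
  by move=> cy; apply: hol_Dw; exact: hol_coord.
have hD := hol_det (fun a b => hN a b z ci).
have [r r0 Hr] := germ_and (chart_germ hf ci) (hol_neq0 hD Nz).
have Nfree y (x : 'rV[C]_m) : nrm (y - z) < r -> x *m (\matrix_(a, b) N a b y) = 0 -> x = 0.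
  move=> yr x0; have [_ Dy] := Hr y yr.
  have u : \matrix_(a, b) N a b y \in unitmx by rewrite unitmxE unitfE.
  by rewrite -[x](mulmxK u) x0 mul0mx.
have sub_col y (x : 'rV[C]_m) : x *m (\matrix_(a, b) N a b y) = \row_b (x *m jets B i y) 0 (sg b).
  by apply/rowP => b; rewrite !mxE; apply: eq_bigr => a _; rewrite !mxE.
have free y : nrm (y - z) < r -> row_free (jets B i y).
  move=> yr; apply/inj_row_free => x x0; apply: (Nfree y) => //.
  by rewrite sub_col x0; apply/rowP => b; rewrite !mxE.
have step0 y w : nrm (y - z) < r -> (size w <= k.+1)%N -> (jet i w y <= jets B i y)%MS.
  move=> yr ws; apply/negPn/negP => nin; apply: nF.
  have [cy _] := Hr y yr; apply: (@frame_extend k.+1 m B y i w) => //; last exact: free.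
  by move=> a; apply: leqW.
have all_in w : forall y, nrm (y - z) < r -> (jet i w y <= jets B i y)%MS.
  elim: w => [|v w IH] y yr; first exact: step0.
  (* Coefficients of the jet of [w] in the frame, from the inverse of the minor [N], hence
     holomorphic. *)
  pose cf (a : 'I_m) x := \sum_b Dw w (Fc i (sg b)) x * invmx (\matrix_(a, b) N a b x) b a.
  have [cy Dy] := Hr y yr.
  have hcf a : hol (cf a) y.
    apply: hol_sum => b _; apply: holM; first by apply: hol_Dw; exact: hol_coord.
    exact: (hol_invmx b a (fun a' b' => hN a' b' y cy) Dy).
  have hB a l : hol (Dw (B a) (Fc i l)) y by apply: hol_Dw; exact: hol_coord.
  have E : germ y (fun x => forall l, \sum_(a <- enum 'I_m) cf a x * Dw (B a) (Fc i l) x = Dw w (Fc i l) x).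
    apply: germ_imp (germ_lt yr) => x xr l; have [_ Dx] := Hr x xr.
    have ux : \matrix_(a, b) N a b x \in unitmx by rewrite unitmxE unitfE.
    have /submxP[d dE] := IH x xr.
    have dd : d = \row_a cf a x.
      rewrite -[d](mulmxK ux) sub_col -dE; apply/rowP => a; rewrite !mxE.
      by apply: eq_bigr => b _; rewrite !mxE.
    have := congr1 (fun v : 'rV[C]_n.+1 => v 0 l) dE; rewrite dd !mxE => ->.
    by rewrite big_enum; apply: eq_bigr => a _; rewrite !mxE.
  have hM a l : hol (fun x => cf a x * Dw (B a) (Fc i l) x) y := holM (hcf a) (hB a l).
  (* Differentiating the expansion leaves the frame and its first derivatives, which have order at
     most [k.+1]. *)
  have -> : jet i (v :: w) y = (\row_a 'D_v (cf a) y) *m jets B i y + \sum_a cf a y *: jet i (v :: B a) y.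
    apply/rowP => l; rewrite !mxE /= summxE.
    have hS : hol (fun x => \sum_(a <- enum 'I_m) cf a x * Dw (B a) (Fc i l) x) y.
      by apply: hol_sum => a _; exact: hM.
    rewrite (derive_germ v hS (germ_imp (fun x h => h l) E)) derive_sums => [|a _]; last exact: hM.
    rewrite big_enum -big_split /=; apply: eq_bigr => a _.
    by rewrite (derive_mul v (hcf a) (hB a l)) !mxE.
  apply: addmx_sub; first exact: submxMl.
  apply: summx_sub => a _; apply: scalemx_sub; apply: step0 => //=.
  by rewrite ltnS.
(* A form killing the [m < n.+1] jets at [z], and so every derivative of the coordinates there. *)
have [e e0 Me] := col_kernel (jets B i z) mn.
have zz : nrm (z - z) < r by rewrite subrr nrm0.
have : germ z (fun x => pairing (norm_coord i (f x)) e = 0).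
  apply: jet_zero; first exact: hol_pairing.
  move=> w; have hl l : hol (Fc i l) z by exact: hol_coord.
  have -> : (fun x => pairing (norm_coord i (f x)) e) = fun x => \sum_l Fc i l x * e l 0.
    by apply/funext => x; rewrite pairingE.
  rewrite (germ_self (Dw_lin w (fun l => e l 0) hl)).
  have /submxP[d dE] := all_in w z zz.
  have K : (jet i w z *m e) 0 0 = 0 by rewrite dE -mulmxA Me mulmx0 mxE.
  by rewrite -[RHS]K mxE; apply: eq_bigr => l _; rewrite [in RHS]mxE.
move=> g0; have := @pairing_germ_all R p n f hf z e _.
have [H' lH] := hyperplane_of_col e0.
move=> K; apply: (hnd H') => x [y _ <-]; apply/(points_ofE _ lH); apply: K.
apply: germ_imp (germ_and g0 (chart_germ hf ci)) => y' [h c]; apply/eqP.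
by rewrite -(pairing_norm _ c) h.
Qed.
End Frame.

Section Rank.
Variables (R : realType) (p n : nat).
Local Notation C := (Cplx R).
Local Notation V := 'rV[C]_p.
Variable f : V -> proj_space R n.
Hypothesis hf : holomorphic_map f.
Local Notation Fc i l := (fun w => norm_coord i (f w) 0 l).

Lemma jacobian_entry i z b j : chart_dom i (f z) ->
  'J (fun w => chart i (f w)) z b j = 'D_(delta_mx 0 b) (Fc i (lift i j)) z.
Proof.
move=> ci; have [_ H] := hf ci; have d := nbhs_singleton H.
rewrite /jacobian mxE -deriveE //.
have @g : {linear 'rV[C]_n -> C}.
  by exists (fun N : 'rV[C]_n => N 0 j); do 2![eexists]; do ?[constructor];
     rewrite ?mxE// => ? *; rewrite ?mxE//; move=> ?; rewrite !mxE.
have cg : continuous g by exact: coord_continuous.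
have dg x : differentiable g x by exact: linear_differentiable.
have -> : (fun w => norm_coord i (f w) 0 (lift i j)) = g \o (fun w => chart i (f w)).
  by apply/funext => w; rewrite /= /chart [RHS]mxE.
rewrite [in RHS]deriveE; last exact: differentiable_comp.
rewrite (diff_comp d (dg _)) /= (diff_lin _ cg) /=.
by rewrite -deriveE.
Qed.

(** The value of [f] and [minn p n] first derivatives from the Jacobian. The [i]-th normalized
    coordinate is constantly 1, which separates the undifferentiated row from the others. *)
Lemma frame_rank : maximal_rank f -> frame f 1 (minn p n).+1.
Proof.
move=> [z [i [ci rk]]].
have JE b j : 'J (fun w => chart i (f w)) z b j = 'D_(delta_mx 0 b) (Fc i (lift i j)) z.
  exact: jacobian_entry.
pose J := 'J (fun w => chart i (f w)) z.
rewrite -rk -/J; pose sg := maxrankfun J.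
pose B (r : 'I_(\rank J).+1) : seq V := if unlift ord0 r is Some r' then [:: delta_mx 0 (sg r')] else [::].
exists B, z, i; split => // [r|]; first by rewrite /B; case: unliftP.
have B0 : B ord0 = [::] by rewrite /B unlift_none.
have BS r : B (lift ord0 r) = [:: delta_mx 0 (sg r)] by rewrite /B liftK.
apply/inj_row_free => x /rowP x0.
have E l : x 0 ord0 * norm_coord i (f z) 0 l + \sum_r x 0 (lift ord0 r) * 'D_(delta_mx 0 (sg r)) (Fc i l) z = 0.
  have jE r : jets f B i z r l = Dw (B r) (Fc i l) z by rewrite mxE.
  have e := x0 l; rewrite [RHS]mxE in e; rewrite -[RHS]e [RHS]mxE big_ord_recl jE B0; congr (_ + _).
  by apply: eq_bigr => r _; rewrite jE BS.
have x00 : x 0 ord0 = 0.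
  have := E i; rewrite norm_coord_self // mulr1 big1 ?addr0 // => r _.
  have -> : 'D_(delta_mx 0 (sg r)) (Fc i i) z = 0; last by rewrite mulr0.
  have e : germ z (fun w => 1 = norm_coord i (f w) 0 i).
    by apply: germ_imp (chart_germ hf ci) => w cw; rewrite norm_coord_self.
  by rewrite (derive_germ _ (hol_cst 1 z) e) derive_const.
have fr : row_free (rowsub sg J) := maxrowsub_free J.
have : (\row_r x 0 (lift ord0 r)) *m rowsub sg J = 0.
  apply/rowP => j; have e := E (lift i j); rewrite x00 mul0r add0r in e; rewrite [RHS]mxE -[RHS]e.
  by rewrite mxE; apply: eq_bigr => r _; rewrite -JE mxE [rowsub _ _ _ _]mxE.
move/eqP; rewrite mulmx_free_eq0 // => /eqP/rowP xr.
apply/rowP => r; rewrite [RHS]mxE; case: (unliftP ord0 r) => [r' ->|->] //.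
by have := xr r'; rewrite !mxE.
Qed.

(** For p < n, order 1 gives p + 1 independent jets and each further order one more, so n + 1 are
    reached at order n + 1 - p; for p >= n order 1 suffices. *)
Lemma frame_kappa : linearly_nondegenerate f -> maximal_rank f -> frame f (kappa p n) n.+1.
Proof.
move=> hnd /frame_rank F1; rewrite /kappa; have [pn|np] := ltnP p n; last first.
  by move: F1; rewrite (minn_idPr np).
rewrite (minn_idPl (ltnW pn)) in F1.
have H m : (m <= n - p)%N -> frame f m.+1 (p + m).+1.
  elim: m => [|m IH] mn; first by rewrite addn0.
  rewrite addnS; apply: (frame_step hf hnd (IH (ltnW mn))); lia.
have := H (n - p)%N (leqnn _); rewrite subnKC ?(ltnW pn) // -subSn // ltnW //.
Qed.

(** The total order is minimized so that [wronsk_scale] applies to every change of chart. *)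
Lemma minimal_wronskian : linearly_nondegenerate f -> maximal_rank f ->
  exists A : 'I_n.+1 -> seq V, [/\ forall r, (size (A r) <= kappa p n)%N,
    exists z i, chart_dom i (f z) /\ wronsk A (fun w => norm_coord i (f w)) z != 0 &
    forall B : 'I_n.+1 -> seq V, (forall r, (size (B r) <= kappa p n)%N) ->
      (\sum_r size (B r) < \sum_r size (A r))%N -> forall z i, chart_dom i (f z) ->
      wronsk B (fun w => norm_coord i (f w)) z = 0].
Proof.
move=> hnd hr; pose Q w := `[< exists A : 'I_n.+1 -> seq V, [/\ forall r, (size (A r) <= kappa p n)%N,
  (\sum_r size (A r) = w)%N & exists z i, chart_dom i (f z) /\ wronsk A (fun w => norm_coord i (f w)) z != 0] >].
have Q0 : exists w, Q w.
  have [B [z [i [HB ci fr]]]] := frame_kappa hnd hr.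
  exists (\sum_r size (B r))%N; apply/asboolP; exists B; split => //; exists z, i; split => //.
  by rewrite /wronsk -unitfE -unitmxE -row_free_unit.
case: (ex_minnP Q0) => w /asboolP[A [HA <- nz]] Hmin; exists A; split => // B HB lt z i ci.
apply/eqP/negPn/negP => Wn; move: lt; rewrite ltnNge => /negP; apply; apply: Hmin.
by apply/asboolP; exists B; split => //; exists z, i.
Qed.
End Rank.

(** * Dividing a power of the Wronskian by powers of the forms *)

Lemma prod_nonzero (R : realType) (V : normedModType (Cplx R)) (I : Type) (s : seq I) (F : I -> V -> Cplx R) z :
  (forall i, hol (F i) z) -> (forall i, ~ germ z (fun w => F i w = 0)) ->
  ~ germ z (fun w => \prod_(i <- s) F i w = 0).
Proof.
move=> HF nF; elim: s => [|i s IH] K.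
  by have := germ_self K; rewrite big_nil => /eqP; rewrite oner_eq0.
have hs : hol (fun w => \prod_(i <- s) F i w) z by apply: hol_prod => j _; exact: HF.
apply: (hol_mul_nonzero (HF i) hs (nF i) IH); apply: germ_imp K => w.
by rewrite big_cons.
Qed.

Lemma exp_nonzero (R : realType) (V : normedModType (Cplx R)) (F : V -> Cplx R) k z :
  ~ germ z (fun w => F w = 0) -> ~ germ z (fun w => F w ^+ k = 0).
Proof. by move=> n K; apply: n; apply: germ_imp K => w /eqP; rewrite expf_eq0 => /andP[_ /eqP]. Qed.

(** The hypothesis bounds the size of [J] by [n]; listing [J] first, the initial [n.+1] indices
    contain it. *)
Lemma select_injection (n q : nat) (J : pred 'I_q) : (n.+1 <= q)%N ->
  (forall s : 'I_n.+1 -> 'I_q, injective s -> exists r, ~~ J (s r)) ->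
  exists s : 'I_n.+1 -> 'I_q, injective s /\ forall j, J j -> exists r, j = s r.
Proof.
move=> hq HJ; pose L := [seq j <- enum 'I_q | J j] ++ [seq j <- enum 'I_q | ~~ J j].
have uL : uniq L.
  have ue := enum_uniq 'I_q; rewrite cat_uniq; apply/and3P; split; [exact: filter_uniq| |exact: filter_uniq]; apply/hasPn => j.
  by rewrite !mem_filter => /andP[/negPf -> _].
have sL : size L = q.
  by rewrite size_cat !size_filter count_predC size_enum_ord.
have rq (r : 'I_n.+1) : (r < size L)%N by rewrite sL; exact: leq_trans (ltn_ord r) hq.
pose j0 : 'I_q := Ordinal (leq_trans (ltn0Sn n) hq).
pose s (r : 'I_n.+1) := nth j0 L r.
have inj : injective s.
  by move=> r r' /eqP; rewrite /s nth_uniq // => /eqP e; apply: val_inj.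
have sJ : (size [seq j <- enum 'I_q | J j] <= n)%N.
  rewrite leqNgt; apply/negP => nJ; have [r /negP] := HJ s inj; apply.
  have rJ : (r < size [seq j <- enum 'I_q | J j])%N by exact: leq_trans (ltn_ord r) nJ.
  by have := mem_nth j0 rJ; rewrite mem_filter => /andP[Jr _]; rewrite /s /L nth_cat rJ.
exists s; split => // j Jj.
have jL : j \in [seq j <- enum 'I_q | J j] by rewrite mem_filter Jj mem_enum.
have lt : (index j [seq j <- enum 'I_q | J j] < n.+1)%N by rewrite ltnS (leq_trans _ sJ) // ltnW // index_mem.
by exists (Ordinal lt); rewrite /s /L nth_cat index_mem jL nth_index.
Qed.

Section Quotient.
Variables (R : realType) (p n q : nat).
Local Notation C := (Cplx R).
Local Notation V := 'rV[C]_p.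
Variables (f : V -> proj_space R n) (H : 'I_q -> hyperplane R n) (a : 'I_q -> 'cV[C]_n.+1).
Variables (A : 'I_n.+1 -> seq V) (N : nat) (Mp : 'I_q -> nat).
Hypotheses (hf : holomorphic_map f) (hq : (n.+1 <= q)%N) (hgp : general_position H)
  (la : forall j, linear_equation (H j) (a j))
  (nr : forall j, ~ (range f `<=` points_of (H j)))
  (HA : forall r, (size (A r) <= kappa p n)%N)
  (ram : forall j k E, (0 < k)%N -> pullback_divisor_term f (H j) E k -> (Mp j * k <= N * (k - kappa p n))%N).
Local Notation F i := (fun w => norm_coord i (f w)).

Definition wr_of i w := wronsk A (F i) w.
Definition form_of i j w := pairing (norm_coord i (f w)) (a j).

Local Notation wr := wr_of.
Local Notation G := form_of.

Lemma hol_wr i z : chart_dom i (f z) -> hol (wr i) z.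
Proof.
move=> ci; have := @hol_det R V n.+1 (fun r l => Dw (A r) (fun x => norm_coord i (f x) 0 l)) z.
by apply=> r l; apply: hol_Dw; exact: hol_coord.
Qed.

Lemma hol_G i j z : chart_dom i (f z) -> hol (G i j) z.
Proof. exact: hol_pairing. Qed.

Lemma G_point i j w : chart_dom i (f w) -> ((f @^-1` points_of (H j)) w <-> G i j w = 0).
Proof.
move=> ci; split => [/(points_ofE _ (la j)) e|/eqP]; first by apply/eqP; rewrite /form_of pairing_norm // e.
by rewrite /form_of pairing_norm // => /eqP e; apply/(points_ofE _ (la j)).
Qed.

Lemma G_nonzero i j z : chart_dom i (f z) -> ~ germ z (fun w => G i j w = 0).
Proof.
move=> ci K; apply: (nr (j := j)) => x [y _ <-]; apply/(points_ofE _ (la j)); move: y.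
apply: (pairing_germ_all hf (z := z)); apply: germ_imp (germ_and K (chart_germ hf ci)) => w [e cw].
by apply/eqP; rewrite -(pairing_norm _ cw); apply/eqP.
Qed.

Lemma hyps_preimage j : hyps (f @^-1` points_of (H j)).
Proof.
move=> z; have [i ci] := chart_exists (f z); exists (G i j); split; first exact: hol_G.
  exact: G_nonzero.
by apply: germ_imp (chart_germ hf ci) => w; exact: G_point.
Qed.

(* Complete a set of indices of vanishing linear forms, which has at most n
   elements, to n+1 indices of independent forms. *)
Lemma select_forms i w (J : pred 'I_q) : chart_dom i (f w) -> (forall j, J j -> G i j w = 0) ->
  exists s : 'I_n.+1 -> 'I_q, injective s /\ forall j, J j -> exists r, j = s r.
Proof.
move=> ci J0; apply: (select_injection hq) => s inj; apply: contrapT => no.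
have Js r : J (s r) by apply/negPn/negP => h; apply: no; exists r.
have u := general_position_unit hgp la inj.
have : norm_coord i (f w) *m \matrix_(l, r) a (s r) l 0 = 0.
  apply/rowP => r; rewrite [RHS]mxE -[RHS](J0 _ (Js r)).
  rewrite /form_of pairingE [LHS]mxE.
  by apply: eq_bigr => l _; rewrite [in LHS]mxE; congr (_ * _); rewrite mxE.
move=> e; have : norm_coord i (f w) 0 i = 0 by rewrite -[norm_coord _ _](mulmxK u) e mul0mx mxE.
by rewrite norm_coord_self // => /eqP; rewrite oner_eq0.
Qed.

(** Multiplicativity of determinants: the coordinates may be replaced by any [n.+1] of the forms, at
    the price of a constant factor. *)
Lemma wr_forms i z (s : 'I_n.+1 -> 'I_q) : chart_dom i (f z) ->
  germ z (fun w => wr i w * \det (\matrix_(l, r) a (s r) l 0) = \det (\matrix_(r, c) Dw (A r) (G i (s c)) w)).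
Proof.
move=> ci.
have K r c : germ z (fun w => Dw (A r) (G i (s c)) w = \sum_l Dw (A r) (fun x => norm_coord i (f x) 0 l) w * a (s c) l 0).
  have := Dw_lin (A r) (fun l => a (s c) l 0) (fun l => hol_coord hf l ci).
  have -> // : (fun y => \sum_l norm_coord i (f y) 0 l * a (s c) l 0) = G i (s c).
  by apply/funext => y; rewrite /form_of pairingE.
apply: germ_imp (germ_fin (fun r => germ_fin (K r))) => w Kw.
rewrite /wr_of /wronsk -det_mulmx; congr (\det _); apply/matrixP => r c; rewrite !mxE Kw.
by apply: eq_bigr => l _; rewrite [in LHS]mxE; congr (_ * _); rewrite mxE.
Qed.

(** Near a smooth point each form with positive exponent is a power of [th] times a unit. The
    vanishing ones are completed to [n.+1] independent forms; a column of order k is divisible by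
    th^(k - kappa), and [ram] compares the resulting power in [wr ^+ N] with that in the
    denominator. *)
Lemma quotient_regular i w th u : chart_dom i (f w) -> SH w th u ->
  germ w (fun x => \prod_j G i j x ^+ Mp j = 0 <-> th x = 0) ->
  exists2 Q, hol Q w & germ w (fun x => wr i x ^+ N = Q x * \prod_j G i j x ^+ Mp j).
Proof.
move=> ci S E; have [Ht t0 _] := S.
have /choice[kc Hkc] : forall j, exists kc : nat * (V -> C), [/\ hol kc.2 w,
    (0 < Mp j)%N -> kc.2 w != 0, germ w (fun x => G i j x = th x ^+ kc.1 * kc.2 x) &
    (0 < kc.1)%N -> G i j w = 0 /\ (Mp j * kc.1 <= N * (kc.1 - kappa p n))%N].
  move=> j; case Mj: (Mp j) => [|m].
    (* A form with exponent 0 is not factored; it is recorded with order 0. *)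
    exists (0%N, G i j); split; [exact: (hol_G j ci)|by []| |by []].
    by apply: germ_all => x; rewrite expr0 mul1r.
  have Gth : germ w (fun x => G i j x = 0 -> th x = 0).
    apply: germ_imp E => x e g0; apply/e; apply/eqP; rewrite prodf_seq_eq0; apply/hasP; exists j.
      by rewrite mem_index_enum.
    by rewrite /= g0 Mj expr0n.
  have [k [c [Hc c0 Ec]]] := SH_order S (hol_G j ci) (@G_nonzero i j w ci) Gth.
  exists (k, c); split; [exact: Hc|by move=> _; exact: c0|exact: Ec|move=> /= k0].
  have G0 : G i j w = 0 by rewrite (germ_self Ec) t0 expr0n gtn_eqF // mul0r.
  split => //; rewrite -Mj.
  have rg : regp (f @^-1` points_of (H j)) w th u.
    split => //; apply: germ_imp (germ_and (germ_and Gth Ec) (chart_germ hf ci)) => x [[g1 g2] cx].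
    rewrite (G_point j cx); split => // tx; by rewrite g2 tx expr0n gtn_eqF // mul0r.
  have [E' tE] := regular_term (hyps_preimage j) rg ci (la j) Hc c0 Ec.
  exact: ram k0 tE.
have [s [inj sJ]] := @select_forms i w (fun j => (0 < (kc j).1)%N) ci (fun j kj =>
  let: And4 _ _ _ h := Hkc j in proj1 (h kj)).
(* At most [kappa p n] derivatives are taken, so every entry of column [c] keeps this power of
   [th]. *)
pose ex c := ((kc (s c)).1 - kappa p n)%N.
have /choice[h Hh] : forall rc : 'I_n.+1 * 'I_n.+1, exists h : V -> C, hol h w /\
    germ w (fun x => Dw (A rc.1) (G i (s rc.2)) x = h x * th x ^+ ex rc.2).
  move=> [r c] /=; have [Hc _ Ec _] := Hkc (s c).
  have [c' Hc' Ec'] := Dw_pow (A r) Ht Hc Ec.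
  exists (fun x => th x ^+ ((kc (s c)).1 - size (A r) - ex c) * c' x); split.
    exact: (holM (holX _ Ht) Hc').
  apply: germ_imp Ec' => x ->; rewrite mulrAC -exprD subnK // /ex leq_sub2l //.
pose D := \det (\matrix_(l, r) a (s r) l 0).
have D0 : D != 0 by have := general_position_unit hgp la inj; rewrite unitmxE unitfE.
pose hd x := \det (\matrix_(r, c) h (r, c) x).
have Hhd : hol hd w.
  have := @hol_det R V n.+1 (fun r c => h (r, c)) w; apply => r c; by have [] := Hh (r, c).
have EW : germ w (fun x => wr i x * D = hd x * th x ^+ (\sum_c ex c)%N).
  apply: germ_imp (germ_and (wr_forms s ci) (germ_fin (fun rc => proj2 (Hh rc)))) => x [-> e].
  have -> : \matrix_(r, c) Dw (A r) (G i (s c)) x = \matrix_(r, c) h (r, c) x *m diag_mx (\row_c th x ^+ ex c).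
    by apply/matrixP => r c; rewrite mul_mx_diag !mxE (e (r, c)).
  rewrite det_mulmx det_diag /hd; congr (_ * _); rewrite expr_sum; apply: eq_bigr => c _; by rewrite mxE.
(* The ramification enters here: [ram] is summed over the selected indices, which include all those
   of positive order. *)
have le_ex : (\sum_j (kc j).1 * Mp j <= (\sum_c ex c) * N)%N.
  have -> : ((\sum_c ex c) * N = \sum_(j in s @: 'I_n.+1) N * ((kc j).1 - kappa p n))%N.
    rewrite big_imset /=; last by move=> ? ? _ _; exact: inj.
    by rewrite big_distrl /=; apply: eq_bigr => c _; rewrite mulnC.
  rewrite [X in (_ <= X)%N]big_mkcond /=; apply: leq_sum => j _.
  have [kj|] := posnP (kc j).1; first by rewrite kj mul0n.
  move=> kj; have [_ _ _ /(_ kj)[_]] := Hkc j; rewrite mulnC.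
  by have [r ->] := sJ j kj; rewrite imset_f.
pose d := ((\sum_c ex c) * N - \sum_j (kc j).1 * Mp j)%N.
pose cp x := \prod_j (kc j).2 x ^+ Mp j.
have Hcp : hol cp w by apply: hol_prod => j _; apply: holX; have [] := Hkc j.
have cp0 : cp w != 0.
  apply/prodf_neq0 => j _; have [_ h0 _ _] := Hkc j; case Mj: (Mp j) => [|m]; first by rewrite expr0 oner_neq0.
  by rewrite expf_neq0 // h0 // Mj.
exists (fun x => th x ^+ d * hd x ^+ N * (D ^- N) / cp x).
  apply: hol_div; [|exact: Hcp|exact: cp0].
  exact: (holM (holM (holX d Ht) (holX N Hhd)) (hol_cst _ w)).
have EG : germ w (fun x => forall j, G i j x = th x ^+ (kc j).1 * (kc j).2 x).
  by apply: germ_fin => j; have [] := Hkc j.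
apply: germ_imp (germ_and (germ_and EW EG) (hol_neq0 Hcp cp0)) => x [[eW eG] cx].
have -> : \prod_j G i j x ^+ Mp j = th x ^+ (\sum_j (kc j).1 * Mp j)%N * cp x.
  rewrite /cp expr_sum -big_split; apply: eq_bigr => j _ /=.
  by rewrite eG exprMn exprM.
have -> : wr i x = hd x * th x ^+ (\sum_c ex c)%N / D by rewrite -eW mulfK.
rewrite expr_div_n exprMn -exprM.
have -> : ((\sum_c ex c) * N = \sum_j (kc j).1 * Mp j + d)%N by rewrite /d subnKC.
rewrite exprD; move: (th x ^+ _) (th x ^+ _) (hd x ^+ N) (D ^- N) => t1 t2 t3 t4.
by rewrite -mulrA; field.
Qed.

Lemma quotient_local i z : chart_dom i (f z) ->
  exists2 Q, hol Q z & germ z (fun w => wr i w ^+ N = Q w * \prod_j G i j w ^+ Mp j).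
Proof.
move=> ci; have hP : hol (fun w => \prod_j G i j w ^+ Mp j) z.
  by apply: hol_prod => j _; apply: holX; exact: hol_G.
apply: (hol_div_generic hP _ (holX N (hol_wr ci))).
  apply: prod_nonzero => j; first by apply: holX; exact: hol_G.
  by apply: exp_nonzero; exact: G_nonzero.
apply: germ_imp (chart_germ hf ci) => w cw th u S E.
have [Q [M HM] EQ] := quotient_regular cw S E; exists M.
apply: germ_imp (germ_and HM EQ) => x [[b _] ->]; rewrite nrmM; apply: ler_wpM2r => //; exact: nrm_ge0.
Qed.
End Quotient.

(** * Gluing the quotients into entire functions *)

Lemma Dw_germ (R : realType) (V : normedModType (Cplx R)) (w : seq V) (f g : V -> Cplx R) z : hol f z ->
  germ z (fun x => f x = g x) -> germ z (fun x => Dw w g x = Dw w f x).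
Proof.
move=> Hf E; elim: w => [|v w IH]; first by apply: germ_imp E => x e; rewrite /= e.
apply: germ_imp (germ_and (germ_open IH) (hol_open Hf)) => x [e hf] /=.
by apply: (derive_germ v (hol_Dw w hf)); apply: germ_imp e => y ->.
Qed.

Lemma cancel_dense (R : realType) (V : normedModType (Cplx R)) (D f g : V -> Cplx R) z : hol f z -> hol g z ->
  ~ germ z (fun x => D x = 0) -> germ z (fun x => f x * D x = g x * D x) -> f z = g z.
Proof.
move=> Hf Hg nD E; have : nrm (f z - g z) <= 0 * nrm (f z).
  apply: (@le_dense _ _ D (fun x => f x - g x) f z 0 (holB2 Hf Hg) Hf nD).
  by apply: germ_imp E => x e Dx; rewrite (mulIf Dx e) subrr nrm0 mul0r.
rewrite mul0r => h; apply/eqP; rewrite -subr_eq0 -nrm_eq0 eq_le h; exact: nrm_ge0.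
Qed.

Section Psi.
Variables (R : realType) (p n q : nat).
Local Notation C := (Cplx R).
Local Notation V := 'rV[C]_p.
Variables (f : V -> proj_space R n) (H : 'I_q -> hyperplane R n) (a : 'I_q -> 'cV[C]_n.+1).
Variables (A : 'I_n.+1 -> seq V) (N D : nat) (Mp : 'I_q -> nat).
Hypotheses (hf : holomorphic_map f) (hq : (n.+1 <= q)%N) (hgp : general_position H)
  (la : forall j, linear_equation (H j) (a j))
  (nr : forall j, ~ (range f `<=` points_of (H j)))
  (HA : forall r, (size (A r) <= kappa p n)%N)
  (ram : forall j k E, (0 < k)%N -> pullback_divisor_term f (H j) E k -> (Mp j * k <= N * (k - kappa p n))%N)
  (Amin : forall B : 'I_n.+1 -> seq V, (forall r, (size (B r) <= kappa p n)%N) ->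
      (\sum_r size (B r) < \sum_r size (A r))%N -> forall z i, chart_dom i (f z) ->
      wronsk B (fun w => norm_coord i (f w)) z = 0)
  (D0 : (0 < D)%N) (HD : (\sum_j (Mp j).-1 = N * n.+1 + D)%N).
Local Notation F i := (fun w => norm_coord i (f w)).
Local Notation wr := (wr_of f A).
Local Notation G := (form_of f a).

Lemma change_hol i j z : chart_dom i (f z) -> chart_dom j (f z) -> hol (fun w => (norm_coord i (f w) 0 j)^-1) z.
Proof. by move=> ci cj; apply: holV; [exact: hol_coord|rewrite norm_coord_dom]. Qed.

Lemma wr_change i j z : chart_dom i (f z) -> chart_dom j (f z) ->
  wr j z = (norm_coord i (f z) 0 j)^-1 ^+ n.+1 * wr i z.
Proof.
move=> ci cj; rewrite /wr_of.
rewrite -(@wronsk_scale R V n.+1 A (F i) (fun w => (norm_coord i (f w) 0 j)^-1) z).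
- rewrite /wronsk; congr (\det _); apply/matrixP => r l; rewrite [LHS]mxE [RHS]mxE.
  apply: esym; apply: (germ_self (Dw_germ (A r) (hol_coord hf l cj) _)).
  apply: germ_imp (germ_and (chart_germ hf ci) (chart_germ hf cj)) => w [cwi cwj].
  by rewrite (norm_coord_change cwi cwj).
- exact: change_hol.
- by move=> l; exact: hol_coord.
- move=> B HB lt; apply: Amin => // r; exact: leq_trans (HB r) (HA r).
Qed.

Lemma G_change i j l z : chart_dom i (f z) -> chart_dom j (f z) ->
  G j l z = (norm_coord i (f z) 0 j)^-1 * G i l z.
Proof. by move=> ci cj; rewrite /form_of (norm_coord_change ci cj) pairingZ. Qed.

Lemma prodG_nonzero i z : chart_dom i (f z) -> ~ germ z (fun w => \prod_j G i j w ^+ (Mp j).-1 = 0).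
Proof.
move=> ci; apply: prod_nonzero => j; first by apply: holX; exact: hol_G.
by apply: exp_nonzero; exact: (G_nonzero hf la nr).
Qed.

(** Lowering each positive exponent by one leaves one factor of each such form in the quotient,
    which therefore vanishes with it. *)
Lemma Phi_local i z : chart_dom i (f z) -> exists Q, [/\ hol Q z,
  germ z (fun w => wr i w ^+ N = Q w * \prod_j G i j w ^+ (Mp j).-1) &
  germ z (fun w => forall j, (0 < Mp j)%N -> G i j w = 0 -> Q w = 0)].
Proof.
move=> ci; have [Q HQ EQ] := quotient_local hf hq hgp la nr HA ram ci.
exists (fun w => Q w * \prod_(j | (0 < Mp j)%N) G i j w); split.
- have HG : hol (fun w => \prod_(j | (0 < Mp j)%N) G i j w) z.
    by apply: hol_prod => j _; exact: (hol_G a hf j ci).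
  exact: (holM HQ HG).
- apply: germ_imp EQ => w ->; rewrite -mulrA; congr (_ * _).
  rewrite [X in _ = X * _]big_mkcond -big_split /=; apply: eq_bigr => j _ /=.
  by case: (Mp j) => [|m] /=; rewrite ?mul1r // exprS.
- apply: germ_all => w j Mj Gj; apply/eqP; rewrite mulf_eq0; apply/orP; right.
  by rewrite prodf_seq_eq0; apply/hasP; exists j; rewrite ?mem_index_enum // Mj Gj eqxx.
Qed.

Definition Phi_spec (Phi : 'I_n.+1 -> V -> C) : Prop := forall i z, chart_dom i (f z) -> [/\ hol (Phi i) z,
  germ z (fun w => wr i w ^+ N = Phi i w * \prod_j G i j w ^+ (Mp j).-1) &
  forall j, (0 < Mp j)%N -> G i j z = 0 -> Phi i z = 0].

Lemma Phi_exists : exists Phi, Phi_spec Phi.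
Proof.
have /choice[T HT] : forall y : 'I_n.+1 * V, exists Q : V -> C, chart_dom y.1 (f y.2) -> [/\ hol Q y.2,
  germ y.2 (fun w => wr y.1 w ^+ N = Q w * \prod_j G y.1 j w ^+ (Mp j).-1) &
  germ y.2 (fun w => forall j, (0 < Mp j)%N -> G y.1 j w = 0 -> Q w = 0)].
  move=> [i z] /=; have [ci|nci] := pselect (chart_dom i (f z)); last by exists (fun=> 0).
  by have [Q HQ] := Phi_local ci; exists Q.
exists (fun i z => T (i, z) z) => i z ci; have [Hz Ez Vz] := HT (i, z) ci.
rewrite /= in Hz Ez Vz.
have E : germ z (fun w => T (i, z) w = T (i, w) w).
  apply: germ_imp (germ_and (germ_and (germ_open Ez) (hol_open Hz)) (chart_germ hf ci)) => w [[e h] cw].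
  have [Hw Ew _] := HT (i, w) cw; apply: (cancel_dense h Hw (prodG_nonzero cw)).
  by apply: germ_imp (germ_and e Ew) => x [/= <- <-].
split; first exact: hol_ext E Hz.
- by apply: germ_imp (germ_and E Ez) => w [<- ->].
- exact: (germ_self Vz).
Qed.

Variable Phi : 'I_n.+1 -> V -> C.
Hypothesis HPhi : Phi_spec Phi.

(** Homogeneity: the numerator has degree [N * n.+1] in the coordinates and the denominator
    [N * n.+1 + D], so [Phi] has degree [- D]. *)
Lemma Phi_change i j z : chart_dom i (f z) -> chart_dom j (f z) ->
  Phi j z * (norm_coord i (f z) 0 j)^-1 ^+ D = Phi i z.
Proof.
move=> ci cj; have [Hi Ei _] := HPhi ci; have [Hj Ej _] := HPhi cj.
have Hc := change_hol ci cj.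
apply: (cancel_dense (f := fun w => Phi j w * (norm_coord i (f w) 0 j)^-1 ^+ D)
  (holM Hj (holX D Hc)) Hi (prodG_nonzero ci)).
apply: germ_imp (germ_and (germ_and Ei Ej) (germ_and (chart_germ hf ci) (chart_germ hf cj))) => w [[ei ej] [cwi cwj]].
have c0 : (norm_coord i (f w) 0 j)^-1 != 0 by rewrite invr_eq0 norm_coord_dom.
rewrite (wr_change cwi cwj) exprMn -exprM ei in ej.
have pE : \prod_l G j l w ^+ (Mp l).-1 = (norm_coord i (f w) 0 j)^-1 ^+ (N * n.+1 + D) * \prod_l G i l w ^+ (Mp l).-1.
  rewrite -HD expr_sum -big_split; apply: eq_bigr => l _ /=; by rewrite (G_change l cwi cwj) exprMn.
rewrite pE exprD [(n.+1 * N)%N]mulnC in ej.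
apply: (mulfI (expf_neq0 (N * n.+1) c0)); rewrite ej; move: (_ ^+ (N * n.+1)) (_ ^+ D) (\prod_l _) => x y t; ring.
Qed.

(** Multiplying by the [D]-th power of a linear form brings the degree to 0, so the product does not
    depend on the chart. *)
Lemma Psi_exists : exists Psi : 'cV[C]_n.+1 -> V -> C, (forall e z, hol (Psi e) z) /\
  forall e i z, chart_dom i (f z) -> Psi e z = Phi i z * pairing (norm_coord i (f z)) e ^+ D.
Proof.
have /choice[ch Hch] : forall z, exists i, chart_dom i (f z) by move=> z; exact: chart_exists.
pose Psi (e : 'cV[C]_n.+1) z := Phi (ch z) z * pairing (norm_coord (ch z) (f z)) e ^+ D.
have PE e i z : chart_dom i (f z) -> Psi e z = Phi i z * pairing (norm_coord i (f z)) e ^+ D.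
  move=> ci; rewrite /Psi -(Phi_change ci (Hch z)) (norm_coord_change ci (Hch z)) pairingZ exprMn.
  by rewrite mulrA.
exists Psi; split => // e z; have ci := Hch z; have [Hi _ _] := HPhi ci.
apply: hol_ext (holM Hi (holX D (hol_pairing hf e ci))).
by apply: germ_imp (chart_germ hf ci) => w cw; rewrite (PE e _ w cw).
Qed.
End Psi.

(** * Local estimate of the quotient *)

Section Aux.
Variable R : realType.
Local Notation C := (Cplx R).

Lemma det_le_perm m (M : 'M[C]_m) : exists s : 'S_m, nrm (\det M) <= (m`!)%:R * \prod_r nrm (M r (s r)).
Proof.
pose F (s : 'S_m) := \prod_r nrm (M r (s r)).
exists [arg max_(s > (1%g : 'S_m)) F s]%O; case: arg_maxP => // s0 _ Hmax.
rewrite /determinant; apply: (@le_trans _ _ (\sum_(s : 'S_m) F s0)); last first.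
  by rewrite sumr_const -[#|_|]/(#|'S_m|) card_Sn mulr_natl.
apply: (big_ind2 (fun (x : C) (y : R) => nrm x <= y)) => [|x1 x2 y1 y2 h1 h2|s _]; first by rewrite nrm0.
  by apply: le_trans (nrmD _ _) _; exact: lerD.
rewrite nrmM nrmX nrmN nrm1 expr1n mul1r nrm_prod; exact: Hmax.
Qed.

Lemma pos_bound (T : finType) (F : T -> R) : exists2 B : R, 0 < B & forall t, F t <= B.
Proof.
exists (1 + \sum_t `|F t|) => [|t]; first by rewrite ltr_pwDl // sumr_ge0.
apply: le_trans (ler_norm _) _; rewrite (bigD1 t) //= addrCA lerDl addr_ge0 // sumr_ge0 //.
Qed.

Lemma argmax_ord m (x : 'I_m.+1 -> R) : exists i, forall k, x k <= x i.
Proof.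
by exists [arg max_(i > ord0) x i]%O; case: arg_maxP => // i _ H k; exact: H.
Qed.
End Aux.

Section Local.
Variables (R : realType) (p n q : nat).
Local Notation C := (Cplx R).
Local Notation V := 'rV[C]_p.
Variables (f : V -> proj_space R n) (H : 'I_q -> hyperplane R n) (a : 'I_q -> 'cV[C]_n.+1).
Hypotheses (hf : holomorphic_map f) (hq : (n.+1 <= q)%N) (hgp : general_position H)
  (la : forall j, linear_equation (H j) (a j)).
Local Notation F i := (fun w => norm_coord i (f w)).
Local Notation G := (form_of f a).

Lemma max_chart (x : proj_space R n) : exists m, chart_dom m x /\ forall k, nrm (norm_coord m x 0 k) <= 1.
Proof.
have [m Hm] := argmax_ord (fun k => nrm (hom_coord x 0 k)).
have cm : chart_dom m x.
  have [i ci] := chart_exists x; rewrite /chart_dom /= -nrm_gt0; apply: lt_le_trans (Hm i).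
  by rewrite nrm_gt0.
exists m; split => // k; rewrite mxE nrmM nrmV mulrC ler_pdivrMr ?mul1r; first exact: Hm.
by rewrite nrm_gt0.
Qed.

(** The 2 by 2 minor in columns [i] and [k] of [y] and the argument; it vanishes at [y]. *)
Definition minor_form (y : 'rV[C]_n.+1) (i k : 'I_n.+1) : 'cV[C]_n.+1 :=
  y 0 i *: delta_mx k 0 - y 0 k *: delta_mx i 0.

Lemma pairing_delta (x : 'rV[C]_n.+1) k : pairing x (delta_mx k 0) = x 0 k.
Proof. by rewrite /pairing -colE mxE. Qed.

Lemma pairing_minor (x y : 'rV[C]_n.+1) i k : pairing x (minor_form y i k) = y 0 i * x 0 k - y 0 k * x 0 i.
Proof.
by rewrite -(pairing_delta x k) -(pairing_delta x i) /pairing /minor_form mulmxBr -!scalemxAr !mxE.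
Qed.

(* Some n+1 of the forms a_j control all the values that are small at f w. *)
Lemma forms_small : exists2 de : R, 0 < de <= 1 & forall i w, chart_dom i (f w) ->
  exists s : 'I_n.+1 -> 'I_q, injective s /\ forall j, (forall r, j != s r) -> de <= nrm (G i j w).
Proof.
pose As (s : {ffun 'I_n.+1 -> 'I_q}) : 'M[C]_n.+1 := \matrix_(l, r) a (s r) l 0.
have [B B0 HB] := pos_bound (fun y : {ffun 'I_n.+1 -> 'I_q} * ('I_n.+1 * 'I_n.+1) => nrm (invmx (As y.1) y.2.1 y.2.2)).
have n1 : 0 < n.+1%:R :> R by rewrite ltr0n.
have nB : 0 < n.+1%:R * B + 1 by rewrite addr_gt0 // mulr_gt0.
(* If [n.+1] independent forms were below this value, solving for the coordinates would give modulus
   less than 1, but the [i]-th coordinate is 1. *)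
exists (n.+1%:R * B + 1)^-1.
  by rewrite invr_gt0 nB /= invf_le1 // lerDr mulr_ge0 // ltW.
move=> i w ci; pose J j := nrm (G i j w) < (n.+1%:R * B + 1)^-1.
have [s [inj sJ]] : exists s : 'I_n.+1 -> 'I_q, injective s /\ forall j, J j -> exists r, j = s r.
  apply: (select_injection hq) => s inj; apply: contrapT => no.
  have Js r : J (s r) by apply/negPn/negP => h; apply: no; exists r.
  pose s' : {ffun 'I_n.+1 -> 'I_q} := [ffun r => s r].
  have u : As s' \in unitmx.
    have -> : As s' = \matrix_(l, r) a (s r) l 0 by apply/matrixP => l r; rewrite !mxE ffunE.
    exact: general_position_unit hgp la inj.
  have : nrm (norm_coord i (f w) 0 i) < 1; last by rewrite norm_coord_self // nrm1 ltxx.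
  rewrite -[norm_coord _ _](mulmxK u) mxE.
  apply: le_lt_trans (nrm_sum _) _.
  apply: (@le_lt_trans _ _ (\sum_(r < n.+1) (n.+1%:R * B + 1)^-1 * B)).
    apply: ler_sum => r _; rewrite nrmM; apply: ler_pM; rewrite ?nrm_ge0 //; last exact: (HB (s', (r, i))).
    have -> : (norm_coord i (f w) *m As s') 0 r = G i (s r) w.
      by rewrite /form_of pairingE mxE; apply: eq_bigr => l _; congr (_ * _); rewrite mxE ffunE.
    exact: ltW (Js r).
  rewrite sumr_const card_ord -[X in X < 1]mulr_natl mulrCA mulrC ltr_pdivrMr // mul1r.
  by rewrite ltrDl.
exists s; split => // j nj; rewrite leNgt; apply/negP => /sJ[r e].
by have := nj r; rewrite e eqxx.
Qed.

Variables (A : 'I_n.+1 -> seq V) (N D : nat) (M : 'I_q -> nat) (Phi : 'I_n.+1 -> V -> C) (Psi : 'cV[C]_n.+1 -> V -> C).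
Hypotheses (N0 : (0 < N)%N) (D0 : (0 < D)%N) (MN : forall j, (M j < N)%N)
  (hPhi : forall i z, chart_dom i (f z) -> hol (Phi i) z)
  (Phi_eq : forall i z, chart_dom i (f z) -> wr_of f A i z ^+ N = Phi i z * \prod_j G i j z ^+ M j)
  (Phi_van : forall i z j, chart_dom i (f z) -> (0 < M j)%N -> G i j z = 0 -> Phi i z = 0)
  (hPsi : forall e z, hol (Psi e) z)
  (PsiE : forall e i z, chart_dom i (f z) -> Psi e z = Phi i z * pairing (norm_coord i (f z)) e ^+ D).

(* Near z, f stays in the chart where its coordinates are maximal at z: the form
   vanishing at f w and taken at f z measures how far these points are. *)
Lemma stay_in_chart (T : R) : 1 <= T -> exists2 c : R, 0 < c <= 1 & forall z d i, 0 < d -> chart_dom i (f z) ->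
  (forall k, nrm (norm_coord i (f z) 0 k) <= 1) -> Phi i z != 0 ->
  (forall w k, nrm (w - z) < d -> nrm (Psi (delta_mx k 0) w) <= T * nrm (Phi i z)) ->
  forall w, nrm (w - z) < c * d -> [/\ chart_dom i (f w), forall k, nrm (norm_coord i (f w) 0 k) <= 4 / 3 &
    nrm (Phi i w) <= T * nrm (Phi i z)].
Proof.
move=> T1; have k1 := K1_gt0 R.
have T0 : 0 < T by lra.
pose L := 4 * K1 R * (2 ^+ D * T).
have L0 : 0 < L by exact: (mulr_gt0 (mulr_gt0 (ltr0n R 4) k1) (mulr_gt0 (@pow2_gt0 R D) T0)).
have f4 : 0 < (1 / 4) ^+ D :> R by rewrite exprn_gt0 //; lra.
pose c := Num.min (1 / 4) ((1 / 4) ^+ D / L).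
have c0 : 0 < c by rewrite /c lt_min; apply/andP; split; [lra|exact: divr_gt0].
have c4 : c <= 1 / 4 by rewrite /c ge_min lexx.
have cL : c * L <= (1 / 4) ^+ D by rewrite -ler_pdivlMr // /c ge_min lexx orbT.
clearbody c; exists c; first by lra.
move=> z d i d0 ci zi Pz HT w wd.
have Pz0 : 0 < nrm (Phi i z) by rewrite nrm_gt0.
have cd4 : c * d <= d / 4 by nra.
have wd4 : nrm (w - z) <= d / 4 by lra.
have wd1 : nrm (w - z) < d by lra.
have [m [cm wm]] := max_chart (f w).
pose y := norm_coord m (f w).
(* For the minor form at [f w], [Psi e] vanishes at [w], so its Lipschitz bound makes it small at
   [z] relative to [Phi i z]; the [D]-th root yields [1 / 4]. *)
have est k : nrm (y 0 i * norm_coord i (f z) 0 k - y 0 k) <= 1 / 4.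
  pose e := minor_form y i k.
  have Pw : Psi e w = 0.
    by rewrite (PsiE e cm) pairing_minor -/y [y 0 i * _]mulrC subrr expr0n gtn_eqF // mulr0.
  have HB : holB (Psi e) z d (2 ^+ D * T * nrm (Phi i z)).
    move=> x xd; split; last by move=> v; exact: hol_derivable.
    have [m' [cm' xm']] := max_chart (f x); rewrite (PsiE e cm') nrmM nrmX.
    have h1 := HT x m' xd; rewrite (PsiE _ cm') pairing_delta norm_coord_self // expr1n mulr1 in h1.
    have h2 : nrm (pairing (norm_coord m' (f x)) e) <= 2.
      rewrite pairing_minor; have := nrmD (y 0 i * norm_coord m' (f x) 0 k) (- (y 0 k * norm_coord m' (f x) 0 i)).
      rewrite nrmN !nrmM => h; apply: le_trans h _.
      have h3 k' k'' : nrm (y 0 k') * nrm (norm_coord m' (f x) 0 k'') <= 1 * 1 by apply: ler_pM; rewrite ?nrm_ge0 // wm.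
      have := h3 i k; have := h3 k i; lra.
    rewrite mulrC -mulrA; apply: ler_pM; rewrite ?exprn_ge0 ?nrm_ge0 //.
    by rewrite lerXn2r ?nnegrE ?nrm_ge0.
  have := holB_lip d0 HB wd4; rewrite [z + _]addrC subrK Pw sub0r nrmN.
  rewrite (PsiE e ci) pairing_minor norm_coord_self // mulr1 nrmM nrmX => h.
  have h2 : nrm (y 0 i * norm_coord i (f z) 0 k - y 0 k) ^+ D <= (1 / 4) ^+ D.
    rewrite -(ler_pM2l Pz0); apply: le_trans h _.
    have -> : 4 * K1 R * (2 ^+ D * T * nrm (Phi i z)) / d * nrm (w - z) = nrm (Phi i z) * (L * (nrm (w - z) / d)).
      by rewrite /L; ring.
    apply: ler_wpM2l; first exact: ltW.
    have h3 : nrm (w - z) / d <= c by rewrite ler_pdivrMr //; exact: ltW.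
    by apply: le_trans (ler_wpM2l (ltW L0) h3) _; rewrite mulrC.
  by rewrite -(ler_pXn2r D0) ?nnegrE ?nrm_ge0 //; lra.
have yi : 3 / 4 <= nrm (y 0 i).
  have := est m; rewrite {2}/y norm_coord_self // => h.
  have := nrm_sub_ge (1 : C) (y 0 i * norm_coord i (f z) 0 m); rewrite nrmB nrm1 nrmM => h2.
  have : nrm (y 0 i) * nrm (norm_coord i (f z) 0 m) <= nrm (y 0 i) * 1 by apply: ler_wpM2l; [exact: nrm_ge0|exact: zi].
  by rewrite mulr1; lra.
have ciw : chart_dom i (f w).
  by have : y 0 i != 0 by [rewrite -nrm_gt0; lra]; rewrite norm_coord_dom.
split => // [k|].
  rewrite (norm_coord_change cm ciw) mxE -/y nrmM nrmV mulrC ler_pdivrMr; last lra.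
  by have := wm k; rewrite -/y; lra.
by have := HT w i wd1; rewrite (PsiE _ ciw) pairing_delta norm_coord_self // expr1n mulr1.
Qed.

(** By [stay_in_chart] the chart [i] remains usable on a comparable ball, and on a smaller one
    [Phi i] has no zero, so neither have the forms of positive exponent. [harnack_Dw] bounds
    derivatives of forms by powers of the forms; expanding the Wronskian in the forms selected by
    [forms_small] then bounds its [N]-th power by rho^-K times the selected factors, the others
    being bounded below. *)
Lemma local_bound (T : R) : 1 <= T -> exists2 B : R, 0 < B & forall z d i, 0 < d -> chart_dom i (f z) ->
  (forall k, nrm (norm_coord i (f z) 0 k) <= 1) -> Phi i z != 0 ->
  (forall w k, nrm (w - z) < d -> nrm (Psi (delta_mx k 0) w) <= T * nrm (Phi i z)) ->
  nrm (Phi i z) * d ^+ (N * \sum_r size (A r)) <= B.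
Proof.
move=> T1; have [c /andP[c0 c1] Hc] := stay_in_chart T1.
have k1 := K1_gt0 R; have T0 : 0 < T by lra.
have kT : 0 < K1 R * T by exact: mulr_gt0.
pose c2 := c / (8 * (K1 R * T + 1)).
have c20 : 0 < c2 by apply: divr_gt0 => //; lra.
have c2E : c2 * (8 * (K1 R * T + 1)) = c by rewrite /c2 divfK // gt_eqF //; lra.
clearbody c2.
have [A1 A10 HA1] := pos_bound (fun j => \sum_l 4 / 3 * nrm (a j l 0)).
pose A0 := A1 + 1; have A01 : 1 <= A0 by rewrite /A0; lra.
have A0p : 0 < A0 by lra.
have /choice[Kr HKr] : forall r, exists K : R, 0 < K /\ forall g z (rho A' : R), 0 < rho -> 0 < A' ->
  (forall x, nrm (x - z) < rho -> [/\ hol g x, g x != 0 & nrm (g x) <= A']) ->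
  nrm (Dw (A r) g z) ^+ N <= K * (A' * nrm (g z) ^+ N.-1) / rho ^+ (N * size (A r)).
  by move=> r; have [K K0 HK] := @harnack_Dw R V N (A r) N0; exists K.
have [C1 C10 HC1] := pos_bound (fun r => Kr r * A0 ^+ N).
have [C2 C20 HC2] := pos_bound (fun r => Kw (A r) ^+ N * A0 ^+ N).
pose C0 := C1 + C2; have C00 : 0 < C0 by rewrite /C0; lra.
have [de /andP[de0 de1] Hde] := forms_small.
have [B3 B30 HB3] := pos_bound (fun s : {ffun 'I_n.+1 -> 'I_q} => (nrm (\det (\matrix_(l, r) a (s r) l 0)) ^+ N)^-1).
pose K := (N * \sum_r size (A r))%N.
pose SM := (\sum_j M j)%N.
have c2K : 0 < c2 ^+ K by rewrite exprn_gt0.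
have deM : 0 < de ^+ SM by rewrite exprn_gt0.
pose F0 : R := (n.+1`!)%:R.
have F00 : 0 < F0 by rewrite /F0 ltr0n fact_gt0.
pose Bt := F0 ^+ N * C0 ^+ n.+1 * B3 / de ^+ SM / c2 ^+ K.
exists Bt.
  by rewrite /Bt; apply: divr_gt0 => //; apply: divr_gt0 => //; apply: mulr_gt0 => //; apply: mulr_gt0; exact: exprn_gt0.
move=> z d i d0 ci zi Pz HT.
have stay := Hc z d i d0 ci zi Pz HT.
have Pz0 : 0 < nrm (Phi i z) by rewrite nrm_gt0.
have cd0 : 0 < c * d by exact: mulr_gt0.
pose rho := c2 * d; have rho0 : 0 < rho by exact: mulr_gt0.
have rc_ : rho <= c * d / 4.
  by rewrite /rho -c2E; have : 0 < c2 * d by []; nra.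
have rcd : rho <= c * d by lra.
have HBP : holB (Phi i) z (c * d) (T * nrm (Phi i z)).
  by move=> w wd; have [cw _ Pw] := stay w wd; split => // v; exact: (hol_derivable v (hPhi cw)).
(* By the Lipschitz bound [Phi i] varies by less than |Phi i z| within [rho]. *)
have Pnz w : nrm (w - z) < rho -> Phi i w != 0.
  move=> wr; have w4 : nrm (w - z) <= c * d / 4 by lra.
  have := holB_lip cd0 HBP w4; rewrite [z + _]addrC subrK => lip.
  have : 4 * K1 R * (T * nrm (Phi i z)) / (c * d) * nrm (w - z) < nrm (Phi i z).
    have -> : 4 * K1 R * (T * nrm (Phi i z)) / (c * d) * nrm (w - z) =
       nrm (Phi i z) * (4 * (K1 R * T) * nrm (w - z) / (c * d)) by ring.
    rewrite -[X in _ < X]mulr1 ltr_pM2l // ltr_pdivrMr // mul1r.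
    have h1 : 4 * (K1 R * T) * nrm (w - z) <= 4 * (K1 R * T) * rho.
      by apply: ler_wpM2l; [apply: mulr_ge0 => //; exact: ltW|exact: ltW].
    apply: le_lt_trans h1 _; rewrite /rho -c2E; nra.
  by move=> lt; rewrite -nrm_gt0; have := nrm_sub_ge (Phi i z) (Phi i w); rewrite nrmB; lra.
have Gb j w : nrm (w - z) < rho -> nrm (G i j w) <= A0.
  move=> wr; have [cw Fw _] := stay w (lt_le_trans wr rcd).
  rewrite /form_of pairingE; apply: le_trans (nrm_sum _) _.
  apply: (@le_trans _ _ A1); last by rewrite /A0; lra.
  apply: le_trans (HA1 j); apply: ler_sum => l _; rewrite nrmM.
  by apply: ler_wpM2r; [exact: nrm_ge0|exact: Fw].
have hG j w : nrm (w - z) < rho -> hol (G i j) w.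
  by move=> wr; have [cw _ _] := stay w (lt_le_trans wr rcd); exact: hol_G.
have zz : nrm (z - z) < rho by rewrite subrr nrm0.
have Gn j w : (0 < M j)%N -> nrm (w - z) < rho -> G i j w != 0.
  move=> Mj wr; have [cw _ _] := stay w (lt_le_trans wr rcd); apply/eqP => G0.
  by have := Pnz w wr; rewrite (Phi_van cw Mj G0) eqxx.
(* For exponent 0 the Cauchy estimate suffices. Otherwise [harnack_Dw] gives the power [N.-1],
   lowered to [M j] at the cost of powers of the bound [A0]. *)
have est r j : nrm (Dw (A r) (G i j) z) ^+ N <= C0 / rho ^+ (N * size (A r)) * nrm (G i j z) ^+ M j.
  have rs : 0 < rho ^+ (N * size (A r)) by rewrite exprn_gt0.
  have g0 := nrm_ge0 (G i j z).
  have [M0|Mj] := posnP (M j).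
    rewrite M0 expr0 mulr1.
    have HB : holB (G i j) z rho A0.
      by move=> w wr; split; [exact: Gb|move=> v; exact: (hol_derivable v (hG j w wr))].
    have D1 := Dw_bound (A r) rho0 HB.
    have := lerXn2r N (nrm_ge0 _) (le_trans (nrm_ge0 _) D1) D1 => D2; apply: le_trans D2 _.
    rewrite expr_div_n exprMn -exprM [(size _ * N)%N]mulnC ler_pM2r ?invr_gt0 //.
    by apply: le_trans (HC2 r) _; rewrite /C0; lra.
  have [_ /(_ (G i j) z rho A0 rho0 A0p)] := HKr r => h.
  have {}h := h (fun x xr => And3 (hG j x xr) (Gn j x Mj xr) (Gb j x xr)).
  apply: le_trans h _; rewrite [X in _ <= X]mulrAC ler_pM2r ?invr_gt0 //.
  have eN : N.-1 = (M j + (N.-1 - M j))%N by rewrite subnKC // -ltnS prednK.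
  have g1 : nrm (G i j z) ^+ N.-1 <= nrm (G i j z) ^+ M j * A0 ^+ N.-1.
    rewrite eN exprD; apply: ler_wpM2l; first exact: exprn_ge0.
    apply: (@le_trans _ _ (A0 ^+ (N.-1 - M j))); first by rewrite lerXn2r ?nnegrE ?(ltW A0p) ?Gb.
    by rewrite ler_weXn2l // leq_addl.
  have Kp : 0 < Kr r by have [] := HKr r.
  apply: (@le_trans _ _ (Kr r * (A0 * (nrm (G i j z) ^+ M j * A0 ^+ N.-1)))).
    by apply: ler_wpM2l; [exact: ltW|apply: ler_wpM2l; [exact: ltW|exact: g1]].
  have -> : Kr r * (A0 * (nrm (G i j z) ^+ M j * A0 ^+ N.-1)) = Kr r * A0 ^+ N * nrm (G i j z) ^+ M j.
    by have -> : A0 ^+ N = A0 * A0 ^+ N.-1 by [rewrite -exprS prednK]; ring.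
  by apply: ler_wpM2r; [exact: exprn_ge0|apply: le_trans (HC1 r) _; rewrite /C0; lra].
have [s [inj sn]] := Hde i z ci.
pose s' : {ffun 'I_n.+1 -> 'I_q} := [ffun r => s r].
pose Dt := \det (\matrix_(l, r) a (s r) l 0).
have Dt0 : Dt != 0 by have := general_position_unit hgp la inj; rewrite unitmxE unitfE.
have DtB : (nrm Dt ^+ N)^-1 <= B3.
  have := HB3 s'; have -> // : \matrix_(l, r) a (s' r) l 0 = \matrix_(l, r) a (s r) l 0.
  by apply/matrixP => l r; rewrite !mxE ffunE.
have Dtp : 0 < nrm Dt ^+ N by rewrite exprn_gt0 // nrm_gt0.
have WD := germ_self (wr_forms a A hf s ci).
have [sg Hsg] := det_le_perm (\matrix_(r, c) Dw (A r) (G i (s c)) z).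
rewrite -WD nrmM in Hsg.
pose X := \prod_c nrm (G i (s c) z) ^+ M (s c).
have X0 : 0 < X.
  apply: prodr_gt0 => l _; have [->|Mc] := posnP (M (s l)); first by rewrite expr0.
  by rewrite exprn_gt0 // nrm_gt0 Gn.
have rK : 0 < rho ^+ K by rewrite exprn_gt0.
have W1 : nrm (wr_of f A i z) ^+ N * nrm Dt ^+ N <= F0 ^+ N * (C0 ^+ n.+1 / rho ^+ K * X).
  rewrite -exprMn.
  have := lerXn2r N (mulr_ge0 (nrm_ge0 _) (nrm_ge0 _)) (le_trans (mulr_ge0 (nrm_ge0 _) (nrm_ge0 _)) Hsg) Hsg => h.
  apply: le_trans h _; rewrite exprMn; apply: ler_wpM2l; first by apply: exprn_ge0; exact: ltW.
  rewrite -prodrXl.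
  apply: (@le_trans _ _ (\prod_r (C0 / rho ^+ (N * size (A r)) * nrm (G i (s (sg r)) z) ^+ M (s (sg r))))).
    by apply: ler_prod => r _; rewrite exprn_ge0 ?nrm_ge0 //= mxE; exact: est.
  rewrite big_split /= le_eqVlt; apply/orP; left; apply/eqP; congr (_ * _).
    by rewrite big_split /= prodr_const card_ord prodfV -expr_sum /K big_distrr.
  by rewrite /X [RHS](reindex_inj (@perm_inj _ sg)).
have W2 : nrm (wr_of f A i z) ^+ N = nrm (Phi i z) * \prod_j nrm (G i j z) ^+ M j.
  by rewrite -nrmX (Phi_eq ci) nrmM nrm_prod; congr (_ * _); apply: eq_bigr => j _; rewrite nrmX.
(* The forms that were not selected are at least [de <= 1] in modulus. *)
have W3 : X * de ^+ SM <= \prod_j nrm (G i j z) ^+ M j.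
  rewrite (bigID (mem (s @: 'I_n.+1))) /= big_imset /=; last by move=> ? ? _ _; exact: inj.
  apply: ler_wpM2l; first exact: ltW.
  rewrite [X in _ <= X]big_mkcond /SM expr_sum; apply: ler_prod => j _.
  rewrite exprn_ge0 ?(ltW de0) //=; case: ifP => jn; last by rewrite exprn_ile1 // ltW.
  rewrite lerXn2r ?nnegrE ?nrm_ge0 ?(ltW de0) //; apply: sn => r; apply: contraNneq jn => ->.
  by rewrite imset_f.
have h4 : nrm (Phi i z) * (X * de ^+ SM) * nrm Dt ^+ N <= F0 ^+ N * (C0 ^+ n.+1 / rho ^+ K * X).
  apply: le_trans W1; rewrite W2; apply: ler_wpM2r; first exact: ltW.
  by apply: ler_wpM2l; [exact: ltW|exact: W3].
have h5 : nrm (Phi i z) * (de ^+ SM * nrm Dt ^+ N * rho ^+ K) <= F0 ^+ N * C0 ^+ n.+1.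
  rewrite -(ler_pM2r X0) -(ler_pM2r (_ : 0 < (rho ^+ K)^-1)) ?invr_gt0 //.
  have -> : nrm (Phi i z) * (de ^+ SM * nrm Dt ^+ N * rho ^+ K) * X * (rho ^+ K)^-1 = nrm (Phi i z) * (X * de ^+ SM) * nrm Dt ^+ N.
    by field; rewrite gt_eqF.
  by apply: le_trans h4 _; rewrite le_eqVlt; apply/orP; left; apply/eqP; ring.
have h6 : nrm (Phi i z) * (de ^+ SM * rho ^+ K) <= F0 ^+ N * C0 ^+ n.+1 * B3.
  have Y0 : 0 <= F0 ^+ N * C0 ^+ n.+1 by apply: mulr_ge0; apply: exprn_ge0; exact: ltW.
  apply: le_trans (ler_wpM2l Y0 DtB); rewrite ler_pdivlMr //; apply: le_trans h5.
  by rewrite le_eqVlt; apply/orP; left; apply/eqP; ring.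
rewrite /Bt ler_pdivlMr // ler_pdivlMr //; apply: le_trans h6.
by rewrite /rho exprMn le_eqVlt; apply/orP; left; apply/eqP; rewrite -/K; ring.
Qed.
End Local.

(** * Maxima of continuous functions over balls *)

Section Compactness.
Variable R : realType.
Local Notation C := (Cplx R).

Lemma square_compact (r : R) : compact [set w : C | `|re w| <= r /\ `|im w| <= r].
Proof.
pose h (x : R * R) : C := rc x.1 + ii R * rc x.2.
have -> : [set w : C | `|re w| <= r /\ `|im w| <= r] = h @` (`[(- r), r] `*` `[(- r), r]).
  apply/seteqP; split => [w /= [h1 h2]|w [[x y] /= [hx hy] <-]].
    exists (re w, im w) => /=; first by rewrite !in_itv /= -!ler_norml.
    by rewrite /h /= -CE.
  rewrite !in_itv /= -!ler_norml in hx hy.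
  have re_h : re (h (x, y)) = x.
    by rewrite /h reD reM !re_rc !im_rc -[re (ii R)]/(0 : R) -[im (ii R)]/(1 : R) mul0r mulr0 subr0 addr0.
  have im_h : im (h (x, y)) = y.
    by rewrite /h imD imM !re_rc !im_rc -[re (ii R)]/(0 : R) -[im (ii R)]/(1 : R) mul0r mul1r !add0r.
  by rewrite re_h im_h.
apply: continuous_compact; last by apply: compact_setX; exact: segment_compact.
apply: continuous_subspaceT => -[x y] A /nbhs_nrm[e e0 HA].
apply/nbhs_ballP; exists (e / 2) => /=; first lra.
move=> [x' y'] [/= bx by_]; apply: HA.
have -> : h (x', y') - h (x, y) = rc (x' - x) + ii R * rc (y' - y) by rewrite /h /= !rcB; ring.
have := nrmD (rc (x' - x)) (ii R * rc (y' - y)); rewrite nrmM nrmii mul1r !nrm_rc.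
by move: bx by_; rewrite /ball /= (distrC x) (distrC y); lra.
Qed.

Lemma coord_lt p (v : 'rV[C]_p) (rho : R) i : nrm v < rho -> nrm (v 0 i) < rho.
Proof.
move=> vr; have : ball_ (fun x : 'rV[C]_p => `|x|) 0 (rc rho) v by rewrite /ball_ /= sub0r normrN nrmE lt_rc.
by rewrite -mx_norm_ball => -[_ /(_ 0 i)]; rewrite /ball /= mxE sub0r normrN nrmE lt_rc.
Qed.

Lemma germ_continuous (V : normedModType C) (u : V -> R) :
  (forall z (e : R), 0 < e -> germ z (fun w => `|u w - u z| < e)) -> continuous u.
Proof.
move=> H z; apply/cvgrPdist_lt => e e0; apply/germ_near; apply: germ_imp (H z e e0) => w.
by rewrite distrC.
Qed.

Lemma continuous_mul_exp (V : normedModType C) (u h : V -> R) k :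
  continuous u -> continuous h -> continuous (fun w => u w * h w ^+ k).
Proof.
move=> cu ch w; apply: cvgM; first exact: cu.
by apply: (@continuous_comp _ _ _ h (fun x => x ^+ k)); [exact: ch|exact: exprn_continuous].
Qed.

(** The maximum is attained on a compact box containing the ball, so the maximizer [zs] may lie
    outside the ball. *)
Lemma ball_max p (u : 'rV[C]_p -> R) z0 (r : R) : continuous u -> 0 < r ->
  exists zs, forall w, nrm (w - z0) <= r -> u w <= u zs.
Proof.
move=> cu r0; pose rho := r + nrm z0 + 1.
have := @rV_compact C p (fun _ => [set w : C | `|re w| <= rho /\ `|im w| <= rho]) (fun _ => @square_compact rho).
move=> K; have inA w : nrm (w - z0) <= r -> [set v : 'rV[C]_p | forall i, [set w : C | `|re w| <= rho /\ `|im w| <= rho] (v ord0 i)] w.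
  move=> wr i /=; have : nrm (w 0 i) < rho.
    by apply: coord_lt; have := nrm_sub_ge w z0; rewrite /rho; lra.
  by have := le_re (w 0 i); have := le_im (w 0 i); lra.
have [||c _ Hc] := @compact_EVT_max _ R u _ _ K.
- by exists z0; apply: inA; rewrite subrr nrm0 ltW.
- exact: continuous_subspaceT.
by exists c => w /inA wA; apply: Hc; rewrite inE.
Qed.
End Compactness.

(** * Rescaling on large balls *)

Section Contradiction.
Variables (R : realType) (p n : nat).
Local Notation C := (Cplx R).
Local Notation V := 'rV[C]_p.
Variables (f : V -> proj_space R n) (D K : nat) (Phi : 'I_n.+1 -> V -> C) (Psi : 'cV[C]_n.+1 -> V -> C).
Hypotheses (K0 : (0 < K)%N) (hPsi : forall e z, hol (Psi e) z)
  (PsiE : forall e i z, chart_dom i (f z) -> Psi e z = Phi i z * pairing (norm_coord i (f z)) e ^+ D)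
  (bound : forall T : R, 1 <= T -> exists2 B : R, 0 < B & forall z d i, 0 < d -> chart_dom i (f z) ->
    (forall k, nrm (norm_coord i (f z) 0 k) <= 1) -> Phi i z != 0 ->
    (forall w k, nrm (w - z) < d -> nrm (Psi (delta_mx k 0) w) <= T * nrm (Phi i z)) ->
    nrm (Phi i z) * d ^+ K <= B).

(* E (r - |z - z0|)^K attains its maximum; the local bound there makes E(z0) r^K
   bounded independently of r. *)
Lemma Phi_zero i z : chart_dom i (f z) -> Phi i z = 0.
Proof.
move=> ci; apply/eqP/negPn/negP => Pz.
pose E w := \sum_(k < n.+1) nrm (Psi (delta_mx k 0) w).
have E0 w : 0 <= E w by apply: sumr_ge0 => k _; exact: nrm_ge0.
have leE k w : nrm (Psi (delta_mx k 0) w) <= E w.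
  by rewrite /E (bigD1 k) //= lerDl sumr_ge0 // => j _; exact: nrm_ge0.
have Ez : 0 < E z.
  apply: lt_le_trans (leE i z); rewrite (PsiE _ ci) pairing_delta norm_coord_self // expr1n mulr1.
  by rewrite nrm_gt0.
have n1 : 0 < n.+1%:R :> R by rewrite ltr0n.
have n1' : 1 <= n.+1%:R :> R by rewrite ler1n.
have p2 : 1 <= 2 ^+ K :> R by rewrite exprn_ege1 // ler1n.
(* [2 ^+ K] pays for halving the distance to the sphere, and [n.+1] for comparing the sum [E] with a
   single value of [Phi]. *)
pose T : R := 2 ^+ K * n.+1%:R.
have T1 : 1 <= T by rewrite /T; nra.
have [B B0 HB] := bound T1.
(* As [K] is positive, the radius [T * B / E z + 1] already contradicts this bound. *)
suff key r : 0 < r -> E z * r ^+ K <= T * B.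
  pose r := T * B / E z + 1.
  have TB : 0 <= T * B by apply: mulr_ge0; lra.
  have r1 : 1 <= r by rewrite /r lerDr divr_ge0 // ltW.
  have := key r ltac:(lra); have : E z * r <= E z * r ^+ K.
    by apply: ler_wpM2l; [exact: ltW|rewrite -(prednK K0) exprS ler_peMr ?exprn_ege1 //; lra].
  have -> : E z * r = T * B + E z by rewrite /r mulrDr mulr1 mulrC divfK // gt_eqF.
  by lra.
(* Truncation at 0 makes [h] continuous and nonnegative everywhere; a maximizer with positive value
   lies inside the ball. *)
move=> r0; pose h w := Num.max 0 (r - nrm (w - z)).
have h0 w : 0 <= h w by rewrite /h le_max lexx.
have cE : continuous E.
  apply: germ_continuous => x e e0; have en : 0 < e / n.+1%:R by exact: divr_gt0.
  apply: germ_imp (germ_fin (fun k => hol_cont (hPsi (delta_mx k 0) x) en)) => w Hw.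
  rewrite /E -sumrB; apply: le_lt_trans (ler_norm_sum _ _ _) _.
  have -> : e = \sum_(k < n.+1) e / n.+1%:R.
    by rewrite sumr_const card_ord -[RHS]mulr_natl mulrC divfK // gt_eqF.
  apply: ltr_sum; first by apply/hasP; exists ord0; rewrite ?mem_index_enum.
  move=> k _; apply: le_lt_trans (Hw k).
  have := nrm_sub_ge (Psi (delta_mx k 0) w) (Psi (delta_mx k 0) x).
  have := nrm_sub_ge (Psi (delta_mx k 0) x) (Psi (delta_mx k 0) w).
  by rewrite (nrmB (Psi _ x)) ler_norml; lra.
have ch : continuous h.
  apply: germ_continuous => x e e0; exists e => // w we.
  have := nrm_le_sub w x z; have := nrm_le_sub x w z; rewrite (nrmB x w) => a1 a2.
  apply: le_lt_trans we; rewrite /h ler_norml.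
  by case: (leP 0 (r - nrm (w - z))); case: (leP 0 (r - nrm (x - z))) => b1 b2; have := nrm_ge0 (w - x); lra.
have cu := @continuous_mul_exp R V E h K cE ch.
have [y Hy] := ball_max z cu r0.
have hz : h z = r by rewrite /h subrr nrm0 subr0 max_r // ltW.
have zr : nrm (z - z) <= r by rewrite subrr nrm0 ltW.
have := Hy z zr; rewrite hz => u0.
have up : 0 < E y * h y ^+ K by apply: lt_le_trans u0; rewrite mulr_gt0 // exprn_gt0.
have hy : 0 < h y.
  by rewrite lt_neqAle h0 andbT eq_sym; apply/eqP => e; move: up; rewrite e expr0n gtn_eqF // mulr0 ltxx.
have Ey : 0 < E y by rewrite -(pmulr_lgt0 (E y) (_ : 0 < h y ^+ K)) // exprn_gt0.
pose d := h y; have dE : d = r - nrm (y - z).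
  by rewrite /d /h; case: (leP 0 (r - nrm (y - z))) => // b; move: hy; rewrite /h max_l ?ltxx // ltW.
have d0 : 0 < d by [].
have [m [cm ym]] := max_chart (f y).
have EP : E y <= n.+1%:R * nrm (Phi m y).
  have -> : n.+1%:R * nrm (Phi m y) = \sum_(k < n.+1) nrm (Phi m y) by rewrite sumr_const card_ord -[RHS]mulr_natl.
  apply: ler_sum => k _; rewrite (PsiE _ cm) pairing_delta nrmM nrmX.
  by rewrite -[X in _ <= X]mulr1; apply: ler_wpM2l; [exact: nrm_ge0|rewrite exprn_ile1 ?nrm_ge0].
have Pm : 0 < nrm (Phi m y) by rewrite -(pmulr_rgt0 _ n1); exact: lt_le_trans EP.
have d20 : 0 < d / 2 by lra.
have near w k : nrm (w - y) < d / 2 -> nrm (Psi (delta_mx k 0) w) <= T * nrm (Phi m y).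
  move=> wd; apply: le_trans (leE k w) _.
  have wz := nrm_le_sub w y z.
  have wr : nrm (w - z) <= r by lra.
  have hw : d / 2 <= h w by rewrite /h le_max; apply/orP; right; lra.
  have h1 : E w * (d / 2) ^+ K <= E y * d ^+ K.
    apply: le_trans (Hy w wr); apply: ler_wpM2l => //.
    by rewrite lerXn2r ?nnegrE // ltW.
  have dK : 0 < d ^+ K by rewrite exprn_gt0.
  have h2 : E w <= 2 ^+ K * E y.
    move: h1; rewrite expr_div_n mulrA ler_pdivrMr ?pow2_gt0 // => h1.
    by rewrite -(ler_pM2r dK); apply: le_trans h1 _; rewrite le_eqVlt; apply/orP; left; apply/eqP; ring.
  apply: le_trans h2 _; rewrite /T -mulrA; apply: ler_wpM2l => //; lra.
have Pm0 : Phi m y != 0 by rewrite -nrm_gt0.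
have := HB y (d / 2) m d20 cm ym Pm0 near; rewrite expr_div_n mulrA ler_pdivrMr ?pow2_gt0 // => hB.
apply: le_trans u0 _; rewrite -/d; apply: (@le_trans _ _ (n.+1%:R * nrm (Phi m y) * d ^+ K)).
  by apply: ler_wpM2r => //; apply: exprn_ge0; exact: ltW.
rewrite -mulrA /T; apply: le_trans (ler_wpM2l (ltW n1) hB) _.
by rewrite le_eqVlt; apply/orP; left; apply/eqP; ring.
Qed.
End Contradiction.

(** * Integer weights attached to the ramification *)

Section Ramification.
Variables (R : realType) (p n q : nat).
Local Notation C := (Cplx R).
Local Notation V := 'rV[C]_p.
Variable f : V -> proj_space R n.
Hypothesis hf : holomorphic_map f.

(** The linear form vanishes on [E], so the local equation divides it and the order cannot be 0. *)
Lemma pullback_term_gt0 (H : hyperplane R n) E m : pullback_divisor_term f H E m -> (0 < m)%N.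
Proof.
move=> [[_ EA _] [z [i [a [_ ci la [h [[_ _ lh] _ nd]]]]]]]; case: m nd => // nd; case: nd.
apply: lh; first by apply/holomorphic_nearE; exact: hol_pairing.
apply/germ_near; apply: germ_imp (chart_germ hf ci) => w cw Ew.
have /(points_ofE _ la) e : points_of H (f w) := EA w Ew.
by apply/eqP; rewrite -[(_ *m _) 0 0]/(pairing _ _) pairing_norm // e.
Qed.

Definition mult_of (mu : option nat) : nat := if mu is Some m then m else 1.

(* N (1 - kappa/mu), truncated at 0 *)
Definition weight (N : nat) (mu : option nat) : nat :=
  if mu is Some m then (N %/ m * (m - kappa p n))%N else N.

Lemma weight_le N mu : (weight N mu <= N)%N.
Proof.
case: mu => [m|] //=; apply: leq_trans (leq_divM N m); by rewrite leq_mul2l leq_subr orbT.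
Qed.

Lemma dvdn_weight c N mu : (c * mult_of mu %| N)%N -> (c %| weight N mu)%N.
Proof.
case: mu => [m|] /=; last by rewrite muln1.
case: m => [|m]; first by rewrite sub0n muln0 dvdn0.
by move=> /dvdnP[k ->]; rewrite mulnA mulnK // -mulnA mulnCA dvdn_mulr.
Qed.

Lemma weight_ge N mu : (mult_of mu %| N)%N -> (0 < mult_of mu)%N ->
  N%:R * (1 - kappa_over R p n mu) <= (weight N mu)%:R.
Proof.
case: mu => [m|] /=; last by rewrite subr0 mulr1.
move=> /dvdnP[t ->] m0; rewrite mulnK //.
have mn : m%:R != 0 :> R by rewrite pnatr_eq0 -lt0n.
have -> : (t * m)%:R * (1 - (kappa p n)%:R / m%:R) = t%:R * (m%:R - (kappa p n)%:R) :> R.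
  by rewrite natrM; field.
rewrite natrM; apply: ler_wpM2l => //; have [km|mk] := leqP (kappa p n) m; first by rewrite natrB.
by apply: (@le_trans _ _ 0) => //; rewrite subr_le0 ler_nat ltnW.
Qed.

(** For k >= m one has (m - kappa) k <= m (k - kappa), also with truncated subtraction. *)
Lemma weight_ram N m k : (m %| N)%N -> (m <= k)%N -> (weight N (Some m) * k <= N * (k - kappa p n))%N.
Proof.
case: m => [|m] /=; first by rewrite sub0n muln0.
move=> /dvdnP[t ->] mk; rewrite mulnK // -!mulnA leq_mul2l; apply/orP; right.
by rewrite mulnBl mulnBr leq_sub2l // [(m.+1 * _)%N]mulnC leq_mul2l mk orbT.
Qed.

(** With total order 0 all rows equal the undifferentiated one, and there are at least two of
    them. *)
Lemma wronsk_weight_gt0 (A : 'I_n.+1 -> seq V) (F : V -> 'rV[C]_n.+1) z : (0 < n)%N ->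
  wronsk A F z != 0 -> (0 < \sum_r size (A r))%N.
Proof.
move=> n0 W; rewrite lt0n; apply: contra W; rewrite sum_nat_eq0 => /forallP A0.
have e r : A r = [::] by apply/nilP; exact: A0.
rewrite /wronsk (@determinant_alternate _ _ _ ord0 ord_max) //.
  by rewrite -val_eqE /= eq_sym -lt0n.
by move=> l; rewrite !mxE !e.
Qed.
End Ramification.

(** * Choice of the exponents and contradiction *)

Theorem mainTheorem5 (R : realType) (p n q : nat) (hp : (0 < p)%N)
  (hn : (0 < n)%N) (hq : (n.+2 <= q)%N)
  (f : 'rV[Cplx R]_p -> proj_space R n) (H : 'I_q -> hyperplane R n)
  (mu : 'I_q -> option nat)
  (hf : holomorphic_map f) (hnd : linearly_nondegenerate f)
  (hrk : maximal_rank f) (hgp : general_position H)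
  (hmu : forall i : 'I_q, completely_ramified f (H i) (mu i)) :
  \sum_(i < q) (1 - kappa_over R p n (mu i)) <= n.+1%:R.
Proof.
rewrite leNgt; apply/negP => big.
have mu0 j : (0 < mult_of (mu j))%N.
  have [_] := hmu j; case: (mu j) => [m|//] [[E tE] _]; exact: (pullback_term_gt0 hf tE).
pose P := (\prod_j mult_of (mu j))%N.
have P0 : (0 < P)%N by rewrite prodn_gt0.
(* The factor [q.+1] makes every weight divisible by [q.+1], which leaves room for lowering [q]
   exponents by one. *)
pose N := (q.+1 * P)%N; have N0 : (0 < N)%N by rewrite muln_gt0.
have dvdN j : (q.+1 * mult_of (mu j) %| N)%N.
  by rewrite dvdn_pmul2l // /P (bigD1 j) //= dvdn_mulr.
have dvdm j : (mult_of (mu j) %| N)%N by apply: dvdn_trans (dvdN j); rewrite dvdn_mull.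
pose Mp j := weight p n N (mu j).
have lt : (N * n.+1 < \sum_j Mp j)%N.
  rewrite -(ltr_nat R) natrM natr_sum.
  apply: (@lt_le_trans _ _ (N%:R * \sum_(j < q) (1 - kappa_over R p n (mu j)))).
    by rewrite ltr_pM2l // ltr0n.
  by rewrite mulr_sumr; apply: ler_sum => j _; apply: weight_ge.
(* Both sides of [lt] are multiples of [q.+1], so they differ by more than [q]. *)
have lt2 : (N * n.+1 + q < \sum_j Mp j)%N.
  have /dvdnP[x ex] : (q.+1 %| \sum_j Mp j)%N by apply: dvdn_sum => j _; exact: dvdn_weight.
  rewrite ex /N in lt *; have {}lt : (P * n.+1 < x)%N by nia.
  nia.
pose D := (\sum_j (Mp j).-1 - N * n.+1)%N.
have sub : (\sum_j Mp j <= \sum_j (Mp j).-1 + q)%N.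
  have e : (\sum_(j < q) 1 = q)%N by rewrite sum1_card card_ord.
  rewrite -[X in (_ <= _ + X)%N]e -big_split; apply: leq_sum => j _ /=; by case: (Mp j) => //= m; rewrite addn1.
have D0 : (0 < D)%N by rewrite /D; lia.
have HD : (\sum_j (Mp j).-1 = N * n.+1 + D)%N by rewrite /D; lia.
have /choice[a la] : forall j, exists a, linear_equation (H j) a.
  by move=> j; have [a _ la] := linear_equation_exists (H j); exists a.
have nr j : ~ (range f `<=` points_of (H j)) by have [] := hmu j.
have [A [HA [z [i [ci Wz]]] Amin]] := minimal_wronskian hf hnd hrk.
have ram j k E : (0 < k)%N -> pullback_divisor_term f (H j) E k -> (Mp j * k <= N * (k - kappa p n))%N.
  move=> k0 tE; have [_] := hmu j; rewrite /Mp; have := dvdm j; case: (mu j) => [m|] /= dm.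
    by move=> [_ Hm]; apply: (weight_ram p n dm); exact: Hm tE.
  (* An omitted hyperplane has empty preimage, so there is no divisor term. *)
  have [[_ EA _] [z' [_ [_ [Ez _ _ _]]]]] := tE.
  by move=> /seteqP[/(_ (f z'))]; case; split; [exists z'|exact: EA].
have hq' : (n.+1 <= q)%N by exact: ltnW.
have [Phi HPhi] := Phi_exists hf hq' hgp la nr HA ram.
have [Psi [hPsi PsiE]] := Psi_exists hf la nr HA Amin HD HPhi.
have K0 : (0 < N * \sum_r size (A r))%N by rewrite muln_gt0 N0 (wronsk_weight_gt0 hn Wz).
have bound := @local_bound R p n q f H a hf hq' hgp la A N D (fun j => (Mp j).-1) Phi Psi N0 D0.
have Pz : Phi i z = 0.
  apply: (Phi_zero K0 hPsi PsiE _ ci); apply: bound => //.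
  - by move=> j; apply: leq_ltn_trans (_ : N.-1 < N)%N; rewrite ?prednK // -!subn1 leq_sub2r // weight_le.
  - by move=> i' z' /HPhi[].
  - by move=> i' z' /HPhi[_ /germ_self].
  - by move=> i' z' j /HPhi[_ _ h] Mj; apply: h; move: Mj; rewrite /Mp; case: (weight _ _ _ _).
have [_ /germ_self E _] := HPhi i z ci.
by move: E; rewrite Pz mul0r => /eqP; rewrite expf_eq0 N0 (negPf Wz).
Qed.
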